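(* Let $\Lambda:=\{\lambda_n,\ -\sqrt{2n},\ \pm i\sqrt{2n} : n\ge1\}\cup\{\pm1\}$ be a sequence of complex numbers. If $$|\sqrt{2n}-\lambda_n|\le\frac{\delta}{\sqrt{2n}},\qquad n\ge1,$$ for some $\delta<1/2$, then $\mathcal{G}_\Lambda$ is complete and minimal in $L^2(\mathbb{R})$.
   Context: $\mathbb{R}^2$ is identified with $\mathbb{C}$ via $(x,y)\leftrightarrow x+iy$. Let $g(t)=e^{-\pi t^2}$ and, for $(x,y)\in\mathbb{R}^2$, $\rho_{(x,y)}g(t):=e^{2i\pi yt}g(t-x)$. For a sequence $\Lambda$ of points of $\mathbb{R}^2\simeq\mathbb{C}$, the Gabor system is $\mathcal{G}_\Lambda:=\{\rho_{(x,y)}g : x+iy\in\Lambda\}$. A system in a Hilbert space is complete if its closed linear span is the whole space, and minimal if no element belongs to the closed linear span of the other elements.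
   Formalization: The points λ_n (n≥1) are assumed pairwise distinct: for δ close to 1/2 the estimate allows λ_1=λ_2 (e.g. both 1.76), and then the system is not complete (as a set) or not minimal (as a family). *)

(* Defs.v *)
From HB Require Import structures.
From mathcomp Require Import all_boot all_order all_algebra.
From mathcomp Require Import complex.
From mathcomp Require Import all_classical all_reals all_analysis.
From mathcomp Require Import measurable_realfun.

Set Implicit Arguments.
Unset Strict Implicit.
Unset Printing Implicit Defensive.

Import Order.TTheory GRing.Theory Num.Theory.
Import numFieldNormedType.Exports.
Import ComplexField.Normc.

Local Open Scope classical_set_scope.
Local Open Scope ring_scope.
Local Open Scope complex_scope.

Section L2.
Variable R : realType.
Implicit Types (f g h : R -> R[i]) (S : set (R -> R[i])).

Definition measurable_cfun f : Prop :=
  measurable_fun [set: R] (fun t => complex.Re (f t)) /\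
  measurable_fun [set: R] (fun t => complex.Im (f t)).

Definition L2norm f : \bar R :=
  'N[@lebesgue_measure R]_2%:E[EFin \o (fun t => normc (f t))]%E.

(* Square-integrable functions, not their classes modulo a.e. equality: the
   notions below compare functions through the L2 norm of their difference. *)
Definition L2 : set (R -> R[i]) :=
  [set f | measurable_cfun f /\ (L2norm f < +oo)%E].

Definition lin_span S : set (R -> R[i]) :=
  [set h | exists (n : nat) (c : 'I_n -> R[i]) (s : 'I_n -> (R -> R[i])),
     (forall i, S (s i)) /\ h = (fun t => \sum_(i < n) c i * s i t)].

Definition closed_span S : set (R -> R[i]) :=
  [set f | L2 f /\ forall eps : R, 0 < eps ->
     exists2 h, lin_span S h & (L2norm (f \- h)%R < eps%:E)%E].

Definition complete_in_L2 S : Prop := L2 `<=` closed_span S.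

Definition minimal_in_L2 S : Prop := forall f, S f -> ~ closed_span (S `\ f) f.

End L2.

Section Gabor.
Variable R : realType.

Definition gauss (t : R) : R := expR (- (pi * t ^+ 2)).

Definition expi (a : R) : R[i] := cos a +i* sin a.

(* time-frequency shift, the parameter z standing for (Re z, Im z) *)
Definition tf_shift (z : R[i]) (g : R -> R) : R -> R[i] :=
  fun t => expi (2 * pi * complex.Im z * t) * (g (t - complex.Re z))%:C.

Definition gabor_system (L : set R[i]) : set (R -> R[i]) :=
  [set tf_shift z gauss | z in L].

Definition sqrt2n (n : nat) : R := Num.sqrt (2 * n%:R).

(* The set of terms of the sequence: it stands for the sequence itself only
   when the terms are pairwise distinct, which is why the injectivity of [lam]
   has to be assumed. For delta close to 1/2 the discs around sqrt 2 and 2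
   overlap, and lam 1 = lam 2 would make the system incomplete. *)
Definition Lambda (lam : nat -> R[i]) : set R[i] :=
  [set z | exists2 n : nat, (1 <= n)%N &
     [\/ z = lam n, z = - (sqrt2n n)%:C, z = 0 +i* sqrt2n n
       | z = 0 -i* sqrt2n n]]
  `|` [set 1; -1].

Lemma tf_shift_gauss_L2 (z : R[i]) : L2 (tf_shift z gauss).
Proof.
have mg : measurable_fun [set: R] (fun t => gauss (t - complex.Re z)).
  rewrite /gauss; apply: measurableT_comp => //; apply: measurableT_comp => //.
  apply: measurable_funM => //.
  by apply: measurable_funX; apply: measurable_funB.
have ml : measurable_fun [set: R] (fun t : R => 2 * pi * complex.Im z * t).
  by apply: measurable_funM.
have nE t : normc (tf_shift z gauss t) = gauss (t - complex.Re z).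
  rewrite /tf_shift normcM /= cos2Dsin2 sqrtr1 mul1r expr0n addr0 sqrtr_sqr.
  by rewrite ger0_norm// expR_ge0.
split.
  split.
  - rewrite (_ : (fun _ => _) = fun t =>
      cos (2 * pi * complex.Im z * t) * gauss (t - complex.Re z)).
      apply: measurable_funM => //.
      by apply: measurableT_comp => //; apply: continuous_measurable_fun => ?; exact: continuous_cos.
    by apply/funext => t; rewrite /tf_shift /= mulr0 subr0.
  - rewrite (_ : (fun _ => _) = fun t =>
      sin (2 * pi * complex.Im z * t) * gauss (t - complex.Re z)).
      apply: measurable_funM => //.
      by apply: measurableT_comp => //; apply: continuous_measurable_fun => ?; exact: continuous_sin.
    by apply/funext => t; rewrite /tf_shift /= mulr0 add0r.
rewrite /L2norm; have -> : (fun t => normc (tf_shift z gauss t)) =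
  (fun t => gauss (t - complex.Re z)) by apply/funext.
rewrite unlock.
apply: poweR_lty.
set s : R := (Num.sqrt (2 * pi))^-1.
have p0 : 0 < 2 * pi :> R by rewrite mulr_gt0// pi_gt0.
have s0 : s != 0 by rewrite invr_eq0 gt_eqF// sqrtr_gt0.
have key t : (gauss (t - complex.Re z) = normal_fun (complex.Re z) s t)%R.
  rewrite /gauss /normal_fun /s exprVn sqr_sqrtr ?ltW//.
  congr expR; rewrite mulNr; congr (- _).
  rewrite [X in _ / X](_ : _ = pi^-1) ?invrK 1?mulrC//.
  by rewrite -[LHS]mulr_natl invfM mulrC divfK ?pnatr_eq0.
have pk0 : 0 < normal_peak s by exact: normal_peak_gt0.
apply: (@le_lt_trans _ _
  (\int[@lebesgue_measure R]_t
     ((normal_peak s)^-1 * normal_pdf (complex.Re z) s t)%:E)%E).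
  apply: ge0_le_integral => //=.
  - apply/measurable_EFinP; apply: (measurableT_comp (measurable_powR _)) => //.
    exact: measurableT_comp.
  - apply/measurable_EFinP; apply: measurable_funM => //.
    exact: measurable_normal_pdf.
  - move=> x _; rewrite normal_pdfE// mulKf ?gt_eqF// -key.
    rewrite ger0_norm ?expR_ge0// lee_fin powR_mulrn ?expR_ge0//.
    rewrite expr2 ler_piMl ?expR_ge0// -[leRHS]expR0 ler_expR oppr_le0.
    by rewrite mulr_ge0// ?pi_ge0// sqr_ge0.
under eq_integral do rewrite EFinM.
rewrite ge0_integralZl//.
- by rewrite integral_normal_pdf// mule1 ltry.
- by apply/measurable_EFinP; exact: measurable_normal_pdf.
- by move=> x _; rewrite lee_fin normal_pdf_ge0.
- by rewrite lee_fin invr_ge0 ltW.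
Qed.

End Gabor.

(* Main.v *)
(* Up to the factor 2^(-1/2), the squared norm of a combination of time-frequency
   shifts of the Gaussian is the quadratic form of the Fock space kernel
   exp(pi z conj(w)), so the theorem concerns zeros of entire functions in the Fock
   space. The generating function
     G(z) = (z^2 - 1) z^-2 sin(pi z^2 / 2) Q(z),
     Q(z) = prod_n (1 - z / lam_n) / (1 - z / sqrt(2n)),
   vanishes exactly on Lambda, and away from a sector around the positive axis
   |z|^-delta <= C |Q(z)| and |Q(z)| <= C |z|^delta.

   Completeness: if H is in the Fock space and vanishes on Lambda, then
   Phragmen-Lindelof in the quadrants bounded by the diagonals gives
   H/G = O(|z|^delta), so H/G is constant. If it were not 0, then
   |H(z)| exp(-pi |z|^2 / 2) >= c |z|^-delta at the points z = j exp(3 pi i / 4),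
   which contradicts their Bessel inequality because 2 delta < 1.

   Minimality: F = G / (z - l) is in the Fock space. The mean of |F|^2 on the
   circles |z|^2 = 2k + 1 is O(r^(2 delta - 3) exp(pi r^2)), where one factor 1/r
   comes from the Poisson kernel; by Parseval the Taylor coefficients with index
   in [m^2, (m+1)^2) then contribute O(m^(2 delta - 2)) to the norm of F.

   Infinite products are avoided: all estimates concern the products over n <= N
   and are uniform in N.

   That the time-frequency shifts with arbitrary parameters span a dense subspace
   is seen by looking at the functions m for which m f is in their closed span
   whenever f is in it: they form an algebra, stable under bounded pointwise limits,
   that contains the trigonometric functions, hence sgn (sin) as a limit of
   iterates of x |-> (3x - x^3) / 2, hence the indicators of half-lines. *)
Require Import Defs.
From HB Require Import structures.
From mathcomp Require Import all_boot all_order all_algebra.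
From mathcomp Require Import complex.
From mathcomp Require Import all_classical all_reals all_analysis.
From mathcomp Require Import measurable_realfun.
From mathcomp Require Import ring lra zify.

Set Implicit Arguments.
Unset Strict Implicit.
Unset Printing Implicit Defensive.

Import Order.TTheory GRing.Theory Num.Theory.
Import numFieldNormedType.Exports.
Import ComplexField.Normc.

Local Open Scope classical_set_scope.
Local Open Scope ring_scope.
Local Open Scope complex_scope.

(** The hypothesis enters through two elementary facts. The relative displacement of [lam n] is
    about delta / (2 n), and its sum up to n = |z|^2 / 2 is delta ln |z|: this is the exponent of Q.
    Moreover |lam n|^2 is within about 2 delta < 1 of 2 n, so for large k the circles |z|^2 = 2 k +
    1 stay away from all zeros; they carry the crude outer bounds. The quotient H / G cannot be
    bounded directly, as both vanish on Lambda. Removing finitely many zeros leaves a quotient of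
    two entire functions whose denominator has no zero in a disc growing with N. Contour integrals
    become sums over roots of unity. The Fock space itself is never built: only its kernel form on
    finite lists appears, and the projection onto the span of the kernels is replaced by almost
    minimising lists, whose entire functions converge. For minimality no limit in N is taken: an
    approximating combination has finitely many terms, and a function vanishing at sufficiently many
    points serves, provided that its norm and its value at l are controlled uniformly in N. *)

Section ComplexNorm.
Variable R : realType.
Implicit Types z w : R[i].

Lemma normc_ge0 z : 0 <= normc z.
Proof. by case: z => a b /=; rewrite sqrtr_ge0. Qed.

Lemma sqr_normcE z : normc z ^+ 2 = complex.Re z ^+ 2 + complex.Im z ^+ 2.
Proof. by case: z => a b /=; rewrite sqr_sqrtr// addr_ge0// sqr_ge0. Qed.

Lemma normc_eq0 z : (normc z == 0) = (z == 0).
Proof.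
apply/eqP/eqP => [|->]; first exact: eq0_normc.
by rewrite normc0.
Qed.

Lemma normc_gt0 z : (0 < normc z) = (z != 0).
Proof. by rewrite lt_neqAle normc_ge0 andbT eq_sym normc_eq0. Qed.

Lemma normc_real (x : R) : normc x%:C = `|x|.
Proof. by rewrite /= expr0n addr0 sqrtr_sqr. Qed.

Lemma normcX z n : normc (z ^+ n) = normc z ^+ n.
Proof.
by elim: n => [|n IHn]; rewrite ?expr0 ?normc1// !exprS normcM IHn.
Qed.

Lemma normc_prod I (r : seq I) (P : pred I) (F : I -> R[i]) :
  normc (\prod_(i <- r | P i) F i) = \prod_(i <- r | P i) normc (F i).
Proof. by apply: (big_morph _ (@normcM _) (@normc1 _)). Qed.

Lemma normcD z w : normc (z + w) <= normc z + normc w.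
Proof. exact: le_normcD. Qed.

Lemma normcN z : normc (- z) = normc z.
Proof. by case: z => a b /=; rewrite !sqrrN. Qed.

Lemma normcB z w : normc (z - w) <= normc z + normc w.
Proof. by rewrite -(normcN w) normcD. Qed.

Lemma normc_distC z w : normc (z - w) = normc (w - z).
Proof. by rewrite -normcN opprB. Qed.

Lemma normc_ge_sub z w : normc z - normc w <= normc (z - w).
Proof. by rewrite lerBlDr; apply: le_trans (normcD _ _); rewrite subrK. Qed.

Lemma normc_ge_subD z w : normc z - normc w <= normc (z + w).
Proof. by rewrite -{2}(opprK w) -(normcN w) normc_ge_sub. Qed.

Lemma normc_sum I (r : seq I) (P : pred I) (F : I -> R[i]) :
  normc (\sum_(i <- r | P i) F i) <= \sum_(i <- r | P i) normc (F i).
Proof.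
elim/big_rec2: _ => [|i y x _ h]; first by rewrite normc0.
by apply: le_trans (normcD _ _) _; rewrite lerD2l.
Qed.

Lemma ler_Re_normc z : `|complex.Re z| <= normc z.
Proof.
rewrite -ler_sqr ?nnegrE ?normc_ge0// sqr_normcE real_normK ?num_real//.
by rewrite lerDl sqr_ge0.
Qed.

Lemma ler_Im_normc z : `|complex.Im z| <= normc z.
Proof.
rewrite -ler_sqr ?nnegrE ?normc_ge0// sqr_normcE real_normK ?num_real//.
by rewrite lerDr sqr_ge0.
Qed.

Lemma normc_le_ReIm z : normc z <= `|complex.Re z| + `|complex.Im z|.
Proof.
rewrite -ler_sqr ?nnegrE ?normc_ge0 ?addr_ge0// sqr_normcE sqrrD.
rewrite !real_normK ?num_real// lerD2r lerDl mulrn_wge0//.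
Qed.

Lemma normc_i : normc ('i%C : R[i]) = 1.
Proof. by rewrite /= expr0n expr1n add0r sqrtr1. Qed.

Lemma normc_conj z : normc z^* = normc z.
Proof. by case: z => a b /=; rewrite sqrrN. Qed.

Lemma mulc_conj z : z * z^* = (normc z ^+ 2)%:C.
Proof.
rewrite sqr_normcE; case: z => a b /=.
by apply/eqP; rewrite eq_complex /=; apply/andP; split; apply/eqP; ring.
Qed.

Lemma ReM z w : complex.Re (z * w) =
  complex.Re z * complex.Re w - complex.Im z * complex.Im w.
Proof. by case: z; case: w. Qed.

Lemma ImM z w : complex.Im (z * w) =
  complex.Re z * complex.Im w + complex.Im z * complex.Re w.
Proof. by case: z; case: w => /= *; ring. Qed.

Lemma ReD z w : complex.Re (z + w) = complex.Re z + complex.Re w.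
Proof. by case: z; case: w. Qed.

Lemma ImD z w : complex.Im (z + w) = complex.Im z + complex.Im w.
Proof. by case: z; case: w. Qed.

Lemma ReN z : complex.Re (- z) = - complex.Re z.
Proof. by case: z. Qed.

Lemma ImN z : complex.Im (- z) = - complex.Im z.
Proof. by case: z. Qed.

Lemma Re_sum I (r : seq I) (P : pred I) (F : I -> R[i]) :
  complex.Re (\sum_(i <- r | P i) F i) = \sum_(i <- r | P i) complex.Re (F i).
Proof. by apply: (big_morph _ ReD). Qed.

Lemma eq_ReIm z w : complex.Re z = complex.Re w ->
  complex.Im z = complex.Im w -> z = w.
Proof. by case: z => a b; case: w => c d /= -> ->. Qed.

(** Turns a bound on a modulus into a bound on a real part, so that real calculus applies to complex
    remainders. *)
Lemma normc_unit_mul z : exists2 u : R[i], normc u = 1 & u * z = (normc z)%:C.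
Proof.
have [->|z0] := eqVneq z 0; first by exists 1; rewrite ?normc1// normc0 mulr0.
have nz0 : normc z != 0 by rewrite normc_eq0.
exists (z^* / (normc z)%:C).
  by rewrite normcM normcV normc_conj normc_real ger0_norm ?normc_ge0// divff.
rewrite mulrAC [z^* * z]mulrC mulc_conj expr2 rmorphM /= mulfK//.
by rewrite eq_complex /= eqxx andbT.
Qed.

End ComplexNorm.

Lemma is_derive_expr_mulc (R : realType) (t c : R) n :
  is_derive t 1 (fun x : R => x ^+ n.+1 * c) (n.+1%:R * t ^+ n * c).
Proof.
have h : is_derive t 1 ((id : R -> R) ^+ n.+1) (n.+1%:R * t ^+ n).
  by apply: is_derive_eq; rewrite -[LHS]/(n.+1%:R * t ^+ n * 1) mulr1.
have -> : (fun x : R => x ^+ n.+1 * c) = (id ^+ n.+1) * cst c.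
  by apply/funext => x; rewrite !fctE.
apply: is_derive_eq.
by rewrite /GRing.scale /= mulr0 add0r mulrC.
Qed.

Lemma is_derive_ge0_le (R : realType) (f df : R -> R) (a b : R) : a <= b ->
  (forall x, a <= x <= b -> is_derive x 1 f (df x)) ->
  (forall x, a <= x <= b -> 0 <= df x) -> f a <= f b.
Proof.
move=> ab fdf df0.
have cf : {within `[a, b], continuous f}.
  apply: derivable_within_continuous => x; rewrite in_itv /= => /fdf h.
  by apply: ex_derive.
have [x|c] := @MVT_segment R f df a b ab _ cf.
  by rewrite in_itv /= => /andP[/ltW ax /ltW xb]; apply: fdf; rewrite ax.
rewrite in_itv /= => cab fE.
by rewrite -subr_ge0 fE mulr_ge0 ?subr_ge0// df0.
Qed.

(** * Complex exponential and its Taylor remainder *)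

Section ComplexExp.
Variable R : realType.
Implicit Types z w u : R[i].

Definition cexp z : R[i] := (expR (complex.Re z))%:C * expi (complex.Im z).

Lemma cexp0 : cexp 0 = 1.
Proof. by rewrite /cexp /expi /= expR0 cos0 sin0 mul1r. Qed.

Lemma expiD (a b : R) : expi (a + b) = expi a * expi b.
Proof.
rewrite /expi cosD sinD; apply: eq_ReIm => /=; ring.
Qed.

Lemma normc_expi (a : R) : normc (expi a) = 1.
Proof. by rewrite /= cos2Dsin2 sqrtr1. Qed.

Lemma cexpD z w : cexp (z + w) = cexp z * cexp w.
Proof.
rewrite /cexp ReD ImD expRD expiD rmorphM /=; ring.
Qed.

Lemma normc_cexp z : normc (cexp z) = expR (complex.Re z).
Proof. by rewrite normcM normc_expi mulr1 normc_real ger0_norm ?expR_ge0. Qed.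

Lemma cexp_neq0 z : cexp z != 0.
Proof. by rewrite -normc_gt0 normc_cexp expR_gt0. Qed.

Lemma cexp_conj z : cexp z^* = (cexp z)^*.
Proof.
by case: z => a b; rewrite /cexp /expi /= cosN sinN; apply: eq_ReIm => /=; ring.
Qed.

(** Real part of [u] times the Taylor remainder of order [n] of the exponential at [t * z], expanded
    into real functions. Differentiation in [t] multiplies [u] by [z] and lowers the order by one,
    so the remainder estimate is an induction on [n] by monotonicity. *)
Let rem_fun u z n (t : R) : R :=
  expR (t * complex.Re z) * (complex.Re u * cos (t * complex.Im z)
     - complex.Im u * sin (t * complex.Im z))
  - \sum_(k < n) t ^+ k * (complex.Re (u * z ^+ k) / k`!%:R).

Let rem_funE u z n t :
  rem_fun u z n t = complex.Re (u * (cexp (t%:C * z) -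
    \sum_(k < n) (t%:C * z) ^+ k / k`!%:R)).
Proof.
rewrite mulrBr ReD ReN mulr_sumr Re_sum; congr (_ - _).
  rewrite /cexp !ReM !ImM /= !(mul0r, subr0, addr0); ring.
apply: eq_bigr => i _; rewrite exprMn -rmorphXn /=.
have -> : (i`!%:R)^-1 = (i`!%:R^-1)%:C :> R[i] by rewrite fmorphV /= rmorph_nat.
by rewrite mulrA mulrCA -mulrA !ReM /= !mul0r !ImM /=; ring.
Qed.

Let rem_fun_deriv u z n (t : R) :
  is_derive t 1 (rem_fun u z n.+1) (rem_fun (u * z) z n t).
Proof.
elim: n => [|n IHn].
  have -> : rem_fun u z 1 = fun t => expR (t * complex.Re z) *
    (complex.Re u * cos (t * complex.Im z) - complex.Im u * sin (t * complex.Im z))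
    - complex.Re u.
    apply/funext => s; rewrite /rem_fun big_ord1 expr0 mul1r expr0 mulr1 fact0.
    by rewrite divr1.
  apply: is_derive_eq; rewrite /rem_fun big_ord0 subr0 /GRing.scale /= ReM ImM.
  ring.
have -> : rem_fun u z n.+2 = fun t => rem_fun u z n.+1 t -
   t ^+ n.+1 * (complex.Re (u * z ^+ n.+1) / n.+1`!%:R).
  by apply/funext => s; rewrite /rem_fun [in LHS]big_ord_recr /= opprD addrA.
have -> : rem_fun (u * z) z n.+1 t = rem_fun (u * z) z n t -
   t ^+ n * (complex.Re (u * z ^+ n.+1) / n`!%:R).
  by rewrite /rem_fun [in LHS]big_ord_recr /= opprD addrA exprS mulrA.
apply: is_deriveB.
set c := complex.Re _.
have -> : t ^+ n * (c / n`!%:R) = n.+1%:R * t ^+ n * (c / n.+1`!%:R).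
  rewrite factS natrM; field.
  by rewrite nat1r !pnatr_eq0 /= -lt0n fact_gt0.
exact: is_derive_expr_mulc.
Qed.

Let rem_fun0 u z n : rem_fun u z n.+1 0 = 0.
Proof.
rewrite /rem_fun !mul0r expR0 cos0 sin0 mulr0 mulr1 mul1r subr0 big_ord_recl /=.
rewrite !expr0 mulr1 fact0 divr1 mul1r big1 ?addr0 ?subrr// => i _.
by rewrite exprS !mul0r.
Qed.

Let rem_fun_le u z n (t : R) : 0 <= t <= 1 ->
  rem_fun u z n t <=
  t ^+ n * (normc u * normc z ^+ n / n`!%:R * expR (normc z)).
Proof.
elim: n u t => [|n IHn] u t /andP[t0 t1].
  rewrite rem_funE big_ord0 subr0 expr0 expr0 mulr1 fact0 divr1 mul1r.
  apply: le_trans (ler_norm _) _; apply: le_trans (ler_Re_normc _) _.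
  rewrite normcM normc_cexp ler_wpM2l ?normc_ge0// ler_expR ReM /= mul0r subr0.
  apply: le_trans (ler_norm _) _; rewrite normrM ger0_norm//.
  by apply: le_trans (ler_Re_normc z); rewrite ler_piMl.
pose g s := s ^+ n.+1 * (normc u * normc z ^+ n.+1 / n.+1`!%:R * expR (normc z))
   - rem_fun u z n.+1 s.
suff : g 0 <= g t.
  by rewrite /g rem_fun0 exprS !mul0r subrr subr_ge0.
pose dg s := n.+1%:R * s ^+ n *
   (normc u * normc z ^+ n.+1 / n.+1`!%:R * expR (normc z)) - rem_fun (u * z) z n s.
apply: (@is_derive_ge0_le _ g dg) => // s /andP[s0 st].
  exact: (is_deriveB (is_derive_expr_mulc _ _ _) (rem_fun_deriv _ _ _ _)).
rewrite /dg subr_ge0; apply: le_trans (IHn _ _ _) _.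
  by rewrite s0 (le_trans st).
rewrite normcM exprS factS natrM le_eqVlt; apply/orP; left; apply/eqP.
by field; rewrite nat1r !pnatr_eq0 /= -lt0n fact_gt0.
Qed.

Lemma cexp_series z n :
  normc (cexp z - \sum_(k < n) z ^+ k / k`!%:R) <=
  normc z ^+ n / n`!%:R * expR (normc z).
Proof.
set w := _ - _; have [u u1 uw] := normc_unit_mul w.
have -> : normc w = rem_fun u z n 1 by rewrite rem_funE mul1r uw.
apply: le_trans (rem_fun_le _ _ _ _) _; first by rewrite ler01 lexx.
by rewrite expr1n mul1r u1 mul1r.
Qed.

End ComplexExp.

(** * Local second-order expansions and the maximum principle *)

Section Analytic.
Variable R : realType.
Implicit Types (f g : R[i] -> R[i]) (z w h : R[i]).

Definition bnd0 f := exists (C e : R), 0 < e /\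
  forall h, normc h < e -> normc (f h) <= C.

Lemma bnd0_cst c : bnd0 (fun=> c).
Proof. by exists (normc c), 1. Qed.

Lemma bnd0_id : bnd0 id.
Proof. by exists 1, 1; split=> // h /ltW. Qed.

Lemma bnd0D f g : bnd0 f -> bnd0 g -> bnd0 (fun h => f h + g h).
Proof.
move=> [C [e [e0 fC]]] [D [d [d0 gD]]].
exists (C + D), (Num.min e d); rewrite lt_min e0 d0; split=> // h.
rewrite lt_min => /andP[he hd]; apply: le_trans (normcD _ _) _.
by apply: lerD; [exact: fC|exact: gD].
Qed.

Lemma bnd0M f g : bnd0 f -> bnd0 g -> bnd0 (fun h => f h * g h).
Proof.
move=> [C [e [e0 fC]]] [D [d [d0 gD]]].
exists (C * D), (Num.min e d); rewrite lt_min e0 d0; split=> // h.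
rewrite lt_min => /andP[he hd]; rewrite normcM.
by apply: ler_pM; rewrite ?normc_ge0//; [exact: fC|exact: gD].
Qed.

Lemma bnd0X f n : bnd0 f -> bnd0 (fun h => f h ^+ n).
Proof.
move=> hf; elim: n => [|n IHn]; first exact: (@bnd0_cst 1).
have := bnd0M hf IHn; congr bnd0; apply/funext => h.
by rewrite exprS.
Qed.

Lemma bnd0_comp_small f g : bnd0 f -> bnd0 g -> bnd0 (fun h => f (h * g h)).
Proof.
move=> [C [e [e0 fC]]] [D [d [d0 gD]]].
have D1 : 0 < `|D| + 1 by rewrite ltr_wpDl.
exists C, (Num.min d (e / (`|D| + 1))).
rewrite lt_min d0 divr_gt0//; split=> // h.
rewrite lt_min => /andP[hd]; rewrite ltr_pdivlMr// => he; apply: fC.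
rewrite normcM; apply: le_lt_trans he; rewrite ler_wpM2l ?normc_ge0//.
by apply: (le_trans (gD _ hd)); rewrite (le_trans (ler_norm D))// lerDl.
Qed.

(* Second-order Taylor expansion at [z]: the only trace of holomorphy that the
   maximum principle below requires. *)
Definition ana f z := exists (a b : R[i]) (rho : R[i] -> R[i]) (e : R),
  [/\ 0 < e, bnd0 rho & forall h, normc h < e ->
  f (z + h) = f z + a * h + b * h ^+ 2 + h ^+ 3 * rho h].

Lemma ana_lip f z : ana f z -> exists (C e : R), 0 < e /\
  forall h, normc h < e -> normc (f (z + h) - f z) <= C * normc h.
Proof.
move=> [a [b [rho [e [e0 [C [d [d0 rC]]] fE]]]]].
exists (normc a + normc b + C), (Num.min (Num.min e d) 1).
rewrite !lt_min e0 d0 ltr01; split=> // h; rewrite !lt_min => /andP[/andP[he hd] /ltW h1].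
rewrite fE// [_ - f z](_ : _ = a * h + (b * h ^+ 2 + h ^+ 3 * rho h)); last ring.
rewrite !mulrDl; apply: le_trans (normcD _ _) _; rewrite normcM -addrA lerD2l.
apply: le_trans (normcD _ _) _; apply: lerD.
  rewrite normcM normcX expr2 ler_wpM2l ?normc_ge0// ler_piMl ?normc_ge0//.
rewrite normcM normcX mulrC ler_pM ?exprn_ge0 ?normc_ge0//; first exact: rC.
by rewrite exprS ler_piMr ?normc_ge0// exprn_ile1 ?normc_ge0.
Qed.

Lemma ana_cst c z : ana (fun=> c) z.
Proof.
exists 0, 0, (fun=> 0), 1; split=> //; first exact: bnd0_cst.
by move=> h _; rewrite !mul0r !mulr0 !addr0.
Qed.

Lemma ana_id z : ana id z.
Proof.
exists 1, 0, (fun=> 0), 1; split=> //; first exact: bnd0_cst.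
by move=> h _; rewrite !mul0r !mulr0 !addr0 mul1r.
Qed.

Lemma anaD f g z : ana f z -> ana g z -> ana (fun w => f w + g w) z.
Proof.
move=> [a [b [rho [e [e0 brho fE]]]]] [c [d [sig [e' [e'0 bsig gE]]]]].
exists (a + c), (b + d), (fun h => rho h + sig h), (Num.min e e').
split; rewrite ?lt_min ?e0//; first exact: bnd0D.
by move=> h; rewrite lt_min => /andP[he he']; rewrite fE// gE//; ring.
Qed.

Lemma anaM f g z : ana f z -> ana g z -> ana (fun w => f w * g w) z.
Proof.
move=> [a [b [rho [e [e0 brho fE]]]]] [c [d [sig [e' [e'0 bsig gE]]]]].
exists (a * g z + f z * c), (f z * d + a * c + b * g z),
  (fun h => a * d + b * c + b * d * h + rho h * (g z + c * h + d * h ^+ 2)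
     + sig h * (f z + a * h + b * h ^+ 2) + h ^+ 3 * (rho h * sig h)),
  (Num.min e e').
split; rewrite ?lt_min ?e0//.
  by do ![apply: bnd0D|apply: bnd0M|apply: bnd0X|exact: bnd0_cst|exact: bnd0_id|assumption].
by move=> h; rewrite lt_min => /andP[he he']; rewrite fE// gE//; ring.
Qed.

Lemma ana_comp f g z : ana g z -> ana f (g z) -> ana (fun w => f (g w)) z.
Proof.
move=> [a [b [rho [e [e0 brho gE]]]]] [c [d [sig [e' [e'0 bsig fE]]]]].
(* [m] is the difference quotient of [g] at [z]: [g (z + h) = g z + h * m h]. *)
pose n h := b + h * rho h; pose m h := a + h * n h.
have bn : bnd0 n.
  by do ![apply: bnd0D|apply: bnd0M|exact: bnd0_cst|exact: bnd0_id|assumption].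
have bm : bnd0 m.
  by do ![apply: bnd0D|apply: bnd0M|exact: bnd0_cst|exact: bnd0_id|assumption].
have [C [e2 [e20 mC]]] := bm.
have C1 : 0 < `|C| + 1 by rewrite ltr_wpDl.
exists (c * a), (c * b + d * a ^+ 2),
  (fun h => c * rho h + d * (2 * a * n h + h * n h ^+ 2) +
     m h ^+ 3 * sig (h * m h)),
  (Num.min (Num.min e e2) (e' / (`|C| + 1))).
split; rewrite ?lt_min ?e0 ?e20 ?divr_gt0//.
  by do ![apply: bnd0D|apply: bnd0M|apply: bnd0X|exact: bnd0_cst
         |exact: bnd0_id|apply: bnd0_comp_small|assumption].
move=> h; rewrite !lt_min => /andP[/andP[he he2]]; rewrite ltr_pdivlMr// => he'.
have -> : g (z + h) = g z + h * m h by rewrite gE// /m /n; ring.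
rewrite fE; last first.
  rewrite normcM; apply: le_lt_trans he'; rewrite ler_wpM2l ?normc_ge0//.
  by apply: (le_trans (mC _ he2)); rewrite (le_trans (ler_norm C))// lerDl.
by rewrite /m /n; ring.
Qed.

Lemma ana_inv z : z != 0 -> ana (fun w => w^-1) z.
Proof.
move=> z0; exists (- z ^- 2), (z ^- 3), (fun h => - z ^- 3 * (z + h)^-1), (normc z).
split; rewrite ?normc_gt0//.
  apply: bnd0M; first exact: bnd0_cst.
  exists (2 / normc z), (normc z / 2); split; first by rewrite divr_gt0 ?normc_gt0.
  move=> h hz; rewrite normcV -[2 / _]invrK invf_div lef_pV2 ?posrE ?normc_gt0//.
  - have := normc_ge_subD z h; lra.
  - apply/eqP => zh0; have := normc_ge_subD z h; rewrite zh0 normc0.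
    by move: z0; rewrite -normc_gt0; lra.
  - by rewrite divr_gt0 ?normc_gt0.
move=> h hz; have zh0 : z + h != 0.
  apply/eqP => zh0; have := normc_ge_subD z h; rewrite zh0 normc0; lra.
by field; rewrite zh0.
Qed.

Lemma ana_div f g z : ana f z -> ana g z -> g z != 0 ->
  ana (fun w => f w / g w) z.
Proof.
move=> af ag gz; apply: anaM => //.
by apply: (@ana_comp (fun w => w^-1)) => //; exact: ana_inv.
Qed.

Lemma ana_cexp z : ana (@cexp R) z.
Proof.
(* The value at 0 is arbitrary, as [rho] enters multiplied by [h ^+ 3]. *)
pose rho h := if h == 0 then 0 else
   cexp z * ((cexp h - (1 + h + h ^+ 2 / 2)) / h ^+ 3).
exists (cexp z), (cexp z / 2), rho, 1; split=> //.
  exists (expR (complex.Re z) * expR 1), 1; split=> // h h1.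
  rewrite /rho; case: eqVneq => [_|h0].
    by rewrite normc0 mulr_ge0 ?expR_ge0.
  rewrite normcM normc_cexp ler_wpM2l ?expR_ge0//.
  rewrite normcM normcV normcX ler_pdivrMr ?exprn_gt0 ?normc_gt0//.
  have := cexp_series h 3; rewrite !big_ord_recr big_ord0 /= add0r expr0 expr1 !divr1.
  move=> /le_trans; apply; rewrite mulrC ler_pM ?expR_ge0 ?divr_ge0 ?exprn_ge0 ?normc_ge0//.
    by rewrite ler_expR ltW.
  by rewrite ler_pdivrMr ?ler_peMr ?exprn_ge0 ?normc_ge0 ?ler1n// ltr0n.
move=> h _; rewrite cexpD /rho; case: eqVneq => [->|h0].
  by rewrite cexp0; ring.
by field.
Qed.

(* Averaging [|f|^2] over [z + i^k r] annihilates the cross terms of order at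
   most two, and [e * x^2] contributes a positive term. *)
Lemma ana_no_local_max f z (e : R) : 0 < e -> ana f z -> forall d : R, 0 < d ->
  exists h, [/\ normc h < d & normc (f z) ^+ 2 + e * complex.Re z ^+ 2 <
    normc (f (z + h)) ^+ 2 + e * complex.Re (z + h) ^+ 2].
Proof.
move=> e0 [a [b [rho [e1 [e10 [C [e2 [e20 rC]]] fE]]]]] d d0.
pose B := normc (f z) + normc a + normc b.
have B0 : 0 <= B by rewrite !addr_ge0 ?normc_ge0.
have C0 : 0 <= C.
  have := rC 0; rewrite normc0 => /(_ e20); apply: le_trans; exact: normc_ge0.
(* The last bound on [r] makes the cubic error of the four values together, [8 * B * C * r ^+ 3],
   smaller than the gain [2 * e * r ^+ 2]. *)
pose r := Num.min (Num.min (e1 / 2) (e2 / 2)) (Num.min (Num.min (d / 2) 1) (e / (8 * (B * C + 1)))).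
have BC : 0 < 8 * (B * C + 1).
  by rewrite mulr_gt0// ltr_wpDl// mulr_ge0.
have r0 : 0 < r by rewrite !lt_min !divr_gt0 ?ltr01.
have [re1 re2 rd r1 rE] : [/\ r < e1, r < e2, r < d, r <= 1 & r * (8 * (B * C + 1)) <= e].
  have : r <= r by []; rewrite {2}/r !le_min.
  clearbody r.
  move=> /andP[/andP[h1 h2] /andP[/andP[h3 h4] h5]].
  rewrite ler_pdivlMr// in h5; split=> //; lra.
pose hh (k : nat) : R[i] := 'i%C ^+ k * r%:C.
have nhh k : normc (hh k) = r.
  by rewrite normcM normcX normc_i expr1n mul1r normc_real gtr0_norm.
pose m h := f z + a * h + b * h ^+ 2.
have lower k : normc (m (hh k)) ^+ 2 - 2 * B * C * r ^+ 3 <= normc (f (z + hh k)) ^+ 2.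
  rewrite fE ?nhh// -/(m (hh k)).
  have mB : normc (m (hh k)) <= B.
    rewrite /m /B; apply: le_trans (normcD _ _) _; apply: lerD.
      apply: le_trans (normcD _ _) _; rewrite lerD2l normcM nhh.
      by rewrite ler_piMr ?normc_ge0.
    by rewrite normcM normcX nhh ler_piMr ?normc_ge0// exprn_ile1// ltW.
  have rho3 : normc (hh k ^+ 3 * rho (hh k)) <= C * r ^+ 3.
    rewrite normcM normcX nhh mulrC; apply: ler_wpM2r.
      by rewrite exprn_ge0// ltW.
    by apply: rC; rewrite nhh.
  have := normc_ge_subD (m (hh k)) (hh k ^+ 3 * rho (hh k)).
  have := normc_ge0 (m (hh k) + hh k ^+ 3 * rho (hh k)).
  have := normc_ge0 (hh k ^+ 3 * rho (hh k)).
  have := normc_ge0 (m (hh k)).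
  move: (normc (m (hh k))) (normc (hh k ^+ 3 * rho (hh k)))
    (normc (m (hh k) + hh k ^+ 3 * rho (hh k))) mB rho3 => p q s mB rho3 p0 q0 s0 pqs.
  have [qp|pq] := leP q p.
    have : (p - q) ^+ 2 <= s ^+ 2 by rewrite ler_sqr ?nnegrE ?subr_ge0.
    have : p * q <= B * (C * r ^+ 3) by exact: ler_pM.
    have := sqr_ge0 q; lra.
  have : p * p <= B * (C * r ^+ 3).
    by apply: ler_pM => //; exact: le_trans (ltW pq) _.
  by have := sqr_ge0 s; have := sqr_ge0 p; rewrite !expr2; lra.
have sumE : \sum_(k < 4) (normc (m (hh k)) ^+ 2 + e * complex.Re (z + hh k) ^+ 2)
   = 4 * (normc (f z) ^+ 2 + e * complex.Re z ^+ 2) + 4 * (normc a * r) ^+ 2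
   + 4 * (normc b * r ^+ 2) ^+ 2 + 2 * e * r ^+ 2.
  rewrite !big_ord_recr big_ord0 /= add0r.
  rewrite /m /hh !exprMn !sqr_normcE.
  have -> : ('i%C : R[i]) ^+ 3 = - 'i%C by rewrite exprS sqr_i mulrN1.
  rewrite sqr_i expr1 expr0.
  case: (f z) => f1 f2; case: (a) => a1 a2; case: (b) => b1 b2; case: (z) => x y /=.
  rewrite !expr2 /=; ring.
have [[k ltk]|nex] := pselect (exists k : 'I_4, normc (f z) ^+ 2 + e * complex.Re z ^+ 2 <
    normc (f (z + hh k)) ^+ 2 + e * complex.Re (z + hh k) ^+ 2).
  by exists (hh k); rewrite nhh.
exfalso.
have : \sum_(k < 4) (normc (m (hh k)) ^+ 2 + e * complex.Re (z + hh k) ^+ 2) <=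
    \sum_(k < 4) (normc (f z) ^+ 2 + e * complex.Re z ^+ 2 + 2 * B * C * r ^+ 3).
  apply: ler_sum => k _; have := lower k.
  have : ~ (normc (f z) ^+ 2 + e * complex.Re z ^+ 2 <
    normc (f (z + hh k)) ^+ 2 + e * complex.Re (z + hh k) ^+ 2).
    by move=> h; apply: nex; exists k.
  move=> /negP; rewrite -leNgt; lra.
rewrite sumE sumr_const card_ord -mulr_natl.
have : 2 * e * r ^+ 2 > 4 * (2 * B * C * r ^+ 3).
  have -> : 4 * (2 * B * C * r ^+ 3) = r ^+ 2 * (r * (8 * (B * C))) by ring.
  rewrite [ltRHS]mulrC ltr_pM2l ?exprn_gt0//.
  apply: le_lt_trans (_ : e < _); last by lra.
  apply: le_trans rE; rewrite ler_pM2l// ler_pM2l//; lra.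
have := sqr_ge0 (normc a * r); have := sqr_ge0 (normc b * r ^+ 2).
by move=> *; lra.
Qed.

Lemma ana_cont_sqr f (e x y : R) : ana f (x +i* y) ->
  {for (x, y), continuous (fun p : R * R =>
     normc (f (p.1 +i* p.2)) ^+ 2 + e * p.1 ^+ 2)}.
Proof.
move=> /ana_lip[C [d [d0 fC]]].
have cf : {for (x, y), continuous (fun p : R * R => normc (f (p.1 +i* p.2)))}.
  apply/cvgrPdist_le => /= eps eps0.
  pose D := `|C| + 1.
  have D0 : 0 < D by rewrite ltr_wpDl.
  set m := Num.min (d / 2) (eps / (2 * D)).
  have m0 : 0 < m by rewrite lt_min !divr_gt0// mulr_gt0.
  exists (ball x m, ball y m) => /=; first by split; exact: nbhsx_ballx.
  move=> [x' y'] [/= ]; rewrite /ball /= => bx by_.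
  have [bx1 bx2] : `|x - x'| < d / 2 /\ `|x - x'| < eps / (2 * D).
    by apply/andP; rewrite -lt_min.
  have [by1 by2] : `|y - y'| < d / 2 /\ `|y - y'| < eps / (2 * D).
    by apply/andP; rewrite -lt_min.
  set h := (x' - x) +i* (y' - y).
  have hE : x' +i* y' = x +i* y + h by rewrite /h; apply: eq_ReIm => /=; ring.
  have nh : normc h <= `|x - x'| + `|y - y'|.
    by apply: le_trans (normc_le_ReIm _) _; rewrite /h /= distrC [`|y' - y|]distrC.
  rewrite distrC hE; apply: (@le_trans _ _ (normc (f (x +i* y + h) - f (x +i* y)))).
    rewrite ler_norml; apply/andP; split; last exact: normc_ge_sub.
    by rewrite lerNl opprB normc_distC normc_ge_sub.
  have hd : normc h < d by apply: (le_lt_trans nh); lra.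
  apply: (le_trans (fC _ hd)).
  apply: (@le_trans _ _ (D * normc h)).
    by rewrite ler_wpM2r ?normc_ge0// (le_trans (ler_norm C))// lerDl.
  rewrite mulrC -ler_pdivlMr//; apply: (le_trans nh).
  have -> : eps / D = eps / (2 * D) + eps / (2 * D).
    by field; rewrite gt_eqF.
  lra.
rewrite /continuous_at.
apply: (@cvgD _ _ _ _ _ (fun p : R * R => normc (f (p.1 +i* p.2)) ^+ 2)
   (fun p : R * R => e * p.1 ^+ 2)).
  by apply: cvgM.
apply: cvgM; first exact: cvg_cst.
by apply: cvgM; exact: cvg_fst.
Qed.

(** The function [|f|^2 + e x^2] attains its maximum on the rectangle, and not inside it; its
    boundary values are at most [C ^+ 2 + e * X], and [e] tends to 0. Rectangles are enough: a
    truncated sector is one in logarithmic coordinates. *)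
Theorem max_principle f (x0 x1 y0 y1 C : R) :
  (forall x y, x0 <= x <= x1 -> y0 <= y <= y1 -> ana f (x +i* y)) ->
  (forall x y, x0 <= x <= x1 -> y0 <= y <= y1 ->
     [|| x == x0, x == x1, y == y0 | y == y1] -> normc (f (x +i* y)) <= C) ->
  forall x y, x0 <= x <= x1 -> y0 <= y <= y1 -> normc (f (x +i* y)) <= C.
Proof.
move=> af bf x y xI yI.
have xx : x0 <= x1 by case/andP: xI; apply: le_trans.
have yy : y0 <= y1 by case/andP: yI; apply: le_trans.
have C0 : 0 <= C.
  by apply: le_trans (bf x0 y0 _ _ _); rewrite ?normc_ge0 ?lexx ?eqxx.
pose K : set (R * R) := `[x0, x1]%classic `*` `[y0, y1]%classic.
have KE p : K p <-> x0 <= p.1 <= x1 /\ y0 <= p.2 <= y1.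
  by rewrite /K /= !in_itv /=.
have cK : compact K by apply: compact_setX; exact: segment_compact.
have K0 : K !=set0 by exists (x, y); apply/KE.
pose X := Num.max (x0 ^+ 2) (x1 ^+ 2).
have X0 : 0 <= X by rewrite le_max sqr_ge0.
have main (e : R) : 0 < e -> normc (f (x +i* y)) ^+ 2 <= C ^+ 2 + e * X.
  move=> e0; pose u (p : R * R) := normc (f (p.1 +i* p.2)) ^+ 2 + e * p.1 ^+ 2.
  have cu : {within K, continuous u}.
    apply: continuous_in_subspaceT => -[p q]; rewrite inE => /KE[/= pI qI].
    by apply: ana_cont_sqr; exact: af.
  have [[p q]] := compact_EVT_max K0 cK cu.
  rewrite inE => /KE[/= pI qI] umax.
  have := umax (x, y); rewrite inE => /(_ ((KE (x, y)).2 (conj xI yI))).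
  rewrite /u /= => uxy.
  have e1 : 0 <= e * x ^+ 2 by rewrite mulr_ge0 ?sqr_ge0 ?ltW.
  have [onb|/norP[p0 /norP[p1 /norP[q0 q1]]]] :=
    boolP [|| p == x0, p == x1, q == y0 | q == y1].
    have fb : normc (f (p +i* q)) ^+ 2 <= C ^+ 2.
      by rewrite ler_sqr ?nnegrE ?normc_ge0//; exact: bf.
    have : e * p ^+ 2 <= e * X.
      apply: ler_wpM2l; first exact: ltW.
      rewrite /X le_max -[p ^+ 2]real_normK ?num_real// -[x0 ^+ 2]real_normK ?num_real//.
      rewrite -[x1 ^+ 2]real_normK ?num_real//.
      have [pp|pp] := leP 0 p.
        apply/orP; right; rewrite ler_sqr ?nnegrE// !ger0_norm//; lra.
      apply/orP; left; rewrite ler_sqr ?nnegrE// !ler0_norm//; lra.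
    lra.
  move/andP: pI => [xp px]; move/andP: qI => [yq qy].
  have ltxp : x0 < p by rewrite lt_neqAle eq_sym p0.
  have ltpx : p < x1 by rewrite lt_neqAle p1.
  have ltyq : y0 < q by rewrite lt_neqAle eq_sym q0.
  have ltqy : q < y1 by rewrite lt_neqAle q1.
  pose d := Num.min (Num.min (p - x0) (x1 - p)) (Num.min (q - y0) (y1 - q)).
  have d0 : 0 < d by rewrite !lt_min !subr_gt0 ltxp ltpx ltyq.
  have afpq : ana f (p +i* q) by apply: af; rewrite ?xp ?yq.
  have [h [hd]] := ana_no_local_max e0 afpq d0.
  have := ler_Re_normc h; have := ler_Im_normc h.
  move: hd; rewrite !lt_min => /andP[/andP[h1 h2] /andP[h3 h4]].
  rewrite !ler_norml => /andP[i1 i2] /andP[r1 r2] lt_u.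
  have := umax (p + complex.Re h, q + complex.Im h); rewrite inE.
  have inK : K (p + complex.Re h, q + complex.Im h) by apply/KE => /=; split; lra.
  move=> /(_ inK); rewrite /u /= => ule.
  move: lt_u; rewrite ltNge => /negP[].
  have -> : p +i* q + h = (p + complex.Re h) +i* (q + complex.Im h).
    by apply: eq_ReIm; rewrite /= ?ReD ?ImD.
  by rewrite /=.
rewrite -ler_sqr ?nnegrE ?normc_ge0//.
apply/ler_addgt0Pr => eps eps0.
have X1 : 0 < X + 1 by rewrite ltr_wpDl.
apply: le_trans (main (eps / (X + 1)) _) _; first by rewrite divr_gt0.
rewrite lerD2l mulrAC ler_pdivrMr// ler_pM2l//; lra.
Qed.

End Analytic.

(** * Entire functions as power series with geometric convergence *)

Section PowerSeries.
Variable R : realType.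
Implicit Types (a b : nat -> R[i]) (f g : R[i] -> R[i]) (z w e : R[i]).

Lemma pow2_ge n : (n%:R : R) <= 2 ^+ n.
Proof.
by rewrite -natrX ler_nat ltnW// ltn_expl.
Qed.

Lemma geo_small (K eps : R) : 0 < eps -> exists n : nat, K / 2 ^+ n < eps.
Proof.
move=> eps0; exists (Num.bound (`|K| / eps)).
rewrite ltr_pdivrMr ?exprn_gt0// mulrC -ltr_pdivrMr//.
apply: lt_le_trans (pow2_ge _); apply: le_lt_trans (_ : `|K| / eps < _).
  by rewrite ler_pM2r ?invr_gt0// ler_norm.
by apply: archi_boundP; rewrite divr_ge0// ltW.
Qed.

(** Passage to the limit in an inequality whose error is explicit; power series are handled through
    this form instead of a topology. *)
Lemma le_geo (x A K : R) : (forall n, x <= A + K / 2 ^+ n) -> x <= A.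
Proof.
move=> h; apply/ler_addgt0Pr => eps eps0.
have [n nE] := geo_small K eps0.
by apply: (le_trans (h n)); rewrite lerD2l ltW.
Qed.

Lemma eq_geo z w (K : R) : (forall n, normc (z - w) <= K / 2 ^+ n) -> z = w.
Proof.
move=> h; apply/eqP; rewrite -subr_eq0 -normc_eq0 eq_le normc_ge0 andbT.
by apply: (@le_geo _ _ K) => n; rewrite add0r.
Qed.

(** The intervals of radius [2 * K / 2 ^+ n] around [x n] are nested; the limit is the supremum of
    their left endpoints. *)
Lemma real_geo_lim (x : nat -> R) (K : R) :
  (forall n, `|x n.+1 - x n| <= K / 2 ^+ n) ->
  exists l, forall n, `|l - x n| <= 2 * K / 2 ^+ n.
Proof.
move=> h.
have step n : 2 * K / 2 ^+ n = K / 2 ^+ n + 2 * K / 2 ^+ n.+1.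
  by rewrite exprS; field; rewrite expf_neq0.
have lo n m : (n <= m)%N -> x n - 2 * K / 2 ^+ n <= x m - 2 * K / 2 ^+ m.
  elim: m => [|m IHm]; first by rewrite leqn0 => /eqP ->.
  rewrite leq_eqVlt => /orP[/eqP -> //|/IHm /le_trans]; apply.
  by have := h m; rewrite (step m) ler_norml => /andP[]; lra.
have hi n m : (n <= m)%N -> x m + 2 * K / 2 ^+ m <= x n + 2 * K / 2 ^+ n.
  elim: m => [|m IHm]; first by rewrite leqn0 => /eqP ->.
  rewrite leq_eqVlt => /orP[/eqP -> //|/IHm]; apply: le_trans.
  by have := h m; rewrite (step m) ler_norml => /andP[]; lra.
have K0 n : 0 <= 2 * K / 2 ^+ n.
  have : 0 <= K by have := h 0; rewrite expr0 divr1; apply: le_trans.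
  by move=> ?; rewrite divr_ge0 ?mulr_ge0 ?exprn_ge0.
have lohi n m : x m - 2 * K / 2 ^+ m <= x n + 2 * K / 2 ^+ n.
  have [nm|/ltnW mn] := leqP n m.
    by have := hi _ _ nm; have := K0 m; lra.
  by have := lo _ _ mn; have := K0 n; lra.
pose E := range (fun n => x n - 2 * K / 2 ^+ n).
have supE : has_sup E.
  split; first by exists (x 0 - 2 * K / 2 ^+ 0); exists 0.
  by exists (x 0 + 2 * K / 2 ^+ 0) => _ [m _ <-]; exact: lohi.
exists (sup E) => n.
have h1 : x n - 2 * K / 2 ^+ n <= sup E.
  by apply: ub_le_sup; [case: supE|exists n].
have h2 : sup E <= x n + 2 * K / 2 ^+ n.
  by apply: ge_sup; [case: supE|move=> _ [m _ <-]; exact: lohi].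
by rewrite ler_norml; apply/andP; split; lra.
Qed.

Lemma complex_geo_lim (x : nat -> R[i]) (K : R) :
  (forall n, normc (x n.+1 - x n) <= K / 2 ^+ n) ->
  exists l, forall n, normc (l - x n) <= 4 * K / 2 ^+ n.
Proof.
move=> h.
have [n|l1 l1P] := @real_geo_lim (fun n => complex.Re (x n)) K.
  by apply: le_trans (h n); rewrite -ReN -ReD ler_Re_normc.
have [n|l2 l2P] := @real_geo_lim (fun n => complex.Im (x n)) K.
  by apply: le_trans (h n); rewrite -ImN -ImD ler_Im_normc.
exists (l1 +i* l2) => n; apply: (le_trans (normc_le_ReIm _)).
rewrite !ReD !ImD !ReN !ImN /=.
by apply: (le_trans (lerD (l1P n) (l2P n))); rewrite le_eqVlt -mulrDl -mulrDl -natrD eqxx.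
Qed.

Definition psum a n z : R[i] := \sum_(k < n) a k * z ^+ k.

Definition dec a := forall rho : R, 0 < rho ->
  exists K, forall k, normc (a k) * rho ^+ k <= K.

(* The geometric rate is the form in which the infinite radius of convergence
   is used; it is equivalent to pointwise convergence plus [dec]. *)
Definition ent a f := forall rho : R, 0 < rho ->
  exists K, forall n z, normc z <= rho -> normc (f z - psum a n z) <= K / 2 ^+ n.

Definition entire f := exists a, ent a f.

Lemma psumS a n z : psum a n.+1 z = psum a n z + a n * z ^+ n.
Proof. by rewrite /psum big_ord_recr. Qed.

Lemma psum0 a z : psum a 0 z = 0. Proof. by rewrite /psum big_ord0. Qed.

Lemma psumSl a n z : psum a n.+1 z = a 0 + z * psum (fun k => a k.+1) n z.
Proof.
rewrite /psum big_ord_recl expr0 mulr1 mulr_sumr; congr (_ + _).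
by apply: eq_bigr => i _; rewrite /= exprS mulrCA.
Qed.

Lemma ent_dec a f : ent a f -> dec a.
Proof.
move=> h rho rho0; have [K fK] := h _ rho0.
have nr : normc (rho%:C) = rho by rewrite normc_real gtr0_norm.
have K0 : 0 <= K.
  have := fK 0 rho%:C; rewrite nr lexx expr0 divr1 => /(_ isT).
  by apply: le_trans; exact: normc_ge0.
exists (2 * K) => k; rewrite -[in rho ^+ k]nr -normcX -normcM.
have -> : a k * rho%:C ^+ k = (f rho%:C - psum a k rho%:C) -
   (f rho%:C - psum a k.+1 rho%:C) by rewrite psumS; ring.
have KK n : K / 2 ^+ n <= K.
  by rewrite ler_pdivrMr ?exprn_gt0// ler_peMr// exprn_ege1// ler1n.
apply: le_trans (normcB _ _) _.
have -> : 2 * K = K + K by ring.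
apply: lerD.
  by apply: (le_trans (fK k _ _)); rewrite ?nr.
by apply: (le_trans (fK k.+1 _ _)); rewrite ?nr.
Qed.

Lemma dec_term a (rho : R) : dec a -> 0 < rho -> exists K, 0 <= K /\
  forall k z, normc z <= rho -> normc (a k * z ^+ k) <= K / 2 ^+ k.
Proof.
move=> da rho0; have [|K aK] := da (2 * rho); first by rewrite mulr_gt0.
exists K; split.
  by have := aK 0; rewrite expr0 mulr1; apply: le_trans; exact: normc_ge0.
move=> k z zr; rewrite ler_pdivlMr ?exprn_gt0//; apply: le_trans (aK k).
rewrite normcM normcX -mulrA ler_wpM2l ?normc_ge0// exprMn mulrC.
by rewrite ler_wpM2l ?exprn_ge0// lerXn2r// ?nnegrE ?normc_ge0 ?ltW.
Qed.

Lemma dec_lim a z : dec a -> exists l K, forall n, normc (l - psum a n z) <= K / 2 ^+ n.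
Proof.
move=> da.
have z1 : 0 < normc z + 1 by rewrite ltr_wpDl ?normc_ge0.
have [K [K0 aK]] := dec_term da z1.
have [n|l lP] := @complex_geo_lim (psum a ^~ z) K.
  by rewrite psumS addrAC subrr add0r aK// lerDl.
by exists l, (4 * K).
Qed.

(** The uniform rate comes from [dec], so only pointwise convergence to [f] remains to be checked,
    with a constant depending on [z] and along a subsequence [m] of the partial sums. The
    subsequence serves for operations that move the indices, such as multiplication by [z] and
    composition with the square. *)
Lemma ent_of_lim a f : dec a -> (forall z, exists K, forall n,
  exists2 m, (n <= m)%N & normc (f z - psum a m z) <= K / 2 ^+ n) -> ent a f.
Proof.
move=> da fl rho rho0; have [K [K0 aK]] := dec_term da rho0.
exists (2 * K) => n z zr.
have step m d : normc (psum a (m + d) z - psum a m z) <= 2 * K / 2 ^+ m - 2 * K / 2 ^+ (m + d).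
  elim: d => [|d IHd]; first by rewrite addn0 !subrr normc0.
  rewrite addnS psumS addrAC; apply: le_trans (normcD _ _) _.
  have -> : 2 * K / 2 ^+ m - 2 * K / 2 ^+ (m + d).+1 =
    2 * K / 2 ^+ m - 2 * K / 2 ^+ (m + d) + K / 2 ^+ (m + d).
    by rewrite [in LHS]exprS; field; rewrite !expf_neq0.
  by apply: lerD => //; exact: aK.
have [L fL] := fl z.
apply: (@le_geo _ _ L) => k.
have [m km fm] := fL (maxn n k).
have nm : (n <= m)%N by apply: leq_trans km; exact: leq_maxl.
have -> : f z - psum a n z = (f z - psum a m z) + (psum a m z - psum a n z) by ring.
apply: (le_trans (normcD _ _)); rewrite addrC; apply: lerD.
  have := step n (m - n)%N; rewrite subnKC// => /le_trans; apply.
  by rewrite gerBl divr_ge0 ?mulr_ge0 ?exprn_ge0.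
have L0 : 0 <= L.
  have [m0 _ fm0] := fL 0; have := le_trans (normc_ge0 _) fm0.
  by rewrite expr0 divr1.
apply: (le_trans fm); rewrite ler_wpM2l// lef_pV2 ?posrE ?exprn_gt0//.
by rewrite ler_weXn2l ?ler1n// leq_maxr.
Qed.

Lemma ent_of_lim_id a f : dec a -> (forall z, exists K, forall n,
  normc (f z - psum a n z) <= K / 2 ^+ n) -> ent a f.
Proof.
move=> da fl; apply: ent_of_lim => // z; have [K fK] := fl z.
by exists K => n; exists n.
Qed.

Lemma dec_ent a : dec a -> exists f, ent a f.
Proof.
move=> da; have [f fP] := choice (fun z => dec_lim z da).
by exists f; exact: ent_of_lim_id.
Qed.

Lemma ent_lim a f z : ent a f -> exists2 K, 0 <= K & forall n, normc (f z - psum a n z) <= K / 2 ^+ n.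
Proof.
move=> ef; have z1 : 0 < normc z + 1 by rewrite ltr_wpDl ?normc_ge0.
have [K fK] := ef _ z1; exists K; last by move=> n; apply: fK; rewrite lerDl.
have := fK 0 z; rewrite lerDl ler01 => /(_ isT); rewrite expr0 divr1.
by apply: le_trans; exact: normc_ge0.
Qed.

Lemma entire_bounded f (rho : R) : entire f -> exists2 K, 0 <= K & forall z,
  normc z <= rho -> normc (f z) <= K.
Proof.
move=> [a ef]; have r1 : 0 < `|rho| + 1 by rewrite ltr_wpDl.
have [K fK] := ef _ r1; exists K => [|z zr].
  have := fK 0 0; rewrite normc0 ltW// => /(_ isT); rewrite expr0 divr1.
  by apply: le_trans; exact: normc_ge0.
have := fK 0 z; rewrite psum0 subr0 expr0 divr1; apply.
by apply: (le_trans zr); rewrite (le_trans (ler_norm rho))// lerDl.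
Qed.

Lemma decD a b : dec a -> dec b -> dec (fun k => a k + b k).
Proof.
move=> da db rho rho0; have [K aK] := da _ rho0; have [L bL] := db _ rho0.
exists (K + L) => k; apply: le_trans (lerD (aK k) (bL k)).
by rewrite -mulrDl ler_wpM2r ?exprn_ge0 ?normcD// ltW.
Qed.

Lemma decZ c a : dec a -> dec (fun k => c * a k).
Proof.
move=> da rho rho0; have [K aK] := da _ rho0.
by exists (normc c * K) => k; rewrite normcM -mulrA ler_wpM2l ?normc_ge0.
Qed.

Lemma dec_shift a : dec a -> dec (fun k => a k.+1).
Proof.
move=> da rho rho0; have [K aK] := da _ rho0.
exists (K / rho) => k; rewrite ler_pdivlMr// -mulrA -exprSr; exact: aK.
Qed.

Lemma dec_consn c a : dec a -> dec (fun k => if k is k'.+1 then a k' else c).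
Proof.
move=> da rho rho0; have [K aK] := da _ rho0.
exists (Num.max (normc c) (K * rho)) => -[|k].
  by rewrite expr0 mulr1 le_max lexx.
by rewrite exprSr mulrA le_max ler_pM2r// aK orbT.
Qed.

Lemma entD a b f g : ent a f -> ent b g ->
  ent (fun k => a k + b k) (fun z => f z + g z).
Proof.
move=> ef eg; apply: ent_of_lim_id.
  by apply: decD; [exact: ent_dec ef|exact: ent_dec eg].
move=> z; have [K _ fK] := ent_lim z ef; have [L _ gL] := ent_lim z eg.
exists (K + L) => n; rewrite mulrDl; apply: le_trans (lerD (fK n) (gL n)).
have -> : psum (fun k => a k + b k) n z = psum a n z + psum b n z.
  by rewrite /psum -big_split /=; apply: eq_bigr => i _; rewrite mulrDl.
by apply: le_trans (normcD _ _); rewrite opprD addrACA.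
Qed.

Lemma entZ c a f : ent a f -> ent (fun k => c * a k) (fun z => c * f z).
Proof.
move=> ef; apply: ent_of_lim_id; first by apply: decZ; exact: ent_dec ef.
move=> z; have [K _ fK] := ent_lim z ef.
exists (normc c * K) => n.
have -> : psum (fun k => c * a k) n z = c * psum a n z.
  by rewrite /psum mulr_sumr; apply: eq_bigr => i _; rewrite mulrA.
by rewrite -mulrBr normcM -mulrA ler_wpM2l ?normc_ge0.
Qed.

Lemma entireD f g : entire f -> entire g -> entire (fun z => f z + g z).
Proof. by move=> [a ef] [b eg]; exists (fun k => a k + b k); exact: entD. Qed.

Lemma entireZ c f : entire f -> entire (fun z => c * f z).
Proof. by move=> [a ef]; exists (fun k => c * a k); exact: entZ. Qed.

Lemma entire_cst c : entire (fun=> c).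
Proof.
have d0 : dec (fun=> 0 : R[i]).
  by move=> rho _; exists 0 => k; rewrite normc0 mul0r.
exists (fun k => if k is k'.+1 then 0 else c); apply: ent_of_lim.
  exact: dec_consn.
move=> z; exists 0 => n; exists n.+1 => //; rewrite psumSl /psum big1.
  by rewrite mulr0 addr0 subrr normc0 mul0r.
by move=> i _; rewrite mul0r.
Qed.

Lemma entire_mulX f : entire f -> entire (fun z => z * f z).
Proof.
move=> [a ef]; exists (fun k => if k is k'.+1 then a k' else 0).
apply: ent_of_lim; first by apply: dec_consn; exact: ent_dec ef.
move=> z; have [K K0 fK] := ent_lim z ef.
exists (normc z * K) => n; exists n.+1 => //.
by rewrite psumSl add0r -mulrBr normcM -mulrA ler_wpM2l ?normc_ge0.
Qed.

Lemma entire_mul_sub e f : entire f -> entire (fun z => (z - e) * f z).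
Proof.
move=> ef; have := entireD (entire_mulX ef) (entireZ (- e) ef).
by congr entire; apply/funext => z; rewrite mulrBl mulNr.
Qed.

(** Synthetic division: the coefficients of the quotient are the tails
    [g k = sum_j a (k + j + 1) e^j], and [f e = 0] says that [a 0 + e * g 0 = 0]. *)
Lemma entire_div f e : entire f -> f e = 0 ->
  exists2 g, entire g & forall z, f z = (z - e) * g z.
Proof.
move=> [a ef] fe0; have da := ent_dec ef.
have dk k : dec (fun j => a (k + j).+1).
  elim: k => [|k IHk]; first exact: dec_shift.
  by have := dec_shift IHk; congr dec; apply/funext => j; rewrite addSn addnS.
have [g gP] := choice (fun k => dec_lim e (dk k)).
have gS k : g k = a k.+1 + e * g k.+1.
  have [K gK] := gP k; have [L gL] := gP k.+1.
  apply: (@eq_geo _ _ (K + normc e * L)) => n.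
  have -> : g k - (a k.+1 + e * g k.+1) =
     (g k - psum (fun j => a (k + j).+1) n.+1 e) -
     e * (g k.+1 - psum (fun j => a (k.+1 + j).+1) n e).
    have -> : (fun j => a (k.+1 + j).+1) = (fun j => a (k + j.+1).+1).
      by apply/funext => j; rewrite addSn addnS.
    by rewrite psumSl addn0; ring.
  apply: (le_trans (normcB _ _)); rewrite mulrDl; apply: lerD.
    apply: (le_trans (gK _)).
    have K0 : 0 <= K.
      by have := gK 0; rewrite expr0 divr1; apply: le_trans; exact: normc_ge0.
    by rewrite ler_wpM2l// lef_pV2 ?posrE ?exprn_gt0// ler_eXn2l// ltr1n.
  by rewrite normcM -mulrA ler_wpM2l ?normc_ge0.
have g0 : a 0 = - (e * g 0).
  have [K K0 fK] := ent_lim e ef; have [L gL] := gP 0.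
  apply: (@eq_geo _ _ (K + normc e * L)) => n.
  have -> : a 0 - - (e * g 0) =
     e * (g 0 - psum (fun j => a (0 + j).+1) n e) - (f e - psum a n.+1 e).
    by rewrite psumSl fe0; ring.
  apply: (le_trans (normcB _ _)); rewrite addrC mulrDl; apply: lerD.
    apply: (le_trans (fK _)).
    by rewrite ler_wpM2l// lef_pV2 ?posrE ?exprn_gt0// ler_eXn2l// ltr1n.
  by rewrite normcM -mulrA ler_wpM2l ?normc_ge0.
have dg : dec g.
  (* Since [r] is at least [2 * normc e], the decay of [a] at radius [r] bounds the terms of the
     tail [g k] by a geometric series of ratio 1/2; and since [r] exceeds [rho], the sum decays at
     radius [rho]. *)
  move=> rho rho0; pose r := 1 + rho + 2 * normc e.
  have r0 : 0 < r by have := normc_ge0 e; rewrite /r; lra.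
  have [K aK] := da _ r0.
  have K0 : 0 <= K.
    by have := aK 0; rewrite expr0 mulr1; apply: le_trans; exact: normc_ge0.
  have gk k : normc (g k) <= 2 * K / r ^+ k.+1.
    have [L gL] := gP k; apply: (@le_geo _ _ L) => n.
    have -> : g k = psum (fun j => a (k + j).+1) n e +
       (g k - psum (fun j => a (k + j).+1) n e) by ring.
    apply: (le_trans (normcD _ _)); apply: lerD => //.
    apply: (@le_trans _ _ ((2 * K - 2 * K / 2 ^+ n) / r ^+ k.+1)); last first.
      rewrite ler_pM2r ?invr_gt0 ?exprn_gt0// gerBl.
      by rewrite divr_ge0 ?mulr_ge0 ?exprn_ge0.
    elim: n => [|n IHn]; first by rewrite psum0 normc0 expr0 divr1 subrr mul0r.
    rewrite psumS; apply: (le_trans (normcD _ _)).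
    have -> : (2 * K - 2 * K / 2 ^+ n.+1) / r ^+ k.+1 =
      (2 * K - 2 * K / 2 ^+ n) / r ^+ k.+1 + K / 2 ^+ n / r ^+ k.+1.
      by rewrite [2 ^+ n.+1]exprS; field; rewrite !expf_neq0// gt_eqF.
    apply: lerD => //; rewrite normcM normcX.
    rewrite -mulrA -invfM ler_pdivlMr ?mulr_gt0 ?exprn_gt0//.
    apply: le_trans (aK (k + n).+1); rewrite -mulrA ler_wpM2l ?normc_ge0//.
    rewrite -addSn addnC exprD mulrA ler_pM2r ?exprn_gt0//.
    rewrite -exprMn lerXn2r ?nnegrE ?mulr_ge0 ?normc_ge0//; first exact: ltW.
    by rewrite /r; lra.
  exists (2 * K) => k.
  apply: (@le_trans _ _ (2 * K / r ^+ k.+1 * r ^+ k.+1)); last first.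
    by rewrite divfK// expf_neq0// gt_eqF.
  apply: ler_pM; [exact: normc_ge0|by rewrite exprn_ge0// ltW|exact: gk|].
  apply: (@le_trans _ _ (r ^+ k)).
    by rewrite lerXn2r ?nnegrE// ?(ltW rho0) ?(ltW r0)// /r; have := normc_ge0 e; lra.
  rewrite exprS ler_peMl ?exprn_ge0 ?(ltW r0)//.
  by rewrite /r; have := normc_ge0 e; lra.
have [f1 f1P] := dec_ent dg.
exists f1; first by exists g.
have rec n z : (z - e) * psum g n.+1 z = psum a n.+1 z + g n * z ^+ n.+1.
  elim: n => [|n IHn].
    by rewrite /psum !big_ord1 expr0 expr1 g0; ring.
  by rewrite psumS mulrDr IHn [psum a n.+2 z]psumS gS exprS [z ^+ n.+2]exprS [z ^+ n.+1]exprS; ring.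
move=> z; have [K K0 fK] := ent_lim z ef; have [L L0 gL] := ent_lim z f1P.
have z1 : 0 < normc z + 1 by rewrite ltr_wpDl ?normc_ge0.
have [M [M0 gM]] := dec_term dg z1.
apply: (@eq_geo _ _ (K + normc z * M + normc (z - e) * L)) => n.
have -> : f z - (z - e) * f1 z = (f z - psum a n.+1 z) - z * (g n * z ^+ n)
   - (z - e) * (f1 z - psum g n.+1 z).
  by rewrite [(z - e) * (_ - _)]mulrBr rec exprS; ring.
have half : (2 ^+ n.+1)^-1 <= (2 ^+ n)^-1 :> R.
  by rewrite lef_pV2 ?posrE ?exprn_gt0// ler_eXn2l// ltr1n.
have -> : (K + normc z * M + normc (z - e) * L) / 2 ^+ n =
   K / 2 ^+ n + normc z * M / 2 ^+ n + normc (z - e) * L / 2 ^+ n by rewrite !mulrDl.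
apply: (le_trans (normcB _ _)); apply: lerD.
  apply: (le_trans (normcB _ _)); apply: lerD.
    by apply: (le_trans (fK _)); rewrite ler_wpM2l.
  by rewrite normcM -mulrA ler_wpM2l ?normc_ge0 ?gM ?lerDl.
rewrite normcM -mulrA ler_wpM2l ?normc_ge0//.
by apply: (le_trans (gL _)); rewrite ler_wpM2l.
Qed.

Lemma entire_div_prod f (s : seq R[i]) : entire f -> uniq s ->
  (forall e, e \in s -> f e = 0) ->
  exists2 g, entire g & forall z, f z = (\prod_(e <- s) (z - e)) * g z.
Proof.
elim: s f => [|e s IHs] f ef; first by exists f => // z; rewrite big_nil mul1r.
rewrite cons_uniq => /andP[es us] f0.
have [|g eg fg] := @entire_div f e ef; first by rewrite f0 ?mem_head.
have [x xs|g1 eg1 gg1] := IHs _ eg us.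
  have := fg x; rewrite f0 ?inE ?xs ?orbT// => /esym/eqP.
  rewrite mulf_eq0 subr_eq0 => /orP[/eqP xe|/eqP //].
  by rewrite -xe xs in es.
by exists g1 => // z; rewrite fg gg1 big_cons mulrA.
Qed.

Lemma entire_subc f c : entire f -> entire (fun z => f z - c).
Proof. by move=> ef; apply: entireD => //; exact: entire_cst. Qed.

(** Three divided differences at [z]: the values of the first two quotients at [z] are the Taylor
    coefficients, and the third quotient is a bounded remainder. *)
Lemma entire_ana f z : entire f -> ana f z.
Proof.
move=> ef.
have [|f1 ef1 fE] := entire_div (e := z) (entire_subc (f z) ef).
  exact: subrr.
have [|f2 ef2 f1E] := entire_div (e := z) (entire_subc (f1 z) ef1).
  exact: subrr.
have [|f3 ef3 f2E] := entire_div (e := z) (entire_subc (f2 z) ef2).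
  exact: subrr.
exists (f1 z), (f2 z), (fun h => f3 (z + h)), 1; split=> //.
  have [K K0 fK] := entire_bounded (normc z + 1) ef3.
  exists K, 1; split=> // h h1; apply: fK.
  by apply: (le_trans (normcD _ _)); rewrite lerD2l ltW.
move=> h _; have := fE (z + h); have := f1E (z + h); have := f2E (z + h).
have -> : z + h - z = h by ring.
move=> /(canRL (subrK _)) -> /(canRL (subrK _)) -> /(canRL (subrK _)) ->.
by ring.
Qed.

Lemma entire_comp_sqr f : entire f -> entire (fun z => f (z ^+ 2)).
Proof.
move=> [a ef]; exists (fun k => if odd k then 0 else a k./2).
apply: ent_of_lim => [rho rho0|z].
  have [|K aK] := (ent_dec ef) (rho ^+ 2); first by rewrite exprn_gt0.
  exists (Num.max 0 K) => k; rewrite -[in rho ^+ k](odd_double_half k).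
  case: (odd k); first by rewrite normc0 mul0r le_max lexx.
  by rewrite add0n -mul2n exprM le_max aK orbT.
have [K K0 fK] := ent_lim (z ^+ 2) ef.
exists K => n; exists n.*2; first by rewrite -addnn leq_addr.
rewrite (_ : psum _ _ _ = psum a n (z ^+ 2))//.
elim: {fK} n => [|n IHn]; first by rewrite !psum0.
rewrite doubleS !psumS IHn /= odd_double /= mul0r addr0.
by rewrite doubleK -mul2n exprM.
Qed.

Lemma expn_fact_le (x : R) n : 0 <= x -> x ^+ n / n`!%:R <= expR x.
Proof.
move=> x0; case: n => [|n].
  by rewrite expr0 fact0 divr1 -[leLHS]expR0 ler_expR.
by apply: le_trans (expR_ge1Dxn n x0); rewrite lerDr.
Qed.

Lemma entire_cexp (c : R[i]) : ent (fun k => c ^+ k / k`!%:R) (fun z => cexp (c * z)).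
Proof.
have fact0 n : (0 : R) < n`!%:R by rewrite ltr0n fact_gt0.
have nfact n : normc (n`!%:R^-1 : R[i]) = n`!%:R^-1.
  by rewrite normcV -(rmorph_nat (real_complex R)) normc_real ger0_norm ?ler0n.
apply: ent_of_lim_id => [rho rho0|z].
  exists (expR (normc c * rho)) => k.
  rewrite normcM nfact normcX mulrAC -exprMn.
  by apply: expn_fact_le; rewrite mulr_ge0 ?normc_ge0 ?ltW.
(* The first factor bounds [(2 |c z|)^n / n!], in which [2 ^+ n] has been absorbed. *)
exists (expR (2 * normc (c * z)) * expR (normc (c * z))) => n.
rewrite (_ : psum _ _ _ = \sum_(k < n) (c * z) ^+ k / k`!%:R); last first.
  by apply: eq_bigr => i _; rewrite exprMn mulrAC.
apply: (le_trans (cexp_series _ _)).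
rewrite [leRHS]mulrAC ler_pM2r ?expR_gt0// ler_pdivlMr ?exprn_gt0//.
rewrite mulrAC -exprMn [_ * 2]mulrC.
by apply: expn_fact_le; rewrite mulr_ge0 ?normc_ge0.
Qed.

End PowerSeries.

(** * Elementary trigonometric bounds and polar coordinates in a sector *)

Section TrigBounds.
Variable R : realType.
Implicit Types x y : R.

Lemma sin_le x : 0 <= x -> sin x <= x.
Proof.
move=> x0; rewrite -subr_ge0.
have -> : 0 = 0 - sin 0 :> R by rewrite sin0 subr0.
apply: (@is_derive_ge0_le R (fun t => t - sin t) (fun t => 1 - cos t)) => // t _.
Qed.

Lemma cos_ge x : 0 <= x -> 1 - x ^+ 2 / 2 <= cos x.
Proof.
move=> x0; rewrite -subr_ge0.
have -> : 0 = cos 0 - (1 - 0 ^+ 2 / 2) :> R by rewrite cos0 expr0n mul0r subr0 subrr.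
apply: (@is_derive_ge0_le R (fun t => cos t - (1 - t ^+ 2 / 2)) (fun t => t - sin t)) => // t /andP[t0 _].
  by apply: is_derive_eq; rewrite /GRing.scale /=; field.
by rewrite subr_ge0 sin_le.
Qed.

Lemma sin_ge_half x : 0 <= x <= 1 -> x / 2 <= sin x.
Proof.
move=> /andP[x0 x1]; rewrite -subr_ge0.
have -> : 0 = sin 0 - 0 / 2 :> R by rewrite sin0 mul0r subr0.
apply: (@is_derive_ge0_le R (fun t => sin t - t / 2) (fun t => cos t - 1 / 2)) => // t /andP[t0 tx].
  by apply: is_derive_eq; rewrite /GRing.scale /=; field.
have : t ^+ 2 <= 1 by rewrite expr_le1// (le_trans tx).
by have := cos_ge t0; lra.
Qed.

Lemma cos_le_abs x y : `|x| <= y -> y <= pi -> cos y <= cos x.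
Proof.
move=> xy ypi; rewrite -(cos_norm x).
have [->//|xy1] := eqVneq `|x| y.
rewrite ltW// ltr_cos ?lt_neqAle ?xy1//= in_itv /= ?normr_ge0 ?(le_trans xy)//.
by rewrite (le_trans _ xy).
Qed.

Lemma sin_pihalfB x : sin (pi / 2 - x) = cos x.
Proof. by rewrite sinB sin_pihalf cos_pihalf mul1r mul0r subr0. Qed.

Lemma cos_pihalfB x : cos (pi / 2 - x) = sin x.
Proof. by rewrite cosB sin_pihalf cos_pihalf mul1r mul0r add0r. Qed.

(** As [Re z >= 0], the argument is [asin (Im z / |z|)]; it is at most [pi / 4] in modulus because
    its sine is dominated by its cosine. *)
Lemma polar_sector (z : R[i]) : z != 0 -> `|complex.Im z| <= complex.Re z ->
  exists s a, [/\ z = cexp (s +i* a), `|a| <= pi / 4 & expR s = normc z].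
Proof.
move=> z0 zs; have nz : 0 < normc z by rewrite normc_gt0.
have Re0 : 0 <= complex.Re z by apply: le_trans zs.
pose y := complex.Im z / normc z.
have yI : -1 <= y <= 1.
  by rewrite -ler_norml normrM normfV (gtr0_norm nz) ler_pdivrMr// mul1r ler_Im_normc.
have ca : cos (asin y) = complex.Re z / normc z.
  rewrite cos_asin// -[RHS]ger0_norm ?divr_ge0 ?normc_ge0// -sqrtr_sqr; congr Num.sqrt.
  rewrite /y !expr_div_n; apply: (mulIf (lt0r_neq0 (exprn_gt0 2 nz))).
  by rewrite mulrBl !divfK ?expf_neq0 ?gt_eqF// mul1r sqr_normcE addrK.
exists (ln (normc z)), (asin y); split.
- rewrite /cexp /= lnK ?posrE// /expi ca asinK ?in_itv//= /y.
  by apply: eq_ReIm => /=; field; rewrite gt_eqF.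
- have a1 : -(pi / 2) <= asin y by exact: asin_geNpi2.
  have a2 : asin y <= pi / 2 by exact: asin_lepi2.
  have pi0 := pi_gt0 R.
  have sc : `|sin (asin y)| <= cos (asin y).
    by rewrite asinK ?in_itv//= ca /y normrM normfV (gtr0_norm nz) ler_pM2r ?invr_gt0.
  have aux (b : R) : pi / 4 < b -> b <= pi / 2 -> cos b < sin b.
    move=> b1 b2; have -> : sin b = cos (pi / 2 - b) by rewrite cos_pihalfB.
    rewrite ltr_cos ?in_itv /=; first lra.
      by apply/andP; split; lra.
    by apply/andP; split; lra.
  rewrite ler_norml; apply/andP; split; rewrite leNgt; apply/negP => h.
    have := aux (- asin y); rewrite cosN sinN.
    have := ler_norm (- sin (asin y)); rewrite normrN; lra.
  have := aux (asin y) h a2.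
  have := ler_norm (sin (asin y)); lra.
- by rewrite lnK.
Qed.

End TrigBounds.

(** * A Phragmen-Lindelof principle in the sector of half-angle pi/4 *)

Section PhragmenLindelof.
Variable R : realType.
Implicit Types (f : R[i] -> R[i]) (z : R[i]).

Lemma expR_ge_sqr (x : R) : 0 <= x -> x ^+ 2 / 2 <= expR x.
Proof. by move=> x0; apply: le_trans (expR_ge1Dxn 1 x0); rewrite lerDr. Qed.

(* In the coordinate [s + i a = log z] the sector becomes a strip, on which
   [exp (- gam z^2 - eta z^p)] is defined for every real exponent [p]; [p] is
   chosen slightly above 2 so that [Re z^p > 0] on the closed sector of
   half-angle [pi/4 - eps]. *)
Lemma phragmen_lindelof (C d r0 rho : R) : 1 <= C -> 0 <= d -> 1 <= r0 -> r0 <= rho ->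
  exists R1, forall Rb f, R1 <= Rb ->
  (forall z, normc z <= Rb -> ana f z) ->
  (forall e s a, 0 <= e <= 20^-1 -> r0 <= expR s <= Rb ->
     `|a| = pi / 4 - e ->
     normc (f (cexp (s +i* a))) <= C * expR (d * s + pi * e ^+ 2 * expR s ^+ 2)) ->
  (forall z, normc z = Rb -> normc (f z) <= expR (C * Rb ^+ 2 * (1 + ln Rb))) ->
  (forall z, normc z = r0 -> normc (f z) <= C) ->
  forall z, r0 <= normc z <= rho -> `|complex.Im z| <= complex.Re z ->
    normc (f z) <= C * expR 5 * expR (d * ln (normc z)).
Proof.
move=> C1 d0 r01 r0rho.
have C0 : 0 < C by lra.
have r00 : 0 < r0 by lra.
have rho0 : 0 < rho by lra.
have pi0 := pi_gt0 R; have pi2 := pi_ge2 R.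
have pi4 : pi < 4 :> R by have := pihalf_lt2 R; lra.
(* With [e * rho ^+ 2 <= 1] the factor [exp (- gam z^2)] costs only a constant on [|z| <= rho]. *)
pose e : R := Num.min 20^-1 (rho ^- 2).
have [e0 e20 erho] : [/\ 0 < e, e <= 20^-1 & e * rho ^+ 2 <= 1].
  split; first by rewrite lt_min invr_gt0 ltr0n invr_gt0 exprn_gt0.
    by rewrite /e ge_min lexx.
  rewrite -ler_pdivlMr ?exprn_gt0// mul1r /e ge_min lexx orbT//.
clearbody e.
pose b : R := pi / 4 - e.
have b0 : 0 < b by rewrite /b; lra.
(* On the strip [|a| <= b] this gives [cos (p * a) >= sin e > 0], while [p > 2] lets [|z|^p] outgrow
   the exponent of the bound on the arc. *)
pose p : R := (pi / 2 - e) / b.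
have pb : p * b = pi / 2 - e by rewrite /p divfK// gt_eqF.
have p2 : p - 2 = e / b 
  by apply: (mulIf (lt0r_neq0 b0)); rewrite mulrBl pb divfK ?gt_eqF// /b; field.
pose k : R := p - 2.
have k0 : 0 < k by rewrite /k p2 divr_gt0.
have p0 : 0 < p by rewrite /k in k0; lra.
(* On the boundary rays [cos (2 * a) = sin (2 * e) >= e], so [gam] cancels the growth
   [pi * e ^+ 2 * |z|^2] allowed there. *)
pose gam : R := pi * e.
have gam0 : 0 < gam by rewrite mulr_gt0.
(* Here [eta * rho^p = 1], hence [exp (- eta z^p)] costs at most a factor [exp 1] on [|z| <= rho];
   with the factor [exp 4] for [gam] this is the [expR 5] of the conclusion. *)
pose eta : R := expR (- (p * ln rho)).
have eta0 : 0 < eta by exact: expR_gt0.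
pose c : R := e / 2.
have c0 : 0 < c by rewrite divr_gt0.
have cosp a : `|a| <= b -> c <= cos (p * a).
  move=> ab; have -> : c = e / 2 by [].
  apply: (@le_trans _ _ (sin e)); first by apply: sin_ge_half; apply/andP; split; lra.
  rewrite -cos_pihalfB -pb; apply: cos_le_abs.
    by rewrite normrM (gtr0_norm p0) ler_pM2l.
  by rewrite pb; lra.
have cos2 a : `|a| <= b -> 0 <= cos (2 * a).
  move=> ab; apply: cos_ge0_pihalf.
  by move: ab; rewrite ler_norml /b => /andP[]; lra.
(* Threshold on [ln Rb] beyond which [eta * c * exp (k ln Rb)] exceeds [C * (1 + ln Rb)], by
   [exp x >= x^2 / 2]. *)
pose K : R := 4 * C / (eta * c * k ^+ 2).
have K0 : 0 < K by rewrite divr_gt0 ?mulr_gt0 ?exprn_gt0.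
exists (Num.max rho (expR (Num.max 1 K))) => Rb f.
rewrite ge_max => /andP[rhoRb expRb] af rays arc inner.
have Rb0 : 0 < Rb by lra.
pose s1 : R := ln Rb; pose s0 : R := ln r0.
have es1 : expR s1 = Rb by rewrite lnK.
have es0 : expR s0 = r0 by rewrite lnK.
have s00 : 0 <= s0 by rewrite ln_ge0.
have [s11 s1K] : 1 <= s1 /\ K <= s1.
  have : Num.max 1 K <= s1 by rewrite -ler_expR es1.
  by rewrite ge_max => /andP.
pose g (w : R[i]) := f (cexp w) * cexp (- d%:C * w + - gam%:C * cexp (2 * w)
   + - eta%:C * cexp (p%:C * w)).
have ng s a : normc (g (s +i* a)) = normc (f (cexp (s +i* a))) *
   expR (- (d * s) - gam * expR s ^+ 2 * cos (2 * a) - eta * expR (p * s) * cos (p * a)).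
  rewrite /g normcM normc_cexp; congr (_ * expR _).
  rewrite /cexp /expi !(ReD, ReM, ImM, ReN, ImN) /= -[2]/(1 + 1) -!mulr2n ?expRD.
  rewrite !(mul0r, mulr0, oppr0, subr0, addr0).
  have -> : (1 + 1) * s = s + s by ring.
  by rewrite expRD !(mul0rn, mul0r, oppr0, addr0, expR0); ring.
have ag w : normc (cexp w) <= Rb -> ana g w.
  move=> wR; apply: anaM.
    by apply: ana_comp; [exact: ana_cexp|exact: af].
  have aexp (q : R[i]) : ana (fun w => cexp (q * w)) w.
    apply: (@ana_comp _ (@cexp R) (fun w => q * w)); last exact: ana_cexp.
    by apply: anaM; [exact: ana_cst|exact: ana_id].
  apply: (@ana_comp _ (@cexp R)); last exact: ana_cexp.
  apply: anaD; last by apply: anaM; [exact: ana_cst|exact: aexp].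
  apply: anaD; first by apply: anaM; [exact: ana_cst|exact: ana_id].
  by apply: anaM; [exact: ana_cst|exact: aexp].
have ncexp s a : normc (cexp (s +i* a)) = expR s by rewrite normc_cexp.
have gbound s a : s0 <= s <= s1 -> - b <= a <= b -> normc (g (s +i* a)) <= C.
  apply: max_principle => {s a}.
    move=> s a /andP[_ ss1] _; apply: ag.
    by rewrite ncexp -es1 ler_expR.
  move=> s a /andP[ss0 ss1] ab onb; rewrite ng.
  have ab' : `|a| <= b by rewrite ler_norml.
  have esb : r0 <= expR s <= Rb by rewrite -es0 -es1 !ler_expR ss0.
  have cp := cosp a ab'; have c2 := cos2 a ab'.
  have s_0 : 0 <= s by lra.
  have t1 : 0 <= d * s by rewrite mulr_ge0.
  have t2 : 0 <= gam * expR s ^+ 2 * cos (2 * a).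
    exact: mulr_ge0 (mulr_ge0 (ltW gam0) (exprn_ge0 _ (expR_ge0 _))) c2.
  have t3 : 0 <= eta * expR (p * s) * cos (p * a).
    exact: mulr_ge0 (mulr_ge0 (ltW eta0) (expR_ge0 _)) (le_trans (ltW c0) cp).
  have trivb : expR (- (d * s) - gam * expR s ^+ 2 * cos (2 * a) -
      eta * expR (p * s) * cos (p * a)) <= 1.
    by rewrite -[leRHS]expR0 ler_expR; lra.
  have ray : `|a| = b -> normc (f (cexp (s +i* a))) * expR (- (d * s) -
      gam * expR s ^+ 2 * cos (2 * a) - eta * expR (p * s) * cos (p * a)) <= C.
    move=> ha; have eI : 0 <= e <= 20^-1 by rewrite (ltW e0).
    apply: le_trans (ler_wpM2r (expR_ge0 _) (rays e s a eI esb ha)) _.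
    rewrite -[leLHS]mulrA -expRD -[leRHS]mulr1 ler_pM2l// -[leRHS]expR0 ler_expR.
    have c2e : e <= cos (2 * a).
      rewrite -cos_norm normrM ha ger0_norm// /b mulrBr.
      have -> : 2 * (pi / 4) = pi / 2 :> R by field.
      rewrite cos_pihalfB; apply: le_trans (sin_ge_half _); first by lra.
      by apply/andP; split; lra.
    have : pi * e ^+ 2 * expR s ^+ 2 <= gam * expR s ^+ 2 * cos (2 * a).
      have -> : pi * e ^+ 2 * expR s ^+ 2 = gam * expR s ^+ 2 * e by rewrite /gam; ring.
      by rewrite ler_pM2l// mulr_gt0// exprn_gt0// expR_gt0.
    lra.
  case/or4P: onb => [/eqP sE|/eqP sE|aE|aE].
  - apply: (@le_trans _ _ (C * 1)); last by rewrite mulr1.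
    apply: ler_pM; rewrite ?normc_ge0 ?expR_ge0//.
    by apply: inner; rewrite ncexp sE.
  - apply: (@le_trans _ _ 1) => //.
    have fb : normc (f (cexp (s +i* a))) <= expR (C * Rb ^+ 2 * (1 + ln Rb)).
      by apply: arc; rewrite ncexp sE.
    apply: le_trans (ler_wpM2r (expR_ge0 _) fb) _.
    rewrite -expRD -[leRHS]expR0 ler_expR -/s1 -es1 sE.
    have main : C * expR s1 ^+ 2 * (1 + s1) <= eta * expR (p * s1) * c.
      have -> : p * s1 = s1 + s1 + k * s1 by rewrite /k; ring.
      rewrite 2!expRD expr2.
      have -> : C * (expR s1 * expR s1) * (1 + s1) = expR s1 * expR s1 * (C * (1 + s1)) by ring.
      have -> : eta * (expR s1 * expR s1 * expR (k * s1)) * c =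
        expR s1 * expR s1 * (eta * c * expR (k * s1)) by ring.
      rewrite ler_pM2l ?mulr_gt0 ?expR_gt0//.
      have ks : 0 <= k * s1 by rewrite mulr_ge0 ?(ltW k0)//; lra.
      apply: le_trans (ler_wpM2l _ (expR_ge_sqr ks)); last first.
        exact: mulr_ge0 (ltW eta0) (ltW c0).
      have : 4 * C <= s1 * (eta * c * k ^+ 2).
        by rewrite -ler_pdivrMr ?mulr_gt0 ?exprn_gt0.
      move=> h; apply: (@le_trans _ _ (s1 * (4 * C) / 2)).
        have -> : s1 * (4 * C) / 2 = C * (s1 + s1) by field.
        by rewrite ler_pM2l//; lra.
      have -> : eta * c * ((k * s1) ^+ 2 / 2) = s1 * (s1 * (eta * c * k ^+ 2)) / 2 by field.
      by rewrite ler_pM2r ?invr_gt0// ler_pM2l//; lra.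
    have : eta * expR (p * s1) * c <= eta * expR (p * s1) * cos (p * a).
      by rewrite ler_pM2l// mulr_gt0// expR_gt0.
    move: t1 t2; rewrite sE; lra.
  - by apply: ray; rewrite (eqP aE) normrN gtr0_norm.
  - by apply: ray; rewrite (eqP aE) gtr0_norm.
move=> z /andP[r0z zrho] zs.
have z0 : z != 0 by rewrite -normc_gt0; lra.
have [s [a [zE a4 esz]]] := polar_sector z0 zs.
have lnz : ln (normc z) = s by rewrite -esz expRK.
have srho : expR s ^+ 2 <= rho ^+ 2.
  by rewrite lerXn2r ?nnegrE ?expR_ge0 ?(ltW rho0)// esz.
have sI : s0 <= s <= s1.
  by apply/andP; split; rewrite -ler_expR ?es0 ?es1 esz//; lra.
have [ab|ba] := leP `|a| b.
  have := gbound s a sI; rewrite -ler_norml => /(_ ab).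
  rewrite ng -zE lnz; set E := expR _; rewrite -ler_pdivlMr ?expR_gt0// => h.
  apply: (le_trans h); rewrite -mulrA ler_pM2l// /E -expRN -expRD ler_expR.
  have : gam * expR s ^+ 2 * cos (2 * a) <= 4.
    apply: (@le_trans _ _ (gam * expR s ^+ 2)).
      by rewrite ler_piMr ?cos_le1//; exact: mulr_ge0 (ltW gam0) (exprn_ge0 _ (expR_ge0 _)).
    apply: (@le_trans _ _ (gam * rho ^+ 2)); first by rewrite ler_pM2l.
    apply: (@le_trans _ _ (pi * 1)); last by lra.
    by rewrite /gam -mulrA ler_pM2l.
  have : eta * expR (p * s) * cos (p * a) <= 1.
    apply: (@le_trans _ _ (eta * expR (p * s))).
      by rewrite ler_piMr ?cos_le1//; exact: mulr_ge0 (ltW eta0) (expR_ge0 _).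
    rewrite /eta -expRD -[leRHS]expR0 ler_expR addrC subr_le0 ler_pM2l//.
    by rewrite -lnz ler_ln ?posrE// -esz expR_gt0.
  lra.
(* Between the strip and the diagonal the point lies on a ray of parameter [e' <= e], where the
   hypothesis on the rays applies directly. *)
pose e' := pi / 4 - `|a|.
have e'I : 0 <= e' <= e by rewrite /e'; move: ba; rewrite /b => ba; apply/andP; split; lra.
have e'20 : 0 <= e' <= 20^-1 by case/andP: e'I => -> /= h; lra.
have esb : r0 <= expR s <= Rb by rewrite esz r0z /=; lra.
have := rays e' s a e'20 esb; rewrite -zE => /(_ _)/le_trans; apply.
  by rewrite /e'; ring.
rewrite -[leRHS]mulrA ler_pM2l// -expRD ler_expR lnz [leRHS]addrC lerD2l.
apply: (@le_trans _ _ (pi * e ^+ 2 * rho ^+ 2)).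
  have [e'0 e'e] := andP e'I.
  apply: ler_pM => //; first exact: mulr_ge0 (ltW pi0) (exprn_ge0 _ e'0).
  by rewrite ler_pM2l// lerXn2r ?nnegrE// ltW.
have -> : pi * e ^+ 2 * rho ^+ 2 = pi * e * (e * rho ^+ 2) by ring.
apply: (@le_trans _ _ (pi * e * 1)); last by rewrite mulr1; nra.
by rewrite ler_pM2l.
Qed.

End PhragmenLindelof.

(** * Sums compared with telescoping series, and products *)

Section SumBounds.
Variable R : realType.
Implicit Types (E a b : nat -> R).

Lemma sum_tele_le (F P : nat -> R) m N : (m <= N)%N ->
  (forall n, (m <= n < N)%N -> F n <= P n.+1 - P n) ->
  \sum_(m <= n < N) F n <= P N - P m.
Proof.
move=> mN h; rewrite -(telescope_sumr P mN) big_nat_cond [leRHS]big_nat_cond.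
by apply: ler_sum => n; rewrite andbT; exact: h.
Qed.

(** The estimates below change regime at an index [m] of the order of [|z|^2], where [sqrt (2 n)]
    passes [|z|]. *)
Lemma sum_split_le E a b m (A B : R) N : 0 <= B ->
  (forall n, (n < m)%N -> E n <= a n) -> (forall n, (m <= n)%N -> E n <= b n) ->
  (forall M, (M <= m)%N -> \sum_(0 <= n < M) a n <= A) ->
  (forall M, (m <= M)%N -> \sum_(m <= n < M) b n <= B) ->
  \sum_(0 <= n < N) E n <= A + B.
Proof.
move=> B0 Ea Eb aA bB; have [Nm|/ltnW mN] := leqP N m.
  apply: (@le_trans _ _ A); last by rewrite lerDl.
  apply: le_trans (aA _ Nm); rewrite big_nat_cond [leRHS]big_nat_cond.
  by apply: ler_sum => n; rewrite andbT => /andP[_ nN]; apply: Ea; exact: leq_trans Nm.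
rewrite (big_cat_nat (leq0n m) mN)//=; apply: lerD.
  apply: le_trans (aA _ (leqnn m)); rewrite big_nat_cond [leRHS]big_nat_cond.
  by apply: ler_sum => n; rewrite andbT => /andP[_ nN]; exact: Ea.
apply: le_trans (bB _ mN); rewrite big_nat_cond [leRHS]big_nat_cond.
by apply: ler_sum => n; rewrite andbT => /andP[mn _]; exact: Eb.
Qed.

Lemma sqrtS_sub (x : R) : 0 <= x ->
  1 / Num.sqrt (x + 1) <= 2 * (Num.sqrt (x + 1) - Num.sqrt x).
Proof.
move=> x0; have s1 : 0 < Num.sqrt (x + 1) by rewrite sqrtr_gt0; lra.
have s0 := sqrtr_ge0 x.
have e1 : Num.sqrt (x + 1) ^+ 2 = x + 1 by rewrite sqr_sqrtr//; lra.
have e0 : Num.sqrt x ^+ 2 = x by rewrite sqr_sqrtr.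
rewrite ler_pdivrMr//; nra.
Qed.

Lemma isqrt_sub (x : R) : 1 <= x ->
  1 / (x * Num.sqrt x) <= 4 * (1 / Num.sqrt x - 1 / Num.sqrt (x + 1)).
Proof.
move=> x1; have s0 : 0 < Num.sqrt x by rewrite sqrtr_gt0; lra.
have s1 : 0 < Num.sqrt (x + 1) by rewrite sqrtr_gt0; lra.
have e1 : Num.sqrt (x + 1) ^+ 2 = x + 1 by rewrite sqr_sqrtr//; lra.
have e0 : Num.sqrt x ^+ 2 = x by rewrite sqr_sqrtr//; lra.
move: (Num.sqrt x) (Num.sqrt (x + 1)) s0 s1 e0 e1 => s t s0 t0 e0 e1.
rewrite -[X in _ <= 4 * X](_ : 1 / (s * t * (s + t)) = _); last first.
  apply: (@mulIf _ (s * t * (s + t))); first by rewrite gt_eqF// !mulr_gt0 ?addr_gt0.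
  rewrite divfK ?gt_eqF ?mulr_gt0 ?addr_gt0//.
  have -> : (1 / s - 1 / t) * (s * t * (s + t)) = t ^+ 2 - s ^+ 2.
    by field; rewrite !gt_eqF.
  by rewrite e1 e0; ring.
rewrite -{1}e0 mulrA mulr1 ler_pdivlMr ?mulr_gt0 ?addr_gt0// mulrAC.
rewrite ler_pdivrMr ?mulr_gt0 ?exprn_gt0// mul1r.
have st : s <= t by nra.
have ts : t <= 3 / 2 * s by nra.
have : t * (s + t) <= (3 / 2 * s) * (s + 3 / 2 * s).
  by apply: ler_pM; lra.
move=> h; have -> : s * t * (s + t) = s * (t * (s + t)) by ring.
have -> : 4 * (s ^+ 2 * s) = s * (4 * s ^+ 2) by ring.
by rewrite ler_pM2l//; nra.
Qed.

Lemma sum_inv_le M : \sum_(0 <= n < M) (n.+1%:R^-1 : R) <= 1 + ln (Num.max 1 M%:R).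
Proof.
case: M => [|M]; first by rewrite big_nil maxEle ler10 /= ln1 addr0.
have -> : Num.max 1 M.+1%:R = M.+1%:R :> R by rewrite maxEle ler1n.
rewrite big_nat_recl//= invr1 lerD2l.
have := @sum_tele_le (fun n => n.+2%:R^-1) (fun n => ln n.+1%:R) 0 M (leq0n M).
rewrite ln1 subr0; apply => n _.
have -> : ln n.+2%:R - ln n.+1%:R = - ln (1 + - n.+2%:R^-1) :> R.
  rewrite -ln_div ?posrE ?ltr0n// -lnV; last first.
    by rewrite posrE subr_gt0 invf_lt1 ?ltr0n// ltr1n.
  congr ln; have n1 : n.+2%:R = n.+1%:R + 1 :> R by rewrite -[n.+2]addn1 natrD.
  have n0 : 0 < n.+1%:R :> R by rewrite ltr0n.
  rewrite n1; move: (n.+1%:R : R) n0 => x x0.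
  have -> : 1 + - (x + 1)^-1 = x / (x + 1) by field; rewrite gt_eqF//; lra.
  by rewrite invf_div.
by rewrite lerNr le_ln1Dx// ltrN2 invf_lt1 ?ltr0n// ltr1n.
Qed.

Lemma sum_inv_sqr_le M : \sum_(0 <= n < M) ((n.+1%:R ^+ 2)^-1 : R) <= 2.
Proof.
case: M => [|M]; first by rewrite big_nil.
rewrite big_nat_recl//= expr1n invr1.
have := @sum_tele_le (fun n => (n.+2%:R ^+ 2)^-1) (fun n => - (n.+1%:R)^-1) 0 M (leq0n M).
have M0 : 0 <= M.+1%:R^-1 :> R by rewrite invr_ge0 ler0n.
rewrite invr1 opprK => h; rewrite -[2]/(1 + 1) lerD2l.
apply: le_trans (h _) _; last by rewrite gerDr oppr_le0.
move=> n _.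
have n0 : 0 < n.+1%:R :> R by rewrite ltr0n.
have n1 : n.+2%:R = n.+1%:R + 1 :> R by rewrite -[n.+2]addn1 natrD.
rewrite n1; move: (n.+1%:R : R) n0 => x x0.
have -> : - (x + 1)^-1 - - x^-1 = (x * (x + 1))^-1.
  by field; rewrite !gt_eqF//; lra.
by rewrite lef_pV2 ?posrE; nra.
Qed.

Lemma sum_isqrt_le M : \sum_(0 <= n < M) (1 / Num.sqrt n.+1%:R : R) <= 2 * Num.sqrt M%:R.
Proof.
have := @sum_tele_le (fun n => 1 / Num.sqrt n.+1%:R) (fun n => 2 * Num.sqrt n%:R) 0 M (leq0n M).
rewrite sqrtr0 mulr0 subr0; apply => n _.
by rewrite -mulrBr -natr1; apply: sqrtS_sub; rewrite ler0n.
Qed.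

Lemma sum_tail_le m M : (m <= M)%N ->
  \sum_(m <= n < M) (1 / (n.+1%:R * Num.sqrt n.+1%:R) : R) <= 4 / Num.sqrt m.+1%:R.
Proof.
move=> mM.
have := @sum_tele_le (fun n => 1 / (n.+1%:R * Num.sqrt n.+1%:R))
  (fun n => - (4 * (1 / Num.sqrt n.+1%:R))) m M mM.
have h : 0 <= 4 * (1 / Num.sqrt M.+1%:R) :> R by rewrite mulr_ge0 ?divr_ge0 ?sqrtr_ge0.
have -> : 4 / Num.sqrt m.+1%:R = 4 * (1 / Num.sqrt m.+1%:R) :> R by rewrite mul1r.
rewrite opprK => H; apply: le_trans (H _) _; last by rewrite gerDr oppr_le0.
move=> n _; rewrite opprK addrC -mulrBr -[n.+2]addn1 natrD.
by apply: isqrt_sub; rewrite ler1n.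
Qed.

(** [(1 - x) * (1 + x + 4 x^2) = 1 + x^2 * (3 - 4 x)], which is at least 1 up to [x = 3 / 4]. *)
Lemma expR_lower (x : R) : 0 <= x <= 3 / 4 -> expR (- (x + 4 * x ^+ 2)) <= 1 - x.
Proof.
move=> /andP[x0 x1]; rewrite expRN.
have h : 1 + (x + 4 * x ^+ 2) <= expR (x + 4 * x ^+ 2) by exact: expR_ge1Dx.
have x2 : 0 <= x ^+ 2 by exact: sqr_ge0.
have p0 : 0 < 1 + (x + 4 * x ^+ 2) by lra.
apply: (@le_trans _ _ (1 + (x + 4 * x ^+ 2))^-1).
  by rewrite lef_pV2 ?posrE// (lt_le_trans p0).
rewrite -div1r ler_pdivrMr//.
have -> : (1 - x) * (1 + (x + 4 * x ^+ 2)) = 1 + x ^+ 2 * (3 - 4 * x) by ring.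
by rewrite lerDl mulr_ge0//; lra.
Qed.

Lemma prod_upper (F : nat -> R[i]) m N :
  normc (\prod_(m <= n < N) (1 + F n)) <= expR (\sum_(m <= n < N) normc (F n)).
Proof.
rewrite normc_prod expR_sum; apply: ler_prod => n _.
rewrite normc_ge0 /=; apply: le_trans (expR_ge1Dx _).
by apply: le_trans (normcD _ _) _; rewrite normc1.
Qed.

Lemma prod_lower (F : nat -> R[i]) m N :
  (forall n, (m <= n < N)%N -> normc (F n) <= 3 / 4) ->
  expR (- (\sum_(m <= n < N) (normc (F n) + 4 * normc (F n) ^+ 2))) <=
  normc (\prod_(m <= n < N) (1 + F n)).
Proof.
move=> h; rewrite normc_prod -sumrN expR_sum big_nat_cond [leRHS]big_nat_cond.
apply: ler_prod => n; rewrite andbT => mn; rewrite expR_ge0 /=.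
apply: le_trans (expR_lower _) _; first by rewrite normc_ge0 h.
by apply: le_trans (normc_ge_subD _ _); rewrite normc1.
Qed.

End SumBounds.

(** * Distance to the perturbed points and size of the truncated product Q *)

Section PerturbedSequence.
Variables (R : realType) (lam : nat -> R[i]) (d : R).
Hypothesis d0 : 0 <= d.
Hypothesis d1 : d < 1 / 2.
Hypothesis near : forall n : nat, (1 <= n)%N ->
  normc ((sqrt2n R n)%:C - lam n) <= d / sqrt2n R n.
Local Notation u := (sqrt2n R).
Implicit Types (z : R[i]) (n : nat).

Lemma sqr_sqrt2n n : u n ^+ 2 = 2 * n%:R.
Proof. by rewrite /sqrt2n sqr_sqrtr// mulr_ge0. Qed.

Lemma sqrt2n_gt0 n : (0 < n)%N -> 0 < u n.
Proof. by move=> n0; rewrite sqrtr_gt0 mulr_gt0// ltr0n. Qed.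

Lemma sqrt2n_ge n : (0 < n)%N -> Num.sqrt n%:R <= u n <= 3 / 2 * Num.sqrt n%:R.
Proof.
move=> n0; have h : 0 <= n%:R :> R by [].
have s0 := sqrtr_ge0 (n%:R : R).
have q : Num.sqrt n%:R ^+ 2 = n%:R :> R by rewrite sqr_sqrtr.
have uq := sqr_sqrt2n n; have u0 := sqrt2n_gt0 n0.
apply/andP; split; rewrite -(@ler_pXn2r _ 2) ?nnegrE ?mulr_ge0 ?(ltW u0)// ?exprMn ?uq ?q; lra.
Qed.

Let n1 n : (0 < n)%N -> 1 <= n%:R :> R.
Proof. by rewrite ler1n. Qed.

Let dist_lam n : (0 < n)%N -> normc ((u n)%:C - lam n) * u n <= d.
Proof. by move=> n0; rewrite -ler_pdivlMr ?sqrt2n_gt0// near. Qed.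

Lemma normc_sqrt2n n : normc (u n)%:C = u n.
Proof. by rewrite normc_real ger0_norm// sqrtr_ge0. Qed.

Lemma lam_bounds n : (0 < n)%N -> [/\ 3 / 4 * u n <= normc (lam n),
  normc (lam n) <= 5 / 4 * u n & 2 * n%:R - d <= u n * normc (lam n)].
Proof.
have dd0 := d0; have dd1 := d1.
move=> n0; have u0 := sqrt2n_gt0 n0; have uq := sqr_sqrt2n n.
have h := dist_lam n0; have := n1 n0.
have h1 := normc_ge_sub (u n)%:C ((u n)%:C - lam n).
have h2 := normcB (u n)%:C ((u n)%:C - lam n).
rewrite subKr normc_sqrt2n in h1 h2.
have D0 := normc_ge0 ((u n)%:C - lam n).
move: (normc ((u n)%:C - lam n)) (normc (lam n)) h h1 h2 D0 => D L h h1 h2 D0 nn.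
have D4 : D <= u n / 4.
  by rewrite -(ler_pM2r u0) mulrAC -expr2 uq; lra.
have : u n * (u n - L) <= u n * D by rewrite ler_pM2l//; lra.
rewrite mulrBr -expr2 uq [u n * D]mulrC => h3.
by split; lra.
Qed.

Lemma sqr_lam_bound n : (0 < n)%N ->
  `|normc (lam n) ^+ 2 - 2 * n%:R| <= 2 * d + d ^+ 2 / (2 * n%:R).
Proof.
have dd0 := d0; have dd1 := d1.
move=> n0; have u0 := sqrt2n_gt0 n0; have uq := sqr_sqrt2n n.
have h := near n0.
have h1 := normc_ge_sub (u n)%:C ((u n)%:C - lam n).
have h2 := normcB (u n)%:C ((u n)%:C - lam n).
rewrite subKr normc_sqrt2n in h1 h2.
have D0 := normc_ge0 ((u n)%:C - lam n).
have L0 := normc_ge0 (lam n).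
move: (normc ((u n)%:C - lam n)) (normc (lam n)) h h1 h2 D0 L0 => D L h h1 h2 D0 L0.
have e : d / u n * u n = d by rewrite divfK// gt_eqF.
have -> : 2 * d + d ^+ 2 / (2 * n%:R) = 2 * u n * (d / u n) + (d / u n) ^+ 2.
  by rewrite -uq; field; rewrite gt_eqF.
rewrite -uq; move: (d / u n) h h1 h2 => x h h1 h2.
by rewrite ler_norml; apply/andP; split; nra.
Qed.

(** [1 + ep z n] is the factor [(1 - z / lam n) / (1 - z / sqrt (2 n))]; the form with the small
    difference [lam n - u n] in the numerator is the one to be estimated. *)
Definition ep z n : R[i] := z * (lam n - (u n)%:C) / (lam n * ((u n)%:C - z)).

Lemma lam_neq0 n : (0 < n)%N -> lam n != 0.
Proof.
have dd0 := d0; have dd1 := d1.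
move=> n0; rewrite -normc_gt0; have [h _ _] := lam_bounds n0.
by have := sqrt2n_gt0 n0; lra.
Qed.

Lemma sqrt2n_neq0 n : (0 < n)%N -> (u n)%:C != 0 :> R[i].
Proof. by move=> n0; rewrite -normc_gt0 normc_sqrt2n sqrt2n_gt0. Qed.

Lemma ep1E z n : (0 < n)%N -> (u n)%:C != z ->
  1 + ep z n = (lam n - z) * (u n)%:C / (lam n * ((u n)%:C - z)).
Proof.
have dd0 := d0; have dd1 := d1.
move=> n0 uz; rewrite /ep; field.
by rewrite subr_eq0 uz lam_neq0.
Qed.

Lemma ep_le z n (D : R) : (0 < n)%N -> 0 < D -> D <= normc ((u n)%:C - z) ->
  normc (ep z n) <= d * normc z / ((2 * n%:R - d) * D).
Proof.
have dd0 := d0; have dd1 := d1.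
move=> n0 D0 DE; have u0 := sqrt2n_gt0 n0; have [_ _ h] := lam_bounds n0.
have nn := n1 n0; have hd := dist_lam n0.
rewrite /ep !normcM normcV normcM normc_distC.
have p0 : 0 < 2 * n%:R - d :> R by lra.
have L0 : 0 < normc (lam n) by rewrite normc_gt0 lam_neq0.
have -> : normc z * normc ((u n)%:C - lam n) / (normc (lam n) * normc ((u n)%:C - z)) =
   normc ((u n)%:C - lam n) * u n * normc z / ((u n * normc (lam n)) * normc ((u n)%:C - z)).
  by field; rewrite !gt_eqF// (lt_le_trans D0).
apply: ler_pM.
- by rewrite !mulr_ge0 ?normc_ge0// ltW.
- by rewrite invr_ge0 !mulr_ge0 ?normc_ge0// ltW.
- by rewrite ler_wpM2r ?normc_ge0.
- rewrite lef_pV2 ?posrE ?mulr_gt0//; last exact: lt_le_trans DE.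
  by apply: ler_pM => //; apply: ltW.
Qed.

Lemma ep_le2 z n (D : R) : (0 < n)%N -> 0 < D -> D <= normc ((u n)%:C - z) ->
  normc (ep z n) <= normc z / (3 * n%:R * D).
Proof.
have dd0 := d0; have dd1 := d1.
move=> n0 D0 DE; apply: le_trans (ep_le n0 D0 DE) _.
have nn := n1 n0.
rewrite ler_pdivrMr; last by rewrite mulr_gt0//; lra.
rewrite mulrAC ler_pdivlMr; last by rewrite !mulr_gt0//; lra.
have -> : d * normc z * (3 * n%:R * D) = (d * (3 * n%:R)) * (normc z * D) by ring.
have -> : normc z * ((2 * n%:R - d) * D) = (2 * n%:R - d) * (normc z * D) by ring.
rewrite ler_wpM2r ?mulr_ge0 ?normc_ge0//; first exact: ltW.
by nra.
Qed.

Definition Q z N : R[i] := \prod_(0 <= n < N) (1 + ep z n.+1).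

(** By the law of cosines [|u - z|^2 >= u^2 + r^2 - 8/5 u r] with [r = |z|], and completing either
    square leaves 9/25 of the other. *)
Lemma left_dist z n : (0 < n)%N -> complex.Re z <= 4 / 5 * normc z ->
  3 / 5 * u n <= normc ((u n)%:C - z) /\ 3 / 5 * normc z <= normc ((u n)%:C - z).
Proof.
have dd0 := d0; have dd1 := d1.
move=> n0 zs; have u0 := sqrt2n_gt0 n0; have r0 := normc_ge0 z.
have h : normc ((u n)%:C - z) ^+ 2 = u n ^+ 2 + normc z ^+ 2 - 2 * u n * complex.Re z.
  by rewrite !sqr_normcE !ReD !ImD !ReN !ImN /=; ring.
have h2 : u n ^+ 2 + normc z ^+ 2 - 2 * u n * (4 / 5 * normc z) <= normc ((u n)%:C - z) ^+ 2.
  by rewrite h lerD2l lerN2 ler_pM2l// mulr_gt0.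
have a0 := sqr_ge0 (normc z - 4 / 5 * u n).
have b0 := sqr_ge0 (u n - 4 / 5 * normc z).
split; rewrite -(@ler_pXn2r _ 2) ?nnegrE ?normc_ge0 ?mulr_ge0// ?(ltW u0)//; apply: le_trans h2.
- by rewrite exprMn; lra.
- by rewrite exprMn; lra.
Qed.

(** The first bound carries the sharp coefficient [d / 2] of [1 / n]: summed up to [|z|^2 / 2] it
    gives [d ln |z|], hence the exponent of [Q]. The second is for the indices beyond. The third
    keeps the factors away from 0 and makes the squares summable. *)
Lemma ep_left z n : (0 < n)%N -> 1 <= normc z -> complex.Re z <= 4 / 5 * normc z ->
  [/\ normc (ep z n) <= d / 2 * n%:R^-1 + (n%:R ^+ 2)^-1 + (normc z)^-1 * (1 / Num.sqrt n%:R),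
      normc (ep z n) <= normc z * (1 / (n%:R * Num.sqrt n%:R)) &
      normc (ep z n) <= 5 / 9 * n%:R^-1].
Proof.
have dd0 := d0; have dd1 := d1.
move=> n0 r1 zs; have [Du Dr] := left_dist n0 zs.
have u0 := sqrt2n_gt0 n0; have nn := n1 n0.
have /andP[su us] := sqrt2n_ge n0.
have s0 : 0 < Num.sqrt n%:R :> R by rewrite sqrtr_gt0; lra.
have sq : Num.sqrt n%:R ^+ 2 = n%:R :> R by rewrite sqr_sqrtr.
have r0 : 0 < normc z by lra.
split.
- have D0 : 0 < normc ((u n)%:C - z) by apply: lt_le_trans Du; rewrite mulr_gt0//; lra.
  apply: le_trans (ep_le n0 D0 (lexx _)) _.
  have rD : normc z <= normc ((u n)%:C - z) + u n.
    by have := normc_ge_sub z (u n)%:C; rewrite normc_sqrt2n normc_distC; lra.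
  have rD2 : normc z / normc ((u n)%:C - z) <= 1 + 5 / 3 * (u n / normc z).
    rewrite ler_pdivrMr// mulrDl mul1r; apply: le_trans rD _; rewrite lerD2l.
    have -> : 5 / 3 * (u n / normc z) * normc ((u n)%:C - z) =
       u n * (5 / 3 * normc ((u n)%:C - z) / normc z) by ring.
    by rewrite ler_peMr ?(ltW u0)// ler_pdivlMr// mul1r; lra.
  have -> : d * normc z / ((2 * n%:R - d) * normc ((u n)%:C - z)) =
     d * ((2 * n%:R - d)^-1 * (normc z / normc ((u n)%:C - z))).
    by field; rewrite !gt_eqF//; lra.
  have i0 : 0 <= (2 * n%:R - d)^-1 by rewrite invr_ge0; lra.
  have inv : (2 * n%:R - d)^-1 <= 2^-1 * n%:R^-1 + 4^-1 * (n%:R ^+ 2)^-1.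
    have -> : 2^-1 * n%:R^-1 + 4^-1 * (n%:R ^+ 2)^-1 = (2 * n%:R + 1) / (4 * n%:R ^+ 2) :> R.
      by field; rewrite gt_eqF//; lra.
    rewrite -div1r ler_pdivrMr; last lra.
    rewrite mulrAC ler_pdivlMr; last by rewrite mulr_gt0// exprn_gt0//; lra.
    by nra.
  apply: (@le_trans _ _ (d * ((2^-1 * n%:R^-1 + 4^-1 * (n%:R ^+ 2)^-1) *
      (1 + 5 / 3 * (u n / normc z))))).
    apply: ler_wpM2l => //; apply: ler_pM => //.
    by rewrite divr_ge0 ?normc_ge0.
  have -> : d * ((2^-1 * n%:R^-1 + 4^-1 * (n%:R ^+ 2)^-1) * (1 + 5 / 3 * (u n / normc z))) =
    d / 2 * n%:R^-1 + d / 4 * (n%:R ^+ 2)^-1 +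
    (normc z)^-1 * (d * 5 / 3 * u n * (2^-1 * n%:R^-1 + 4^-1 * (n%:R ^+ 2)^-1)).
    by field; rewrite !gt_eqF//; lra.
  have i2 : 0 <= (n%:R ^+ 2)^-1 :> R by rewrite invr_ge0 sqr_ge0.
  apply: lerD; first by rewrite lerD2l; nra.
  rewrite ler_wpM2l ?invr_ge0 ?normc_ge0//.
  have h34 : 2^-1 * n%:R^-1 + 4^-1 * (n%:R ^+ 2)^-1 <= 3 / 4 * n%:R^-1 :> R.
    have : (n%:R ^+ 2)^-1 <= n%:R^-1 :> R by rewrite lef_pV2 ?posrE; nra.
    lra.
  apply: (@le_trans _ _ (1 / 2 * 5 / 3 * (3 / 2 * Num.sqrt n%:R) * (3 / 4 * n%:R^-1))).
    apply: ler_pM; last exact: h34.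
    - by rewrite !mulr_ge0// ltW.
    - by rewrite addr_ge0// mulr_ge0// invr_ge0.
    - by apply: ler_pM; rewrite ?mulr_ge0 ?(ltW u0)//; lra.
  have -> : n%:R^-1 = (Num.sqrt n%:R ^+ 2)^-1 :> R by rewrite sq.
  have -> : 1 / 2 * 5 / 3 * (3 / 2 * Num.sqrt n%:R) * (3 / 4 * (Num.sqrt n%:R ^+ 2)^-1) =
    15 / 16 * (1 / Num.sqrt n%:R) :> R by field; rewrite gt_eqF.
  rewrite ler_piMl ?divr_ge0 ?(ltW s0)//; lra.
- have D0 : 0 < 3 / 5 * u n by rewrite mulr_gt0//; lra.
  apply: le_trans (ep_le2 n0 D0 Du) _.
  rewrite ler_wpM2l ?normc_ge0// mul1r lef_pV2 ?posrE ?mulr_gt0//; try lra.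
  have -> : 3 * n%:R * (3 / 5 * u n) = n%:R * (9 / 5 * u n) :> R by field.
  by rewrite ler_wpM2l//; lra.
- have D0 : 0 < 3 / 5 * normc z by rewrite mulr_gt0//; lra.
  apply: le_trans (ep_le2 n0 D0 Dr) _.
  rewrite le_eqVlt; apply/orP; left; apply/eqP; field.
  by rewrite !gt_eqF//; lra.
Qed.

Lemma sum_ep_left z N : 1 <= normc z -> complex.Re z <= 4 / 5 * normc z ->
  \sum_(0 <= n < N) normc (ep z n.+1) <= d * ln (normc z) + 13.
Proof.
have dd0 := d0; have dd1 := d1.
move=> r1 zs; have r0 : 0 < normc z by lra.
(* The index at which [u n ^+ 2 = 2 n] reaches [|z|^2]. *)
pose m := Num.truncn (normc z ^+ 2 / 2).
have /andP[m1 m2] : m%:R <= normc z ^+ 2 / 2 < m.+1%:R.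
  by apply: truncn_itv; rewrite divr_ge0// sqr_ge0.
have r2 : 1 <= normc z ^+ 2 by rewrite exprn_ege1.
have mr : m%:R <= normc z ^+ 2 by lra.
have := @sum_split_le R (fun n => normc (ep z n.+1))
  (fun n => d / 2 * n.+1%:R^-1 + (n.+1%:R ^+ 2)^-1 + (normc z)^-1 * (1 / Num.sqrt n.+1%:R))
  (fun n => normc z * (1 / (n.+1%:R * Num.sqrt n.+1%:R))) m
  (d * ln (normc z) + 5) 8 N.
have -> : d * ln (normc z) + 5 + 8 = d * ln (normc z) + 13 by ring.
apply => //.
- by move=> n _; have [] := ep_left (ltn0Sn n) r1 zs.
- by move=> n _; have [] := ep_left (ltn0Sn n) r1 zs.
- move=> M Mm; rewrite !big_split /= -!mulr_sumr.
  have h1 := @sum_inv_le R M; have h2 := @sum_inv_sqr_le R M; have h3 := @sum_isqrt_le R M.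
  have Mr : M%:R <= normc z ^+ 2 by apply: le_trans mr; rewrite ler_nat.
  have l1 : ln (Num.max 1 M%:R) <= 2 * ln (normc z).
    have -> : 2 * ln (normc z) = ln (normc z ^+ 2) by rewrite lnXn// mulr_natl.
    by rewrite ler_ln ?posrE ?exprn_gt0 ?lt_max ?ltr01// ge_max r2.
  have l3 : Num.sqrt M%:R <= normc z.
    rewrite -(@ler_pXn2r _ 2) ?nnegrE ?sqrtr_ge0 ?normc_ge0//.
    by rewrite sqr_sqrtr.
  have t3 : (normc z)^-1 * (\sum_(0 <= i < M) 1 / Num.sqrt i.+1%:R) <= 2.
    rewrite mulrC ler_pdivrMr//; apply: (le_trans h3); lra.
  have t1 : d / 2 * (\sum_(0 <= i < M) i.+1%:R^-1) <= d / 2 * (1 + 2 * ln (normc z)).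
    by rewrite ler_wpM2l//; lra.
  rewrite -mulr_sumr in t3; lra.
- move=> M mM; rewrite -mulr_sumr; have := @sum_tail_le R m M mM => h.
  apply: le_trans (ler_wpM2l (normc_ge0 _) h) _.
  rewrite mulrA ler_pdivrMr ?sqrtr_gt0 ?ltr0n//.
  have : normc z / 2 <= Num.sqrt m.+1%:R.
    rewrite -(@ler_pXn2r _ 2) ?nnegrE ?sqrtr_ge0 ?divr_ge0 ?normc_ge0//.
    by rewrite sqr_sqrtr// expr_div_n; lra.
  lra.
Qed.

(** [21 = 13 + 8]: the quadratic terms of [prod_lower] add 4 times a sum of squares that is at most
    2. *)
Lemma Q_left z N : 1 <= normc z -> complex.Re z <= 4 / 5 * normc z ->
  expR (- (d * ln (normc z) + 21)) <= normc (Q z N) <= expR (d * ln (normc z) + 21).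
Proof.
have dd0 := d0; have dd1 := d1.
move=> r1 zs; have h := sum_ep_left N r1 zs.
apply/andP; split; last first.
  by apply: le_trans (prod_upper _ _ _) _; rewrite ler_expR; lra.
have e9 n : normc (ep z n.+1) <= 5 / 9 * n.+1%:R^-1.
  by have [] := ep_left (ltn0Sn n) r1 zs.
have i1 n : 0 <= (n.+1%:R^-1 : R) <= 1.
  by rewrite invr_ge0 ler0n invf_le1 ?ltr0n// ler1n.
apply: le_trans (prod_lower _); last first.
  by move=> n _; apply: (le_trans (e9 n)); have /andP[] := i1 n; move: (n.+1%:R^-1) => x *; lra.
rewrite ler_expR lerN2 big_split /= -mulr_sumr.
suff : \sum_(0 <= i < N) normc (ep z i.+1) ^+ 2 <= 2 by lra.
apply: le_trans (@sum_inv_sqr_le R N); apply: ler_sum => n _.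
have /andP[ia ib] := i1 n; rewrite -exprVn lerXn2r ?nnegrE ?normc_ge0//.
by apply: (le_trans (e9 n)); have /andP[] := i1 n; move: (n.+1%:R^-1) => x *; lra.
Qed.

(** Substitute for the convergence of the product, uniform in [N] and in the disc. The constant 400
    in [N1] gives [sqrt (n + 1) >= 20 * rho] for [n >= N1], and then the sum of the [|ep|] is at
    most 1/5. *)
Lemma tail_ep (rho : R) : 0 <= rho -> exists N1, forall z N, normc z <= rho -> (N1 <= N)%N ->
  expR (-1) <= normc (\prod_(N1 <= n < N) (1 + ep z n.+1)) <= expR 1.
Proof.
have dd0 := d0; have dd1 := d1.
move=> rho0; pose N1 := Num.bound (400 * rho ^+ 2).
have N1P : 400 * rho ^+ 2 < N1%:R.
  by apply: archi_boundP; exact: mulr_ge0 (ler0n _ _) (sqr_ge0 _).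
exists N1 => z N zr N1N.
have big n : (N1 <= n)%N -> 20 * rho <= Num.sqrt n.+1%:R.
  move=> h; rewrite -(@ler_pXn2r _ 2) ?nnegrE ?mulr_ge0 ?sqrtr_ge0//.
  rewrite sqr_sqrtr// exprMn; have : N1%:R <= n.+1%:R :> R by rewrite ler_nat ltnW.
  lra.
have epb n : (N1 <= n)%N -> normc (ep z n.+1) <= rho * (1 / (n.+1%:R * Num.sqrt n.+1%:R)).
  move=> h; have n0 := ltn0Sn n; have u0 := sqrt2n_gt0 n0.
  have /andP[su us] := sqrt2n_ge n0; have hb := big _ h.
  have D : u n.+1 / 2 <= normc ((u n.+1)%:C - z).
    by have := normc_ge_sub (u n.+1)%:C z; rewrite normc_sqrt2n; lra.
  have D0 : 0 < u n.+1 / 2 by rewrite divr_gt0.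
  apply: le_trans (ep_le2 n0 D0 D) _.
  apply: ler_pM; rewrite ?normc_ge0 ?invr_ge0 ?mulr_ge0 ?(ltW u0)//.
  have nn := n1 n0.
  have s0 : 0 < Num.sqrt n.+1%:R :> R by rewrite sqrtr_gt0; lra.
  rewrite mul1r lef_pV2 ?posrE ?mulr_gt0//.
  have -> : 3 * n.+1%:R * (u n.+1 / 2) = n.+1%:R * (3 / 2 * u n.+1) :> R by field.
  by rewrite ler_wpM2l//; lra.
have sumb : \sum_(N1 <= n < N) normc (ep z n.+1) <= 5^-1.
  apply: (@le_trans _ _ (rho * (4 / Num.sqrt N1.+1%:R))).
    apply: le_trans (ler_wpM2l rho0 (@sum_tail_le R N1 N N1N)).
    rewrite mulr_sumr big_nat_cond [leRHS]big_nat_cond; apply: ler_sum => n.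
    by rewrite andbT => /andP[h _]; exact: epb.
  rewrite mulrA ler_pdivrMr ?sqrtr_gt0 ?ltr0n//.
  by have := big _ (leqnn N1); lra.
have e1 n : (N1 <= n)%N -> normc (ep z n.+1) <= 20^-1.
  move=> h; apply: (le_trans (epb _ h)).
  have s0 : 0 < Num.sqrt n.+1%:R :> R by rewrite sqrtr_gt0 ltr0n.
  rewrite mulrA mulr1 ler_pdivrMr ?mulr_gt0 ?ltr0n//.
  have := big _ h; have := n1 (ltn0Sn n) => *.
  have : 1 * Num.sqrt n.+1%:R <= n.+1%:R * Num.sqrt n.+1%:R :> R by rewrite ler_wpM2r// ltW.
  lra.
apply/andP; split; last first.
  by apply: le_trans (prod_upper _ _ _) _; rewrite ler_expR; lra.
apply: le_trans (prod_lower _); last by move=> n /andP[h _]; have := e1 _ h; lra.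
rewrite ler_expR lerN2.
apply: (@le_trans _ _ (\sum_(N1 <= n < N) (5 * normc (ep z n.+1)))); last first.
  by rewrite -mulr_sumr; lra.
rewrite big_nat_cond [leRHS]big_nat_cond; apply: ler_sum => n.
rewrite andbT => /andP[h _]; have := e1 _ h; have := normc_ge0 (ep z n.+1); nra.
Qed.

Lemma QE z m N : (m <= N)%N -> Q z N = Q z m * \prod_(m <= n < N) (1 + ep z n.+1).
Proof. by move=> mN; rewrite /Q (big_cat_nat (leq0n m) mN). Qed.

(** The true order is logarithmic; square roots telescope, and a bound [O(|z|)] is all that
    [Q_arc_upper] asks for. *)
Lemma sum_dist_odd_le k M :
  \sum_(0 <= n < M) (`|2 * n.+1%:R - (2 * k%:R + 1)|^-1 : R) <=
    2 * (Num.sqrt M%:R + Num.sqrt k%:R).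
Proof.
(* With truncated subtraction one of the two terms vanishes: [psi n] is twice the signed square root
   of [n - k]. *)
pose psi n : R := 2 * (Num.sqrt (n - k)%N%:R - Num.sqrt (k - n)%N%:R).
have := @sum_tele_le R (fun n => `|2 * n.+1%:R - (2 * k%:R + 1)|^-1) psi 0 M (leq0n M).
have h : psi M - psi 0 <= 2 * (Num.sqrt M%:R + Num.sqrt k%:R).
  rewrite /psi sub0n sqrtr0 subn0 sub0r.
  have := sqrtr_ge0 ((k - M)%N%:R : R).
  have : Num.sqrt (M - k)%N%:R <= Num.sqrt M%:R :> R.
    by rewrite ler_wsqrtr// ler_nat leq_subr.
  lra.
move=> H; apply: le_trans h; apply: H => n _.
have key (j : nat) : (2 * j%:R + 1)^-1 <= 2 * (Num.sqrt j.+1%:R - Num.sqrt j%:R) :> R.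
  have j0 : 0 <= j%:R :> R by [].
  rewrite -(natr1 j); apply: le_trans (sqrtS_sub j0).
  have s0 : 0 < Num.sqrt (j%:R + 1) :> R by rewrite sqrtr_gt0; lra.
  have sq : Num.sqrt (j%:R + 1) ^+ 2 = j%:R + 1 :> R by rewrite sqr_sqrtr//; lra.
  have p0 : 0 < 2 * j%:R + 1 :> R by lra.
  rewrite div1r lef_pV2 ?posrE//.
  have : 1 <= Num.sqrt (j%:R + 1) :> R.
    by rewrite -[1 in X in X <= _]sqrtr1 ler_wsqrtr//; lra.
  nra.
have [kn|nk] := leqP k n.
  have := key (n - k)%N; rewrite /psi (subSn kn).
  have -> : (k - n.+1)%N = 0%N by apply/eqP; rewrite subn_eq0 ltnW.
  have -> : (k - n)%N = 0%N by apply/eqP; rewrite subn_eq0.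
  rewrite sqrtr0 !subr0 mulrBr natrB// => h1; apply: le_trans h1.
  have kn' : k%:R <= n%:R :> R by rewrite ler_nat.
  rewrite ger0_norm -(natr1 n); last lra.
  by rewrite le_eqVlt; apply/orP; left; apply/eqP; congr (_^-1); ring.
have := key (k - n.+1)%N; rewrite /psi subnSK//.
have -> : (n.+1 - k)%N = 0%N by apply/eqP; rewrite subn_eq0.
have -> : (n - k)%N = 0%N by apply/eqP; rewrite subn_eq0 ltnW.
rewrite sqrtr0 !sub0r natrB// => h1.
have nk' : n.+1%:R <= k%:R :> R by rewrite ler_nat.
have e : `|2 * n.+1%:R - (2 * k%:R + 1)|^-1 = (2 * (k%:R - n.+1%:R) + 1)^-1 :> R.
  by congr (_^-1); rewrite ler0_norm; [ring|lra].
by rewrite e; lra.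
Qed.

(** [u n ^+ 2 - |z|^2] is an odd integer, hence not 0, and it has the factor [u n - |z|]. *)
Lemma arc_dist z n k : (0 < n)%N -> normc z ^+ 2 = 2 * k%:R + 1 ->
  0 < `|2 * n%:R - (2 * k%:R + 1)| / (u n + normc z) /\
  `|2 * n%:R - (2 * k%:R + 1)| / (u n + normc z) <= normc ((u n)%:C - z).
Proof.
move=> n0 zE; have u0 := sqrt2n_gt0 n0; have r0 := normc_ge0 z.
have s0 : 0 < u n + normc z by lra.
split.
  rewrite divr_gt0// normr_gt0 subr_eq0; apply/eqP => /eqP.
  rewrite -natrM -natrM -[1]/(1%:R) -natrD eqr_nat => /eqP h.
  by have := congr1 odd h; rewrite oddD !oddM.
rewrite ler_pdivrMr// -sqr_sqrt2n -zE.
have -> : u n ^+ 2 - normc z ^+ 2 = (u n - normc z) * (u n + normc z) by ring.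
rewrite normrM [X in _ * X]gtr0_norm// ler_wpM2r ?(ltW s0)//.
rewrite ler_norml; have := normc_ge_sub (u n)%:C z; have := normc_ge_sub z (u n)%:C.
by rewrite !normc_sqrt2n normc_distC => *; apply/andP; split; lra.
Qed.

Lemma ep_arc z n k : (0 < n)%N -> normc z ^+ 2 = 2 * k%:R + 1 -> 1 <= normc z ->
  (n%:R <= 2 * normc z ^+ 2 -> normc (ep z n) <=
    1 / Num.sqrt n%:R + 2 * `|2 * n%:R - (2 * k%:R + 1)|^-1) /\
  (2 * normc z ^+ 2 < n%:R ->
    normc (ep z n) <= normc z * (1 / (n%:R * Num.sqrt n%:R)) /\
    normc (ep z n) <= 4^-1).
Proof.
have dd0 := d0; have dd1 := d1.
move=> n0 zE r1; have u0 := sqrt2n_gt0 n0; have nn := n1 n0.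
have /andP[su us] := sqrt2n_ge n0; have uq := sqr_sqrt2n n.
have s0 : 0 < Num.sqrt n%:R :> R by rewrite sqrtr_gt0; lra.
have sq : Num.sqrt n%:R ^+ 2 = n%:R :> R by rewrite sqr_sqrtr.
have s1 : 1 <= Num.sqrt n%:R :> R.
  by rewrite -[1 in X in X <= _]sqrtr1 ler_wsqrtr.
split=> h.
  have [D0 Dle] := arc_dist n0 zE.
  have r0 : 0 < normc z by lra.
  apply: le_trans (ep_le2 n0 D0 Dle) _.
  move: D0; rewrite pmulr_lgt0; last by rewrite invr_gt0; lra.
  move=> X0.
  have X1 : normc z ^+ 2 <= `|2 * n%:R - (2 * k%:R + 1)| + 2 * n%:R.
    rewrite -zE; have := ler_norm (- (2 * n%:R - normc z ^+ 2)); rewrite normrN; lra.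
  move: (`|2 * n%:R - (2 * k%:R + 1)|) X0 X1 => X X0 X1.
  have ur : u n <= 2 * normc z.
    by rewrite -(@ler_pXn2r _ 2) ?nnegrE ?mulr_ge0 ?normc_ge0 ?(ltW u0)// exprMn uq; lra.
  have -> : normc z / (3 * n%:R * (X / (u n + normc z))) =
     normc z * (u n + normc z) / (3 * n%:R * X).
    by field; rewrite !gt_eqF//; lra.
  apply: (@le_trans _ _ (normc z ^+ 2 / (n%:R * X))).
    have -> : normc z ^+ 2 / (n%:R * X) = normc z * (3 * normc z) / (3 * n%:R * X).
      by field; rewrite !gt_eqF//; lra.
    rewrite ler_pM2r ?invr_gt0 ?mulr_gt0//; try lra.
    by rewrite ler_pM2l//; lra.
  apply: (@le_trans _ _ ((X + 2 * n%:R) / (n%:R * X))).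
    by rewrite ler_pM2r// invr_gt0 mulr_gt0//; lra.
  have -> : (X + 2 * n%:R) / (n%:R * X) = n%:R^-1 + 2 * X^-1.
    by field; rewrite !gt_eqF//; lra.
  have p0 : 0 < n%:R :> R by lra.
  rewrite lerD2r div1r lef_pV2 ?posrE//.
  by rewrite -[leRHS]sq expr2 ler_peMl// ltW.
have ur : 2 * normc z <= u n.
  by rewrite -(@ler_pXn2r _ 2) ?nnegrE ?mulr_ge0 ?normc_ge0 ?(ltW u0)// exprMn uq; lra.
have D : u n / 2 <= normc ((u n)%:C - z).
  by have := normc_ge_sub (u n)%:C z; rewrite normc_sqrt2n; lra.
have D0 : 0 < u n / 2 by rewrite divr_gt0.
have e1 := ep_le2 n0 D0 D.
have E : 3 * n%:R * (u n / 2) = n%:R * (3 / 2 * u n) :> R by field.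
split.
  apply: (le_trans e1); rewrite ler_wpM2l ?normc_ge0//.
  by rewrite mul1r lef_pV2 ?posrE ?mulr_gt0//; try lra; rewrite E ler_wpM2l//; lra.
apply: (le_trans e1); rewrite E ler_pdivrMr; last by rewrite mulr_gt0//; lra.
have n3 : 3 <= n%:R :> R.
  rewrite ler_nat; have : 2%:R < n%:R :> R.
    by apply: le_lt_trans h; have := exprn_ege1 2 r1; lra.
  by rewrite ltr_nat.
have : 3 * (3 / 2 * u n) <= n%:R * (3 / 2 * u n) by rewrite ler_wpM2r//; lra.
lra.
Qed.

(** Crude, but valid near the positive axis too, where the sine is smaller than [exp (pi |z|^2 / 2)]
    by a Gaussian factor. [17 = 13 + 4]: head and tail of the sum. *)
Lemma Q_arc_upper z N k : normc z ^+ 2 = 2 * k%:R + 1 -> 1 <= normc z ->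
  normc (Q z N) <= expR (17 * normc z).
Proof.
move=> zE r1; apply: le_trans (prod_upper _ _ _) _; rewrite ler_expR.
have r0 : 0 < normc z by lra.
pose m := Num.truncn (2 * normc z ^+ 2).
have /andP[m1 m2] : m%:R <= 2 * normc z ^+ 2 < m.+1%:R.
  by apply: truncn_itv; rewrite mulr_ge0// sqr_ge0.
have := @sum_split_le R (fun n => normc (ep z n.+1))
  (fun n => 1 / Num.sqrt n.+1%:R + 2 * `|2 * n.+1%:R - (2 * k%:R + 1)|^-1)
  (fun n => normc z * (1 / (n.+1%:R * Num.sqrt n.+1%:R))) m
  (13 * normc z) 4 N.
move=> H; apply: le_trans (H _ _ _ _ _) _ => {H} //; last by lra.
- move=> n nm; have [h _] := ep_arc (ltn0Sn n) zE r1; apply: h.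
  by apply: le_trans m1; rewrite ler_nat.
- move=> n mn; have [_ h] := ep_arc (ltn0Sn n) zE r1.
  by have [] // : _ /\ _ := h _; apply: (lt_le_trans m2); rewrite ler_nat.
- move=> M Mm; rewrite big_split /= -!mulr_sumr.
  have h1 := @sum_isqrt_le R M; have h2 := sum_dist_odd_le k M.
  have sM : Num.sqrt M%:R <= 3 / 2 * normc z.
    rewrite -(@ler_pXn2r _ 2) ?nnegrE ?mulr_ge0 ?sqrtr_ge0 ?normc_ge0//.
    rewrite sqr_sqrtr// exprMn; have : M%:R <= m%:R :> R by rewrite ler_nat.
    have := sqr_ge0 (normc z); lra.
  have sk : Num.sqrt k%:R <= normc z.
    rewrite -(@ler_pXn2r _ 2) ?nnegrE ?sqrtr_ge0 ?normc_ge0//.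
    by rewrite sqr_sqrtr// zE; have : 0 <= k%:R :> R by []; lra.
  by rewrite -mulr_sumr in h1; lra.
- move=> M mM; rewrite -mulr_sumr; have h := @sum_tail_le R m M mM.
  apply: le_trans (ler_wpM2l (normc_ge0 _) h) _.
  rewrite mulrA ler_pdivrMr ?sqrtr_gt0 ?ltr0n//.
  have : normc z <= Num.sqrt m.+1%:R.
    rewrite -(@ler_pXn2r _ 2) ?nnegrE ?sqrtr_ge0 ?normc_ge0//.
    by rewrite sqr_sqrtr//; have := sqr_ge0 (normc z); lra.
  lra.
Qed.

(** [|lam n|^2] is within [2 d + d^2 / (2 n)] of an even integer. With [c = (1 - 2 d) / 2] and
    [n >= 1 / c] this is at most [2 d + c = 1 - c], which leaves the distance [c] to odd integers;
    the smaller [n] are avoided by taking [k] large. *)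
Lemma lam_arc_sep : exists (c : R) k0, [/\ 0 < c, c <= 1 &
  forall k n, (k0 <= k)%N -> (0 < n)%N -> c <= `|normc (lam n) ^+ 2 - (2 * k%:R + 1)|].
Proof.
have dd0 := d0; have dd1 := d1.
pose c := (1 - 2 * d) / 2.
have c0 : 0 < c by rewrite divr_gt0// subr_gt0; lra.
pose n0 := Num.bound (c^-1).
have n0P : c^-1 < n0%:R by apply: archi_boundP; rewrite invr_ge0 ltW.
exists c, n0.+1; split=> //; first by rewrite /c; lra.
move=> k n kn0 np; have h := sqr_lam_bound np; have nn := n1 np.
have [nn0|nn0] := leqP n0 n.
  have nc : 1 <= c * n%:R.
    have : c * c^-1 <= c * n%:R.
      by rewrite ler_pM2l// ltW// (lt_le_trans n0P)// ler_nat.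
    by rewrite divff// gt_eqF.
  have e1 : d ^+ 2 / (2 * n%:R) <= c.
    rewrite ler_pdivrMr; last lra.
    have : d ^+ 2 <= 1 by rewrite expr_le1//; lra.
    have -> : c * (2 * n%:R) = 2 * (c * n%:R) by ring.
    lra.
  have odd1 : 1 <= `|2 * n%:R - (2 * k%:R + 1)| :> R.
    have [kn|nk] := leqP n k.
      have : n%:R <= k%:R :> R by rewrite ler_nat.
      by move=> ?; rewrite ler0_norm; lra.
    have : k%:R + 1 <= n%:R :> R by rewrite (natr1 k) ler_nat.
    by move=> ?; rewrite ger0_norm; lra.
  have := ler_distD (2 * n%:R) (normc (lam n) ^+ 2) (2 * k%:R + 1).
  have := ler_distD (normc (lam n) ^+ 2) (2 * n%:R) (2 * k%:R + 1).
  rewrite [`|2 * n%:R - normc (lam n) ^+ 2|]distrC.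
  have : 2 * d + c = 1 - c by rewrite /c; field.
  lra.
have e1 : d ^+ 2 / (2 * n%:R) <= 1 / 8.
  rewrite ler_pdivrMr; last lra.
  have : d ^+ 2 <= 1 / 4 by rewrite expr2; nra.
  lra.
have nk : n%:R + 2 <= k%:R :> R.
  by rewrite -natrD ler_nat addn2; apply: leq_trans kn0.
move: h; rewrite ler_norml => /andP[_ h].
rewrite ler0_norm; last lra.
by rewrite /c; lra.
Qed.

(** At most [2 |z|^2] factors can be small, each being at least of order [c / |z|^2]; the others
    contribute at least [exp (- 20)]. The resulting loss, of exponent [|z|^2 ln |z|], is what
    [phragmen_lindelof] admits on the outer arc. *)
Lemma Q_arc_lower : exists (C : R) k0, 0 < C /\ forall k z N, (k0 <= k)%N ->
  normc z ^+ 2 = 2 * k%:R + 1 -> 1 <= normc z ->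
  expR (- (C * normc z ^+ 2 * (1 + ln (normc z)))) <= normc (Q z N).
Proof.
have [c [k0 [c0 c1 sep]]] := lam_arc_sep.
have L0 : 0 <= ln (14 / c) by rewrite ln_ge0// ler_pdivlMr//; lra.
exists (2 * ln (14 / c) + 24), k0; split; first by lra.
move=> k z N kk0 zE r1; have r0 : 0 < normc z by lra.
have l0 : 0 <= ln (normc z) by rewrite ln_ge0.
have r2 : 1 <= normc z ^+ 2 by rewrite exprn_ege1.
pose m := Num.truncn (2 * normc z ^+ 2).
have /andP[m1 m2] : m%:R <= 2 * normc z ^+ 2 < m.+1%:R.
  by apply: truncn_itv; rewrite mulr_ge0// sqr_ge0.
(* [|lam - z| >= c / (7/2 |z|)], [|lam| <= 5/4 u] and [|u - z| <= 3 |z|] bound a factor below by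
   [8 c / (105 |z|^2)], which [x] rounds down. *)
pose x := c / (14 * normc z ^+ 2).
have x0 : 0 < x by rewrite divr_gt0// mulr_gt0//; lra.
have x1 : x <= 1 by rewrite ler_pdivrMr; lra.
have lnx : ln x = - (ln (14 / c) + 2 * ln (normc z)).
  have -> : x = (14 / c * normc z ^+ 2)^-1 by rewrite /x; field; rewrite !gt_eqF.
  rewrite lnV; last by rewrite posrE mulr_gt0 ?divr_gt0 ?exprn_gt0.
  by rewrite lnM ?posrE ?divr_gt0 ?exprn_gt0// lnXn// -[ln (normc z) *+ 2]mulr_natl.
have fac n : n.+1%:R <= 2 * normc z ^+ 2 -> x <= normc (1 + ep z n.+1).
  move=> nr; have n0 := ltn0Sn n; have u0 := sqrt2n_gt0 n0.
  have [D0 Dle] := arc_dist n0 zE.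
  have uz : (u n.+1)%:C != z.
    by rewrite -subr_eq0 -normc_gt0; exact: lt_le_trans Dle.
  have [l1 l2 _] := lam_bounds n0.
  have ur : u n.+1 <= 2 * normc z.
    by rewrite -(@ler_pXn2r _ 2) ?nnegrE ?mulr_ge0 ?(ltW u0) ?normc_ge0// exprMn sqr_sqrt2n; lra.
  have lz : c / (7 / 2 * normc z) <= normc (lam n.+1 - z).
    have s0 : 0 < normc (lam n.+1) + normc z by lra.
    apply: (@le_trans _ _ (c / (normc (lam n.+1) + normc z))).
      by rewrite ler_pM2l// lef_pV2 ?posrE ?mulr_gt0//; lra.
    rewrite ler_pdivrMr//; apply: (le_trans (sep k n.+1 kk0 n0)); rewrite -zE.
    have -> : normc (lam n.+1) ^+ 2 - normc z ^+ 2 =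
      (normc (lam n.+1) - normc z) * (normc (lam n.+1) + normc z) by ring.
    rewrite normrM [X in _ * X]gtr0_norm// ler_wpM2r ?(ltW s0)//.
    rewrite ler_norml; have := normc_ge_sub (lam n.+1) z.
    have := normc_ge_sub z (lam n.+1).
    by rewrite [normc (z - _)]normc_distC => *; apply/andP; split; lra.
  rewrite ep1E// !normcM normcV normcM normc_sqrt2n.
  have La0 : 0 < normc (lam n.+1) by lra.
  have Du : normc ((u n.+1)%:C - z) <= 3 * normc z.
    by have := normcB (u n.+1)%:C z; rewrite normc_sqrt2n; lra.
  have Dp : 0 < normc ((u n.+1)%:C - z) by exact: lt_le_trans Dle.
  rewrite ler_pdivlMr ?mulr_gt0//.
  apply: (@le_trans _ _ (x * (5 / 4 * u n.+1 * (3 * normc z)))).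
    rewrite ler_pM2l//; apply: ler_pM; rewrite ?normc_ge0//.
  have -> : x * (5 / 4 * u n.+1 * (3 * normc z)) = (15 / 16) * (c / (7 / 2 * normc z) * u n.+1).
    by rewrite /x; field; rewrite gt_eqF.
  have p0 : 0 < c / (7 / 2 * normc z) * u n.+1.
    by rewrite mulr_gt0// divr_gt0// mulr_gt0.
  apply: (@le_trans _ _ (c / (7 / 2 * normc z) * u n.+1)); first lra.
  by rewrite ler_wpM2r// ltW.
have head M : (M <= m)%N -> expR (2 * normc z ^+ 2 * ln x) <=
    normc (\prod_(0 <= n < M) (1 + ep z n.+1)).
  move=> Mm; apply: (@le_trans _ _ (x ^+ M)).
    rewrite -[X in X ^+ M]lnK ?posrE// -expRM_natl ler_expR.
    have Mr : M%:R <= 2 * normc z ^+ 2 by apply: le_trans m1; rewrite ler_nat.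
    have : ln x <= 0 by rewrite ln_le0.
    by move=> ?; rewrite ler_wnM2r.
  rewrite normc_prod -{1}(subn0 M) -prodr_const_nat big_nat_cond [leRHS]big_nat_cond.
  apply: ler_prod => n; rewrite andbT => /andP[_ nM]; rewrite (ltW x0) /=.
  by apply: fac; apply: le_trans m1; rewrite ler_nat; exact: leq_trans Mm.
have target : expR (- ((2 * ln (14 / c) + 24) * normc z ^+ 2 * (1 + ln (normc z)))) <=
    expR (2 * normc z ^+ 2 * ln x) * expR (- 20).
  rewrite -expRD ler_expR lnx.
  have a1 : 0 <= normc z ^+ 2 * ln (normc z) by rewrite mulr_ge0//; lra.
  have a2 : 0 <= ln (14 / c) * (normc z ^+ 2 * ln (normc z)) by rewrite mulr_ge0.
  lra.
apply: (le_trans target).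
have e20 : expR (-20) <= 1 :> R by rewrite -[leRHS]expR0 ler_expR; lra.
have [Nm|/ltnW mN] := leqP N m.
  rewrite -[leRHS]mulr1; apply: ler_pM; rewrite ?expR_ge0//.
  exact: head.
rewrite (QE _ mN) normcM; apply: ler_pM; rewrite ?expR_ge0//; first exact: head.
have tl n : (m <= n)%N -> normc (ep z n.+1) <= normc z * (1 / (n.+1%:R * Num.sqrt n.+1%:R))
    /\ normc (ep z n.+1) <= 4^-1.
  move=> mn; have [_ h] := ep_arc (ltn0Sn n) zE r1; apply: h.
  by apply: (lt_le_trans m2); rewrite ler_nat.
apply: le_trans (prod_lower _); last by move=> n /andP[mn _]; have [_] := tl n mn; lra.
rewrite ler_expR lerN2.
apply: (@le_trans _ _ (\sum_(m <= n < N) 5 * (normc z * (1 / (n.+1%:R * Num.sqrt n.+1%:R))))).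
  rewrite big_nat_cond [leRHS]big_nat_cond; apply: ler_sum => n.
  rewrite andbT => /andP[mn _]; have [t1 t2] := tl n mn.
  apply: (@le_trans _ _ (5 * normc (ep z n.+1))); last by rewrite ler_pM2l.
  by have := normc_ge0 (ep z n.+1); nra.
rewrite -mulr_sumr -mulr_sumr; have h := @sum_tail_le R m N mN.
have : normc z * (\sum_(m <= n < N) 1 / (n.+1%:R * Num.sqrt n.+1%:R)) <= 4; last by lra.
apply: le_trans (ler_wpM2l (normc_ge0 _) h) _.
rewrite mulrA ler_pdivrMr ?sqrtr_gt0 ?ltr0n//.
have : normc z <= Num.sqrt m.+1%:R.
  rewrite -(@ler_pXn2r _ 2) ?nnegrE ?sqrtr_ge0 ?normc_ge0//.
  by rewrite sqr_sqrtr//; lra.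
lra.
Qed.

End PerturbedSequence.

(** * The complex sine: size and zeros *)

Section ComplexSine.
Variable R : realType.
Implicit Types (w v z : R[i]).

Definition csin w : R[i] := (cexp ('i%C * w) - cexp (- 'i%C * w)) / (2 * 'i%C).

Lemma normc_nat n : normc (n%:R : R[i]) = n%:R.
Proof. by rewrite -(rmorph_nat (real_complex R)) normc_real ger0_norm. Qed.

Lemma normc_csin2 w : normc (csin w) =
  normc (cexp ('i%C * w) - cexp (- 'i%C * w)) / 2.
Proof. by rewrite normcM normcV normcM normc_i normc_nat mulr1. Qed.

Lemma normc_cexp_iM w : normc (cexp ('i%C * w)) = expR (- complex.Im w).
Proof. by rewrite normc_cexp ReM /= mul0r mul1r sub0r. Qed.

Lemma normc_cexp_NiM w : normc (cexp (- 'i%C * w)) = expR (complex.Im w).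
Proof. by rewrite normc_cexp mulNr ReN ReM /= mul0r mul1r sub0r opprK. Qed.

Lemma csin_upper w : normc (csin w) <= expR `|complex.Im w|.
Proof.
rewrite normc_csin2 ler_pdivrMr//; apply: (le_trans (normcB _ _)).
rewrite normc_cexp_iM normc_cexp_NiM mulr_natr mulr2n.
apply: lerD; rewrite ler_expR ?ler_norm//.
by rewrite -normrN ler_norm.
Qed.

Lemma csin_lower w : 1 <= `|complex.Im w| -> expR `|complex.Im w| / 4 <= normc (csin w).
Proof.
move=> h; rewrite normc_csin2.
have key (x : R) : 1 <= x -> expR x / 4 <= (expR x - expR (- x)) / 2.
  move=> x1; have := expR_gt0 x; rewrite expRN => e0.
  have e2 : 2 <= expR x by have := expR_ge1Dx x; lra.
  have : (expR x)^-1 <= 2^-1 by rewrite lef_pV2 ?posrE.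
  lra.
have [I0|I0] := leP 0 (complex.Im w).
  rewrite (ger0_norm I0) in h *; apply: (le_trans (key _ h)).
  rewrite ler_pM2r ?invr_gt0// -normc_cexp_iM -normc_cexp_NiM normc_distC.
  exact: normc_ge_sub.
rewrite (ltr0_norm I0) in h *; apply: (le_trans (key _ h)).
rewrite ler_pM2r ?invr_gt0// opprK -normc_cexp_iM -normc_cexp_NiM.
exact: normc_ge_sub.
Qed.

Lemma csinE (a b : R) : csin (a +i* b) =
  (sin a * (expR b + expR (- b)) / 2) +i* (cos a * (expR b - expR (- b)) / 2).
Proof.
apply: (@mulIf _ (2 * 'i%C)).
  by rewrite -normc_eq0 normcM normc_i normc_nat mulr1 pnatr_eq0.
rewrite /csin divfK; last first.
  by rewrite -normc_eq0 normcM normc_i normc_nat mulr1 pnatr_eq0.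
rewrite /cexp /expi !(ReM, ImM, ReN, ImN) /= !(mul0r, mul1r, sub0r, oppr0, add0r, addr0, subr0, opprK, mulN1r).
rewrite sinN cosN -(rmorph_nat (real_complex R)).
by apply: eq_ReIm => /=; rewrite !(mul0r, subr0, sub0r, addr0, add0r); field.
Qed.

Lemma sin_ge_quarter (t : R) : 0 <= t <= 1 -> t / 2 <= sin (pi / 2 * t).
Proof.
move=> /andP[t0 t1]; have pi2 := pihalf_ge1 R.
have pt : t <= pi / 2 * t by rewrite ler_peMl.
have [h|h] := leP (pi / 2 * t) 1.
  apply: le_trans (sin_ge_half _); first by lra.
  by rewrite h andbT mulr_ge0//; lra.
have h1 : pi / 2 * t <= pi / 2 by rewrite ler_piMr//; lra.
apply: (@le_trans _ _ (1 / 2)); first by lra.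
apply: (@le_trans _ _ (sin 1)); first by apply: sin_ge_half; rewrite ler01 lexx.
rewrite -[in leRHS](cos_pihalfB (pi / 2 * t)) -cos_pihalfB.
apply: cos_le_abs; last by have := pi_ge2 R; lra.
by rewrite ger0_norm; lra.
Qed.

Lemma sinh_ge (b : R) : b ^+ 2 <= ((expR b - expR (- b)) / 2) ^+ 2.
Proof.
have key (x : R) : 0 <= x -> x <= (expR x - expR (- x)) / 2.
  move=> x0; rewrite -subr_ge0.
  have -> : 0 = (expR 0 - expR (- 0)) / 2 - 0 :> R by rewrite oppr0 subrr mul0r addr0.
  apply: (@is_derive_ge0_le R (fun t => (expR t - expR (- t)) / 2 - t)
    (fun t => (expR t + expR (- t)) / 2 - 1)) => // t _.
    by apply: is_derive_eq; rewrite /GRing.scale /=; field.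
  have := expR_gt0 t => e0; rewrite expRN.
  rewrite subr_ge0 ler_pdivlMr// mul1r.
  have : 0 <= (expR t - 1) ^+ 2 / expR t by rewrite divr_ge0 ?sqr_ge0// ltW.
  have -> : (expR t - 1) ^+ 2 / expR t = expR t + (expR t)^-1 - 2.
    by field; rewrite gt_eqF.
  lra.
have [b0|b0] := leP 0 b.
  by rewrite lerXn2r ?nnegrE// ?key// (le_trans b0)// key.
have nb : 0 <= - b by lra.
rewrite -(sqrrN b) -[leRHS]sqrrN.
have -> : - ((expR b - expR (- b)) / 2) = (expR (- b) - expR (- - b)) / 2.
  by rewrite (opprK b); field.
by rewrite lerXn2r ?nnegrE// ?key// (le_trans nb)// key.
Qed.

Lemma sqr_csin (a b : R) : normc (csin (a +i* b)) ^+ 2 =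
  sin a ^+ 2 + ((expR b - expR (- b)) / 2) ^+ 2.
Proof.
rewrite csinE sqr_normcE /= !expr_div_n !exprMn cos2sin2.
have e : expR b * expR (- b) = 1 :> R by rewrite expRxMexpNx_1.
have -> : (expR b + expR (- b)) ^+ 2 = (expR b - expR (- b)) ^+ 2 + 4 :> R.
  have -> : (expR b + expR (- b)) ^+ 2 = (expR b - expR (- b)) ^+ 2 +
    4 * (expR b * expR (- b)) by ring.
  by rewrite e mulr1.
by field.
Qed.

Lemma csinN w : csin (- w) = - csin w.
Proof. rewrite /csin -[RHS]mulNr opprB mulrN -[in cexp (- _)]mulNr.
by have -> : - 'i%C * - w = 'i%C * w by ring. Qed.

Lemma sin_nat_pi (x : R) n : sin (x + pi *+ n) ^+ 2 = sin x ^+ 2.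
Proof.
elim: n => [|n IHn]; first by rewrite mulr0n addr0.
by rewrite mulrSr addrA sinDpi sqrrN.
Qed.

Let csin_near_pos v : 0 <= complex.Re v -> exists m : nat,
  2 * m%:R <= complex.Re v + 1 /\
  normc (v - (2 * m%:R)%:C) / 2 <= normc (csin ((pi / 2)%:C * v)).
Proof.
case: v => s t s0; have {}s0 : 0 <= s by []; pose m := Num.truncn ((s + 1) / 2); exists m.
have /andP[m1 m2] : m%:R <= (s + 1) / 2 < m.+1%:R.
  by apply: truncn_itv; rewrite divr_ge0//; lra.
have m3 : m.+1%:R = m%:R + 1 :> R by rewrite -(natr1 m).
rewrite m3 in m2; split; first by rewrite /=; lra.
have -> : (pi / 2)%:C * (s +i* t) = (pi / 2 * s) +i* (pi / 2 * t).
  by apply: eq_ReIm => /=; ring.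
rewrite -(@ler_pXn2r _ 2) ?nnegrE ?divr_ge0 ?normc_ge0// sqr_csin.
rewrite expr_div_n sqr_normcE /= oppr0 addr0.
pose tau := s - 2 * m%:R.
have tauI : -1 <= tau <= 1 by rewrite /tau; apply/andP; split; lra.
have -> : pi / 2 * s = pi / 2 * tau + pi *+ m.
  by rewrite /tau -mulr_natr; field.
rewrite sin_nat_pi.
have h1 : tau ^+ 2 / 4 <= sin (pi / 2 * tau) ^+ 2.
  have [a0|a0] := leP 0 tau.
    have aI : 0 <= tau <= 1 by case/andP: tauI => _ ->; rewrite a0.
    have -> : tau ^+ 2 / 4 = (tau / 2) ^+ 2 by field.
    by rewrite lerXn2r ?nnegrE ?divr_ge0 ?(le_trans _ (sin_ge_quarter aI)) ?divr_ge0// sin_ge_quarter.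
  have aI : 0 <= - tau <= 1 by case/andP: tauI => *; apply/andP; split; lra.
  have -> : tau ^+ 2 / 4 = (- tau / 2) ^+ 2 by field.
  rewrite -[leRHS]sqrrN -sinN -mulrN.
  have n0 : 0 <= - tau / 2 by case/andP: aI => ? ?; rewrite divr_ge0.
  by rewrite lerXn2r ?nnegrE// ?(le_trans n0)// sin_ge_quarter.
have h2 : t ^+ 2 / 4 <= ((expR (pi / 2 * t) - expR (- (pi / 2 * t))) / 2) ^+ 2.
  apply: le_trans (sinh_ge _).
  have p1 : 1 <= (pi / 2 : R) ^+ 2 by rewrite exprn_ege1// pihalf_ge1.
  rewrite exprMn; have := sqr_ge0 t; nra.
have -> : (s - 2 * m%:R) = tau by [].
lra.
Qed.

(** [e] is an even integer nearest to [Re v]. The inequality serves twice: it bounds the sine below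
    away from the even integers, and it shows that there are no other zeros. *)
Lemma csin_near v : exists e : R[i], [/\ normc (v - e) / 2 <= normc (csin ((pi / 2)%:C * v)),
  normc e <= normc v + 1 & exists m : nat, e = (2 * m%:R)%:C \/ e = - (2 * m%:R)%:C].
Proof.
have hb (m : nat) x : 2 * m%:R <= complex.Re x + 1 -> normc ((2 * m%:R)%:C : R[i]) <= normc x + 1.
  rewrite normc_real ger0_norm ?mulr_ge0// => h.
  by have := ler_Re_normc x; have := ler_norm (complex.Re x); lra.
have [v0|v0] := leP 0 (complex.Re v).
  have [m [m1 m2]] := csin_near_pos v0.
  by exists (2 * m%:R)%:C; split=> //; [exact: hb|exists m; left].
have [|m [m1 m2]] := @csin_near_pos (- v); first by rewrite ReN; lra.
exists (- (2 * m%:R)%:C); split; last by exists m; right.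
  by move: m2; rewrite mulrN csinN normcN -opprD normcN opprK.
by rewrite normcN -(normcN v); exact: hb.
Qed.

Lemma csin_arc v k : normc v = 2 * k%:R + 1 -> 1 / 2 <= normc (csin ((pi / 2)%:C * v)).
Proof.
move=> vk; have [e [h _ [m em]]] := csin_near v; apply: le_trans h.
rewrite ler_pM2r ?invr_gt0//.
have ne : normc e = 2 * m%:R.
  by case: em => ->; rewrite ?normcN normc_real ger0_norm ?mulr_ge0.
have := normc_ge_sub v e; have := normc_ge_sub e v; rewrite [normc (e - v)]normc_distC ne vk.
have [mk|km] := leqP m k.
  have : m%:R <= k%:R :> R by rewrite ler_nat.
  lra.
have : k%:R + 1 <= m%:R :> R by rewrite (natr1 k) ler_nat.
lra.
Qed.

(** Expresses that the zeros are simple; needed to exclude a double zero in [csin_factor]. *)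
Lemma csin_even (m : nat) (h : R) : 0 <= h <= 1 ->
  h / 2 <= normc (csin ((pi / 2)%:C * ((2 * m%:R)%:C + h%:C))) /\
  h / 2 <= normc (csin ((pi / 2)%:C * (- (2 * m%:R)%:C - h%:C))).
Proof.
move=> hI; have h0 : 0 <= h by case/andP: hI.
have e : h / 2 <= normc (csin ((pi / 2)%:C * ((2 * m%:R)%:C + h%:C))).
  have -> : (pi / 2)%:C * ((2 * m%:R)%:C + h%:C) = (pi / 2 * h + pi *+ m) +i* 0.
    by rewrite -(mulr_natr pi m); apply: eq_ReIm => /=; field.
  rewrite -(@ler_pXn2r _ 2) ?nnegrE ?divr_ge0 ?normc_ge0// sqr_csin sin_nat_pi.
  rewrite oppr0 subrr mul0r expr0n addr0.
  by rewrite lerXn2r ?nnegrE ?divr_ge0 ?(le_trans _ (sin_ge_quarter hI)) ?divr_ge0// sin_ge_quarter.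
by split=> //; rewrite -opprD mulrN csinN normcN.
Qed.

Lemma csin_even0 (m : nat) : csin ((pi / 2)%:C * (2 * m%:R)%:C) = 0 :> R[i].
Proof.
have -> : (pi / 2)%:C * (2 * m%:R)%:C = (0 + pi *+ m) +i* 0 :> R[i].
  by rewrite -(mulr_natr pi m); apply: eq_ReIm => /=; field.
apply/eqP; rewrite -normc_eq0 -sqrf_eq0 sqr_csin sin_nat_pi sin0 expr0n add0r.
by rewrite oppr0 subrr mul0r expr0n.
Qed.

Lemma entire_csin (c : R[i]) : entire (fun w => csin (c * w)).
Proof.
have e1 : entire (fun w => cexp ('i%C * c * w)).
  by exists (fun k => ('i%C * c) ^+ k / k`!%:R); exact: entire_cexp.
have e2 : entire (fun w => cexp (- 'i%C * c * w)).
  by exists (fun k => (- 'i%C * c) ^+ k / k`!%:R); exact: entire_cexp.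
have := entireZ (2 * 'i%C)^-1 (entireD e1 (entireZ (-1) e2)).
congr entire; apply/funext => w; rewrite /csin !mulrA mulN1r [LHS]mulrC.
by rewrite !mulNr.
Qed.

(* [sin (pi z^2/2) / z^2], freed from its zeros in the disc [|z|^2 <= 2N + 1]. *)
Lemma csin_factor N : exists g : R[i] -> R[i], [/\ entire g,
  forall z, csin ((pi / 2)%:C * z ^+ 2) = z ^+ 2 *
     (\prod_(0 <= n < N) (z ^+ 4 - (2 * n.+1%:R)%:C ^+ 2)) * g z &
  forall z, normc z ^+ 2 <= 2 * N%:R + 1 -> g z != 0].
Proof.
pose f w : R[i] := csin ((pi / 2)%:C * w).
pose pos := [seq (2 * n%:R)%:C : R[i] | n <- iota 0 N.+1].
pose neg := [seq - (2 * n%:R)%:C : R[i] | n <- iota 1 N].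
have f0 e : e \in pos ++ neg -> f e = 0.
  rewrite mem_cat => /orP[] /mapP[n _ ->]; first exact: csin_even0.
  by rewrite /f mulrN csinN csin_even0 oppr0.
have inj2 : injective (fun n : nat => (2 * n%:R)%:C : R[i]).
  move=> m n /complexI /(mulfI _) h; apply/eqP; rewrite -(eqr_nat R).
  by apply/eqP/h; rewrite pnatr_eq0.
have un : uniq (pos ++ neg).
  rewrite cat_uniq map_inj_uniq// iota_uniq /=.
  rewrite (map_inj_uniq (inj_comp oppr_inj inj2)) iota_uniq andbT.
  apply/hasPn => _ /mapP[n nI ->]; apply/negP => /mapP[m _].
  move=> /(congr1 (@complex.Re R)) /= h.
  have : 0 < n%:R :> R by rewrite ltr0n; move: nI; rewrite mem_iota => /andP[].
  have : 0 <= m%:R :> R by [].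
  lra.
have [g eg fg] := entire_div_prod (entire_csin (pi / 2)%:C) un f0.
exists (fun z => g (z ^+ 2)); split; first exact: entire_comp_sqr.
  move=> z; rewrite fg big_cat /= !big_map; congr (_ * _).
  rewrite -[iota 0 N.+1]/(0%N :: iota 1 N) big_cons mulr0 subr0 -mulrA; congr (_ * _).
  rewrite -big_split /= -[1%N]addn0 iotaDl big_map.
  rewrite -{1}(subn0 N) -/(index_iota 0 N); apply: eq_bigr => n _.
  by rewrite add1n; ring.
move=> z zN; set w := z ^+ 2.
have wN : normc w <= 2 * N%:R + 1 by rewrite normcX.
apply/negP => /eqP gw0.
have fw0 : f w = 0 by rewrite /f fg gw0 mulr0.
have [e [h1 h2 [m em]]] := csin_near w.
have we : w = e.
  apply/eqP; rewrite -subr_eq0 -normc_eq0 eq_le normc_ge0 andbT.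
  by move: h1; rewrite -/(f w) fw0 normc0; lra.
have mN : (m <= N)%N.
  rewrite -ltnS -(ltr_nat R) -(natr1 N).
  have : normc e = 2 * m%:R.
    by case: em => ->; rewrite ?normcN normc_real ger0_norm ?mulr_ge0.
  by rewrite -we; lra.
have win : w \in pos ++ neg.
  rewrite mem_cat we; case: em => ->.
    by apply/orP; left; apply/mapP; exists m => //; rewrite mem_iota.
  case: m {fw0} mN => [|m] mN.
    by rewrite mulr0 oppr0; apply/orP; left; apply/mapP; exists 0%N => //; rewrite mulr0.
  by apply/orP; right; apply/mapP; exists m.+1 => //; rewrite mem_iota add1n ltnS.
have entP (s : seq R[i]) : entire (fun v => \prod_(e <- s) (v - e)).
  elim: s => [|x s IHs].
    have := entire_cst (1 : R[i]); congr entire; apply/funext => v.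
    by rewrite big_nil.
  have := entire_mul_sub x IHs; congr entire; apply/funext => v.
  by rewrite big_cons.
(* If [g] vanished at [w], then [w] would be a double zero of [f]: [f (w + x)] would be [O(|x|^2)],
   with a constant made of [K] and [C], against [csin_even] for the small step [h]. *)
have [K K0 PK] := entire_bounded (normc w + 1) (entP (rem w (pos ++ neg))).
have [C [d [d0 gC]]] := ana_lip (entire_ana w eg).
have C1 : 0 < 2 * K * (`|C| + 1) + 1.
  by rewrite ltr_wpDl// !mulr_ge0// addr_ge0.
pose h : R := Num.min (Num.min 1 (d / 2)) (2 * K * (`|C| + 1) + 1)^-1 / 2.
have h0 : 0 < h by rewrite divr_gt0// !lt_min ltr01 divr_gt0//= invr_gt0.
have [hle1 hd hC] : [/\ h <= 1, h < d & h * (2 * K * (`|C| + 1)) < 1].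
  have : Num.min (Num.min 1 (d / 2)) (2 * K * (`|C| + 1) + 1)^-1 = 2 * h by rewrite /h; field.
  move=> E; have : 2 * h <= Num.min (Num.min 1 (d / 2)) (2 * K * (`|C| + 1) + 1)^-1 by rewrite E.
  rewrite !le_min => /andP[/andP[a1 a2] a3]; split; try lra.
  have a4 : 2 * h * (2 * K * (`|C| + 1) + 1) <= 1.
    by rewrite -[leRHS](mulVf (lt0r_neq0 C1)) ler_pM2r.
  lra.
clearbody h.
have main (x : R[i]) : normc x = h -> h / 2 <= normc (f (w + x)) -> False.
  move=> xh; rewrite /f fg (big_rem w win) /= addrAC subrr add0r !normcM xh.
  have b1 : normc (\prod_(y <- rem w (pos ++ neg)) (w + x - y)) <= K.
    by apply: PK; apply: (le_trans (normcD _ _)); rewrite lerD2l xh.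
  have b2 : normc (g (w + x)) <= (`|C| + 1) * h.
    have := gC x; rewrite xh gw0 subr0 => /(_ hd) /le_trans; apply.
    by rewrite ler_pM2r// (le_trans (ler_norm C))// lerDl.
  have : h * normc (\prod_(y <- rem w (pos ++ neg)) (w + x - y)) * normc (g (w + x)) <=
     h * K * ((`|C| + 1) * h).
    apply: ler_pM; rewrite ?mulr_ge0 ?normc_ge0 ?(ltW h0)//.
    by rewrite ler_pM2l.
  have -> : h * K * ((`|C| + 1) * h) = (h * (2 * K * (`|C| + 1))) * (h / 2) by field.
  have : (h * (2 * K * (`|C| + 1))) * (h / 2) < 1 * (h / 2) by rewrite ltr_pM2r// divr_gt0.
  lra.
have hI : 0 <= h <= 1 by rewrite (ltW h0).
have nh : normc (h%:C : R[i]) = h by rewrite normc_real gtr0_norm.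
have [e1 e2] := csin_even m hI.
case: em => emE; rewrite -we in emE.
  by apply: (main h%:C nh); rewrite /f emE.
by apply: (main (- h%:C)); rewrite ?normcN// /f emE.
Qed.

End ComplexSine.

(** * The truncated generating function and its zeros *)

Section GeneratingFunction.
Variables (R : realType) (lam : nat -> R[i]) (d : R).
Hypothesis d0 : 0 <= d.
Hypothesis d1 : d < 1 / 2.
Hypothesis near : forall n : nat, (1 <= n)%N ->
  normc ((sqrt2n R n)%:C - lam n) <= d / sqrt2n R n.
Hypothesis lam_inj : forall m n : nat, (1 <= m)%N -> (1 <= n)%N ->
  lam m = lam n -> m = n.
Local Notation u := (sqrt2n R).
Local Notation Q := (Q lam).
Implicit Types (z : R[i]) (n N : nat).

Definition zeros N : seq R[i] := [:: 1; -1] ++ [seq lam n | n <- iota 1 N] ++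
  [seq - (u n)%:C | n <- iota 1 N] ++ [seq 0 +i* u n | n <- iota 1 N] ++
  [seq 0 -i* u n | n <- iota 1 N].

Lemma sqrt2n_inj : injective u.
Proof.
move=> m n /(congr1 (fun x => x ^+ 2)); rewrite !sqr_sqrt2n => /(mulfI _) h.
by apply/eqP; rewrite -(eqr_nat R); apply/eqP/h; rewrite pnatr_eq0.
Qed.

(** With 4/3 one gets [|lam n| >= 3/4 * u n > 1], which separates [lam n] from 1 and -1. *)
Lemma sqrt2n_gt1 n : (0 < n)%N -> 4 / 3 < u n.
Proof.
move=> n0; rewrite -(@ltr_pXn2r _ 2) ?nnegrE ?sqrtr_ge0// sqr_sqrt2n.
by have : 1 <= n%:R :> R; [rewrite ler1n|lra].
Qed.

Lemma Re_lam_gt0 n : (0 < n)%N -> 0 < complex.Re (lam n).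
Proof.
move=> n0; have h := near n0; have u1 := sqrt2n_gt1 n0.
have := ler_Re_normc ((u n)%:C - lam n); rewrite ReD ReN /= => hR.
have dd1 := d1; have dd0 := d0.
have : d / u n <= 1 / 2 by rewrite ler_pdivrMr; lra.
have := ler_norm (u n - complex.Re (lam n)); lra.
Qed.

Lemma uniq_zeros N : uniq (zeros N).
Proof.
have inI n : n \in iota 1 N -> (0 < n)%N by rewrite mem_iota => /andP[].
have injU : injective (fun n => - (u n)%:C : R[i]).
  by move=> m n /oppr_inj /complexI /sqrt2n_inj.
have injI : injective (fun n => 0 +i* u n : R[i]).
  by move=> m n /(congr1 (@complex.Im R)) /= /sqrt2n_inj.
have injN : injective (fun n => 0 -i* u n : R[i]).
  by move=> m n /(congr1 (@complex.Im R)) /= /oppr_inj /sqrt2n_inj.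
rewrite /zeros !cat_uniq !map_inj_in_uniq ?iota_uniq; first last.
- by move=> m n /inI m0 /inI n0; exact: lam_inj.
- by move=> m n _ _; exact: injU.
- by move=> m n _ _; exact: injI.
- by move=> m n _ _; exact: injN.
rewrite /= !andbT; apply/and5P; split.
- rewrite inE -subr_eq0 opprK -normc_eq0.
  by rewrite (_ : 1 + 1 = 2%:R)// normc_nat pnatr_eq0.
- apply/hasPn => x; rewrite !mem_cat !inE => xin; apply/negP => x1.
  have : normc x = 1 by case/orP: x1 => /eqP ->; rewrite ?normcN normc1.
  case/or4P: xin => /mapP[n /inI n0 ->]; have u1 := sqrt2n_gt1 n0.
  + by have [] := lam_bounds d0 d1 near n0; lra.
  + by rewrite normcN normc_sqrt2n; lra.
  + by rewrite /= expr0n add0r sqrtr_sqr ger0_norm; lra.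
  + by rewrite /= expr0n add0r sqrrN sqrtr_sqr ger0_norm; lra.
- apply/hasPn => x; rewrite !mem_cat => xin; apply/negP => /mapP[n /inI n0 xE].
  have : 0 < complex.Re x by rewrite xE Re_lam_gt0.
  case/or3P: xin => /mapP[m /inI m0 ->] /=; have u1 := sqrt2n_gt1 m0; lra.
- apply/hasPn => x; rewrite !mem_cat => xin; apply/negP => /mapP[n /inI n0 xE].
  have : complex.Re x < 0 by rewrite xE /=; have u1 := sqrt2n_gt1 n0; lra.
  by case/orP: xin => /mapP[m /inI m0 ->] /=; rewrite ltxx.
- apply/hasPn => x xin; apply/negP => /mapP[n /inI n0 xE].
  have : 0 < complex.Im x by rewrite xE /=; have u1 := sqrt2n_gt1 n0; lra.
  case/mapP: xin => m /inI m0 -> /=; have u1 := sqrt2n_gt1 m0; lra.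
Qed.

(** [Q] is normalised to be 1 at 0, whereas the product over [zeros N] is monic; this is the
    correction. *)
Definition scale N : R[i] := \prod_(0 <= n < N) (lam n.+1 / (u n.+1)%:C).

Lemma scale_neq0 N : scale N != 0.
Proof.
rewrite prodf_seq_neq0; apply/allP => n _ /=.
by rewrite mulf_neq0 ?invr_eq0 ?(lam_neq0 d0 d1 near) ?sqrt2n_neq0.
Qed.

Lemma big_iota1 (F : nat -> R[i]) N :
  \prod_(n <- iota 1 N) F n = \prod_(0 <= n < N) F n.+1.
Proof.
rewrite -[1%N]addn0 iotaDl big_map /index_iota subn0.
by apply: eq_bigr => n _; rewrite add1n.
Qed.

(** [z^4 - (2 n)^2] splits over the four points [u n], [- u n], [i u n] and [- i u n], and the
    factor of [Q] exchanges [u n] for [lam n]. *)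
Lemma zeros_prod N g z :
  csin ((pi / 2)%:C * z ^+ 2) = z ^+ 2 *
     (\prod_(0 <= n < N) (z ^+ 4 - (2 * n.+1%:R)%:C ^+ 2)) * g ->
  (forall n, (0 < n)%N -> z != (u n)%:C) ->
  scale N * ((z ^+ 2 - 1) * csin ((pi / 2)%:C * z ^+ 2) * Q z N) =
  (\prod_(e <- zeros N) (z - e)) * z ^+ 2 * g.
Proof.
move=> -> zu; rewrite /zeros !big_cat /= !big_map big_cons big_seq1 !big_iota1.
have -> : Q z N = \prod_(0 <= n < N) ((lam n.+1 - z) * (u n.+1)%:C / (lam n.+1 * ((u n.+1)%:C - z))).
  by apply: eq_bigr => n _; rewrite (ep1E d0 d1 near)// eq_sym zu.
rewrite opprK.
have -> : (z ^+ 2 - 1) = (z - 1) * (z + 1) by ring.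
set A := (z - 1) * (z + 1).
pose C := z ^+ 2 * g.
transitivity (A * C * (scale N * \prod_(0 <= n < N) (z ^+ 4 - (2 * n.+1%:R)%:C ^+ 2) *
  \prod_(0 <= n < N) ((lam n.+1 - z) * (u n.+1)%:C / (lam n.+1 * ((u n.+1)%:C - z))))).
  by rewrite /C; ring.
transitivity (A * C * (\prod_(0 <= n < N) (z - lam n.+1) * (\prod_(0 <= n < N) (z - - (u n.+1)%:C) *
 (\prod_(0 <= n < N) (z - 0 +i* u n.+1) * \prod_(0 <= n < N) (z - 0 -i* u n.+1))))); last first.
  by rewrite /C; ring.
congr (_ * _); rewrite /scale -!big_split /=; apply: eq_bigr => n _.
have -> : (0 +i* u n.+1) = 'i%C * (u n.+1)%:C :> R[i] by apply: eq_ReIm => /=; ring.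
have -> : (0 -i* u n.+1) = - 'i%C * (u n.+1)%:C :> R[i] by apply: eq_ReIm => /=; ring.
have -> : (2 * n.+1%:R)%:C = (u n.+1)%:C ^+ 2 :> R[i] by rewrite -rmorphXn /= sqr_sqrt2n.
have u0 := sqrt2n_neq0 R (ltn0Sn n); have l0 := lam_neq0 d0 d1 near (ltn0Sn n).
have zn : (u n.+1)%:C - z != 0 by rewrite subr_eq0 eq_sym zu.
have i2 : ('i%C : R[i]) ^+ 2 = -1 by exact: sqr_i.
move: ((u n.+1)%:C : R[i]) u0 zn => v v0 vz.
have -> : (z - 'i%C * v) = z - 'i%C * v by [].
have -> : (z - - v) * ((z - 'i%C * v) * (z - - 'i%C * v)) = (z + v) * (z ^+ 2 + v ^+ 2).
  rewrite opprK; congr (_ * _).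
  have -> : (z - 'i%C * v) * (z - - 'i%C * v) = z ^+ 2 - 'i%C ^+ 2 * v ^+ 2 by ring.
  by rewrite i2 mulN1r opprK.
by field; rewrite v0 vz l0.
Qed.

Lemma arc_neq z k : normc z ^+ 2 = 2 * k%:R + 1 -> forall n, (0 < n)%N -> z != (u n)%:C.
Proof.
move=> zE n n0; have [h1 h2] := arc_dist n0 zE.
by rewrite eq_sym -subr_eq0 -normc_gt0; exact: lt_le_trans h2.
Qed.

Lemma left_neq z n : 0 < normc z -> complex.Re z <= 4 / 5 * normc z -> (0 < n)%N ->
  z != (u n)%:C.
Proof.
move=> r0 zs n0; have [_ h2] := left_dist d0 d1 n0 zs.
by rewrite eq_sym -subr_eq0 -normc_gt0; apply: lt_le_trans h2; lra.
Qed.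

Lemma normc_sqr_sub1 z : 2 <= normc z ->
  3 / 4 * normc z ^+ 2 <= normc (z ^+ 2 - 1) <= 5 / 4 * normc z ^+ 2.
Proof.
move=> r2; have r4 : 4 <= normc z ^+ 2.
  by rewrite expr2; nra.
have := normc_ge_sub (z ^+ 2) 1; have := normcB (z ^+ 2) 1; rewrite normcX normc1.
by move=> *; apply/andP; split; lra.
Qed.

Lemma Im_sqr z : complex.Im (z ^+ 2) = 2 * complex.Re z * complex.Im z.
Proof. by case: z => a b; rewrite expr2 /=; ring. Qed.

Lemma normc_csin_sqr z : normc (csin ((pi / 2)%:C * z ^+ 2)) <=
    expR (pi / 2 * `|complex.Im (z ^+ 2)|) /\
  (1 <= `|complex.Im (z ^+ 2)| ->
   expR (pi / 2 * `|complex.Im (z ^+ 2)|) / 4 <= normc (csin ((pi / 2)%:C * z ^+ 2))).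
Proof.
have p1 := pihalf_ge1 R; have p0 : 0 <= pi / 2 :> R by lra.
have e : `|complex.Im ((pi / 2)%:C * z ^+ 2)| = pi / 2 * `|complex.Im (z ^+ 2)|.
  by rewrite ImM /= mul0r addr0 normrM (ger0_norm p0).
split; first by rewrite -e; exact: csin_upper.
by move=> h; rewrite -e; apply: csin_lower; rewrite e; nra.
Qed.

End GeneratingFunction.

(** * Quotient of a function vanishing on Lambda by the generating function *)

Section Uniqueness.
Variables (R : realType) (lam : nat -> R[i]) (d : R).
Hypothesis d0 : 0 <= d.
Hypothesis d1 : d < 1 / 2.
Hypothesis near : forall n : nat, (1 <= n)%N ->
  normc ((sqrt2n R n)%:C - lam n) <= d / sqrt2n R n.
Hypothesis lam_inj : forall m n : nat, (1 <= m)%N -> (1 <= n)%N ->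
  lam m = lam n -> m = n.
Local Notation u := (sqrt2n R).
Local Notation Q := (Q lam).
Variables (H : R[i] -> R[i]) (B : R).
Hypothesis eH : entire H.
Hypothesis HB : forall z, normc (H z) <= B * expR (pi / 2 * normc z ^+ 2).
Hypothesis H0 : forall N e, e \in zeros lam N -> H e = 0.
Implicit Types (z : R[i]) (n N : nat).

Lemma quotient_rep N : exists h g, [/\ entire h, entire g,
  forall z, normc z ^+ 2 <= 2 * N%:R + 1 -> g z != 0 &
  forall z, (forall n, (0 < n)%N -> z != (u n)%:C) ->
    H z * z ^+ 2 * g z = (z ^+ 2 - 1) * csin ((pi / 2)%:C * z ^+ 2) * Q z N * h z].
Proof.
have [h eh hE] := entire_div_prod eH (uniq_zeros d0 d1 near lam_inj N) (@H0 N).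
have [g [eg gE g0]] := csin_factor R N.
exists (fun z => scale lam N * h z), g; split=> //; first exact: entireZ.
move=> z zu; have := zeros_prod d0 d1 near (gE z) zu => E.
rewrite hE; transitivity ((\prod_(e <- zeros lam N) (z - e)) * z ^+ 2 * g z * h z).
  by ring.
by rewrite -E; ring.
Qed.

(** [h / g] is the quotient of [H] by the generating function truncated at [N]. Written with two
    entire functions, [g] having no zero in the disc [|z|^2 <= 2 N + 1], it is analytic there even
    at the points of [Lambda]. *)
Definition rep N (h g : R[i] -> R[i]) := [/\ entire h, entire g,
  forall z, normc z ^+ 2 <= 2 * N%:R + 1 -> g z != 0 &
  forall z, (forall n, (0 < n)%N -> z != (u n)%:C) ->
    H z * z ^+ 2 * g z = (z ^+ 2 - 1) * csin ((pi / 2)%:C * z ^+ 2) * Q z N * h z].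

Let B0 : 0 <= B.
Proof.
have := HB 0; rewrite normc0 expr0n mulr0 expR0 mulr1.
by apply: le_trans; exact: normc_ge0.
Qed.

Lemma rep_norm N h g z : rep N h g -> normc z ^+ 2 <= 2 * N%:R + 1 ->
  (forall n, (0 < n)%N -> z != (u n)%:C) ->
  normc (H z) * normc z ^+ 2 = normc (z ^+ 2 - 1) *
    normc (csin ((pi / 2)%:C * z ^+ 2)) * normc (Q z N) * normc (h z / g z).
Proof.
move=> [_ _ g0 E] zN zu; have gz := g0 z zN.
rewrite -!normcM -normcX -normcM; congr normc.
by apply: (mulIf gz); rewrite E// -[RHS]mulrA divfK.
Qed.

(** Close to the diagonals [|Im z^2|] is almost [|z|^2] and only the factor [|z|^d] remains. [16/3]
    is the inverse of [3/4 * 1/4], from [z^2 - 1] and from the sine. *)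
Lemma rep_left N h g z : rep N h g -> normc z ^+ 2 <= 2 * N%:R + 1 ->
  2 <= normc z -> complex.Re z <= 4 / 5 * normc z -> 1 <= `|complex.Im (z ^+ 2)| ->
  normc (h z / g z) <= 16 / 3 * B * expR 21 *
    expR (d * ln (normc z) + pi / 2 * (normc z ^+ 2 - `|complex.Im (z ^+ 2)|)).
Proof.
move=> r zN r2 zs Iz.
have r0 : 0 < normc z by lra.
have := rep_norm r zN (fun n => @left_neq _ _ d0 d1 z n r0 zs); move: (h z / g z) => T E.
have /andP[q1 _] := normc_sqr_sub1 r2.
have [_ /(_ Iz) q2] := normc_csin_sqr z.
have r1 : 1 <= normc z by lra.
have /andP[q3 _] := Q_left d0 d1 near N r1 zs.
set s := `|complex.Im (z ^+ 2)| in q2 *.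
set r' := normc z in r2 zs r0 r1 q1 q3 E *.
have p1 : 0 < 3 / 4 * r' ^+ 2 by rewrite mulr_gt0// exprn_gt0.
have p2 : 0 < expR (pi / 2 * s) / 4 by rewrite divr_gt0// expR_gt0.
have p3 := expR_gt0 (- (d * ln r' + 21)).
have low : 3 / 4 * r' ^+ 2 * (expR (pi / 2 * s) / 4) * expR (- (d * ln r' + 21)) <=
   normc (z ^+ 2 - 1) * normc (csin ((pi / 2)%:C * z ^+ 2)) * normc (Q z N).
  apply: (ler_pM (mulr_ge0 (ltW p1) (ltW p2)) (ltW p3)) => //.
  exact: (ler_pM (ltW p1) (ltW p2)).
have p123 := mulr_gt0 (mulr_gt0 p1 p2) p3.
rewrite -(ler_pM2l p123); apply: le_trans (ler_wpM2r (normc_ge0 T) low) _.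
rewrite -E; apply: le_trans (ler_wpM2r (sqr_ge0 _) (HB z)) _.
rewrite le_eqVlt; apply/orP; left; apply/eqP; rewrite -/r'.
have -> : 3 / 4 * r' ^+ 2 * (expR (pi / 2 * s) / 4) * expR (- (d * ln r' + 21)) *
  (16 / 3 * B * expR 21 * expR (d * ln r' + pi / 2 * (r' ^+ 2 - s))) =
  r' ^+ 2 * B * (expR (pi / 2 * s) * expR (- (d * ln r' + 21)) * expR 21 *
    expR (d * ln r' + pi / 2 * (r' ^+ 2 - s))) by field.
rewrite -!expRD mulrC mulrA; congr (_ * expR _); ring.
Qed.

(** On the circles [|z|^2 = 2 k + 1] both the sine and [Q] are bounded below in every direction,
    including that of the positive axis. *)
Lemma rep_arc : exists (C : R) k0, 1 <= C /\ forall N k h g z, rep N h g ->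
  normc z ^+ 2 <= 2 * N%:R + 1 -> (k0 <= k)%N -> normc z ^+ 2 = 2 * k%:R + 1 ->
  2 <= normc z -> normc (h z / g z) <= expR (C * normc z ^+ 2 * (1 + ln (normc z))).
Proof.
have [C [k0 [C0 QC]]] := Q_arc_lower d0 d1 near.
exists (8 / 3 * B + 2 + C), k0; split; first by have := B0; lra.
move=> N k h g z r zN kk zE r2.
have := rep_norm r zN (arc_neq zE); move: (h z / g z) => T E.
have /andP[q1 _] := normc_sqr_sub1 r2.
have q2 : 1 / 2 <= normc (csin ((pi / 2)%:C * z ^+ 2)).
  by apply: (@csin_arc _ _ k); rewrite normcX.
have r1 : 1 <= normc z by lra.
have q3 := QC k z N kk zE r1.
set r' := normc z in zE r2 r1 q1 q3 E *.
have r0 : 0 < r' by lra.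
have p1 : 0 < 3 / 4 * r' ^+ 2 by rewrite mulr_gt0// exprn_gt0.
have p2 : 0 < 1 / 2 :> R by [].
have p3 := expR_gt0 (- (C * r' ^+ 2 * (1 + ln r'))).
have low : 3 / 4 * r' ^+ 2 * (1 / 2) * expR (- (C * r' ^+ 2 * (1 + ln r'))) <=
   normc (z ^+ 2 - 1) * normc (csin ((pi / 2)%:C * z ^+ 2)) * normc (Q z N).
  apply: (ler_pM (mulr_ge0 (ltW p1) (ltW p2)) (ltW p3)) => //.
  exact: (ler_pM (ltW p1) (ltW p2)).
have p123 := mulr_gt0 (mulr_gt0 p1 p2) p3.
rewrite -(ler_pM2l p123); apply: le_trans (ler_wpM2r (normc_ge0 T) low) _.
rewrite -E; apply: le_trans (ler_wpM2r (sqr_ge0 _) (HB z)) _; rewrite -/r'.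
have -> : 3 / 4 * r' ^+ 2 * (1 / 2) * expR (- (C * r' ^+ 2 * (1 + ln r'))) *
  expR ((8 / 3 * B + 2 + C) * r' ^+ 2 * (1 + ln r')) =
  3 / 8 * r' ^+ 2 * (expR (- (C * r' ^+ 2 * (1 + ln r'))) *
  expR ((8 / 3 * B + 2 + C) * r' ^+ 2 * (1 + ln r'))) by field.
rewrite -expRD [leRHS]mulrAC ler_pM2r; last by rewrite exprn_gt0.
have l0 : 0 <= ln r' by rewrite ln_ge0.
have rr : 1 <= r' ^+ 2 by rewrite exprn_ege1.
apply: (@le_trans _ _ (3 / 8 * (expR (8 / 3 * B) * expR (pi / 2 * r' ^+ 2)))).
  rewrite [leRHS]mulrA; apply: ler_pM; rewrite ?B0 ?expR_ge0//.
  have := expR_ge1Dx (8 / 3 * B); lra.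
have h38 : 0 < 3 / 8 :> R by [].
rewrite ler_pM2l// -expRD ler_expR.
have p4 : pi / 2 <= 2 :> R by have := pihalf_lt2 R; lra.
have a1 : 8 / 3 * B <= 8 / 3 * B * r' ^+ 2 by rewrite ler_peMr// mulr_ge0.
have a2 : pi / 2 * r' ^+ 2 <= 2 * r' ^+ 2 by rewrite ler_wpM2r// ltW// (lt_le_trans _ rr).
have a3 : 0 <= (8 / 3 * B + 2) * r' ^+ 2 * ln r'.
  by apply: mulr_ge0 => //; apply: mulr_ge0; [have := B0; lra|lra].
by lra.
Qed.

(** Both coordinates are bounded by [4/5 |w|] because the ray is to be rotated by any power of [i].
    The defect [|w|^2 - |Im w^2|] is [|w|^2 * (1 - cos (2 e))], the source of the term
    [pi * e ^+ 2 * r^2] in [phragmen_lindelof]. *)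
Lemma ray_facts (e s a : R) : 0 <= e <= 20^-1 -> `|a| = pi / 4 - e ->
  let w := cexp (s +i* a) in [/\ `|complex.Re w| <= 4 / 5 * normc w,
    `|complex.Im w| <= 4 / 5 * normc w,
    normc w ^+ 2 - `|complex.Im (w ^+ 2)| <= 2 * e ^+ 2 * normc w ^+ 2 &
    1 / 2 * normc w ^+ 2 <= `|complex.Im (w ^+ 2)|].
Proof.
move=> /andP[e0 e1] ae w; have nw : normc w = expR s by rewrite normc_cexp.
have es := expR_gt0 s.
have Rw : complex.Re w = expR s * cos a by rewrite /w /cexp /expi /=; ring.
have Iw : complex.Im w = expR s * sin a by rewrite /w /cexp /expi /=; ring.
have c2 : cos (2 * a) = sin (2 * e).
  rewrite -(cos_norm (2 * a)) normrM ae ger0_norm// mulrBr.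
  have -> : 2 * (pi / 4) = pi / 2 :> R by field.
  by rewrite cos_pihalfB.
have s2 : `|sin (2 * a)| = cos (2 * e).
  have : `|sin (2 * a)| = `|sin (2 * `|a|)|.
    have [a0|a0] := leP 0 a; first by rewrite (ger0_norm a0).
    by rewrite (ltr0_norm a0) mulrN sinN normrN.
  move=> ->; rewrite ae mulrBr.
  have -> : 2 * (pi / 4) = pi / 2 :> R by field.
  rewrite sin_pihalfB ger0_norm//; apply: le_trans (cos_ge _); last by lra.
  have : (2 * e) ^+ 2 <= 1 by rewrite expr_le1//; lra.
  lra.
have e2 : 0 <= sin (2 * e) <= 10^-1.
  apply/andP; split; last by apply: le_trans (sin_le _) _; lra.
  by apply: le_trans (sin_ge_half _); lra.
have cc : cos a ^+ 2 = (1 + cos (2 * a)) / 2.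
  by rewrite [2 * a]mulr_natl cos_mulr2n mulr2n; field.
have ss : sin a ^+ 2 = (1 - cos (2 * a)) / 2 by rewrite sin2cos2 cc; field.
have ic : normc w ^+ 2 * cos (2 * e) = `|complex.Im (w ^+ 2)|.
  rewrite Im_sqr Rw Iw nw -s2 [2 * a]mulr_natl sin_mulr2n.
  have -> : 2 * (expR s * cos a) * (expR s * sin a) = expR s ^+ 2 * ((cos a * sin a) *+ 2).
    by rewrite mulr2n; ring.
  by rewrite normrM (ger0_norm (sqr_ge0 _)).
have ce : 1 - 2 * e ^+ 2 <= cos (2 * e).
  have e2' : 0 <= 2 * e by lra.
  by have := cos_ge e2'; rewrite exprMn; lra.
have nw2 : 0 <= normc w ^+ 2 by exact: sqr_ge0.
split.
- rewrite Rw nw normrM gtr0_norm// mulrC ler_pM2r//.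
  rewrite -(@ler_pXn2r _ 2) ?nnegrE// real_normK ?num_real// cc c2; lra.
- rewrite Iw nw normrM gtr0_norm// mulrC ler_pM2r//.
  rewrite -(@ler_pXn2r _ 2) ?nnegrE// real_normK ?num_real// ss c2; lra.
- rewrite -ic.
  have -> : normc w ^+ 2 - normc w ^+ 2 * cos (2 * e) = (1 - cos (2 * e)) * normc w ^+ 2 by ring.
  by rewrite ler_wpM2r//; lra.
- rewrite -ic mulrC ler_wpM2l//.
  have : e ^+ 2 <= 20^-1 by rewrite expr2; nra.
  lra.
Qed.

Lemma rot_sector z : exists j : R[i], [/\ normc j = 1,
  forall w, complex.Re (j * w) <= Num.max `|complex.Re w| `|complex.Im w|,
  forall w, `|complex.Im ((j * w) ^+ 2)| = `|complex.Im (w ^+ 2)| &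
  exists w, z = j * w /\ `|complex.Im w| <= complex.Re w].
Proof.
have i2 : ('i%C : R[i]) * 'i%C = -1 by rewrite -expr2 sqr_i.
have H1 (x y : R) : x <= Num.max `|x| y.
  by rewrite le_max ler_norm.
have H2 (x y : R) : - x <= Num.max `|x| y.
  by rewrite le_max -normrN ler_norm.
have H3 (x y : R) : y <= Num.max x `|y|.
  by rewrite le_max ler_norm orbT.
have H4 (x y : R) : - y <= Num.max x `|y|.
  by rewrite le_max -(normrN y) ler_norm orbT.
have RiM (w : R[i]) : complex.Re ('i%C * w) = - complex.Im w.
  by rewrite ReM /= mul0r mul1r sub0r.
have sq1 (j w : R[i]) : j ^+ 2 = -1 -> `|complex.Im ((j * w) ^+ 2)| = `|complex.Im (w ^+ 2)|.
  by move=> j2; rewrite exprMn j2 mulN1r ImN normrN.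
have [c1|c1] := leP `|complex.Im z| `|complex.Re z|.
  have [p|p] := leP 0 (complex.Re z).
    exists 1; split; rewrite ?normc1//.
    - by move=> w; rewrite mul1r.
    - by move=> w; rewrite mul1r.
    - by exists z; rewrite mul1r; split=> //; rewrite -[leRHS]ger0_norm.
  exists (-1); split; rewrite ?normcN ?normc1//.
  - by move=> w; rewrite mulN1r ReN.
  - by move=> w; rewrite mulN1r sqrrN.
  - exists (- z); rewrite mulN1r opprK; split=> //.
    by rewrite ImN ReN normrN -ltr0_norm.
have [p|p] := leP 0 (complex.Im z).
  exists 'i%C; split; rewrite ?normc_i//.
  - by move=> w; rewrite RiM.
  - by move=> w; apply: sq1; exact: sqr_i.
  - exists (- 'i%C * z); split; first by rewrite mulrA mulrN i2 opprK mul1r.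
    rewrite mulNr ImN ReN RiM opprK ImM /= mul0r mul1r add0r normrN.
    by rewrite -(ger0_norm p) ltW.
exists (- 'i%C); split; rewrite ?normcN ?normc_i//.
- by move=> w; rewrite mulNr ReN RiM opprK.
- by move=> w; apply: sq1; rewrite sqrrN; exact: sqr_i.
- exists ('i%C * z); split; first by rewrite mulrA mulNr i2 opprK mul1r.
  by rewrite RiM ImM /= mul0r mul1r add0r -ltr0_norm// ltW.
Qed.

(** [C] and [r0] depend neither on [N] nor on [rho]: this uniformity replaces the limit in [N]. Only
    the threshold [N0] depends on [rho], through the radius of the outer circle. *)
Lemma rep_uniform : exists C r0 : R, [/\ 1 <= C, 2 <= r0 &
  forall rho, r0 <= rho -> exists N0, forall N h g, (N0 <= N)%N -> rep N h g ->
  rho ^+ 2 <= 2 * N%:R + 1 /\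
  forall z, r0 <= normc z <= rho -> normc (h z / g z) <= C * expR (d * ln (normc z))].
Proof.
have [A [k0 [A1 arc]]] := rep_arc.
(* [r0 ^+ 2], and later [Rb ^+ 2], are odd integers, so that [rep_arc] applies on the inner and on
   the outer circle. *)
pose k1 := maxn k0 2; pose r0 : R := Num.sqrt (2 * k1%:R + 1).
have r0E : r0 ^+ 2 = 2 * k1%:R + 1 by rewrite sqr_sqrtr// addr_ge0// mulr_ge0.
have r00 : 0 <= r0 by exact: sqrtr_ge0.
have r02 : 2 <= r0.
  rewrite -(@ler_pXn2r _ 2) ?nnegrE// r0E.
  have : 2%:R <= k1%:R :> R by rewrite ler_nat leq_maxr.
  lra.
pose C := A + 16 / 3 * B * expR 21 + expR (A * r0 ^+ 2 * (1 + ln r0)).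
have B00 := B0.
have b21 : 0 <= 16 / 3 * B * expR 21 by rewrite !mulr_ge0// expR_ge0.
have ex0 := expR_ge0 (A * r0 ^+ 2 * (1 + ln r0)).
have C1 : 1 <= C by rewrite /C; lra.
exists (C * expR 5), r0; split=> //.
  by rewrite mulr_ege1//; have := expR_ge1Dx (5 : R); lra.
move=> rho r0rho; have r01 : 1 <= r0 by lra.
have [R1 PL] := phragmen_lindelof C1 d0 r01 r0rho.
pose k2 := maxn k1 (Num.bound (Num.max R1 rho ^+ 2)).
pose Rb : R := Num.sqrt (2 * k2%:R + 1).
have RbE : Rb ^+ 2 = 2 * k2%:R + 1 by rewrite sqr_sqrtr// addr_ge0// mulr_ge0.
have Rb0 : 0 <= Rb by exact: sqrtr_ge0.
have R1Rb : Num.max R1 rho <= Rb.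
  have m0 : 0 <= Num.max R1 rho by rewrite le_max (le_trans r00 r0rho) orbT.
  rewrite -(@ler_pXn2r _ 2) ?nnegrE// RbE.
  have : Num.max R1 rho ^+ 2 < (Num.bound (Num.max R1 rho ^+ 2))%:R.
    by apply: archi_boundP; exact: sqr_ge0.
  have : (Num.bound (Num.max R1 rho ^+ 2))%:R <= k2%:R :> R by rewrite ler_nat leq_maxr.
  have : 0 <= k2%:R :> R by []. 
  lra.
move: R1Rb; rewrite ge_max => /andP[R1Rb rhoRb].
have r0Rb : r0 <= Rb by lra.
have k01 : (k0 <= k1)%N by exact: leq_maxl.
have k12 : (k1 <= k2)%N by exact: leq_maxl.
exists k2 => N h g k2N rp.
have inN z : normc z <= Rb -> normc z ^+ 2 <= 2 * N%:R + 1.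
  move=> zR; apply: (@le_trans _ _ (Rb ^+ 2)).
    by rewrite lerXn2r ?nnegrE ?normc_ge0.
  by rewrite RbE lerD2r ler_pM2l// ler_nat.
split.
  apply: (@le_trans _ _ (Rb ^+ 2)); first by rewrite lerXn2r ?nnegrE//; lra.
  by rewrite RbE lerD2r ler_pM2l// ler_nat.
have [eh eg g0 _] := rp.
move=> z; have [j [nj jRe jIm [w [-> wsec]]]] := rot_sector z.
rewrite normcM nj mul1r => wI.
have njw v : normc (j * v) = normc v by rewrite normcM nj mul1r.
have := PL Rb (fun v => h (j * v) / g (j * v)) R1Rb _ _ _ _ w wI wsec.
apply.
- move=> v vR.
  have ajv : ana (fun v => j * v) v by apply: anaM; [exact: ana_cst|exact: ana_id].
  apply: (@ana_div _ (fun v => h (j * v)) (fun v => g (j * v))).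
  + by apply: (@ana_comp _ h (fun v => j * v)) => //; exact: entire_ana.
  + by apply: (@ana_comp _ g (fun v => j * v)) => //; exact: entire_ana.
  + by apply: g0; apply: inN; rewrite njw.
- move=> e s a eI /andP[sr0 sR] ae.
  have [f1 f2 f3 f4] := ray_facts s eI ae.
  set v := cexp (s +i* a) in f1 f2 f3 f4 *.
  have nv : normc v = expR s by rewrite normc_cexp.
  have v2 : 2 <= normc v by rewrite nv; lra.
  apply: le_trans (@rep_left N h g (j * v) rp _ _ _ _) _.
  + by apply: inN; rewrite njw nv.
  + by rewrite njw.
  + by rewrite njw; apply: le_trans (jRe v) _; rewrite ge_max f1.
  + rewrite jIm; apply: le_trans f4.
    have : 4 <= normc v ^+ 2 by rewrite expr2; nra.
    lra.
  rewrite njw jIm; apply: ler_pM; rewrite ?expR_ge0//; first by rewrite /C; lra.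
  rewrite ler_expR nv expRK lerD2l.
  have -> : pi * e ^+ 2 * expR s ^+ 2 = pi / 2 * (2 * e ^+ 2 * expR s ^+ 2) by field.
  by rewrite ler_pM2l ?divr_gt0 ?pi_gt0// -nv.
- move=> v vR; apply: le_trans (@arc N k2 h g (j * v) rp _ _ _ _) _.
  + by apply: inN; rewrite njw vR.
  + exact: leq_trans k12.
  + by rewrite njw vR.
  + by rewrite njw vR; lra.
  rewrite njw vR ler_expR; apply: ler_wpM2r; first by rewrite addr_ge0// ln_ge0; lra.
  by apply: ler_wpM2r; [exact: sqr_ge0|rewrite /C; lra].
- move=> v vR; apply: le_trans (@arc N k1 h g (j * v) rp _ _ _ _) _ => //.
  + by apply: inN; rewrite njw vR.
  + by rewrite njw vR.
  + by rewrite njw vR.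
  by rewrite njw vR /C; lra.
Qed.

End Uniqueness.

(** * Uniqueness through a finite form of Liouville's theorem *)

Section FockUniqueness.
Variables (R : realType) (lam : nat -> R[i]) (d : R).
Hypothesis d0 : 0 <= d.
Hypothesis d1 : d < 1 / 2.
Hypothesis near : forall n : nat, (1 <= n)%N ->
  normc ((sqrt2n R n)%:C - lam n) <= d / sqrt2n R n.
Hypothesis lam_inj : forall m n : nat, (1 <= m)%N -> (1 <= n)%N ->
  lam m = lam n -> m = n.
Local Notation u := (sqrt2n R).
Local Notation Q := (Q lam).
Variables (H : R[i] -> R[i]) (B : R).
Hypothesis eH : entire H.
Hypothesis HB : forall z, normc (H z) <= B * expR (pi / 2 * normc z ^+ 2).
Hypothesis H0 : forall N e, e \in zeros lam N -> H e = 0.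
Implicit Types (z : R[i]) (n N : nat).

(** Liouville's theorem with an error: by the maximum principle on the square of half-side [X], the
    quotient is at most [C (2 X)^(1/2)], the exponent [d] being weakened to 1/2, and its difference
    quotient at [a] is at most [4 C (2 X)^(1/2) / X], small for large [X]. *)
Lemma rep_close a z (eps : R) : 0 < eps -> exists N0, forall N h g, (N0 <= N)%N ->
  rep lam H N h g -> normc (h z / g z - h a / g a) <= eps.
Proof.
move=> eps0; have dd1 := d1.
have [C [r0 [C1 r02 unif]]] := rep_uniform d0 d1 near HB.
(* The final bound [8 * C * |z - a| / q] is at most [eps] as soon as [q >= K], and
   [q ^+ 2 = 2 * X]. *)
pose K := 8 * C * (normc (z - a) + 1) / eps.
have D0 := normc_ge0 (z - a).
have K0 : 0 < K by rewrite divr_gt0// !mulr_gt0//; lra.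
pose X := r0 + 2 * normc a + normc z + K ^+ 2.
have na := normc_ge0 a; have nz := normc_ge0 z.
have XK : K ^+ 2 <= X by rewrite /X; lra.
have K20 := sqr_ge0 K.
have [X2 Xr Xa Xz] : [/\ 2 <= X, r0 <= X, 2 * normc a <= X & normc z <= X].
  by rewrite /X; split; lra.
clearbody X.
have [|N0 N0P] := unif (2 * X); first by lra.
exists N0 => N h g NN rp; have [XN TB] := N0P N h g NN rp.
have [eh eg g0 _] := rp.
pose q := expR (ln (2 * X) / 2).
have q0 : 0 < q by exact: expR_gt0.
have qq : q ^+ 2 = 2 * X.
  rewrite /q expr2 -expRD -[RHS]lnK ?posrE ?mulr_gt0//; last lra.
  by congr expR; field.
have sqX x y : - X <= x <= X -> - X <= y <= X -> normc (x +i* y) <= 2 * X.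
  rewrite -!ler_norml => hx hy; apply: (le_trans (normc_le_ReIm _)) => /=; lra.
have gsq x y : - X <= x <= X -> - X <= y <= X -> g (x +i* y) != 0.
  move=> hx hy; apply: g0; apply: le_trans XN.
  by rewrite lerXn2r ?nnegrE ?normc_ge0 ?sqX//; lra.
have bX x y : [|| x == - X, x == X, y == - X | y == X] -> X <= normc (x +i* y).
  have X0 : 0 <= X by lra.
  have hx := ler_Re_normc (x +i* y); have hy := ler_Im_normc (x +i* y).
  by case/or4P => /eqP e; rewrite e ?normrN (ger0_norm X0) in hx, hy; rewrite /= e //;
    rewrite ?normrN ?(ger0_norm X0) //= in hx hy *.
have Tb x y : - X <= x <= X -> - X <= y <= X -> normc (h (x +i* y) / g (x +i* y)) <= C * q.
  apply: (@max_principle _ (fun w => h w / g w)).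
    move=> x' y' hx hy; apply: ana_div; [exact: entire_ana|exact: entire_ana|exact: gsq].
  move=> x' y' hx hy hb; have wX := bX _ _ hb; have w2X := sqX _ _ hx hy.
  apply: le_trans (TB _ _) _; first by apply/andP; split; lra.
  rewrite ler_wpM2l//; first lra.
  rewrite ler_expR.
  have l0 : 0 <= ln (normc (x' +i* y')) by rewrite ln_ge0//; lra.
  have l1 : ln (normc (x' +i* y')) <= ln (2 * X) by rewrite ler_ln ?posrE//; lra.
  nra.
have inX w : normc w <= X -> - X <= complex.Re w <= X /\ - X <= complex.Im w <= X.
  move=> wX; rewrite -!ler_norml.
  by split; apply: le_trans wX; [exact: ler_Re_normc|exact: ler_Im_normc].
have wE w : w = complex.Re w +i* complex.Im w :> R[i] by case: w.
have [aRe aIm] := inX a ltac:(lra); have [zRe zIm] := inX z Xz.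
have Ta : normc (h a / g a) <= C * q by rewrite (wE a); exact: Tb.
have ga : g a != 0 by rewrite (wE a); exact: gsq.
have gz : g z != 0 by rewrite (wE z); exact: gsq.
have [||h2 eh2 h2E] := @entire_div _ (fun w => h w + - (h a / g a) * g w) a.
- by apply: entireD => //; exact: entireZ.
- by rewrite mulNr divfK// subrr.
have diffE w : g w != 0 -> h w / g w - h a / g a = (w - a) * (h2 w / g w).
  move=> gw; rewrite mulrA -h2E; field.
  by rewrite gw ga.
have Vb : normc (h2 z / g z) <= 4 * C * q / X.
  rewrite (wE z); move: (complex.Re z) (complex.Im z) zRe zIm => x y.
  apply: (@max_principle _ (fun w => h2 w / g w)).
    move=> x' y' hx hy; apply: ana_div; [exact: entire_ana|exact: entire_ana|exact: gsq].
  move=> x' y' hx hy hb; have wX := bX _ _ hb.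
  have gw := gsq _ _ hx hy; have Tw := Tb _ _ hx hy.
  have E := diffE _ gw; set w := x' +i* y' in wX gw Tw E *.
  have wa : X / 2 <= normc (w - a) by have := normc_ge_sub w a; lra.
  have X20 : 0 < X / 2 by rewrite divr_gt0//; lra.
  rewrite -(ler_pM2l X20); apply: (@le_trans _ _ (normc (w - a) * normc (h2 w / g w))).
    by rewrite ler_wpM2r ?normc_ge0.
  rewrite -normcM -E; apply: (le_trans (normcB _ _)).
  have -> : X / 2 * (4 * C * q / X) = C * q + C * q by field; rewrite gt_eqF//; lra.
  exact: lerD.
rewrite diffE// normcM.
apply: (@le_trans _ _ (normc (z - a) * (4 * C * q / X))); first by rewrite ler_wpM2l.
have -> : normc (z - a) * (4 * C * q / X) = 8 * C * normc (z - a) / q.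
  have -> : X = q ^+ 2 / 2 by rewrite qq; field.
  by field; rewrite gt_eqF.
have Kq : K <= q.
  by rewrite -(@ler_pXn2r _ 2) ?nnegrE ?(ltW K0) ?(ltW q0)// qq; lra.
rewrite ler_pdivrMr//; apply: (@le_trans _ _ (eps * K)); last by rewrite ler_pM2l.
have -> : eps * K = 8 * C * (normc (z - a) + 1) by rewrite /K; field; rewrite gt_eqF.
by rewrite ler_wpM2l ?lerDl// mulr_ge0//; lra.
Qed.

Definition diag (j : nat) : R[i] := (- (j%:R / Num.sqrt 2)) +i* (j%:R / Num.sqrt 2).

Lemma normc_diag j : normc (diag j) = j%:R.
Proof.
apply/eqP; rewrite -(@eqrXn2 _ 2) ?normc_ge0// sqr_normcE /= sqrrN expr_div_n.
by rewrite sqr_sqrtr//; apply/eqP; field.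
Qed.

Lemma Im_diag_sqr j : complex.Im (diag j ^+ 2) = - j%:R ^+ 2.
Proof.
rewrite Im_sqr /= mulrN mulNr -mulrA; congr (- _).
have -> : j%:R / Num.sqrt 2 * (j%:R / Num.sqrt 2) = (j%:R / Num.sqrt 2) ^+ 2 :> R by rewrite expr2.
by rewrite expr_div_n sqr_sqrtr//; field.
Qed.

Hypothesis bessel : exists S, forall J,
  \sum_(2 <= j < J) normc (H (diag j)) ^+ 2 * expR (- (pi * j%:R ^+ 2)) <= S.

(** If [H a] were not 0, the quotients would be at least [c] at [a], hence at least [c / 2] at each
    [diag j] for [N] large, and the terms of [bessel] would dominate a harmonic series. At 0 and at
    the [u n] the identity of [rep] gives no such lower bound. *)
Let unique_good a : a != 0 -> (forall n, (0 < n)%N -> a != (u n)%:C) -> H a = 0.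
Proof.
move=> a0 au; apply/eqP; apply: contraT => Ha; exfalso.
have dd1 := d1; have dd0 := d0.
have na : 0 < normc a by rewrite normc_gt0.
have nHa : 0 < normc (H a) by rewrite normc_gt0.
have [N1 tail] := tail_ep d0 d1 near (normc_ge0 a).
pose D := normc (a ^+ 2 - 1) * normc (csin ((pi / 2)%:C * a ^+ 2)) *
   (normc (Q a N1) * expR 1) + 1.
have D0 : 0 < D by rewrite ltr_wpDl// !mulr_ge0 ?normc_ge0 ?expR_ge0.
pose c := normc (H a) * normc a ^+ 2 / D.
have c0 : 0 < c by rewrite divr_gt0// mulr_gt0// exprn_gt0.
have Tlow N h g : (N1 <= N)%N -> normc a ^+ 2 <= 2 * N%:R + 1 -> rep lam H N h g ->
    c <= normc (h a / g a).
  move=> N1N aN rp; rewrite ler_pdivrMr// (rep_norm rp aN au) [leRHS]mulrC.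
  rewrite ler_wpM2r ?normc_ge0//; apply: (@le_trans _ _ (D - 1)); last by lra.
  rewrite /D addrK ler_wpM2l ?mulr_ge0 ?normc_ge0//.
  rewrite (QE _ _ N1N) normcM ler_wpM2l ?normc_ge0//.
  by have /andP[] := tail a N (lexx _) N1N.
clearbody c.
(* [3 / 32 = 3/4 * 1/4 * 1/2], from [z^2 - 1], the sine and [c / 2]. *)
pose kap := 3 / 32 * expR (- 21) * c.
have kap0 : 0 < kap by apply: mulr_gt0 c0; apply: mulr_gt0 (expR_gt0 _).
have Hlow j : (2 <= j)%N -> kap ^+ 2 / j%:R <= normc (H (diag j)) ^+ 2 * expR (- (pi * j%:R ^+ 2)).
  move=> j2; have jr : 2 <= j%:R :> R by rewrite (ler_nat _ 2).
  have c20 : 0 < c / 2 by rewrite divr_gt0.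
  have [N0 close] := rep_close a (diag j) c20.
  pose N := maxn (maxn N0 N1) (maxn (j ^ 2) (Num.bound (normc a ^+ 2))).
  have [N0N N1N jN aN] : [/\ N0 <= N, N1 <= N, j ^ 2 <= N & Num.bound (normc a ^+ 2) <= N]%N.
    by rewrite /N !leq_max !leqnn !orbT.
  have [h [g rp']] := quotient_rep d0 d1 near lam_inj eH H0 N.
  have rp : rep lam H N h g by [].
  have aN' : normc a ^+ 2 <= 2 * N%:R + 1.
    have : normc a ^+ 2 < (Num.bound (normc a ^+ 2))%:R by apply: archi_boundP; exact: sqr_ge0.
    have : (Num.bound (normc a ^+ 2))%:R <= N%:R :> R by rewrite ler_nat.
    by have : 0 <= N%:R :> R by []; lra.
  have jN' : normc (diag j) ^+ 2 <= 2 * N%:R + 1.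
    have : (j ^ 2)%:R <= N%:R :> R by rewrite ler_nat.
    by rewrite normc_diag natrX; have : 0 <= N%:R :> R by []; lra.
  have T1 := Tlow _ _ _ N1N aN' rp.
  have T2 := close _ _ _ N0N rp.
  have T3 : c / 2 <= normc (h (diag j) / g (diag j)).
    have := normc_ge_sub (h a / g a) (h a / g a - h (diag j) / g (diag j)).
    by rewrite subKr [X in _ - X <= _]normc_distC; lra.
  have r2 : 2 <= normc (diag j) by rewrite normc_diag.
  have r1 : 1 <= normc (diag j) by lra.
  have r0 : 0 < normc (diag j) by lra.
  have zs : complex.Re (diag j) <= 4 / 5 * normc (diag j).
    apply: (@le_trans _ _ 0); last by rewrite mulr_ge0 ?normc_ge0.
    by rewrite oppr_le0 divr_ge0 ?sqrtr_ge0.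
  have E := rep_norm rp jN' (fun n => @left_neq _ _ d0 d1 _ n r0 zs).
  have /andP[q1 _] := normc_sqr_sub1 r2.
  have Iz : `|complex.Im (diag j ^+ 2)| = j%:R ^+ 2.
    by rewrite Im_diag_sqr normrN ger0_norm ?sqr_ge0.
  have j1 : 1 <= `|complex.Im (diag j ^+ 2)|.
    by rewrite Iz exprn_ege1//; lra.
  have [_ /(_ j1) q2] := normc_csin_sqr (diag j).
  have /andP[q3 _] := Q_left d0 d1 near N r1 zs.
  rewrite Iz in q2; rewrite !normc_diag in q1 q3 E.
  have j0 : 0 < j%:R :> R by lra.
  have p1 : 0 < 3 / 4 * j%:R ^+ 2 :> R by rewrite mulr_gt0// exprn_gt0.
  have p2 : 0 < expR (pi / 2 * j%:R ^+ 2) / 4 :> R by rewrite divr_gt0// expR_gt0.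
  have p3 := expR_gt0 (- (d * ln (j%:R : R) + 21)).
  have low : 3 / 4 * j%:R ^+ 2 * (expR (pi / 2 * j%:R ^+ 2) / 4) *
      expR (- (d * ln j%:R + 21)) * (c / 2) <= normc (H (diag j)) * j%:R ^+ 2.
    rewrite E.
    apply: (ler_pM (mulr_ge0 (mulr_ge0 (ltW p1) (ltW p2)) (ltW p3)) (ltW c20)) => //.
    apply: (ler_pM (mulr_ge0 (ltW p1) (ltW p2)) (ltW p3)) => //.
    exact: (ler_pM (ltW p1) (ltW p2)).
  have Hj : kap * expR (pi / 2 * j%:R ^+ 2) * expR (- (d * ln j%:R)) <= normc (H (diag j)).
    rewrite -(@ler_pM2r _ (j%:R ^+ 2)) ?exprn_gt0//; apply: le_trans low.
    rewrite le_eqVlt; apply/orP; left; apply/eqP.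
    by rewrite opprD expRD /kap; field.
  have base0 : 0 <= kap * expR (pi / 2 * j%:R ^+ 2) * expR (- (d * ln j%:R)).
    exact: mulr_ge0 (mulr_ge0 (ltW kap0) (expR_ge0 _)) (expR_ge0 _).
  apply: (@le_trans _ _ ((kap * expR (pi / 2 * j%:R ^+ 2) * expR (- (d * ln j%:R))) ^+ 2 *
     expR (- (pi * j%:R ^+ 2)))); last first.
    by rewrite ler_wpM2r ?expR_ge0// lerXn2r ?nnegrE ?normc_ge0.
  have -> : (kap * expR (pi / 2 * j%:R ^+ 2) * expR (- (d * ln j%:R))) ^+ 2 * expR (- (pi * j%:R ^+ 2))
    = kap ^+ 2 * (expR (pi / 2 * j%:R ^+ 2) * expR (pi / 2 * j%:R ^+ 2) *
       expR (- (d * ln j%:R)) * expR (- (d * ln j%:R)) * expR (- (pi * j%:R ^+ 2))) by ring.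
  rewrite ler_wpM2l ?sqr_ge0// -!expRD.
  have -> : (j%:R)^-1 = expR (- ln (j%:R : R)) by rewrite expRN lnK.
  rewrite ler_expR; have l0 : 0 <= ln (j%:R : R) by rewrite ln_ge0//; lra.
  have -> : pi / 2 * j%:R ^+ 2 + pi / 2 * j%:R ^+ 2 + - (d * ln j%:R) + - (d * ln j%:R) +
    - (pi * j%:R ^+ 2) = - (2 * d * ln j%:R) :> R by field.
  (* By [2 * d <= 1], [j^(- 2 d)] is at least [1 / j], the term of a divergent series. *)
  by rewrite lerN2 ler_piMl//; lra.
have [S SP] := bessel.
have harm J : (2 <= J)%N -> ln (J%:R : R) - ln 2 <= \sum_(2 <= j < J) j%:R^-1.
  move=> J2; rewrite -(telescope_sumr (fun j => ln (j%:R : R)) J2).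
  rewrite big_nat_cond [leRHS]big_nat_cond; apply: ler_sum => j.
  rewrite andbT => /andP[j2 _]; have jr : 2 <= j%:R :> R by rewrite (ler_nat _ 2).
  have j0 : 0 < j%:R :> R by lra.
  have -> : ln j.+1%:R - ln j%:R = ln (1 + j%:R^-1) :> R.
    rewrite -ln_div ?posrE ?ltr0n//; last by rewrite -(ltr_nat R).
    by congr ln; rewrite -(natr1 j); field; rewrite gt_eqF.
  by apply: le_ln1Dx; apply: lt_trans (_ : 0 < _); rewrite ?invr_gt0// ltrN10.
pose X := expR (S / kap ^+ 2 + ln 2 + 1).
pose J := maxn 2 (Num.bound X).
have JX : S / kap ^+ 2 + ln 2 + 1 <= ln (J%:R : R).
  rewrite -ler_expR lnK ?posrE ?ltr0n ?leq_max//.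
  apply: (@le_trans _ _ (Num.bound X)%:R); last by rewrite ler_nat leq_maxr.
  by rewrite ltW// archi_boundP// expR_ge0.
have := SP J; apply/negP; rewrite -ltNge.
apply: (@lt_le_trans _ _ (kap ^+ 2 * (ln J%:R - ln 2))).
  by rewrite mulrC -ltr_pdivrMr ?exprn_gt0//; lra.
apply: (@le_trans _ _ (\sum_(2 <= j < J) kap ^+ 2 / j%:R)).
  by rewrite -mulr_sumr ler_wpM2l ?sqr_ge0// harm// leq_maxl.
rewrite big_nat_cond [leRHS]big_nat_cond; apply: ler_sum => j.
by rewrite andbT => /andP[j2 _]; exact: Hlow.
Qed.

(** The points left out by [unique_good] are real, and [H] is Lipschitz near each of them: a small
    vertical displacement [s] reaches a point already treated. *)
Theorem fock_uniqueness a : H a = 0.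
Proof.
apply/eqP; rewrite -normc_eq0 eq_le normc_ge0 andbT leNgt; apply/negP => Ha.
have [C [e [e0 lip]]] := ana_lip (entire_ana a eH).
have C1 : 0 < `|C| + 1 by rewrite ltr_wpDl.
pose t := Num.min (Num.min (e / 2) (normc (H a) / (`|C| + 1) / 2)) 1.
have t0 : 0 < t by rewrite !lt_min !divr_gt0 ?ltr01.
have [te tH] : t < e /\ (`|C| + 1) * t < normc (H a).
  have : t <= t by []; rewrite {2}/t !le_min => /andP[/andP[t1 t2] _]; split; first lra.
  have : (`|C| + 1) * t <= (`|C| + 1) * (normc (H a) / (`|C| + 1) / 2) by rewrite ler_pM2l.
  have -> : (`|C| + 1) * (normc (H a) / (`|C| + 1) / 2) = normc (H a) / 2.
    by field; rewrite gt_eqF.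
  lra.
clearbody t.
pose s : R := if complex.Im a == 0 then t else
  Num.min t (`|complex.Im a| / 2).
have [s0 st sI] : [/\ 0 < s, s <= t & complex.Im a + s != 0].
  rewrite /s; case: eqVneq => [->|Ia]; first by rewrite add0r gt_eqF.
  have Ia0 : 0 < `|complex.Im a| by rewrite normr_gt0.
  split; first by rewrite lt_min t0 divr_gt0.
    by rewrite ge_min lexx.
  have h : Num.min t (`|complex.Im a| / 2) <= `|complex.Im a| / 2 by rewrite ge_min lexx orbT.
  have h0 : 0 < Num.min t (`|complex.Im a| / 2) by rewrite lt_min t0 divr_gt0.
  move: (Num.min _ _) h h0 => m h h0; apply/eqP => E.
  have e2 : complex.Im a = - m by lra.
  by move: h; rewrite e2 normrN gtr0_norm//; lra.
pose w : R[i] := 0 +i* s.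
have nw : normc w = s by rewrite /= expr0n add0r sqrtr_sqr gtr0_norm.
have Iw : complex.Im (a + w) != 0 by rewrite ImD.
have := lip w; rewrite nw unique_good.
- rewrite sub0r normcN => /(_ (le_lt_trans st te)) h.
  have : C * s <= (`|C| + 1) * t.
    apply: (@le_trans _ _ ((`|C| + 1) * s)); last by rewrite ler_pM2l.
    by rewrite ler_pM2r// (le_trans (ler_norm C))// lerDl.
  lra.
- by apply: contraNneq Iw => ->.
- by move=> n _; apply: contraNneq Iw => ->.
Qed.

End FockUniqueness.

(** * Roots of unity, discrete Parseval identity and Poisson kernel *)

Section RootsOfUnity.
Variable R : realType.

Definition rootu M : R[i] := expi (2 * pi / M%:R).

Lemma expi_nat (x : R) n : expi (n%:R * x) = expi x ^+ n.
Proof.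
elim: n => [|n IHn]; first by rewrite mul0r expr0 /expi cos0 sin0.
by rewrite -(natr1 n) mulrDl mul1r expiD IHn exprSr.
Qed.

Lemma rootu1 M : (0 < M)%N -> rootu M ^+ M = 1.
Proof.
move=> M0; rewrite -expi_nat mulrC divfK ?pnatr_eq0 -?lt0n// /expi mulr_natl.
by rewrite cos2pi sin2pi.
Qed.

Lemma rootu_neq1 M k : (0 < k < M)%N -> rootu M ^+ k != 1.
Proof.
move=> /andP[k0 kM]; rewrite -expi_nat; apply/eqP => /(congr1 (@complex.Re R)) /= h.
have M0 : 0 < M%:R :> R by rewrite ltr0n (leq_trans _ kM).
pose t : R := pi * (k%:R / M%:R).
have st : 0 < sin t.
  apply: sin_gt0_pi; apply/andP; split.
    by apply: mulr_gt0; rewrite ?pi_gt0// divr_gt0// ltr0n.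
  by rewrite /t gtr_pMr ?pi_gt0// ltr_pdivrMr// mul1r ltr_nat.
move: h; have -> : k%:R * (2 * pi / M%:R) = t *+ 2 :> R.
  by rewrite /t -mulr_natl; field; rewrite gt_eqF.
rewrite cos_mulr2n cos2sin2 mulr2n => h.
have : sin t ^+ 2 = 0 by lra.
by move/eqP; rewrite sqrf_eq0 => /eqP s0; move: st; rewrite s0 ltxx.
Qed.

Lemma normc_rootu M : normc (rootu M) = 1.
Proof. exact: normc_expi. Qed.

Lemma rootu_conj M : rootu M * (rootu M)^* = 1.
Proof. by rewrite mulc_conj normc_rootu expr1n. Qed.

Lemma geo_sum0 (x : R[i]) M : x != 1 -> x ^+ M = 1 -> \sum_(j < M) x ^+ j = 0.
Proof.
move=> x1 xM; apply: (@mulfI _ (x - 1)); first by rewrite subr_eq0.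
by rewrite mulr0 -subrX1 xM subrr.
Qed.

Lemma rootu_orth M (k l : 'I_M) :
  \sum_(j < M) (rootu M ^+ j) ^+ k * ((rootu M ^+ j) ^+ l)^* = if k == l then M%:R else 0.
Proof.
have M0 : (0 < M)%N by exact: leq_ltn_trans (ltn_ord k).
have E (j : 'I_M) : (rootu M ^+ j) ^+ k * ((rootu M ^+ j) ^+ l)^* =
    (rootu M ^+ k * (rootu M ^+ l)^*) ^+ j.
  by rewrite exprMn -rmorphXn -!exprM ![(j * _)%N]mulnC.
under eq_bigr do rewrite E.
have unit m : rootu M ^+ m * (rootu M ^+ m)^* = 1.
  by rewrite rmorphXn /= -exprMn rootu_conj expr1n.
case: eqVneq => [->|kl].
  by under eq_bigr do rewrite unit expr1n; rewrite sumr_const card_ord.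
have xM : (rootu M ^+ k * (rootu M ^+ l)^*) ^+ M = 1.
  by rewrite exprMn -rmorphXn -!exprM ![(_ * M)%N]mulnC !exprM rootu1// !expr1n rmorph1 mulr1.
apply: geo_sum0 => //.
wlog lk : k l kl xM {E} / (l < k)%N => [hw|].
  have [lk|kl'] := ltnP l k; first exact: hw.
  have kl2 : (k < l)%N by rewrite ltn_neqAle kl' andbT; apply: contra_neq kl => /val_inj.
  have -> : rootu M ^+ k * (rootu M ^+ l)^* = (rootu M ^+ l * (rootu M ^+ k)^*)^*.
    by rewrite rmorphM /= conjcK mulrC.
  have xM' : (rootu M ^+ l * (rootu M ^+ k)^*) ^+ M = 1.
    by rewrite exprMn -rmorphXn -!exprM ![(_ * M)%N]mulnC !exprM rootu1// !expr1n rmorph1 mulr1.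
  apply: contra (hw l k _ xM' kl2) => [/eqP h|]; last by rewrite eq_sym.
  by rewrite -[X in X == _]conjcK h rmorph1.
have -> : rootu M ^+ k = rootu M ^+ (k - l) * rootu M ^+ l by rewrite -exprD subnK// ltnW.
rewrite -mulrA unit mulr1; apply: rootu_neq1.
by rewrite subn_gt0 lk (leq_ltn_trans _ (ltn_ord k))// leq_subr.
Qed.

Lemma parseval M (b : 'I_M -> R[i]) :
  \sum_(j < M) normc (\sum_(k < M) b k * (rootu M ^+ j) ^+ k) ^+ 2 =
  M%:R * \sum_(k < M) normc (b k) ^+ 2.
Proof.
apply: complexI; rewrite rmorphM rmorph_nat /= !rmorph_sum /=.
transitivity (\sum_(j < M) \sum_(k < M) \sum_(l < M)
   (b k * (b l)^*) * ((rootu M ^+ j) ^+ k * ((rootu M ^+ j) ^+ l)^*)).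
  apply: eq_bigr => j _; rewrite -mulc_conj rmorph_sum /= mulr_suml.
  apply: eq_bigr => k _; rewrite mulr_sumr; apply: eq_bigr => l _.
  by rewrite rmorphM /=; ring.
rewrite exchange_big /= mulr_sumr; apply: eq_bigr => k _.
rewrite exchange_big /= (bigD1 k)//= [X in _ + X]big1 => [|l lk].
  by rewrite -mulr_sumr rootu_orth eqxx addr0 mulrC mulc_conj.
by rewrite -mulr_sumr rootu_orth eq_sym (negbTE lk) mulr0.
Qed.

(* The mean of the Poisson kernel over the [L]-th roots of unity, computed by
   expanding [1 / (1 + s x)] in a geometric series modulo [x^L = 1]. *)
Lemma poisson_mean L (s : R) : ~~ odd L -> (0 < L)%N -> 0 <= s < 1 -> s ^+ L <= 1 / 3 ->
  \sum_(j < 4 * L) (normc (1 + s%:C * (rootu (4 * L) ^+ j) ^+ 4) ^+ 2)^-1 <=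
  2 * (4 * L)%:R / (1 - s ^+ 2).
Proof.
move=> Lev L0 /andP[s0 s1] sL; set M := (4 * L)%N.
have M0 : (0 < M)%N by rewrite muln_gt0.
pose x (j : nat) : R[i] := (rootu M ^+ j) ^+ 4.
have xL j : x j ^+ L = 1 by rewrite /x -exprM -exprM mulnC exprM rootu1// expr1n.
have nx j : normc (x j) = 1 by rewrite /x !normcX normc_rootu !expr1n.
pose t : R := s ^+ L.
have t0 : 0 <= t by rewrite exprn_ge0.
have s2 : 0 < 1 - s ^+ 2 by rewrite subr_gt0 expr_lt1.
have den j : 1 + s%:C * x j != 0.
  rewrite -normc_gt0; apply: lt_le_trans (normc_ge_subD _ _).
  by rewrite normc1 normcM nx mulr1 normc_real ger0_norm// subr_gt0.
have sLE j : (- (s%:C * x j)) ^+ L = t%:C.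
  rewrite exprNn exprMn xL mulr1 -signr_odd (negbTE Lev) expr0 mul1r.
  by rewrite -rmorphXn.
have inv j : (1 + s%:C * x j)^-1 * (1 - t%:C) = \sum_(k < L) (- s%:C) ^+ k * x j ^+ k.
  apply: (mulfI (den j)); rewrite mulrA mulfV// mul1r.
  have := subrX1 (- (s%:C * x j)) L; rewrite sLE => h.
  have -> : 1 - t%:C = (1 + s%:C * x j) * \sum_(i < L) (- (s%:C * x j)) ^+ i.
    have -> : 1 - t%:C = - (t%:C - 1) by rewrite opprB.
    by rewrite h -mulNr; congr (_ * _); ring.
  by congr (_ * _); apply: eq_bigr => k _; rewrite -mulNr exprMn.
have sumx (k : nat) : (0 < k < L)%N -> \sum_(j < M) x j ^+ k = 0.
  move=> /andP[k0 kL].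
  under eq_bigr do rewrite /x -!exprM mulnC exprM.
  apply: geo_sum0; last by rewrite -exprM mulnC exprM rootu1// expr1n.
  by apply: rootu_neq1; rewrite muln_gt0 k0/= /M ltn_mul2l.
have S1 : (\sum_(j < M) (1 + s%:C * x j)^-1) * (1 - t%:C) = M%:R.
  rewrite mulr_suml; under eq_bigr do rewrite inv.
  rewrite exchange_big /= (bigD1 (Ordinal L0))//= [X in _ + X]big1 => [|k k0].
    rewrite addr0; under eq_bigr do rewrite !expr0 mul1r.
    by rewrite sumr_const card_ord.
  rewrite -mulr_sumr sumx ?mulr0// ltn_ord andbT lt0n.
  by apply: contra_neq k0 => k0; apply: val_inj.
have t1 : 0 < 1 - t by rewrite /t; lra.
have S2 : \sum_(j < M) complex.Re ((1 + s%:C * x j)^-1) = M%:R / (1 - t).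
  rewrite -Re_sum; have h : \sum_(j < M) (1 + s%:C * x j)^-1 = (M%:R / (1 - t))%:C.
    apply: (@mulIf _ (1 - t%:C)).
      by rewrite -(rmorph1 (real_complex R)) -rmorphB -normc_gt0 normc_real normr_gt0 gt_eqF.
    rewrite S1 -(rmorph1 (real_complex R)) -rmorphB -rmorphM /= divfK ?gt_eqF//.
    by rewrite rmorph_nat.
  by rewrite h.
(* Poisson's identity: for [w = 1 + s x] with [|x| = 1] one has [2 Re w - |w|^2 = 1 - s^2]. *)
have point j : (normc (1 + s%:C * x j) ^+ 2)^-1 =
    (2 * complex.Re ((1 + s%:C * x j)^-1) - 1) / (1 - s ^+ 2).
  set w := 1 + s%:C * x j; have w0 : w != 0 by exact: den.
  have nw : normc w ^+ 2 != 0 by rewrite expf_neq0// normc_eq0.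
  have Rw : complex.Re w^-1 = complex.Re w / normc w ^+ 2.
    have -> : w^-1 = w^* * ((normc w ^+ 2)^-1)%:C.
      apply: (mulfI w0); rewrite mulfV// mulrA mulc_conj -rmorphM /= divff//.
    by case: (w) => a b; rewrite ReM /= mulr0 subr0.
  have key : 2 * complex.Re w - normc w ^+ 2 = 1 - s ^+ 2.
    have nxj := nx j; have : complex.Re (x j) ^+ 2 + complex.Im (x j) ^+ 2 = 1.
      by rewrite -sqr_normcE nxj expr1n.
    rewrite /w; case: (x j) => a b; rewrite [complex.Re _]/= [complex.Im _]/= => h.
    have -> : s%:C * (a +i* b) = (s * a) +i* (s * b) by apply: eq_ReIm => /=; ring.
    rewrite sqr_normcE /= [LHS](_ : _ = 1 - s ^+ 2 * (a ^+ 2 + b ^+ 2)); last by ring.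
    by rewrite h mulr1.
  rewrite Rw -key.
  have k0 : 2 * complex.Re w - normc w ^+ 2 != 0 by rewrite key gt_eqF.
  move: (complex.Re w) (normc w ^+ 2) nw k0 => p q q0 k0; field.
  by rewrite k0 q0.
rewrite (eq_bigr (fun j : 'I_M => (2 * complex.Re ((1 + s%:C * x j)^-1) - 1) / (1 - s ^+ 2))); last first.
  by move=> j _; exact: point.
rewrite -mulr_suml ler_pM2r ?invr_gt0// sumrB -mulr_sumr S2 sumr_const card_ord.
(* The mean of [2 Re (1 / w) - 1] is [(1 + t) / (1 - t)], at most 2 for [t <= 1 / 3]. *)
have -> : 2 * (M%:R / (1 - t)) - 1 *+ M = M%:R * (2 / (1 - t) - 1) :> R by ring.
rewrite [leRHS]mulrC ler_wpM2l// lerBlDr ler_pdivrMr//.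
rewrite /t; lra.
Qed.

End RootsOfUnity.

(** * Means over circles *)

Section CircleMeans.
Variable R : realType.
Implicit Types (r d : R) (a F : R[i]).

Definition circ r L (j : nat) : R[i] := r%:C * rootu R (4 * L) ^+ j.

Lemma normc_circ r L j : 0 <= r -> normc (circ r L j) = r.
Proof.
by move=> r0; rewrite normcM normcX normc_rootu expr1n mulr1 normc_real ger0_norm.
Qed.

(** Parseval is exact for the partial sum with as many terms as sample points. That sum differs from
    [F] by at most [B / 2 ^+ M] on the circle, whence the factor 2 and an error that vanishes as [n]
    grows. *)
Lemma parseval_le (a : nat -> R[i]) (F : R[i] -> R[i]) r (A : R) : ent a F -> 0 <= r ->
  (forall n, exists2 L, (n <= L)%N &
     \sum_(j < 4 * L) normc (F (circ r L j)) ^+ 2 <= (4 * L)%:R * A) ->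
  forall K, \sum_(k < K) normc (a k) ^+ 2 * r ^+ (2 * k) <= 2 * A.
Proof.
move=> aF r0 mean K; have r1 : 0 < r + 1 by lra.
have [B FB] := aF _ r1.
apply: (@le_geo _ _ _ (2 * B ^+ 2)) => n.
have [L nL LA] := mean (maxn (maxn n K) 1); set M := (4 * L)%N in LA.
have [nM KM M0] : [/\ n <= M, K <= M & 0 < M]%N.
  by move: nL; rewrite !geq_max /M => nL; split; lia.
pose p z := psum a M z.
have pF j : normc (p (circ r L j)) ^+ 2 <= 2 * normc (F (circ r L j)) ^+ 2 + 2 * B ^+ 2 / 2 ^+ n.
  have h := FB M (circ r L j); rewrite normc_circ// in h.
  have {}h : normc (F (circ r L j) - p (circ r L j)) <= B / 2 ^+ M by apply: h; lra.
  have h2 : normc (p (circ r L j)) <= normc (F (circ r L j)) + B / 2 ^+ M.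
    have := normc_ge_sub (p (circ r L j)) (F (circ r L j)); rewrite normc_distC; lra.
  have e0 : 0 <= B / 2 ^+ M by apply: le_trans h; exact: normc_ge0.
  apply: (@le_trans _ _ ((normc (F (circ r L j)) + B / 2 ^+ M) ^+ 2)).
    by rewrite lerXn2r ?nnegrE ?normc_ge0// addr_ge0// normc_ge0.
  apply: (@le_trans _ _ (2 * normc (F (circ r L j)) ^+ 2 + 2 * (B / 2 ^+ M) ^+ 2)).
    have := sqr_ge0 (normc (F (circ r L j)) - B / 2 ^+ M); rewrite sqrrB sqrrD; lra.
  rewrite lerD2l -mulrA ler_pM2l// expr_div_n ler_wpM2l ?sqr_ge0//.
  rewrite lef_pV2 ?posrE ?exprn_gt0// -exprM ler_eXn2l ?ltr1n//; lia.
have S1 : \sum_(j < M) normc (p (circ r L j)) ^+ 2 =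
    M%:R * \sum_(k < M) normc (a k * r%:C ^+ k) ^+ 2.
  rewrite -(parseval (fun k : 'I_M => a k * r%:C ^+ k)).
  apply: eq_bigr => j _; congr (normc _ ^+ 2).
  by apply: eq_bigr => k _; rewrite /circ exprMn mulrA.
have Mr : 0 < M%:R :> R by rewrite ltr0n.
rewrite -(ler_pM2l Mr).
apply: (@le_trans _ _ (\sum_(j < M) normc (p (circ r L j)) ^+ 2)).
  rewrite S1 ler_pM2l// (big_ord_widen_cond M xpredT (fun k => normc (a k) ^+ 2 * r ^+ (2 * k)))//.
  rewrite big_mkcond; apply: ler_sum => k _; case: ifP => _; last exact: sqr_ge0.
  by rewrite normcM exprMn normcX normc_real ger0_norm// -exprM mulnC.
apply: (@le_trans _ _ (\sum_(j < M) (2 * normc (F (circ r L j)) ^+ 2 + 2 * B ^+ 2 / 2 ^+ n))).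
  by apply: ler_sum => j _; exact: pF.
rewrite big_split /= -mulr_sumr sumr_const card_ord -[X in _ + X]mulr_natl.
rewrite mulrDr lerD2r mulrCA; lra.
Qed.

(** On [|z| = r] at the angle [t] this is [1 / (1 + r^2 cos^2 (2 t))], a rational majorant of the
    Gaussian [exp (- pi (r^2 - |Im z^2|))], chosen because its mean can be computed. *)
Definition weight (z : R[i]) : R := (1 + complex.Re (z ^+ 2) ^+ 2 / normc z ^+ 2)^-1.

(** [1 + r^2 cos^2 (2 t) = 1 + r^2 / 2 + r^2 / 2 cos (4 t)] is a multiple of
    [|1 + s exp (4 i t)|^2], and matching coefficients gives [s = (T - 1) / (T + 1)]: the weight is
    a Poisson kernel in the fourth power of the root of unity. *)
Lemma weight_circ r L j : 0 < r -> let T := Num.sqrt (1 + r ^+ 2) in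
  weight (circ r L j) = 4 / (T + 1) ^+ 2 *
    (normc (1 + ((T - 1) / (T + 1))%:C * (rootu R (4 * L) ^+ j) ^+ 4) ^+ 2)^-1.
Proof.
move=> r0 T; have T2 : T ^+ 2 = 1 + r ^+ 2 by rewrite sqr_sqrtr// addr_ge0// sqr_ge0.
have T0 : 0 <= T by exact: sqrtr_ge0.
rewrite /weight normc_circ ?ltW// /circ; set w := rootu R (4 * L) ^+ j.
have nw : normc w = 1 by rewrite normcX normc_rootu expr1n.
have : normc w ^+ 2 = 1 by rewrite nw expr1n.
rewrite sqr_normcE; case: w {nw} => x y; rewrite [complex.Re _]/= [complex.Im _]/= => h.
have T1 : T + 1 != 0 by rewrite gt_eqF//; lra.
have -> : 4 / (T + 1) ^+ 2 = ((T + 1) ^+ 2 / 4)^-1 by field.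
rewrite -invfM; congr (_^-1).
have -> : complex.Re ((r%:C * (x +i* y)) ^+ 2) = r ^+ 2 * (x ^+ 2 - y ^+ 2).
  by rewrite expr2 /=; ring.
have -> : (x +i* y) ^+ 4 = ((x ^+ 2 - y ^+ 2) ^+ 2 - (2 * x * y) ^+ 2) +i*
   (2 * (x ^+ 2 - y ^+ 2) * (2 * x * y)).
  rewrite (exprM _ 2 2) expr2; apply: eq_ReIm => /=; ring.
have hh : (x ^+ 2 - y ^+ 2) ^+ 2 + (2 * x * y) ^+ 2 = 1.
  have -> : (x ^+ 2 - y ^+ 2) ^+ 2 + (2 * x * y) ^+ 2 = (x ^+ 2 + y ^+ 2) ^+ 2 by ring.
  by rewrite h expr1n.
move: (x ^+ 2 - y ^+ 2) (2 * x * y) hh => p q hh.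
set s := (T - 1) / (T + 1).
have -> : s%:C * ((p ^+ 2 - q ^+ 2) +i* (2 * p * q)) = (s * (p ^+ 2 - q ^+ 2)) +i* (s * (2 * p * q)).
  by apply: eq_ReIm => /=; ring.
rewrite sqr_normcE /= add0r.
have -> : (1 + s * (p ^+ 2 - q ^+ 2)) ^+ 2 + (s * (2 * p * q)) ^+ 2 =
   1 + 2 * s * (p ^+ 2 - q ^+ 2) + s ^+ 2 * (p ^+ 2 + q ^+ 2) ^+ 2 by ring.
rewrite hh expr1n mulr1 exprMn -mulrA.
have -> : r ^+ 2 = T ^+ 2 - 1 by rewrite T2 addrC addKr.
have q2 : q ^+ 2 = 1 - p ^+ 2 by lra.
have r2 : T ^+ 2 - 1 != 0 by rewrite T2 addrC addKr gt_eqF// exprn_gt0.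
rewrite q2 /s; field.
by rewrite T1 r2.
Qed.

(** The weight peaks on the diagonals with an angular width of order [1 / r]. In the computation,
    [4 / (T + 1)^2 * 2 / (1 - s^2) = 2 / T], and [T >= r]. *)
Lemma weight_mean r : 0 < r -> forall n, exists2 L, (n <= L)%N &
  \sum_(j < 4 * L) weight (circ r L j) <= (4 * L)%:R * (2 / r).
Proof.
move=> r0 n; pose T := Num.sqrt (1 + r ^+ 2).
have T2 : T ^+ 2 = 1 + r ^+ 2 by rewrite sqr_sqrtr// addr_ge0// sqr_ge0.
have rT : r <= T by rewrite -(@ler_pXn2r _ 2) ?nnegrE ?sqrtr_ge0 ?(ltW r0)// T2; lra.
have T1 : 1 <= T.
  by rewrite -(@ler_pXn2r _ 2) ?nnegrE ?sqrtr_ge0// T2 expr1n; have := sqr_ge0 r; lra.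
pose s := (T - 1) / (T + 1).
have s01 : 0 <= s < 1 by apply/andP; rewrite /s; split; [rewrite divr_ge0|rewrite ltr_pdivrMr]; lra.
have /andP[s0 s1] := s01.
(* Bernoulli: [s^-k >= 1 + k (s^-1 - 1)]. *)
have [k0 sk] : exists k, s ^+ k <= 1 / 3.
  have [->|sn] := eqVneq s 0; first by exists 1%N; rewrite expr1; lra.
  have sp : 0 < s by rewrite lt_neqAle eq_sym sn.
  have i0 : 0 < s^-1 - 1 by rewrite subr_gt0 invf_gt1.
  exists (Num.bound (2 / (s^-1 - 1))); set k := Num.bound _.
  have kP : 2 / (s^-1 - 1) < k%:R by apply: archi_boundP; rewrite divr_ge0// ltW.
  have bern (m : nat) : 1 + m%:R * (s^-1 - 1) <= s^-1 ^+ m.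
    elim: m => [|m IHm]; first by rewrite expr0 mul0r addr0.
    have si : 0 <= s^-1 by rewrite invr_ge0.
    have := ler_wpM2l si IHm; rewrite -exprS; apply: le_trans.
    rewrite -(natr1 m); have m0 : 0 <= m%:R :> R by [].
    by have := mulr_ge0 m0 (sqr_ge0 (s^-1 - 1)); rewrite expr2; lra.
  have := bern k; rewrite exprVn => h.
  have h3 : 3 <= (s ^+ k)^-1.
    by apply: le_trans h; move: kP; rewrite ltr_pdivrMr//; lra.
  by rewrite ler_pdivlMr// mulrC -ler_pdivlMr ?exprn_gt0// mul1r.
pose L := (2 * (n + k0 + 1))%N.
exists L; first by rewrite /L; lia.
have L0 : (0 < L)%N by rewrite /L; lia.
have Lev : ~~ odd L by rewrite /L oddM.
have sL : s ^+ L <= 1 / 3.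
  apply: le_trans sk; apply: ler_wiXn2l => //; first exact: ltW.
  by rewrite /L; lia.
under eq_bigr do rewrite weight_circ//; rewrite -mulr_sumr -/T -/s.
have T10 : 0 < 4 / (T + 1) ^+ 2 by rewrite divr_gt0// exprn_gt0//; lra.
apply: le_trans (ler_wpM2l (ltW T10) (poisson_mean Lev L0 s01 sL)) _.
have -> : 4 / (T + 1) ^+ 2 * (2 * (4 * L)%:R / (1 - s ^+ 2)) = (4 * L)%:R * (2 / T).
  have Tn : T != 0 by rewrite gt_eqF//; lra.
  have T1n : T + 1 != 0 by rewrite gt_eqF//; lra.
  have -> : 1 - s ^+ 2 = 4 * T / (T + 1) ^+ 2 by rewrite /s; field.
  by move: ((4 * L)%:R : R) => q; field; rewrite Tn T1n.
rewrite ler_wpM2l// ler_pM2l// lef_pV2// posrE; lra.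
Qed.

End CircleMeans.

(** * Stirling's bound and summation of coefficients by blocks *)

Section Blocks.
Variable R : realType.
Implicit Types (r d x : R).

Lemma ln1Dx_ge x : 0 <= x -> 2 * x / (2 + x) <= ln (1 + x).
Proof.
move=> x0; rewrite -subr_ge0.
pose f t : R := ln (1 + t) - 2 * t / (2 + t).
pose df t : R := (1 + t)^-1 - 4 / (2 + t) ^+ 2.
have := @is_derive_ge0_le R f df 0 x x0; have -> : f 0 = 0 by rewrite /f addr0 ln1 mulr0 mul0r subr0.
apply.
  move=> t /andP[t0 _].
  have t1 : 0 < 1 + t by lra.
  have t2 : 2 + t != 0 by rewrite gt_eqF//; lra.
  have h1 : is_derive t 1 (fun t : R => 1 + t) 1.
    by apply: is_derive_eq; rewrite add0r mulr1.
  have h2 : is_derive t 1 (fun t : R => ln (1 + t)) (1 + t)^-1.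
    have h3 : is_derive (1 + t) 1 (@ln R) (1 + t)^-1 by exact: is_derive1_ln.
    have := @is_derive1_comp R (@ln R) (fun t => 1 + t) t _ _ h3 h1.
    by rewrite mulr1.
  have h4 : is_derive t 1 (fun t : R => 2 * t / (2 + t)) (4 / (2 + t) ^+ 2).
    apply: is_derive_eq; rewrite /GRing.scale /=; field.
    by rewrite t2.
  exact: is_deriveB h2 h4.
move=> t /andP[t0 _]; rewrite /df.
have -> : (1 + t)^-1 - 4 / (2 + t) ^+ 2 = t ^+ 2 / ((1 + t) * (2 + t) ^+ 2).
  by field; rewrite !gt_eqF//; lra.
by rewrite divr_ge0 ?sqr_ge0// mulr_ge0 ?sqr_ge0//; lra.
Qed.

(** Stirling's upper bound with the constant [e]. The induction step is
    [(k + 1/2) ln (1 + 1/k) >= 1], which is [ln1Dx_ge] at [1 / k]. *)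
Lemma fact_le k : (0 < k)%N ->
  k`!%:R <= expR (1 + (k%:R + 1 / 2) * ln k%:R - k%:R) :> R.
Proof.
elim: k => // -[_ _|k IHk _].
  have -> : 1 + (1%:R + 1 / 2) * ln 1%:R - 1%:R = 0 :> R by rewrite ln1; ring.
  by rewrite expR0.
have k0 : 0 < k.+1%:R :> R by [].
rewrite factS natrM; apply: le_trans (ler_wpM2l _ (IHk isT)) _ => //.
have e : k.+2%:R = expR (ln k.+2%:R) :> R by rewrite lnK// posrE.
rewrite {1}e -expRD ler_expR -(natr1 k.+1).
have := @ln1Dx_ge k.+1%:R^-1; rewrite invr_ge0 => /(_ (ltW k0)).
have -> : 1 + k.+1%:R^-1 = (k.+1%:R + 1) / k.+1%:R :> R by field; rewrite gt_eqF.
rewrite ln_div ?posrE ?addr_gt0//.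
move: (k.+1%:R : R) k0 => n n0.
have -> : 2 * n^-1 / (2 + n^-1) = 1 / (n + 1 / 2).
  by field; rewrite !gt_eqF//; lra.
rewrite ler_pdivrMr; last by lra.
lra.
Qed.

(** [k ln (k / P) <= (k - P)^2 / P + k - P], and [|k - P| <= 15 m] bounds the quadratic term by 225;
    one more unit comes from [fact_le], and [sqrt k] is at most [m + 1]. *)
Lemma fact_block (k m : nat) (P : R) : (0 < m)%N -> (m ^ 2 <= k < m.+1 ^ 2)%N ->
  m%:R ^+ 2 <= P <= m%:R ^+ 2 + 12 ->
  k`!%:R <= expR 226 * m.+1%:R * expR (- P) * P ^+ k.
Proof.
move=> m0 /andP[mk km] /andP[P1 P2].
have k0 : (0 < k)%N by apply: leq_trans mk; rewrite expn_gt0 m0.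
have m1 : 1 <= m%:R :> R by rewrite ler1n.
have mk' : m%:R ^+ 2 <= k%:R :> R by rewrite -natrX ler_nat.
have km' : k%:R <= (m%:R + 1) ^+ 2 :> R.
  by rewrite natr1 -natrX ler_nat ltnW.
have mm : 1 <= m%:R ^+ 2 :> R by rewrite exprn_ege1.
have P0 : 0 < P by lra.
have kr : 0 < k%:R :> R by rewrite ltr0n.
apply: (le_trans (fact_le k0)).
have -> : P ^+ k = expR (k%:R * ln P) by rewrite mulrC expRM_natr lnK.
have sk : expR (1 / 2 * ln k%:R) <= m.+1%:R :> R.
  rewrite -(@ler_pXn2r _ 2) ?nnegrE ?expR_ge0// -expRM_natr.
  have -> : 1 / 2 * ln k%:R * 2%:R = ln k%:R :> R by field.
  by rewrite lnK ?posrE// -(natr1 m).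
have lnk : ln k%:R <= ln P + (k%:R / P - 1) :> R.
  have -> : k%:R = P * (1 + (k%:R / P - 1)) :> R by field; rewrite gt_eqF.
  rewrite lnM ?posrE//; last by rewrite addrC subrK divr_gt0.
  have -> : P * (1 + (k%:R / P - 1)) / P = 1 + (k%:R / P - 1) :> R by field; rewrite gt_eqF.
  rewrite lerD2l; apply: le_trans (le_ln1Dx _) _.
    by rewrite ltrBrDl subrr divr_gt0.
  lra.
have sq : (k%:R - P) ^+ 2 / P <= 225.
  rewrite ler_pdivrMr//.
  have kP : `|k%:R - P| <= 15 * m%:R.
    by rewrite ler_norml; apply/andP; split; nra.
  rewrite -(real_normK (num_real _)).
  apply: (@le_trans _ _ ((15 * m%:R) ^+ 2)); last by rewrite exprMn; lra.
  by rewrite lerXn2r ?nnegrE// mulr_ge0.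
have split : 1 + (k%:R + 1 / 2) * ln k%:R - k%:R <=
    226 + 1 / 2 * ln k%:R - P + k%:R * ln P.
  have : k%:R * ln k%:R <= k%:R * (ln P + (k%:R / P - 1)) by rewrite ler_pM2l.
  have e : k%:R * (k%:R / P - 1) = (k%:R - P) ^+ 2 / P + k%:R - P by field; rewrite gt_eqF.
  lra.
apply: (@le_trans _ _ (expR (226 + 1 / 2 * ln k%:R - P + k%:R * ln P))).
  by rewrite ler_expR.
rewrite 3!expRD; apply: ler_wpM2r; first exact: expR_ge0.
apply: ler_wpM2r; first exact: expR_ge0.
by apply: ler_wpM2l; first exact: expR_ge0.
Qed.

(** Consecutive admissible values of [pi r^2] differ by [2 pi], so that one of them lies in a window
    of length 12 above [m^2]. *)
Lemma circle_near (m : nat) : (0 < m)%N -> exists r k, [/\ r ^+ 2 = 2 * k%:R + 1,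
  m%:R / 2 <= r & m%:R ^+ 2 <= pi * r ^+ 2 <= m%:R ^+ 2 + 12].
Proof.
move=> m0; have p2 : 2 <= pi :> R by have := pihalf_ge1 R; lra.
have p4 : pi <= 4 :> R by have := pihalf_lt2 R; lra.
have p0 : 0 < pi :> R by lra.
pose x : R := m%:R ^+ 2 / (2 * pi).
have x0 : 0 <= x by rewrite divr_ge0 ?sqr_ge0// mulr_ge0//; lra.
have /andP[t1 t2] := truncn_itv x0.
pose k := (Num.truncn x).
exists (Num.sqrt (2 * k%:R + 3)), k.+1.
have s0 : 0 <= 2 * k%:R + 3 :> R by have : 0 <= k%:R :> R by []; lra.
have xE : m%:R ^+ 2 = 2 * pi * x by rewrite /x mulrC divfK// mulf_neq0// gt_eqF.
have b1 : m%:R ^+ 2 <= pi * (2 * k%:R + 3) :> R.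
  rewrite xE; move: t2; rewrite -(natr1 k) -/k => t2; nra.
split.
- by rewrite sqr_sqrtr// -(natr1 k); ring.
- rewrite -(@ler_pXn2r _ 2) ?nnegrE ?sqrtr_ge0// ?divr_ge0// sqr_sqrtr// expr_div_n.
  rewrite ler_pdivrMr ?exprn_gt0//; nra.
- rewrite sqr_sqrtr// b1 xE /=; move: t1; rewrite -/k => t1; nra.
Qed.

Lemma zeta_le (eta : R) m M : 0 < eta -> (2 <= m)%N -> (m <= M)%N ->
  \sum_(m <= n < M) expR (- (1 + eta) * ln n%:R) <= eta^-1.
Proof.
move=> e0 m2 mM.
pose P (n : nat) : R := - (eta^-1 * expR (- eta * ln n.-1%:R)).
have := @sum_tele_le R (fun n => expR (- (1 + eta) * ln n%:R)) P m M mM.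
move=> h; apply: (le_trans (h _)).
  move=> n /andP[mn _]; have n2 : (2 <= n)%N by exact: leq_trans mn.
  case: n n2 {mn} => // n n1; rewrite /P /=.
  have n0 : 0 < n%:R :> R by rewrite ltr0n.
  have nS : 0 < n.+1%:R :> R by [].
  have key : ln n%:R <= ln n.+1%:R - n.+1%:R^-1 :> R.
    have -> : n%:R = n.+1%:R * (1 - n.+1%:R^-1) :> R.
      by rewrite -(natr1 n); field; rewrite natr1 gt_eqF.
    have i1 : n.+1%:R^-1 < 1 :> R by rewrite invf_lt1// ltr1n.
    rewrite lnM ?posrE ?subr_gt0// lerD2l; apply: le_trans (le_ln1Dx _) _; last by [].
    by rewrite ltrN2.
  rewrite opprK [leRHS]addrC -mulrBr ler_pdivlMl//.
  have -> : - (1 + eta) * ln n.+1%:R = - eta * ln n.+1%:R - ln n.+1%:R by ring.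
  rewrite expRD expRN lnK ?posrE//.
  apply: (@le_trans _ _ (expR (- eta * ln n.+1%:R + eta * n.+1%:R^-1) - expR (- eta * ln n.+1%:R))).
    rewrite expRD -[X in _ - X]mulr1 -mulrBr mulrCA ler_wpM2l ?expR_ge0//.
    have := expR_ge1Dx (eta * n.+1%:R^-1); move: (eta * n.+1%:R^-1) => y; lra.
  rewrite lerD2r ler_expR.
  have := ler_wpM2l (ltW e0) key; move: (n.+1%:R^-1) => y; lra.
rewrite /P; case: m m2 mM {h} => [//|[//|m]] _ mM; rewrite /= opprK.
apply: (@le_trans _ _ (eta^-1 * expR (- eta * ln m.+1%:R))).
  by rewrite gerDr oppr_le0 mulr_ge0 ?expR_ge0// invr_ge0 ltW.
apply: ler_piMr; first by rewrite invr_ge0 ltW.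
rewrite -[X in _ <= X]expR0 ler_expR mulNr oppr_le0.
by apply: mulr_ge0; [exact: ltW|rewrite ln_ge0// ler1n].
Qed.

(* The coefficients with index in [m^2, (m+1)^2) are estimated on a circle with
   [pi r^2] close to [m^2], where [b_j r^(2j)] is comparable to [b_j j! / pi^j]. *)
Lemma block_sum (C d r0 : R) : 0 <= C -> 0 <= d -> d < 1 / 2 -> exists S, forall b : nat -> R,
  (forall k, 0 <= b k) ->
  (forall r k, r ^+ 2 = 2 * k%:R + 1 -> r0 <= r -> forall K,
     \sum_(j < K) b j * r ^+ (2 * j) <= C * expR ((2 * d - 3) * ln r + pi * r ^+ 2)) ->
  forall K, \sum_(0 <= j < K) b j * (j`!%:R / pi ^+ j) <= S.
Proof.
move=> C0 d0 d1.
have p2 : 2 <= pi :> R by have := pihalf_ge1 R; lra.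
have p0 : 0 < pi :> R by lra.
pose k1 := Num.bound (r0 ^+ 2).
pose r1 : R := Num.sqrt (2 * k1%:R + 1).
have k1P : r0 ^+ 2 < k1%:R by apply: archi_boundP; exact: sqr_ge0.
have k10 : 0 <= 2 * k1%:R + 1 :> R by have : 0 <= k1%:R :> R by []; lra.
have r11 : 1 <= r1.
  rewrite -(@ler_pXn2r _ 2) ?nnegrE ?sqrtr_ge0// sqr_sqrtr// expr1n.
  by have : 0 <= k1%:R :> R by []; lra.
have r01 : r0 <= r1.
  apply: (le_trans (ler_norm _)).
  rewrite -(@ler_pXn2r _ 2) ?nnegrE ?sqrtr_ge0// sqr_sqrtr// real_normK ?num_real//.
  by have : 0 <= k1%:R :> R by []; lra.
have r1E : r1 ^+ 2 = 2 * k1%:R + 1 by rewrite sqr_sqrtr.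
pose A0 := C * expR ((2 * d - 3) * ln r1 + pi * r1 ^+ 2).
pose m0 := maxn 2 (Num.bound (2 * `|r0|)).
have m02 : (2 <= m0)%N by rewrite leq_maxl.
have m0r : 2 * r0 <= m0%:R.
  apply: (@le_trans _ _ (Num.bound (2 * `|r0|))%:R); last by rewrite ler_nat leq_maxr.
  have := ler_norm r0; have : 2 * `|r0| < (Num.bound (2 * `|r0|))%:R by apply: archi_boundP; rewrite mulr_ge0.
  lra.
(* [16 = 2 * 8]: from [m + 1 <= 2 m] and, as [r >= m / 2], from [2^(3 - 2 d) <= 8]. The block [m]
   then contributes [m^(2 d - 2)], summable as [2 d < 1]. *)
pose D := expR 226 * C * 16.
have D0 : 0 <= D by rewrite /D !mulr_ge0 ?expR_ge0.
exists (A0 * \sum_(0 <= j < m0 ^ 2) j`!%:R + D * (1 - 2 * d)^-1) => b b0 hb.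
pose f j := b j * (j`!%:R / pi ^+ j).
have f0 j : 0 <= f j by rewrite mulr_ge0// divr_ge0// exprn_ge0// ltW.
have low : \sum_(0 <= j < m0 ^ 2) f j <= A0 * \sum_(0 <= j < m0 ^ 2) j`!%:R.
  rewrite mulr_sumr; apply: ler_sum => j _.
  apply: ler_pM => //; first by rewrite divr_ge0// exprn_ge0// ltW.
    apply: le_trans (hb r1 k1 r1E r01 j.+1); rewrite big_ord_recr /=.
    apply: (@le_trans _ _ (b j * r1 ^+ (2 * j))); first by rewrite ler_peMr// exprn_ege1.
    rewrite lerDr sumr_ge0// => i _; rewrite mulr_ge0// exprn_ge0//; lra.
  by rewrite ler_pdivrMr ?exprn_gt0// ler_peMr// exprn_ege1//; lra.
have block m : (m0 <= m)%N ->
    \sum_(m ^ 2 <= j < m.+1 ^ 2) f j <= D * expR (- (1 + (1 - 2 * d)) * ln m%:R).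
  move=> m0m; have m2 : (2 <= m)%N by exact: leq_trans m0m.
  have m0' : (0 < m)%N by exact: ltnW.
  have mr : 2 <= m%:R :> R by rewrite (ler_nat _ 2).
  have [r [k [rE mr2 Pr]]] := circle_near m0'.
  have m0mr : m0%:R <= m%:R :> R by rewrite ler_nat.
  have r0r : r0 <= r by lra.
  have rp : 0 < r by lra.
  apply: (@le_trans _ _ (\sum_(m ^ 2 <= j < m.+1 ^ 2) b j * r ^+ (2 * j) *
     (expR 226 * m.+1%:R * expR (- (pi * r ^+ 2))))).
    rewrite big_nat_cond [leRHS]big_nat_cond; apply: ler_sum => j /andP[jm _].
    have h := fact_block m0' jm Pr.
    rewrite /f -mulrA ler_wpM2l// ler_pdivrMr ?exprn_gt0//; apply: (le_trans h).
    by rewrite exprMn -exprM le_eqVlt; apply/orP; left; apply/eqP; ring.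
  rewrite -mulr_suml.
  have sumle : \sum_(m ^ 2 <= j < m.+1 ^ 2) b j * r ^+ (2 * j) <=
      C * expR ((2 * d - 3) * ln r + pi * r ^+ 2).
    apply: le_trans (hb r k rE r0r (m.+1 ^ 2)%N).
    rewrite -(big_mkord xpredT (fun j => b j * r ^+ (2 * j))).
    have mS : (m ^ 2 <= m.+1 ^ 2)%N by rewrite leq_exp2r.
    rewrite (big_cat_nat (leq0n _) mS) /= lerDr sumr_ge0// => i _.
    by rewrite mulr_ge0// exprn_ge0// ltW.
  apply: (le_trans (ler_wpM2r _ sumle)); first by rewrite !mulr_ge0 ?expR_ge0.
  have -> : C * expR ((2 * d - 3) * ln r + pi * r ^+ 2) *
    (expR 226 * m.+1%:R * expR (- (pi * r ^+ 2))) =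
    expR 226 * C * (m.+1%:R * expR ((2 * d - 3) * ln r)).
    rewrite expRD expRN; field.
    by rewrite gt_eqF// expR_gt0.
  rewrite /D -[leRHS]mulrA ler_wpM2l ?mulr_ge0 ?expR_ge0//.
  have lnr : ln m%:R - ln 2 <= ln r.
    by rewrite -ln_div ?posrE ?ler_ln ?posrE ?divr_gt0//; lra.
  apply: (@le_trans _ _ (2 * m%:R * expR ((2 * d - 3) * (ln m%:R - ln 2)))).
    apply: ler_pM; rewrite ?expR_ge0//; first by rewrite -(natr1 m); lra.
    by rewrite ler_expR ler_wnM2l//; lra.
  have e2 : expR ((3 - 2 * d) * ln 2) <= 8 :> R.
    have l2 : 0 <= ln 2 :> R by rewrite ln_ge0 ?ler1n.
    apply: (@le_trans _ _ (expR (ln 2 * 3%:R))).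
      rewrite ler_expR mulrC ler_wpM2l//; lra.
    by rewrite expRM_natr lnK ?posrE// -natrX ler_nat.
  have em : m%:R = expR (ln m%:R) :> R by rewrite lnK// posrE; lra.
  rewrite {1}em.
  have -> : (2 * d - 3) * (ln m%:R - ln 2) = - (1 + (1 - 2 * d)) * ln m%:R - ln m%:R + (3 - 2 * d) * ln 2 by ring.
  rewrite !expRD expRN; have ep := expR_gt0 (ln (m%:R : R)).
  have -> : 2 * expR (ln m%:R) * (expR (- (1 + (1 - 2 * d)) * ln m%:R) * (expR (ln m%:R))^-1 * expR ((3 - 2 * d) * ln 2))
    = 2 * expR ((3 - 2 * d) * ln 2) * expR (- (1 + (1 - 2 * d)) * ln m%:R).
    by field; rewrite gt_eqF.
  by rewrite ler_wpM2r ?expR_ge0//; lra.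
move=> K; pose M := maxn K m0.
have m0M : (m0 <= M)%N by rewrite leq_maxr.
have KM : (K <= M ^ 2)%N.
  apply: leq_trans (leq_maxl K m0) _; rewrite -/M expnS expn1 leq_pmulr//.
  by apply: leq_trans m0M; exact: ltnW.
apply: (@le_trans _ _ (\sum_(0 <= j < M ^ 2) f j)).
  by rewrite (big_cat_nat (leq0n _) KM) /= lerDl sumr_ge0.
have -> : \sum_(0 <= j < M ^ 2) f j = \sum_(0 <= j < m0 ^ 2) f j +
    \sum_(m0 <= m < M) \sum_(m ^ 2 <= j < m.+1 ^ 2) f j.
  elim: M m0M {KM} => [|M IHM].
    by rewrite leqn0 => /eqP ->; rewrite [X in _ + X]big_geq// addr0.
  rewrite leq_eqVlt => /predU1P[->|]; first by rewrite [X in _ + X]big_geq// addr0.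
  rewrite ltnS => mM; have MS : (M ^ 2 <= M.+1 ^ 2)%N by rewrite leq_exp2r.
  by rewrite (big_cat_nat (leq0n _) MS) /= IHM// [X in _ = _ + X]big_nat_recr//= addrA.
apply: lerD => //; have e0 : 0 < 1 - 2 * d by lra.
apply: le_trans (ler_wpM2l D0 (zeta_le e0 m02 m0M)).
rewrite mulr_sumr big_nat_cond [leRHS]big_nat_cond; apply: ler_sum => m.
by rewrite andbT => /andP[m0m _]; exact: block.
Qed.

End Blocks.

(** * Functions vanishing on Lambda except at one point *)

Section DualFunction.
Variables (R : realType) (lam : nat -> R[i]) (d : R).
Hypothesis d0 : 0 <= d.
Hypothesis d1 : d < 1 / 2.
Hypothesis near : forall n : nat, (1 <= n)%N ->
  normc ((sqrt2n R n)%:C - lam n) <= d / sqrt2n R n.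
Hypothesis lam_inj : forall m n : nat, (1 <= m)%N -> (1 <= n)%N ->
  lam m = lam n -> m = n.
Local Notation u := (sqrt2n R).
Local Notation Q := (Q lam).
Implicit Types (z l : R[i]) (n N : nat) (F : R[i] -> R[i]).

(** [F] is the generating function truncated at [N] and divided by [z - l]; the last clause is this
    equality cleared of denominators. The zeros beyond [N] are not controlled. *)
Definition dual l N F := [/\ entire F,
  forall e, e \in zeros lam N -> e != l -> F e = 0,
  (normc l ^+ 2 <= 2 * N%:R + 1 -> F l != 0) &
  forall z, (forall n, (0 < n)%N -> z != (u n)%:C) ->
    F z * (z - l) * z ^+ 2 = (z ^+ 2 - 1) * csin ((pi / 2)%:C * z ^+ 2) * Q z N].

Lemma dual_exists l N : l \in zeros lam N -> exists F, dual l N F.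
Proof.
move=> lN; have [g [eg gE g0]] := csin_factor R N.
have uz := uniq_zeros d0 d1 near lam_inj N.
pose s := rem l (zeros lam N).
have es (t : seq R[i]) : entire (fun z => (\prod_(e <- t) (z - e)) * g z).
  elim: t => [|x t IHt]; first by congr entire: eg; apply/funext => z; rewrite big_nil mul1r.
  have := entire_mul_sub x IHt; congr entire; apply/funext => z.
  by rewrite big_cons mulrA.
exists (fun z => (scale lam N)^-1 * ((\prod_(e <- s) (z - e)) * g z)).
have sc := scale_neq0 d0 d1 near N.
split; first exact/entireZ/es.
- move=> e ez el; rewrite (big_rem e) /=; last by rewrite mem_rem_uniq// inE el.
  by rewrite subrr !mul0r mulr0.
- move=> lR; rewrite !mulf_neq0 ?invr_eq0 ?g0//.
  rewrite prodf_seq_neq0; apply/allP => e; rewrite mem_rem_uniq// inE => /andP[el _] /=.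
  by rewrite subr_eq0 eq_sym.
- move=> z zu; apply: (mulfI sc); rewrite (zeros_prod d0 d1 near (gE z) zu).
  rewrite (big_rem l lN) -/s /=.
  move: (scale lam N) sc (\prod_(e <- s) (z - e)) (g z) => c c0 p q; by field.
Qed.

Lemma dual_normE l N F z : dual l N F -> (forall n, (0 < n)%N -> z != (u n)%:C) ->
  normc (F z) * normc (z - l) * normc z ^+ 2 =
  normc (z ^+ 2 - 1) * normc (csin ((pi / 2)%:C * z ^+ 2)) * normc (Q z N).
Proof. by move=> [_ _ _ E] zu; rewrite -normcX -!normcM E. Qed.

Lemma dual_norm l N F z : dual l N F -> (forall n, (0 < n)%N -> z != (u n)%:C) ->
  2 <= normc z -> 2 * normc l + 2 <= normc z ->
  normc (F z) <= 5 / 2 * (normc z)^-1 * expR (pi / 2 * `|complex.Im (z ^+ 2)|) * normc (Q z N).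
Proof.
move=> dF zu r2 rl; have E := dual_normE dF zu.
have /andP[_ q1] := normc_sqr_sub1 r2.
have [q2 _] := normc_csin_sqr z.
have zl : normc z / 2 <= normc (z - l) by have := normc_ge_sub z l; lra.
have r0 : 0 < normc z by lra.
have p0 : 0 < normc z / 2 * normc z ^+ 2.
  by apply: mulr_gt0; [rewrite divr_gt0|rewrite exprn_gt0].
rewrite -(ler_pM2r p0).
apply: (@le_trans _ _ (normc (F z) * normc (z - l) * normc z ^+ 2)).
  by rewrite -[leRHS]mulrA ler_wpM2l ?normc_ge0// ler_wpM2r ?sqr_ge0.
rewrite E; apply: (@le_trans _ _ (5 / 4 * normc z ^+ 2 *
   expR (pi / 2 * `|complex.Im (z ^+ 2)|) * normc (Q z N))).
  rewrite ler_wpM2r ?normc_ge0//.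
  apply: (ler_pM (normc_ge0 _) (normc_ge0 _) q1 q2).
rewrite le_eqVlt; apply/orP; left; apply/eqP.
move: (expR _) (normc (Q z N)) (normc z) r0 => A B r r0; field.
by rewrite gt_eqF.
Qed.

(** Let [y] be [(Re z^2)^2 / |z|^2]. Since [|z|^4] is the sum of the squares of [Re z^2] and
    [Im z^2], the defect [|z|^2 - |Im z^2|] is at least [y / 2], and [exp (- pi y / 2) <= 1 / (1 +
    pi y / 2) <= 1 / (1 + y)]. *)
Lemma weight_ge (z : R[i]) : 0 < normc z ->
  expR (pi * `|complex.Im (z ^+ 2)|) <= expR (pi * normc z ^+ 2) * weight z.
Proof.
move=> r0; have p1 := pihalf_ge1 R.
set y := complex.Re (z ^+ 2) ^+ 2 / normc z ^+ 2.
have r20 : 0 < normc z ^+ 2 by rewrite exprn_gt0.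
have y0 : 0 <= y by rewrite divr_ge0// sqr_ge0.
have key : `|complex.Im (z ^+ 2)| <= normc z ^+ 2 - y / 2.
  have := sqr_normcE (z ^+ 2); rewrite normcX -(real_normK (num_real (complex.Im (z ^+ 2)))).
  have := ler_Im_normc (z ^+ 2); rewrite normcX.
  have : y * normc z ^+ 2 = complex.Re (z ^+ 2) ^+ 2 by rewrite /y divfK// gt_eqF.
  have := normr_ge0 (complex.Im (z ^+ 2)).
  move: (complex.Re (z ^+ 2) ^+ 2) `|complex.Im (z ^+ 2)| (normc z ^+ 2) r20 y y0 => A I r r20 y y0 I0 yr Ir rr.
  have rr' : (r - I) * (r + I) = y * r by rewrite yr -(addrK (I ^+ 2) A) -rr; ring.
  have : y * r <= (r - I) * (2 * r) by rewrite -rr' ler_wpM2l//; lra.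
  rewrite mulrA ler_pM2r//; lra.
have yw : expR (- (pi * (y / 2))) <= weight z.
  rewrite expRN /weight -/y lef_pV2 ?posrE ?expR_gt0//; last by lra.
  apply: le_trans (expR_ge1Dx _); rewrite lerD2l; nra.
apply: (@le_trans _ _ (expR (pi * normc z ^+ 2) * expR (- (pi * (y / 2))))).
  by rewrite -expRD ler_expR -mulrBr ler_wpM2l// pi_ge0.
by rewrite ler_wpM2l ?expR_ge0.
Qed.

(** Outside the sector around the positive axis, [Q_left] and the weight give the bound. Inside it
    [|Im z^2| <= 24/25 |z|^2], and the Gaussian gain absorbs [exp (17 |z|)] and all powers of [|z|];
    the term [1 / |z|] stands for that part. *)
Lemma dual_circle l : exists2 C, 0 <= C & forall N F k z, dual l N F ->
  normc z ^+ 2 = 2 * k%:R + 1 -> 2 * normc l + 2 <= normc z ->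
  normc (F z) ^+ 2 <= C * expR ((2 * d - 2) * ln (normc z) + pi * normc z ^+ 2) *
    (weight z + (normc z)^-1).
Proof.
(* [4000] exceeds the maximum of [35 r - 8/100 r^2], reached at [r = 875/4]; [35 r] comes from
   [Q_arc_upper] squared and from [ln r <= r]. *)
exists (25 / 4 * expR 4000); first by rewrite mulr_ge0 ?expR_ge0.
have dd0 := d0; have dd1 := d1; have p1 := pihalf_ge1 R.
move=> N F k z dF zE rl.
have r2 : 2 <= normc z by have := normc_ge0 l; lra.
have r0 : 0 < normc z by lra.
have ri : (normc z)^-1 = expR (- ln (normc z)) by rewrite expRN lnK.
have r1 : 1 <= normc z by lra.
have l0 : 0 <= ln (normc z) by rewrite ln_ge0.
have w0 : 0 <= weight z.
  by rewrite invr_ge0 addr_ge0// divr_ge0 ?sqr_ge0.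
have h := dual_norm dF (arc_neq zE) r2 rl.
have h2 : normc (F z) ^+ 2 <= 25 / 4 * (expR (- (2 * ln (normc z))) *
    (expR (pi * `|complex.Im (z ^+ 2)|) * normc (Q z N) ^+ 2)).
  apply: (@le_trans _ _ ((5 / 2 * (normc z)^-1 * expR (pi / 2 * `|complex.Im (z ^+ 2)|) * normc (Q z N)) ^+ 2)).
    by rewrite lerXn2r ?nnegrE ?normc_ge0// !mulr_ge0 ?invr_ge0 ?normc_ge0 ?expR_ge0.
  rewrite !exprMn ri -!expRM_natr le_eqVlt; apply/orP; left; apply/eqP.
  have -> : - ln (normc z) * 2%:R = - (2 * ln (normc z)) by ring.
  have -> : pi / 2 * `|complex.Im (z ^+ 2)| * 2%:R = pi * `|complex.Im (z ^+ 2)|.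
    by rewrite mulrAC divfK.
  by move: (expR _) (expR _) (normc (Q z N)) => A B q; field.
apply: (le_trans h2).
rewrite (expRD ((2 * d - 2) * _)).
have -> : 25 / 4 * expR 4000 * (expR ((2 * d - 2) * ln (normc z)) * expR (pi * normc z ^+ 2)) *
   (weight z + (normc z)^-1) = 25 / 4 * (expR 4000 * expR ((2 * d - 2) * ln (normc z)) *
   (expR (pi * normc z ^+ 2) * weight z + expR (pi * normc z ^+ 2) * (normc z)^-1)) by ring.
rewrite ler_pM2l; last by [].
have [zs|zs] := leP (complex.Re z) (4 / 5 * normc z).
  have /andP[_ q3] := Q_left d0 d1 near N r1 zs.
  have q4 : normc (Q z N) ^+ 2 <= expR (2 * d * ln (normc z) + 42).
    apply: (@le_trans _ _ (expR (d * ln (normc z) + 21) ^+ 2)).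
      by rewrite lerXn2r ?nnegrE ?normc_ge0// expR_ge0.
    by rewrite -expRM_natr ler_expR; lra.
  apply: (@le_trans _ _ (expR (- (2 * ln (normc z))) * ((expR (pi * normc z ^+ 2) * weight z) *
     expR (2 * d * ln (normc z) + 42)))).
    rewrite ler_wpM2l ?expR_ge0//; apply: ler_pM; rewrite ?expR_ge0 ?sqr_ge0//.
    exact: weight_ge.
  rewrite mulrCA [leRHS]mulrC; apply: ler_pM.
  - by rewrite mulr_ge0// expR_ge0.
  - by rewrite mulr_ge0// expR_ge0.
  - by rewrite lerDl mulr_ge0 ?expR_ge0// invr_ge0 ltW.
  - by rewrite -!expRD ler_expR; lra.
have q3 := Q_arc_upper d0 d1 near N zE r1.
have q4 : normc (Q z N) ^+ 2 <= expR (34 * normc z).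
  apply: (@le_trans _ _ (expR (17 * normc z) ^+ 2)).
    by rewrite lerXn2r ?nnegrE ?normc_ge0// expR_ge0.
  by rewrite -expRM_natr ler_expR; lra.
have Iz : `|complex.Im (z ^+ 2)| <= 96 / 100 * normc z ^+ 2.
  have R0 : 0 <= 96 / 100 * normc z ^+ 2 by rewrite mulr_ge0// sqr_ge0.
  rewrite -(@ler_pXn2r _ 2)// real_normK ?num_real// Im_sqr.
  move: zs; have := sqr_normcE z; move: (complex.Re z) (complex.Im z) (normc z) r0 => x y r r0 E xr.
  have x2 : 16 / 25 * r ^+ 2 <= x ^+ 2.
    have -> : 16 / 25 * r ^+ 2 = (4 / 5 * r) ^+ 2 by field.
    by rewrite lerXn2r ?nnegrE//; lra.
  have -> : (2 * x * y) ^+ 2 = 4 * x ^+ 2 * y ^+ 2 by ring.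
  have -> : y ^+ 2 = r ^+ 2 - x ^+ 2 by lra.
  have := sqr_ge0 r; rewrite exprMn; move: (x ^+ 2) (r ^+ 2) x2 => X Y XY Y0.
  have : 0 <= (X - 16 / 25 * Y) * (X - 9 / 25 * Y) by apply: mulr_ge0; lra.
  rewrite (_ : _ * _ = X ^+ 2 - X * Y + 144 / 625 * Y ^+ 2); last by field.
  rewrite (_ : 4 * X * (Y - X) = 4 * (X * Y) - 4 * X ^+ 2); last by ring.
  by rewrite expr_div_n; lra.
apply: (@le_trans _ _ (expR (- (2 * ln (normc z))) *
    (expR (pi * (96 / 100 * normc z ^+ 2)) * expR (34 * normc z)))).
  rewrite ler_wpM2l ?expR_ge0//; apply: ler_pM; rewrite ?expR_ge0 ?sqr_ge0//.
  by rewrite ler_expR ler_wpM2l// pi_ge0.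
apply: (@le_trans _ _ (expR 4000 * expR ((2 * d - 2) * ln (normc z)) *
   (expR (pi * normc z ^+ 2) * (normc z)^-1))); last first.
  by rewrite ler_wpM2l ?mulr_ge0 ?expR_ge0// lerDr mulr_ge0 ?expR_ge0.
rewrite ri -!expRD ler_expR.
have lr : ln (normc z) <= normc z by exact/ltW/ln_sublinear.
have pz : (4 / 100 * pi) * normc z ^+ 2 >= 8 / 100 * normc z ^+ 2.
  by rewrite ler_wpM2r ?sqr_ge0//; lra.
have dl : 0 <= 2 * d * ln (normc z) by rewrite mulr_ge0// mulr_ge0.
have sq := sqr_ge0 (normc z - 875 / 4).
rewrite expr2 in sq; move: pz; rewrite !expr2; lra.
Qed.

(** The mean of [weight + 1 / r] over the circle is at most [3 / r]: this lowers the exponent from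
    [2 d - 2] to [2 d - 3]. *)
Lemma dual_coef l : exists2 C, 0 <= C & forall N F a, dual l N F -> ent a F ->
  forall r k, r ^+ 2 = 2 * k%:R + 1 -> 2 * normc l + 2 <= r ->
  forall K, \sum_(j < K) normc (a j) ^+ 2 * r ^+ (2 * j) <=
    C * expR ((2 * d - 3) * ln r + pi * r ^+ 2).
Proof.
have [C C0 h] := dual_circle l; exists (6 * C); first by rewrite mulr_ge0.
move=> N F a dF aF r k rE rl K.
have r0 : 0 < r by have := normc_ge0 l; lra.
pose E := C * expR ((2 * d - 2) * ln r + pi * r ^+ 2).
have E0 : 0 <= E by rewrite mulr_ge0 ?expR_ge0.
have := @parseval_le R a F r (E * (3 / r)) aF (ltW r0); move=> P.
have -> : 6 * C * expR ((2 * d - 3) * ln r + pi * r ^+ 2) = 2 * (E * (3 / r)).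
  have -> : (2 * d - 3) * ln r + pi * r ^+ 2 = (2 * d - 2) * ln r + pi * r ^+ 2 - ln r by ring.
  by rewrite expRD expRN lnK ?posrE// /E; ring.
apply: P => n; have [L nL WL] := weight_mean r0 n; exists L => //.
apply: (@le_trans _ _ (\sum_(j < 4 * L) E * (weight (circ r L j) + r^-1))).
  apply: ler_sum => j _; have := h N F k (circ r L j) dF; rewrite (normc_circ _ _ (ltW r0)).
  by apply.
rewrite -mulr_sumr big_split /= sumr_const card_ord -[X in _ + X]mulr_natl.
rewrite mulrCA ler_wpM2l//; move: WL; move: (\sum_(i < _) _) ((4 * L)%:R : R) => S q Sq.
have -> : q * (3 / r) = q * (2 / r) + q * r^-1 by ring.
by rewrite lerD2r.
Qed.

Lemma mem_zeros_mono l m N : (m <= N)%N -> l \in zeros lam m -> l \in zeros lam N.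
Proof.
move=> mN; rewrite /zeros !mem_cat.
have sub (f : nat -> R[i]) : l \in [seq f n | n <- iota 1 m] -> l \in [seq f n | n <- iota 1 N].
  move=> /mapP[n nm ->]; apply: map_f; move: nm; rewrite !mem_iota; lia.
by case/or4P => [->|/sub ->|/sub ->|/orP[/sub ->|/sub ->]]; rewrite ?orbT.
Qed.

(** Continuity, the point [l] being approached vertically so that the inequality is only required
    off the real axis, where no [u n] interferes. *)
Lemma ana_perturb F G l (c : R) : ana F l -> ana G l -> 0 <= c ->
  (forall z, complex.Im z != 0 -> z != l -> normc (z - l) <= 1 -> c * normc (F z) <= normc (G z)) ->
  c * normc (F l) <= normc (G l).
Proof.
move=> /ana_lip[A [e [e0 FA]]] /ana_lip[B [e' [e'0 GB]]] c0 h.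
apply/ler_addgt0Pr => eps eps0.
pose D := c * `|A| + `|B| + 1.
have D0 : 0 < D by rewrite ltr_wpDl// addr_ge0// mulr_ge0.
pose t := Num.min (Num.min (e / 2) (e' / 2)) (Num.min (eps / D) 1).
have t0 : 0 < t by rewrite !lt_min !divr_gt0 ?ltr01.
have [te te' tD t1] : [/\ t < e, t < e', t <= eps / D & t <= 1].
  have : t <= t by []; rewrite {2}/t !le_min => /andP[/andP[? ?] /andP[? ?]].
  by split=> //; lra.
clearbody t.
have [s [s0 st sI]] : exists s, [/\ 0 < s, s <= t & complex.Im l + s != 0].
  have [E|] := eqVneq (complex.Im l + t) 0; last by exists t.
  by exists (t / 2); split; [rewrite divr_gt0|lra|apply/eqP; lra].
pose w : R[i] := 0 +i* s.
have nw : normc w = s by rewrite /= expr0n add0r sqrtr_sqr gtr0_norm.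
have h1 := FA w; rewrite nw in h1; have {}h1 := h1 ltac:(lra).
have h2 := GB w; rewrite nw in h2; have {}h2 := h2 ltac:(lra).
have lw : l + w - l = w by rewrite addrAC subrr add0r.
have wl : l + w != l by rewrite -subr_eq0 lw -normc_gt0 nw.
have h3 : c * normc (F (l + w)) <= normc (G (l + w)).
  by apply: h => //; [rewrite ImD|rewrite lw nw (le_trans st)].
have h4 := normc_ge_sub (F l) (F l - F (l + w)); rewrite subKr in h4.
rewrite [X in _ - X]normc_distC in h4.
have h5 := normc_ge_sub (G (l + w)) (G (l + w) - G l); rewrite subKr in h5.
have st' (x : R) : x * s <= `|x| * t.
  apply: (@le_trans _ _ (`|x| * s)); first by rewrite ler_wpM2r ?ler_norm// ltW.
  by rewrite ler_wpM2l.
have As := st' A; have Bs := st' B.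
have Dt : D * t <= eps by rewrite mulrC -ler_pdivlMr.
have : c * normc (F l) <= c * (normc (F (l + w)) + `|A| * t) by rewrite ler_wpM2l//; lra.
rewrite /D in Dt; lra.
Qed.

(** All the functions in [dual] agree up to a tail of [Q]. Near [l], comparison with a fixed one,
    [G], costs at most the ratio [exp (- 1) / exp 1] of the bounds of [tail_ep], and [ana_perturb]
    carries the inequality to [l]. *)
Lemma dual_lower l N0 : l \in zeros lam N0 -> exists c N1, 0 < c /\
  forall N F, (N1 <= N)%N -> dual l N F -> c <= normc (F l).
Proof.
move=> lN0; have rho0 : 0 <= normc l + 1 by rewrite addr_ge0 ?normc_ge0.
have [N1 tail] := tail_ep d0 d1 near rho0.
pose M := maxn (maxn N0 N1) (Num.bound (normc l ^+ 2)).
have [N0M N1M lM] : [/\ N0 <= M, N1 <= M & Num.bound (normc l ^+ 2) <= M]%N.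
  by rewrite /M !leq_max !leqnn !orbT.
have [G dG] := dual_exists (mem_zeros_mono N0M lN0).
have Gl : G l != 0.
  case: dG => _ _ -> //.
  have : normc l ^+ 2 < (Num.bound (normc l ^+ 2))%:R by apply: archi_boundP; exact: sqr_ge0.
  have : (Num.bound (normc l ^+ 2))%:R <= M%:R :> R by rewrite ler_nat.
  by have : 0 <= M%:R :> R by []; lra.
exists (expR (-2) * normc (G l)), M; split; first by rewrite mulr_gt0 ?expR_gt0 ?normc_gt0.
move=> N F MN dF.
apply: ana_perturb (expR_ge0 _) _; [by case: dG => eG *; exact: entire_ana|by case: dF => eF *; exact: entire_ana|].
move=> z Iz zl zl1.
have zu n : (0 < n)%N -> z != (u n)%:C by move=> _; apply: contraNneq Iz => ->.
have z0 : z != 0 by apply: contraNneq Iz => ->.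
have p0 : 0 < normc (z - l) * normc z ^+ 2.
  by rewrite mulr_gt0 ?exprn_gt0 ?normc_gt0// subr_eq0.
have zr : normc z <= normc l + 1.
  by have := normc_ge_sub z l; lra.
have EG := dual_normE dG zu; have EF := dual_normE dF zu.
have N1N : (N1 <= N)%N by exact: leq_trans MN.
have /andP[t1 t2] := tail z M zr N1M; have /andP[t3 t4] := tail z N zr N1N.
have QE' n : (N1 <= n)%N -> normc (Q z n) =
    normc (Q z N1) * normc (\prod_(N1 <= i < n) (1 + ep lam z i.+1)).
  by move=> N1n; rewrite (QE _ _ N1n) normcM.
rewrite QE'// in EF; rewrite QE'// in EG.
rewrite -(ler_pM2r p0).
pose X := normc (z ^+ 2 - 1) * normc (csin ((pi / 2)%:C * z ^+ 2)) * normc (Q z N1).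
have X0 : 0 <= X by rewrite !mulr_ge0 ?normc_ge0.
have -> : normc (F z) * (normc (z - l) * normc z ^+ 2) =
    X * normc (\prod_(N1 <= n < N) (1 + ep lam z n.+1)) by rewrite mulrA EF mulrA.
have -> : expR (-2) * normc (G z) * (normc (z - l) * normc z ^+ 2) =
    X * (expR (-2) * normc (\prod_(N1 <= n < M) (1 + ep lam z n.+1))).
  by rewrite -mulrA [normc (G z) * _]mulrA EG /X; ring.
apply: (ler_wpM2l X0).
apply: le_trans t3; apply: (@le_trans _ _ (expR (-2) * expR 1)); first by rewrite ler_wpM2l ?expR_ge0.
by rewrite -expRD ler_expR; lra.
Qed.

Lemma dual_bound l N0 : l \in zeros lam N0 -> exists S c N1, 0 < c /\
  forall N, (N1 <= N)%N -> exists a F, [/\ ent a F,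
    forall e, e \in zeros lam N -> e != l -> F e = 0, c <= normc (F l) &
    forall K, \sum_(0 <= j < K) normc (a j) ^+ 2 * (j`!%:R / pi ^+ j) <= S].
Proof.
move=> lN0; have [c [N1 [c0 low]]] := dual_lower lN0.
have [C C0 coef] := dual_coef l.
have [S SP] := block_sum (2 * normc l + 2) C0 d0 d1.
exists S, c, (maxn N0 N1); split=> // N; rewrite geq_max => /andP[N0N N1N].
have [F dF] := dual_exists (mem_zeros_mono N0N lN0).
have [[a aF] F0 _ _] := dF.
exists a, F; split=> //; first exact: low dF.
apply: (SP (fun j => normc (a j) ^+ 2)) => [k|r k rE rl K]; first exact: sqr_ge0.
exact: coef dF aF _ _ rE rl K.
Qed.

End DualFunction.

(** * Quadratic form of the Fock kernel on finite combinations *)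

Section Kernel.
Variable R : realType.
Implicit Types (p q r : seq (R[i] * R[i])) (c z w : R[i]).

(* [p] stands for the combination of the [x.1 k_(x.2)], [x \in p], of the
   reproducing kernels [k_z] of the Fock space. *)
Definition kf p q : R[i] :=
  \sum_(x <- p) \sum_(y <- q) x.1 * y.1^* * cexp (pi%:C * x.2 * y.2^*).

Definition scal c p : seq (R[i] * R[i]) := [seq (c * x.1, x.2) | x <- p].

(** The entire function [kf [:: (1, w)] p] of [w] has as Taylor coefficients [pi^k / k!] times the
    conjugates of these sums. *)
Definition bsum p k : R[i] := \sum_(x <- p) x.1 * x.2 ^+ k.

Definition qf p : R := complex.Re (kf p p).

Lemma kf_catl p q r : kf (p ++ q) r = kf p r + kf q r.
Proof. by rewrite /kf big_cat. Qed.

Lemma kf_catr p q r : kf r (p ++ q) = kf r p + kf r q.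
Proof. by rewrite /kf -big_split /=; apply: eq_bigr => x _; rewrite big_cat. Qed.

Lemma kf_scall c p q : kf (scal c p) q = c * kf p q.
Proof.
rewrite /kf big_map mulr_sumr; apply: eq_bigr => x _.
by rewrite mulr_sumr; apply: eq_bigr => y _; rewrite /= !mulrA.
Qed.

Lemma kf_scalr c p q : kf p (scal c q) = c^* * kf p q.
Proof.
rewrite /kf mulr_sumr; apply: eq_bigr => x _.
rewrite big_map mulr_sumr; apply: eq_bigr => y _ /=.
by rewrite rmorphM /=; ring.
Qed.

Lemma kf_conj p q : kf q p = (kf p q)^*.
Proof.
rewrite /kf exchange_big /= rmorph_sum; apply: eq_bigr => x _.
rewrite rmorph_sum; apply: eq_bigr => y _.
have E (a b v : R[i]) : (a * b * cexp v)^* = a^* * b^* * cexp v^*.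
  by rewrite cexp_conj; move: (cexp v) => f; rewrite !rmorphM.
rewrite /= E conjCK [y.1 * _]mulrC; congr (_ * cexp _).
by case: (x.2) (y.2) => a b [a' b']; apply: eq_ReIm => /=; ring.
Qed.

Lemma kf_qf p : kf p p = (qf p)%:C.
Proof.
have := kf_conj p p; rewrite /qf; case: (kf p p) => a b [] h.
by apply: eq_ReIm => //=; lra.
Qed.

Lemma kf_series p q : exists2 K, 0 <= K & forall n,
  normc (kf p q - \sum_(k < n) (pi ^+ k / k`!%:R)%:C * (bsum p k * (bsum q k)^*)) <= K / 2 ^+ n.
Proof.
have ex (t : R[i] * R[i]) : exists K, 0 <= K /\ forall n, normc (cexp (pi%:C * t.1 * t.2) -
    psum (fun k => (pi%:C * t.1) ^+ k / k`!%:R) n t.2) <= K / 2 ^+ n.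
  by have [K K0 h] := ent_lim t.2 (entire_cexp (pi%:C * t.1)); exists K.
have [K KP] := choice ex.
exists (\sum_(x <- p) \sum_(y <- q) normc (x.1 * y.1^*) * K (x.2, y.2^*)).
  apply: sumr_ge0 => x _; apply: sumr_ge0 => y _.
  by rewrite mulr_ge0 ?normc_ge0//; have [] := KP (x.2, y.2^*).
move=> n.
have -> : \sum_(k < n) (pi ^+ k / k`!%:R)%:C * (bsum p k * (bsum q k)^*) =
    \sum_(x <- p) \sum_(y <- q) x.1 * y.1^* *
      psum (fun k => (pi%:C * x.2) ^+ k / k`!%:R) n y.2^*.
  under [RHS]eq_bigr do under eq_bigr do rewrite mulr_sumr.
  under [RHS]eq_bigr do rewrite exchange_big.
  rewrite [RHS]exchange_big; apply: eq_bigr => k _ /=.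
  rewrite rmorph_sum /= mulr_suml mulr_sumr; apply: eq_bigr => x _.
  rewrite mulr_sumr mulr_sumr; apply: eq_bigr => y _.
  rewrite !rmorphM rmorphXn fmorphV rmorph_nat rmorphXn /= exprMn.
  by ring.
rewrite /kf -sumrB; apply: (le_trans (normc_sum _ _ _)).
rewrite mulr_suml; apply: ler_sum => x _.
rewrite -sumrB; apply: (le_trans (normc_sum _ _ _)).
rewrite mulr_suml; apply: ler_sum => y _.
rewrite -mulrBr normcM -[leRHS]mulrA ler_wpM2l ?normc_ge0//.
by have [_] := KP (x.2, y.2^*); apply.
Qed.

Lemma qf_series p : exists2 K, 0 <= K & forall n,
  `|qf p - \sum_(k < n) pi ^+ k / k`!%:R * normc (bsum p k) ^+ 2| <= K / 2 ^+ n.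
Proof.
have [K K0 h] := kf_series p p; exists K => // n.
apply: le_trans (h n); apply: le_trans (ler_Re_normc _).
rewrite ReD ReN le_eqVlt; apply/orP; left; apply/eqP.
congr (`| _ - _|); rewrite Re_sum; apply: eq_bigr => k _.
by rewrite mulc_conj -rmorphM.
Qed.

(** The series of [qf] in powers has nonnegative terms; truncating it is Bessel's inequality for the
    monomials, and positivity of the form is the case [K = 0]. *)
Lemma bessel_kf p K : \sum_(k < K) pi ^+ k / k`!%:R * normc (bsum p k) ^+ 2 <= qf p.
Proof.
have [C C0 h] := qf_series p; apply: (@le_geo _ _ _ C) => n.
have term0 k : 0 <= pi ^+ k / k`!%:R * normc (bsum p k) ^+ 2 :> R.
  by rewrite mulr_ge0 ?sqr_ge0// divr_ge0// exprn_ge0// pi_ge0.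
have := h (maxn n K); rewrite ler_norml => /andP[h1 _].
have : \sum_(k < K) pi ^+ k / k`!%:R * normc (bsum p k) ^+ 2 <=
    \sum_(k < maxn n K) pi ^+ k / k`!%:R * normc (bsum p k) ^+ 2.
  rewrite -!(big_mkord xpredT (fun k => pi ^+ k / k`!%:R * normc (bsum p k) ^+ 2)).
  by rewrite [leRHS](big_cat_nat (leq0n K) (leq_maxr n K)) /= lerDl sumr_ge0.
have : C / 2 ^+ maxn n K <= C / 2 ^+ n.
  by rewrite ler_wpM2l// lef_pV2 ?posrE ?exprn_gt0// ler_eXn2l ?ltr1n// leq_maxl.
lra.
Qed.

Lemma qf_ge0 p : 0 <= qf p.
Proof. by have := bessel_kf p 0; rewrite big_ord0. Qed.

Lemma quad_disc (A K B : R) : 0 <= K -> 0 <= B ->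
  (forall s : R, 0 <= A - 2 * s * K + s ^+ 2 * K * B) -> K <= A * B.
Proof.
move=> K0 B0 h; have [BE|Bn] := eqVneq B 0.
  rewrite BE mulr0 leNgt; apply/negP => Kp.
  have := h ((A + 1) / (2 * K)); rewrite BE mulr0 addr0.
  have -> : 2 * ((A + 1) / (2 * K)) * K = A + 1 by field; rewrite gt_eqF.
  lra.
have Bp : 0 < B by rewrite lt_neqAle eq_sym Bn.
have := h B^-1; have -> : A - 2 * B^-1 * K + B^-1 ^+ 2 * K * B = A - K / B by field.
by rewrite subr_ge0 ler_pdivrMr.
Qed.

Lemma qf_addZ p q c : qf (p ++ scal c q) =
  qf p + 2 * complex.Re (c^* * kf p q) + normc c ^+ 2 * qf q.
Proof.
rewrite {1}/qf kf_catl !kf_catr !kf_scall !kf_scalr (kf_conj p q) (kf_qf p) (kf_qf q).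
rewrite mulrA mulc_conj !ReD -rmorphM /=.
have -> : complex.Re (c * (kf p q)^*) = complex.Re (c^* * kf p q).
  by case: c (kf p q) => a b [a' b'] /=; ring.
ring.
Qed.

(* Cauchy-Schwarz for the form [qf] shifted by its minimum [A - e]. *)
Lemma qf_near_min p q (A e : R) : (forall c, A - e <= qf (p ++ scal c q)) -> qf p <= A ->
  normc (kf p q) ^+ 2 <= e * qf q.
Proof.
move=> h pA; apply: quad_disc; rewrite ?sqr_ge0 ?qf_ge0// => s.
have := h (- s%:C * kf p q); rewrite qf_addZ.
have -> : complex.Re ((- s%:C * kf p q)^* * kf p q) = - s * normc (kf p q) ^+ 2.
  by rewrite sqr_normcE; case: (kf p q) => a b /=; ring.
rewrite normcM normcN normc_real exprMn real_normK ?num_real//.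
lra.
Qed.

Lemma kf_CS p q : normc (kf p q) ^+ 2 <= qf p * qf q.
Proof. by apply: (@qf_near_min _ _ (qf p)) => // c; rewrite subrr qf_ge0. Qed.

End Kernel.

(** * Cauchy estimates and locally uniform limits *)

Section EntireLimit.
Variable R : realType.

(** Obtained from [parseval_le] by keeping a single coefficient, at the price of the factor 2. *)
Lemma cauchy_est (a : nat -> R[i]) F (rho B : R) : ent a F -> 0 < rho ->
  (forall z, normc z <= rho -> normc (F z) <= B) -> forall k, normc (a k) * rho ^+ k <= 2 * B.
Proof.
move=> aF rho0 FB k.
have B0 : 0 <= B by apply: le_trans (FB 0 _); rewrite ?normc_ge0// normc0 ltW.
have h : \sum_(j < k.+1) normc (a j) ^+ 2 * rho ^+ (2 * j) <= 2 * B ^+ 2.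
  apply: (parseval_le aF (ltW rho0)) => n; exists n => //.
  apply: (@le_trans _ _ (\sum_(j < 4 * n) B ^+ 2)).
    apply: ler_sum => j _; rewrite lerXn2r ?nnegrE ?normc_ge0//; apply: FB.
    by rewrite (normc_circ _ _ (ltW rho0)).
  by rewrite sumr_const card_ord mulr_natl.
have rk : 0 <= rho ^+ k by rewrite exprn_ge0// ltW.
rewrite -(@ler_pXn2r _ 2) ?nnegrE ?mulr_ge0 ?normc_ge0//.
apply: (@le_trans _ _ (2 * B ^+ 2)); last by rewrite exprMn ler_wpM2r ?sqr_ge0// expr2; lra.
apply: le_trans h; rewrite big_ord_recr /= exprMn -exprM mulnC lerDr.
by apply: sumr_ge0 => j _; rewrite mulr_ge0 ?sqr_ge0// exprn_ge0// ltW.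
Qed.

(** By Cauchy's estimate the coefficients converge geometrically at every radius; radius [2 * rho]
    makes the errors summable over the coefficients on [|z| <= rho]. *)
Lemma entire_lim (F : nat -> R[i] -> R[i]) : (forall m, entire (F m)) ->
  (forall rho : R, 0 < rho -> exists K, forall m z, normc z <= rho ->
     normc (F m.+1 z - F m z) <= K / 2 ^+ m) ->
  exists2 H, entire H & forall rho : R, 0 < rho -> exists K, forall m z, normc z <= rho ->
     normc (H z - F m z) <= K / 2 ^+ m.
Proof.
move=> eF cF; have [a aF] := choice eF.
have dE m : ent (fun k => a m.+1 k + -1 * a m k) (fun z => F m.+1 z + -1 * F m z).
  by apply: entD => //; exact: entZ.
have ac (rho : R) : 0 < rho -> exists2 K, 0 <= K & forall m k,
    normc (a m.+1 k - a m k) * rho ^+ k <= K / 2 ^+ m.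
  move=> rho0; have [K KP] := cF rho rho0; exists (2 * `|K|); first by rewrite mulr_ge0.
  move=> m k; have := @cauchy_est _ _ rho (`|K| / 2 ^+ m) (dE m) rho0.
  rewrite -mulrA => h; rewrite -mulN1r; apply: h => z zr; rewrite mulN1r.
  by apply: le_trans (KP m z zr) _; rewrite ler_wpM2r ?ler_norm// invr_ge0 exprn_ge0.
have bex k : exists b, exists K, forall m, normc (b - a m k) <= K / 2 ^+ m.
  have [K K0 KP] := ac 1 ltr01.
  have [m|l lP] := @complex_geo_lim _ (fun m => a m k) K.
    by have := KP m k; rewrite expr1n mulr1.
  by exists l, (4 * K).
have [b bP] := choice bex.
have bc (rho : R) : 0 < rho -> exists2 K, 0 <= K & forall m k,
    normc (b k - a m k) * rho ^+ k <= K / 2 ^+ m.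
  move=> rho0; have [K K0 KP] := ac rho rho0; exists (4 * K); first by rewrite mulr_ge0.
  move=> m k; have [m'|l lP] := @complex_geo_lim _ (fun m => a m k * (rho ^+ k)%:C) K.
    have := KP m' k; rewrite -mulrBl normcM normc_real ger0_norm//.
    by rewrite exprn_ge0// ltW.
  have lE : l = b k * (rho ^+ k)%:C.
    have [L LP] := bP k.
    apply: (@eq_geo _ _ _ (4 * K + L * rho ^+ k)) => n.
    have -> : l - b k * (rho ^+ k)%:C = (l - a n k * (rho ^+ k)%:C) + (a n k - b k) * (rho ^+ k)%:C.
      by ring.
    apply: le_trans (normcD _ _) _; rewrite [leRHS]mulrDl; apply: lerD; first exact: lP.
    have rk : 0 <= rho ^+ k by rewrite exprn_ge0// ltW.
    rewrite normcM normc_distC normc_real ger0_norm//.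
    by rewrite mulrAC ler_wpM2r.
  by have := lP m; rewrite lE -mulrBl normcM normc_real ger0_norm// exprn_ge0// ltW.
have db : dec b.
  move=> rho rho0; have [K K0 KP] := bc rho rho0.
  have [L LP] := ent_dec (aF 0%N) rho0; exists (K + L) => k.
  have := KP 0%N k; rewrite expr0 divr1 => h.
  have -> : b k = (b k - a 0%N k) + a 0%N k by rewrite subrK.
  apply: (@le_trans _ _ ((normc (b k - a 0%N k) + normc (a 0%N k)) * rho ^+ k)).
    by rewrite ler_wpM2r ?normcD// exprn_ge0// ltW.
  by rewrite mulrDl; apply: lerD.
have [H bH] := dec_ent db.
exists H; first by exists b.
move=> rho rho0; have r2 : 0 < 2 * rho by rewrite mulr_gt0.
have [K K0 KP] := bc _ r2; exists (2 * K) => m z zr.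
have [L L0 LP] := ent_lim z bH; have [M M0 MP] := ent_lim z (aF m).
apply: (@le_geo _ _ _ (L + M)) => n.
have -> : H z - F m z = (H z - psum b n z) + (psum b n z - psum (a m) n z) - (F m z - psum (a m) n z).
  by ring.
apply: (le_trans (normcB _ _)); apply: (le_trans (lerD (normcD _ _) (lexx _))).
have mid : normc (psum b n z - psum (a m) n z) <= 2 * K / 2 ^+ m.
  rewrite /psum -sumrB; apply: (le_trans (normc_sum _ _ _)).
  apply: (@le_trans _ _ (\sum_(k < n) K / 2 ^+ m * (2 ^+ k)^-1)).
    apply: ler_sum => k _; rewrite -mulrBl normcM normcX.
    rewrite ler_pdivlMr ?exprn_gt0// -mulrA -exprMn; apply: le_trans (KP m k).
    rewrite ler_wpM2l ?normc_ge0// lerXn2r ?nnegrE ?mulr_ge0 ?normc_ge0 ?(ltW rho0)//.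
    by rewrite mulrC ler_pM2l.
  rewrite -mulr_sumr.
  have geo : \sum_(k < n) (2 ^+ k)^-1 <= 2 - 2 * (2 ^+ n)^-1 :> R.
    elim: n => [|n' IHn]; first by rewrite big_ord0 expr0 invr1 mulr1 subrr.
    rewrite big_ord_recr /= exprS invfM; move: IHn; move: ((2 ^+ n')^-1 : R) => y; lra.
  have -> : 2 * K / 2 ^+ m = K / 2 ^+ m * 2 by rewrite -mulrA mulrC.
  apply: ler_wpM2l; first by rewrite divr_ge0// exprn_ge0.
  have : 0 <= (2 ^+ n)^-1 :> R by rewrite invr_ge0 exprn_ge0.
  move: (2 ^+ n)^-1 geo => y geo; lra.
have := LP n; have := MP n; rewrite mulrDl; lra.
Qed.

End EntireLimit.

(** * Bessel inequality at the points of a diagonal *)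

Section Schur.
Variable R : realType.
Implicit Types (p q : seq (R[i] * R[i])).

(** [(j - l) + (l - j)] is the distance of [j] and [l], one of the truncated differences being 0. *)
Lemma geo_dist_le (j J : nat) : \sum_(0 <= l < J) (2 ^+ ((j - l) + (l - j)))^-1 <= 4 :> R.
Proof.
have pow0 n : 0 <= (2 ^+ n)^-1 :> R by rewrite invr_ge0 exprn_ge0.
have geo n : \sum_(0 <= l < n) (2 ^+ l)^-1 <= 2 :> R.
  suff : \sum_(0 <= l < n) (2 ^+ l)^-1 = 2 - 2 * (2 ^+ n)^-1 :> R.
    by have := pow0 n; move: (2 ^+ n)^-1 => y; lra.
  elim: n => [|n IHn]; first by rewrite big_geq// expr0 invr1 mulr1 subrr.
  rewrite big_nat_recr//= IHn exprS invfM; move: (2 ^+ n)^-1 => y; lra.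
have right : \sum_(j <= l < J) (2 ^+ ((j - l) + (l - j)))^-1 <= 2 :> R.
  rewrite -{1}[j]add0n big_addn; apply: le_trans (geo (J - j)%N).
  by apply: ler_sum => l _; rewrite (_ : _ + _ = l)%N//; lia.
have left n : (n <= j)%N -> \sum_(0 <= l < n) (2 ^+ ((j - l) + (l - j)))^-1 <= 2 :> R.
  move=> nj; suff : \sum_(0 <= l < n) (2 ^+ ((j - l) + (l - j)))^-1 <= 2 * (2 ^+ (j - n).+1)^-1 :> R.
    move=> /le_trans; apply; rewrite exprS invfM mulVKf ?pnatr_eq0//.
    apply: (@le_trans _ _ 1); last by lra.
    by rewrite invf_le1 ?exprn_gt0// exprn_ege1// ler1n.
  elim: n nj => [|n IHn] nj; first by rewrite big_geq// mulr_ge0.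
  rewrite big_nat_recr//=; have := IHn (ltnW nj).
  have -> : ((j - n) + (n - j) = j - n)%N by lia.
  have -> : (j - n)%N = (j - n.+1).+1 by lia.
  rewrite (exprS _ (_.+1)) invfM; move: (2 ^+ _.+1)^-1 (\sum_(0 <= l < n) _) => y s; lra.
have [Jj|jJ] := leqP J j; first by apply: le_trans (left J Jj) _; lra.
by rewrite (big_cat_nat (leq0n j) (ltnW jJ)) /=; have := left j (leqnn j); lra.
Qed.

(** Schur's test and duality. The normalised kernels at the points [diag j] have Gram matrix
    [exp (- pi (j - l)^2 / 2)], dominated by [2^(- |j - l|)], whose row sums are at most 4. The
    combination [s] is the one for which Cauchy-Schwarz reads [X^2 <= 4 X * qf p]. *)
Lemma diag_schur p J :
  \sum_(2 <= j < J) normc (kf [:: (1, diag R j)] p) ^+ 2 * expR (- (pi * j%:R ^+ 2)) <= 4 * qf p.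
Proof.
pose g (j : nat) := expR (- (pi / 2 * j%:R ^+ 2)) : R.
pose x j := (g j)%:C * kf [:: (1, diag R j)] p.
have gg j : g j ^+ 2 = expR (- (pi * j%:R ^+ 2)).
  by rewrite -expRM_natr; congr expR; field.
have xE j : normc (kf [:: (1, diag R j)] p) ^+ 2 * expR (- (pi * j%:R ^+ 2)) = normc (x j) ^+ 2.
  by rewrite normcM normc_real ger0_norm ?expR_ge0// exprMn gg mulrC.
under eq_bigr do rewrite xE; set X := \sum_(2 <= j < J) _.
pose s := [seq ((x j)^* * (g j)%:C, diag R j) | j <- index_iota 2 J].
have sp : kf s p = X%:C.
  rewrite /kf big_map rmorph_sum; apply: eq_bigr => j _ /=.
  have -> : (normc (x j) ^+ 2)%:C = (x j)^* * (g j)%:C * kf [:: (1, diag R j)] p.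
    by rewrite -mulc_conj mulrC -mulrA.
  rewrite /kf big_seq1 mulr_sumr; apply: eq_bigr => y _ /=; ring.
have X0 : 0 <= X by apply: sumr_ge0 => j _; exact: sqr_ge0.
have gjl j l : g j * g l * expR (pi * (j%:R * l%:R)) <= (2 ^+ ((j - l) + (l - j)))^-1.
  wlog lj : j l / (l <= j)%N => [hw|].
    have [lj|jl] := leqP l j; first exact: hw.
    by rewrite [g j * _]mulrC [_%:R * _]mulrC addnC; apply: hw; exact: ltnW.
  rewrite -!expRD; have -> : ((j - l) + (l - j) = j - l)%N by lia.
  have jE : j%:R = l%:R + (j - l)%:R :> R by rewrite -natrD addnC subnK.
  rewrite jE; have -> : - (pi / 2 * (l%:R + (j - l)%:R) ^+ 2) + - (pi / 2 * l%:R ^+ 2) +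
     pi * ((l%:R + (j - l)%:R) * l%:R) = - (pi / 2 * (j - l)%:R ^+ 2) :> R by field.
  rewrite expRN lef_pV2 ?posrE ?expR_gt0 ?exprn_gt0//.
  apply: (@le_trans _ _ (expR ((j - l)%:R))).
    rewrite -[X in expR X]mul1r expRM_natr lerXn2r ?nnegrE ?expR_ge0//.
    by have := expR_ge1Dx (1 : R); lra.
  rewrite ler_expR; have := pihalf_ge1 R; move: (j - l)%N => n p1.
  have nn : n%:R <= n%:R ^+ 2 :> R by rewrite -natrX ler_nat; nia.
  by have := sqr_ge0 (n%:R : R); nra.
have qs : qf s <= 4 * X.
  have -> : 4 * X = \sum_(2 <= j < J) normc (x j) ^+ 2 * 4 by rewrite mulrC mulr_suml.
  apply: (@le_trans _ _ (\sum_(2 <= j < J) \sum_(2 <= l < J)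
     normc (x j) * normc (x l) * (2 ^+ ((j - l) + (l - j)))^-1)).
    rewrite /qf /kf big_map Re_sum; apply: ler_sum => j _.
    rewrite big_map Re_sum; apply: ler_sum => l _ /=.
    apply: (le_trans (ler_norm _)); apply: (le_trans (ler_Re_normc _)).
    set w := pi%:C * diag R j * (diag R l)^*.
    have Rw : complex.Re w = pi * (j%:R * l%:R).
      have -> : pi * (j%:R * l%:R) = pi * (2 * (j%:R / Num.sqrt 2 * (l%:R / Num.sqrt 2))) :> R.
        have -> : j%:R / Num.sqrt 2 * (l%:R / Num.sqrt 2) = j%:R * l%:R / Num.sqrt 2 ^+ 2 :> R.
          by rewrite mulrACA -invfM -expr2.
        by rewrite sqr_sqrtr//; field.
      by rewrite /w /=; ring.
    have nc (z : R[i]) : normc (z^*)%R = normc z by exact: normc_conj.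
    have ng (k : nat) : normc (g k)%:C = g k by rewrite normc_real ger0_norm ?expR_ge0.
    rewrite normcM normc_cexp Rw normcM nc !(normcM (_^*)%R) !nc !ng.
    rewrite (_ : normc (x j) * _ * _ * _ = normc (x j) * normc (x l) * (g j * g l * expR (pi * (j%:R * l%:R)))).
      by rewrite ler_wpM2l ?mulr_ge0 ?normc_ge0.
    by ring.
  have sym : \sum_(2 <= j < J) \sum_(2 <= l < J) normc (x l) ^+ 2 * (2 ^+ ((j - l) + (l - j)))^-1 =
     \sum_(2 <= j < J) \sum_(2 <= l < J) normc (x j) ^+ 2 * (2 ^+ ((j - l) + (l - j)))^-1.
    rewrite exchange_big /=; apply: eq_bigr => j _; apply: eq_bigr => l _.
    by rewrite addnC.
  apply: (@le_trans _ _ (\sum_(2 <= j < J) \sum_(2 <= l < J)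
     normc (x j) ^+ 2 * (2 ^+ ((j - l) + (l - j)))^-1)); last first.
    apply: ler_sum => j _; rewrite -mulr_sumr ler_wpM2l ?sqr_ge0//.
    apply: le_trans (geo_dist_le j J).
    have [J2|J2] := leqP J 2.
      by rewrite big_geq// sumr_ge0// => l _; rewrite invr_ge0 exprn_ge0.
    rewrite [leRHS](big_cat_nat (leq0n 2) (ltnW J2)) /= lerDr; apply: sumr_ge0 => l _.
    by rewrite invr_ge0 exprn_ge0.
  rewrite -(@ler_pM2l _ 2)// [leRHS](mulr_natl _ 2) [leRHS]mulr2n -{2}sym -big_split /= mulr_sumr.
  apply: ler_sum => j _; rewrite -big_split /= mulr_sumr; apply: ler_sum => l _.
  rewrite -mulrDl mulrA; apply: ler_wpM2r; first by rewrite invr_ge0 exprn_ge0.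
  by have := sqr_ge0 (normc (x j) - normc (x l)); rewrite sqrrB; lra.
have := kf_CS s p; rewrite sp normc_real (ger0_norm X0) => CS.
have [->|Xn] := eqVneq X 0; first by rewrite mulr_ge0// qf_ge0.
have Xp : 0 < X by rewrite lt_neqAle eq_sym Xn.
rewrite -(ler_pM2l Xp) -expr2; apply: (le_trans CS).
by rewrite mulrA [X * _]mulrC ler_wpM2r ?qf_ge0.
Qed.

End Schur.

(** * Completeness of the kernels at the points of Lambda *)

Section KernelComplete.
Variables (R : realType) (lam : nat -> R[i]) (d : R).
Hypothesis d0 : 0 <= d.
Hypothesis d1 : d < 1 / 2.
Hypothesis near : forall n : nat, (1 <= n)%N ->
  normc ((sqrt2n R n)%:C - lam n) <= d / sqrt2n R n.
Hypothesis lam_inj : forall m n : nat, (1 <= m)%N -> (1 <= n)%N ->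
  lam m = lam n -> m = n.
Implicit Types (z : R[i]) (p q r : seq (R[i] * R[i])).

Definition in_zeros p := forall x, x \in p -> exists N, x.2 \in zeros lam N.

Lemma qf_eq p q : (forall s, kf p s = kf q s) -> qf p = qf q.
Proof. by move=> h; rewrite /qf h kf_conj h -kf_conj. Qed.

Lemma entire_kf p : entire (fun w => kf [:: (1, w)] p).
Proof.
have -> : (fun w => kf [:: (1, w)] p) = (fun w => \sum_(y <- p) y.1^* * cexp (pi%:C * y.2^* * w)).
  apply/funext => w; rewrite /kf big_seq1; apply: eq_bigr => y _ /=.
  by rewrite mul1r mulrAC.
elim: p => [|y p IHp].
  have := entire_cst (0 : R[i]); congr entire; apply/funext => w; by rewrite big_nil.
have ey : entire (fun w : R[i] => cexp (pi%:C * y.2^* * w)) by eexists; exact: entire_cexp.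
have := entireD (entireZ (y.1^*) ey) IHp; congr entire; apply/funext => w.
by rewrite big_cons.
Qed.

Lemma qf_unit (w : R[i]) : qf [:: (1, w)] = expR (pi * normc w ^+ 2).
Proof.
rewrite -[LHS]ger0_norm ?qf_ge0// -normc_real -kf_qf /kf !big_seq1 normcM normc_cexp.
rewrite rmorph1 mulr1 normc1 mul1r sqr_normcE; congr expR.
by case: w => a b /=; ring.
Qed.

(** An almost minimal combination is almost orthogonal to everything supported on the zeros. *)
Lemma min_step (z0 : R[i]) (dl e : R) p q : (forall s, in_zeros s -> dl <= qf ((1, z0) :: s)) ->
  in_zeros p -> in_zeros q -> 0 <= e -> qf ((1, z0) :: p) <= dl + e ^+ 2 ->
  normc (kf ((1, z0) :: p) q) ^+ 2 <= e ^+ 2 * qf q.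
Proof.
move=> low pz qz e0 pe; apply: (@qf_near_min _ _ _ (dl + e ^+ 2)) => // c.
rewrite addrK; apply: low => x; rewrite mem_cat => /orP[/pz//|].
by move=> /mapP[y yq ->] /=; exact: qz.
Qed.

(** An orthogonal projection without the Hilbert space: the almost minimising combinations [r m] are
    Cauchy for [qf], the entire functions that they represent converge to some [H], orthogonality
    becomes [H = 0] on [Lambda], and [fock_uniqueness] gives [H z0 = 0], which forces the infimum to
    be 0. *)
Theorem kernel_complete (z0 : R[i]) (eps : R) : 0 < eps ->
  exists2 q, in_zeros q & qf ((1, z0) :: q) < eps.
Proof.
move=> eps0.
pose A : set R := [set x | exists2 q, in_zeros q & x = qf ((1, z0) :: q)].
have A0 : A !=set0 by exists (qf [:: (1, z0)]); exists [::].
have lA : has_lbound A by exists 0 => _ [q _ ->]; exact: qf_ge0.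
have hA : has_inf A by split.
set dl := inf A.
have low s : in_zeros s -> dl <= qf ((1, z0) :: s).
  by move=> sz; apply: ge_inf => //; exists s.
suff dl0 : dl <= 0.
  have : inf A < eps by exact: le_lt_trans eps0.
  by move=> /(inf_lt A0) [_ [q qz ->] qe]; exists q.
have dlp : 0 <= dl by apply: lb_le_inf => // _ [q _ ->]; exact: qf_ge0.
pose e m : R := (2 ^+ m)^-1.
have e0 m : 0 < e m by rewrite invr_gt0 exprn_gt0.
have eS m : e m.+1 = e m / 2 by rewrite /e exprS invfM mulrC.
have e1 m : e m <= 1 by rewrite invf_le1 ?exprn_gt0// exprn_ege1// ler1n.
have ex m : exists q, in_zeros q /\ qf ((1, z0) :: q) <= dl + e m ^+ 2.
  have [|_ [q qz ->] qe] := @inf_adherent _ A (e m ^+ 2) _ hA; first by rewrite exprn_gt0.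
  by exists q; split=> //; exact: ltW.
have [q qP] := choice ex.
have qz m : in_zeros (q m) by case: (qP m).
pose r m := (1, z0) :: q m.
have rE m : qf (r m) <= dl + e m ^+ 2 by case: (qP m).
have rB m : qf (r m) <= dl + 1.
  by apply: (le_trans (rE m)); rewrite lerD2l expr_le1// ltW.
pose F m w := kf [:: (1, w)] (r m).
pose D m := q m.+1 ++ scal (-1) (q m).
have Dz m : in_zeros (D m).
  move=> x; rewrite mem_cat => /orP[/qz//|/mapP[y yq ->]] /=; exact: qz yq.
have rD m s : kf (r m.+1) s = kf (r m ++ scal 1 (D m)) s.
  rewrite kf_catl kf_scall kf_catl kf_scall /r -(cat1s _ (q m.+1)) -(cat1s _ (q m)) !kf_catl; ring.
(* If [x] is the norm of the increment, almost orthogonality gives [x^2 - 2 e x <= e^2 / 4], hence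
   [x <= 3 e]. *)
have qD m : qf (D m) <= (3 * e m) ^+ 2.
  have := qf_addZ (r m) (D m) 1; rewrite -(qf_eq (rD m)) rmorph1 mul1r normc1 expr1n mul1r => E.
  have := min_step low (qz m) (Dz m) (ltW (e0 m)) (rE m); rewrite -/(r m) => h.
  have D0 := qf_ge0 (D m).
  set x := Num.sqrt (qf (D m)); have x0 : 0 <= x by exact: sqrtr_ge0.
  have xx : x ^+ 2 = qf (D m) by rewrite sqr_sqrtr.
  have k1 : normc (kf (r m) (D m)) <= e m * x.
    by rewrite -(@ler_pXn2r _ 2) ?nnegrE ?normc_ge0 ?mulr_ge0 ?(ltW (e0 m))// exprMn xx.
  have k2 := ler_Re_normc (kf (r m) (D m)); rewrite ler_norml in k2.
  have /andP[k3 _] := k2.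
  have := rE m.+1; have := low _ (qz m); rewrite -/(r m) eS => l1 l2.
  rewrite -xx in E *; rewrite lerXn2r ?nnegrE ?mulr_ge0 ?(ltW (e0 m))//.
  have em := e0 m; rewrite leNgt; apply/negP => xe.
  have : 3 * e m * x <= x * x by rewrite ler_wpM2r// ltW.
  rewrite expr_div_n !expr2 in E l2 *; have : e m * e m <= e m * x by rewrite ler_wpM2l ?ltW//; lra.
  have : 0 < e m * x by rewrite mulr_gt0//; lra.
  lra.
have cF (rho : R) : 0 < rho -> exists K, forall m z, normc z <= rho ->
     normc (F m.+1 z - F m z) <= K / 2 ^+ m.
  move=> rho0; exists (3 * expR (pi / 2 * rho ^+ 2)) => m z zr.
  have -> : F m.+1 z - F m z = kf [:: (1, z)] (D m).
    rewrite /F /r -(cat1s _ (q m.+1)) -(cat1s _ (q m)) !kf_catr kf_scalr rmorphN rmorph1.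
    ring.
  have K0 : 0 <= 3 * expR (pi / 2 * rho ^+ 2) / 2 ^+ m.
    by rewrite divr_ge0 ?exprn_ge0// mulr_ge0// expR_ge0.
  rewrite -(@ler_pXn2r _ 2) ?nnegrE ?normc_ge0//.
  apply: (le_trans (kf_CS _ _)); rewrite qf_unit.
  apply: (@le_trans _ _ (expR (pi * rho ^+ 2) * (3 * e m) ^+ 2)).
    apply: ler_pM; rewrite ?expR_ge0 ?qf_ge0// ler_expR ler_wpM2l ?pi_ge0//.
    by rewrite lerXn2r ?nnegrE ?normc_ge0 ?(ltW rho0).
  have -> : pi * rho ^+ 2 = pi / 2 * rho ^+ 2 * 2%:R by field.
  by rewrite expRM_natr /e le_eqVlt; apply/orP; left; apply/eqP; ring.
have [H eH HF] := entire_lim (fun m => entire_kf (r m)) cF.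
have HFz z : exists2 K, 0 <= K & forall m, normc (H z - F m z) <= K / 2 ^+ m.
  have z1 : 0 < normc z + 1 by rewrite ltr_wpDl ?normc_ge0.
  have [K KP] := HF _ z1; have h m : normc (H z - F m z) <= K / 2 ^+ m.
    by apply: KP; rewrite lerDl.
  exists K => //; have := h 0%N; rewrite expr0 divr1; apply: le_trans; exact: normc_ge0.
have FB m z : normc (F m z) ^+ 2 <= expR (pi * normc z ^+ 2) * (dl + 1).
  apply: (le_trans (kf_CS _ _)); rewrite qf_unit ler_wpM2l ?expR_ge0//; exact: rB.
have HB z : normc (H z) <= Num.sqrt (dl + 1) * expR (pi / 2 * normc z ^+ 2).
  have [K K0 KP] := HFz z; apply: (@le_geo _ _ _ K) => m.
  have h : normc (F m z) <= Num.sqrt (dl + 1) * expR (pi / 2 * normc z ^+ 2).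
    rewrite -(@ler_pXn2r _ 2) ?nnegrE ?normc_ge0 ?mulr_ge0 ?sqrtr_ge0 ?expR_ge0//.
    apply: (le_trans (FB m z)); rewrite exprMn sqr_sqrtr; last by lra.
    rewrite -expRM_natr mulrC ler_wpM2l//; first lra.
    by rewrite ler_expR; lra.
  by have := normc_ge_sub (H z) (F m z); have := KP m; lra.
have H0 N l : l \in zeros lam N -> H l = 0.
  move=> lN; have [K K0 KP] := HFz l.
  have l1 : in_zeros [:: (1, l)] by move=> x; rewrite inE => /eqP ->; exists N.
  apply: (@eq_geo _ _ _ (K + Num.sqrt (qf [:: (1, l)]))) => m; rewrite subr0 mulrDl.
  have h : normc (F m l) <= Num.sqrt (qf [:: (1, l)]) / 2 ^+ m.
    rewrite -(@ler_pXn2r _ 2) ?nnegrE ?normc_ge0 ?divr_ge0 ?sqrtr_ge0 ?exprn_ge0//.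
    rewrite /F kf_conj normc_conj; apply: le_trans (min_step low (qz m) l1 (ltW (e0 m)) (rE m)) _.
    by rewrite [leRHS]exprMn sqr_sqrtr ?qf_ge0// mulrC.
  by have := normc_ge_sub (H l) (F m l); have := KP m; lra.
have bes : exists S, forall J,
    \sum_(2 <= j < J) normc (H (diag R j)) ^+ 2 * expR (- (pi * j%:R ^+ 2)) <= S.
  exists (2 * (4 * (dl + 1))) => J.
  have [K KP] := choice (fun j => let: ex_intro2 K K0 KP := HFz (diag R j) in
     ex_intro (fun K => forall m, normc (H (diag R j) - F m (diag R j)) <= K / 2 ^+ m) K KP).
  apply: (@le_geo _ _ _ (\sum_(2 <= j < J) 2 * K j ^+ 2)) => m.
  apply: (@le_trans _ _ (\sum_(2 <= j < J) (2 * (normc (F m (diag R j)) ^+ 2 *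
     expR (- (pi * j%:R ^+ 2))) + 2 * K j ^+ 2 / 2 ^+ m))).
    apply: ler_sum => j _; have h := KP j m.
    have ej0 : 0 <= expR (- (pi * j%:R ^+ 2)) :> R by exact: expR_ge0.
    have ej1 : expR (- (pi * j%:R ^+ 2)) <= 1 :> R.
      by rewrite -[leRHS]expR0 ler_expR oppr_le0 mulr_ge0 ?sqr_ge0 ?pi_ge0.
    have hK : normc (H (diag R j)) <= normc (F m (diag R j)) + normc (H (diag R j) - F m (diag R j)).
      by have := normc_ge_sub (H (diag R j)) (F m (diag R j)); lra.
    have hs : normc (H (diag R j) - F m (diag R j)) ^+ 2 <= K j ^+ 2 / 2 ^+ m.
      apply: (@le_trans _ _ ((K j / 2 ^+ m) ^+ 2)).
        by rewrite lerXn2r ?nnegrE ?normc_ge0// (le_trans (normc_ge0 _) h).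
      rewrite expr_div_n ler_wpM2l ?sqr_ge0// lef_pV2 ?posrE ?exprn_gt0//.
      by rewrite -exprM ler_eXn2l ?ltr1n// muln2 -addnn leq_addr.
    apply: (@le_trans _ _ ((2 * normc (F m (diag R j)) ^+ 2 + 2 * (K j ^+ 2 / 2 ^+ m)) *
       expR (- (pi * j%:R ^+ 2)))).
      rewrite ler_wpM2r//; apply: (@le_trans _ _ ((normc (F m (diag R j)) + normc (H (diag R j) - F m (diag R j))) ^+ 2)).
        by rewrite lerXn2r ?nnegrE ?addr_ge0 ?normc_ge0.
      have := sqr_ge0 (normc (F m (diag R j)) - normc (H (diag R j) - F m (diag R j))).
      rewrite sqrrB sqrrD; lra.
    rewrite mulrDl -mulrA lerD2l mulrA ler_piMr//.
    by apply: divr_ge0; [rewrite mulr_ge0// sqr_ge0|rewrite exprn_ge0].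
  rewrite big_split /= -mulr_sumr -mulr_suml lerD2r ler_pM2l//.
  apply: (le_trans (diag_schur (r m) J)); rewrite ler_pM2l//; exact: rB.
have Hz := fock_uniqueness d0 d1 near lam_inj eH HB H0 bes z0.
have [K K0 KP] := HFz z0.
pose B := 3 * (dl + 1 + expR (pi * normc z0 ^+ 2)).
have B0 : 0 <= B by rewrite mulr_ge0// addr_ge0 ?expR_ge0//; lra.
have qB m : qf (q m) <= B.
  have -> : qf (q m) = qf (r m ++ scal (-1) [:: (1, z0)]).
    apply: qf_eq => s; rewrite /r -(cat1s (1, z0) (q m)) !kf_catl kf_scall; ring.
  rewrite qf_addZ normcN normc1 expr1n mul1r.
  rewrite rmorphN rmorph1 mulN1r ReN.
  have h := kf_CS (r m) [:: (1, z0)].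
  have a0 := qf_ge0 (r m); have b0 := qf_ge0 [:: (1, z0)].
  have k1 : normc (kf (r m) [:: (1, z0)]) <= qf (r m) + qf [:: (1, z0)].
    rewrite -(@ler_pXn2r _ 2) ?nnegrE ?normc_ge0 ?addr_ge0//; apply: (le_trans h).
    rewrite sqrrD; have := mulr_ge0 a0 b0; have := sqr_ge0 (qf (r m)); have := sqr_ge0 (qf [:: (1, z0)]).
    lra.
  have := ler_Re_normc (kf (r m) [:: (1, z0)]); rewrite ler_norml => /andP[k2 _].
  have := rB m; rewrite /B -qf_unit; lra.
apply: (@le_geo _ _ _ (K + Num.sqrt B)) => m; rewrite add0r mulrDl.
apply: (le_trans (low _ (qz m))); rewrite -/(r m).
(* [r m] consists of the kernel at [z0], which pairs to [F m z0], and of [q m], which is supported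
   on the zeros and so almost orthogonal to [r m]. *)
have -> : qf (r m) = complex.Re (F m z0) + complex.Re (kf (q m) (r m)).
  by rewrite -ReD /F -kf_catl.
apply: lerD.
  apply: le_trans (KP m); rewrite Hz sub0r normcN.
  by apply: (le_trans (ler_norm _)); exact: ler_Re_normc.
apply: (le_trans (ler_norm _)); apply: (le_trans (ler_Re_normc _)).
rewrite kf_conj normc_conj -(@ler_pXn2r _ 2) ?nnegrE ?normc_ge0 ?divr_ge0 ?sqrtr_ge0 ?exprn_ge0//.
apply: le_trans (min_step low (qz m) (qz m) (ltW (e0 m)) (rE m)) _.
rewrite [leRHS]exprMn sqr_sqrtr// [leRHS]mulrC ler_wpM2l ?sqr_ge0//; exact: qB.
Qed.

End KernelComplete.

(** * Gaussian integrals of complex exponentials *)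

Section GaussianTransform.
Variable R : realType.
Local Notation mu := (@lebesgue_measure R).
Implicit Types (f g : R -> R) (a : R) (c s z : R[i]).

Definition itg f := mu.-integrable [set: R] (EFin \o f).
Definition ing f : R := Rintegral mu [set: R] f.

Lemma itg_measurable f : itg f -> measurable_fun [set: R] f.
Proof. by move=> /integrableP[/measurable_EFinP]. Qed.

Lemma itgD f g : itg f -> itg g -> itg (fun t => f t + g t).
Proof. by move=> hf hg; exact: integrableD hf hg. Qed.

Lemma itgZ a f : itg f -> itg (fun t => a * f t).
Proof. by move=> hf; exact: integrableZl hf. Qed.

Lemma itg_le f g : measurable_fun [set: R] f -> (forall t, `|f t| <= g t) -> itg g -> itg f.
Proof.
move=> mf fg hg; apply: le_integrable hg => //; first exact/measurable_EFinP.
by move=> t _ /=; rewrite lee_fin (le_trans (fg t))// ler_norm.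
Qed.

Lemma ingD f g : itg f -> itg g -> ing (fun t => f t + g t) = ing f + ing g.
Proof. by move=> hf hg; exact: RintegralD. Qed.

Lemma ingZ a f : itg f -> ing (fun t => a * f t) = a * ing f.
Proof. by move=> hf; exact: RintegralZl. Qed.

Lemma itg_ing_sum I (r : seq I) (F : I -> R -> R) : (forall i, itg (F i)) ->
  itg (fun t => \sum_(i <- r) F i t) /\
  ing (fun t => \sum_(i <- r) F i t) = \sum_(i <- r) ing (F i).
Proof.
move=> hF; elim: r => [|i r [h1 h2]].
  have -> : (fun t => \sum_(i <- [::]) F i t) = (fun=> 0) by apply/funext => t; rewrite big_nil.
  split; first exact: integrable0.
  by rewrite big_nil /ing /Rintegral integral0.
have -> : (fun t => \sum_(j <- i :: r) F j t) = (fun t => F i t + \sum_(j <- r) F j t).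
  by apply/funext => t; rewrite big_cons.
by split; [exact: itgD|rewrite ingD// h2 big_cons].
Qed.

Lemma ing_le f g : measurable_fun [set: R] f -> (forall t, `|f t| <= g t) -> itg g ->
  `|ing f| <= ing g.
Proof.
move=> mf fg hg; have hf := itg_le mf fg hg.
apply: le_trans (le_normr_Rintegral measurableT hf) _.
apply: le_Rintegral => //; exact: integrable_norm.
Qed.

Definition gsn (t : R) : R := expR (- (2 * pi * t ^+ 2)).

(** Completing the square yields the normal density of mean [a / (4 pi)] and variance
    [1 / (4 pi)]. *)
Lemma gsn_exp a : itg (fun t => expR (a * t) * gsn t) /\
  ing (fun t => expR (a * t) * gsn t) = expR (a ^+ 2 / (8 * pi)) / Num.sqrt 2.
Proof.
have p0 : 0 < pi :> R by exact: pi_gt0.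
pose s : R := (Num.sqrt (4 * pi))^-1.
have p4 : 0 < 4 * pi :> R by rewrite mulr_gt0.
have s0 : s != 0 by rewrite invr_eq0 gt_eqF// sqrtr_gt0.
have s2 : s ^+ 2 = (4 * pi)^-1 by rewrite /s exprVn sqr_sqrtr// ltW.
have pk : normal_peak s = Num.sqrt 2.
  rewrite /normal_peak s2 -mulr_natl.
  have -> : 2 * ((4 * pi)^-1 * pi) = 2^-1 :> R by move: (pi : R) p0 => p p0; field; rewrite gt_eqF.
  by rewrite sqrtrV// invrK.
have E t : expR (a * t) * gsn t =
    expR (a ^+ 2 / (8 * pi)) / Num.sqrt 2 * normal_pdf (a / (4 * pi)) s t.
  rewrite normal_pdfE// -[X in _ = _ * X]/(normal_peak s * normal_fun (a / (4 * pi)) s t).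
  rewrite pk /normal_fun s2 -mulr_natl.
  rewrite mulrA mulfVK ?gt_eqF ?sqrtr_gt0// /gsn -!expRD; congr expR.
  by move: (pi : R) p0 => p p0; field; rewrite gt_eqF.
have -> : (fun t => expR (a * t) * gsn t) =
    (fun t => expR (a ^+ 2 / (8 * pi)) / Num.sqrt 2 * normal_pdf (a / (4 * pi)) s t).
  exact/funext.
have h := integrable_normal_pdf (a / (4 * pi)) s.
split; first exact: itgZ.
by rewrite ingZ// /ing /Rintegral integral_normal_pdf mulr1.
Qed.

Lemma measurable_gsn : measurable_fun [set: R] gsn.
Proof.
have [/itg_measurable h _] := gsn_exp 0; move: h.
by congr measurable_fun; apply/funext => t; rewrite mul0r expR0 mul1r.
Qed.

(** Keeps all integrals real: varying [c] recovers both components of the complex integral. *)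
Definition phi c s (t : R) : R := complex.Re (c * cexp (s * t%:C)).

Lemma phi_bound c s t : `|phi c s t| <= normc c * expR (complex.Re s * t).
Proof.
apply: le_trans (ler_Re_normc _) _; rewrite normcM normc_cexp ReM /=.
by rewrite mulr0 subr0.
Qed.

Lemma measurable_phi c s : measurable_fun [set: R] (phi c s).
Proof.
have -> : phi c s = (fun t => expR (complex.Re s * t) *
   (complex.Re c * cos (complex.Im s * t) - complex.Im c * sin (complex.Im s * t))).
  apply/funext => t; rewrite /phi /cexp /expi; case: c s => x y [u v] /=; rewrite !(mulr0, subr0, addr0, add0r, mul0r); ring.
have lin (b : R) : measurable_fun [set: R] (fun t => b * t) by exact: measurable_funM.
apply: measurable_funM; first exact: measurableT_comp.
apply: measurable_funB; apply: measurable_funM => //; apply: measurableT_comp => //.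
- by apply: continuous_measurable_fun => ?; exact: continuous_cos.
- by apply: continuous_measurable_fun => ?; exact: continuous_sin.
Qed.

Lemma itg_phi c s : itg (fun t => phi c s t * gsn t).
Proof.
have [h _] := gsn_exp (complex.Re s); apply: itg_le (itgZ (normc c) h).
  by apply: measurable_funM; [exact: measurable_phi|exact: measurable_gsn].
move=> t; rewrite normrM (ger0_norm (expR_ge0 _)) mulrA ler_wpM2r ?expR_ge0//.
exact: phi_bound.
Qed.

Definition cosh_bound (a : R) (t : R) : R := expR (a * t) * gsn t + expR (- a * t) * gsn t.

Lemma itg_cosh a : itg (cosh_bound a).
Proof. by apply: itgD; [case: (gsn_exp a)|case: (gsn_exp (- a))]. Qed.

Lemma expR_norm_le a t : 0 <= a -> expR (a * `|t|) * gsn t <= cosh_bound a t.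
Proof.
move=> a0; rewrite /cosh_bound -mulrDl ler_wpM2r ?expR_ge0//.
have [t0|t0] := leP 0 t; first by rewrite (ger0_norm t0) lerDl expR_ge0.
by rewrite (ltr0_norm t0) mulrN mulNr lerDr expR_ge0.
Qed.

Lemma mom_bound a t k : 0 <= a -> `|(a * t) ^+ k / k`!%:R * gsn t| <= cosh_bound a t.
Proof.
move=> a0; apply: le_trans (expR_norm_le t a0).
rewrite normrM (ger0_norm (expR_ge0 _)) ler_wpM2r ?expR_ge0//.
rewrite normrM normrX normrM (ger0_norm a0) [`|_^-1|]ger0_norm ?invr_ge0//.
by apply: expn_fact_le; rewrite mulr_ge0.
Qed.

Lemma itg_mom k : itg (fun t => t ^+ k / k`!%:R * gsn t).
Proof.
apply: itg_le (itg_cosh 1).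
  apply: measurable_funM; last exact: measurable_gsn.
  by apply: measurable_funM => //; exact: measurable_funX.
by move=> t; have := mom_bound t k ler01; rewrite mul1r.
Qed.

Definition mom k : R := ing (fun t => t ^+ k / k`!%:R * gsn t).

Lemma dec_mom : dec (fun k => (mom k)%:C).
Proof.
move=> rho rho0; exists (ing (cosh_bound rho)) => k.
rewrite normc_real -[X in _ * X]ger0_norm ?exprn_ge0 ?(ltW rho0)// -normrM mulrC.
rewrite /mom -ingZ; last exact: itg_mom.
apply: ing_le; last exact: itg_cosh.
  by apply: measurable_funM => //; exact: itg_measurable (itg_mom k).
move=> t; have := mom_bound t k (ltW rho0); rewrite exprMn.
by rewrite !mulrA.
Qed.

(** Term by term integration of the exponential series, by the remainder bound rather than by a
    convergence theorem. *)
Lemma phi_series c s : exists2 K, 0 <= K & forall n,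
  `|ing (fun t => phi c s t * gsn t) - complex.Re (c * psum (fun k => (mom k)%:C) n s)| <= K / 2 ^+ n.
Proof.
(* Of the factor 3, two parts pay for [2 ^+ n] and one for the exponential in the remainder. *)
pose a := 3 * normc s; have a0 : 0 <= a by rewrite mulr_ge0 ?normc_ge0.
have C0 : 0 <= ing (cosh_bound a).
  by apply: Rintegral_ge0 => t _; rewrite addr_ge0// mulr_ge0 ?expR_ge0.
exists (normc c * ing (cosh_bound a)); first by rewrite mulr_ge0 ?normc_ge0.
move=> n.
pose T (k : 'I_n) t := complex.Re (c * s ^+ k) * (t ^+ k / k`!%:R * gsn t).
have hT k : itg (T k) by apply: itgZ; exact: itg_mom.
have [S1 S2] := itg_ing_sum (index_enum 'I_n) hT.
have -> : complex.Re (c * psum (fun k => (mom k)%:C) n s) = ing (fun t => \sum_k T k t).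
  rewrite S2 /psum mulr_sumr Re_sum; apply: eq_bigr => k _.
  rewrite /T ingZ; last exact: itg_mom.
  rewrite -/(mom k); case: (s ^+ k) => x y; case: (c) => u v /=; ring.
rewrite -[X in _ - X]mul1r -mulNr -(ingZ (-1) S1).
have hS := itgZ (-1) S1; rewrite -(ingD (itg_phi c s) hS).
rewrite mulrAC -(ingZ _ (itg_cosh a)).
apply: ing_le; last exact/itgZ/itg_cosh.
  exact: itg_measurable (itgD (itg_phi c s) hS).
move=> t; rewrite mulN1r.
have -> : \sum_k T k t = complex.Re (c * \sum_(k < n) (s * t%:C) ^+ k / k`!%:R) * gsn t.
  rewrite mulr_sumr Re_sum mulr_suml; apply: eq_bigr => k _.
  rewrite /T [LHS]mulrA; congr (_ * _).
  have -> : c * ((s * t%:C) ^+ k / k`!%:R) = c * s ^+ k * (t ^+ k / k`!%:R)%:C.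
    by rewrite exprMn rmorphM rmorphXn fmorphV rmorph_nat /=; ring.
  by rewrite [in RHS]ReM /= mulr0 subr0.
rewrite -mulrBl normrM (ger0_norm (expR_ge0 _)).
rewrite /phi -ReN -ReD -mulrN -mulrDr.
apply: (@le_trans _ _ (normc c / 2 ^+ n * expR (a * `|t|) * gsn t)).
  rewrite ler_wpM2r ?expR_ge0//; apply: le_trans (ler_Re_normc _) _.
  rewrite normcM -mulrA ler_wpM2l ?normc_ge0//; apply: (le_trans (cexp_series _ n)).
  rewrite normcM normc_real; have x0 : 0 <= normc s * `|t| by rewrite mulr_ge0 ?normc_ge0.
  have -> : a * `|t| = 2 * (normc s * `|t|) + normc s * `|t| by rewrite /a; ring.
  move: (normc s * `|t|) x0 => x x0; rewrite expRD mulrA ler_wpM2r ?expR_ge0//.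
  rewrite ler_pdivlMl ?exprn_gt0// mulrA -exprMn; apply: expn_fact_le.
  by rewrite mulr_ge0.
rewrite -mulrA ler_wpM2l ?expR_norm_le// divr_ge0 ?normc_ge0// exprn_ge0.
Qed.

(** Identity theorem on the real line, one coefficient at a time: the value at 0 is the first
    coefficient, and the quotient by [z] vanishes on the real line again, at 0 by continuity. *)
Lemma ent_real_step (b : nat -> R[i]) D : ent b D -> (forall x : R, D x%:C = 0) ->
  b 0%N = 0 /\ exists D', ent (fun k => b k.+1) D' /\ forall x : R, D' x%:C = 0.
Proof.
move=> bD D0; have b0 : b 0%N = 0.
  have [K _ KP] := ent_lim 0 bD; apply: (@eq_geo _ _ _ (K / 2)) => n.
  have := KP n.+1; rewrite (D0 0) psumSl mul0r addr0 normc_distC exprS.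
  by rewrite invfM mulrA.
split=> //; have [D' bD'] := dec_ent (dec_shift (ent_dec bD)); exists D'; split=> //.
have DE z : D z = z * D' z.
  have [K _ KP] := ent_lim z bD; have [L _ LP] := ent_lim z bD'.
  apply: (@eq_geo _ _ _ (K / 2 + normc z * L)) => n.
  have -> : D z - z * D' z = (D z - psum b n.+1 z) - z * (D' z - psum (fun k => b k.+1) n z).
    by rewrite psumSl b0 add0r; ring.
  apply: (le_trans (normcB _ _)); rewrite mulrDl; apply: lerD.
    by have := KP n.+1; rewrite exprS invfM mulrA.
  by rewrite normcM -mulrA ler_wpM2l ?normc_ge0.
have Dn (x : R) : x != 0 -> D' x%:C = 0.
  move=> x0; have := DE x%:C; rewrite D0 => /esym/eqP; rewrite mulf_eq0 => /orP[|/eqP//].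
  by rewrite -normc_eq0 normc_real normr_eq0 (negbTE x0).
move=> x; have [->|] := eqVneq x 0; last exact: Dn.
have eD' : entire D' by eexists; exact: bD'.
have [C [e [e0 lip]]] := ana_lip (entire_ana (0 : R[i]) eD').
apply/eqP; rewrite -normc_eq0 eq_le normc_ge0 andbT.
apply: (@le_geo _ _ _ (`|C| * (e / 2))) => n; rewrite add0r.
pose t := e / 2 / 2 ^+ n; have t0 : 0 < t by rewrite !divr_gt0// exprn_gt0.
have te : t < e.
  apply: (@le_lt_trans _ _ (e / 2)); last by lra.
  by rewrite ler_pdivrMr ?exprn_gt0// ler_peMr ?exprn_ege1 ?ler1n// divr_ge0// ltW.
have := lip t%:C; rewrite normc_real gtr0_norm// add0r Dn ?gt_eqF// sub0r normcN => /(_ te) h.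
by apply: (le_trans h); rewrite -mulrA ler_wpM2r ?ler_norm// ltW.
Qed.

Lemma ent_real_zero (b : nat -> R[i]) D : ent b D -> (forall x : R, D x%:C = 0) ->
  forall z, D z = 0.
Proof.
move=> bD D0.
have b0 k : b k = 0.
  elim: k b D bD D0 => [|k IHk] b D bD D0; have [b00 [D' [bD' D'0]]] := ent_real_step bD D0.
    exact: b00.
  exact: (IHk _ _ bD' D'0).
move=> z; have [K _ KP] := ent_lim z bD.
apply: (@eq_geo _ _ _ K) => n; have := KP n.
by rewrite /psum big1 => [|j _]; rewrite ?b0 ?mul0r.
Qed.

(** Both sides are real parts of [c] times entire functions of [s], the left one having the moments
    as coefficients; the two functions agree for real [s] by [gsn_exp], hence everywhere. *)
Theorem gauss_transform c s : ing (fun t => phi c s t * gsn t) =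
  complex.Re (c * cexp ((8 * pi)^-1%:C * s ^+ 2)) / Num.sqrt 2.
Proof.
have [f ef] := dec_ent dec_mom.
have fE c' s' : ing (fun t => phi c' s' t * gsn t) = complex.Re (c' * f s').
  have [K K0 KP] := phi_series c' s'; have [L L0 LP] := ent_lim s' ef.
  apply/eqP; rewrite -subr_eq0 -normr_eq0 eq_le normr_ge0 andbT.
  apply: (@le_geo _ _ _ (K + normc c' * L)) => n; rewrite add0r mulrDl.
  apply: le_trans (ler_distD (complex.Re (c' * psum (fun k => (mom k)%:C) n s')) _ _) _.
  apply: lerD; first exact: KP.
  rewrite -ReN -ReD -mulrBr; apply: le_trans (ler_Re_normc _) _.
  by rewrite normcM -mulrA ler_wpM2l ?normc_ge0// normc_distC.
have phir (x t : R) : cexp (x%:C * t%:C) = (expR (x * t))%:C :> R[i].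
  rewrite -rmorphM /cexp /expi /= cos0 sin0; apply: eq_ReIm => /=; ring.
pose g z := (- (Num.sqrt 2)^-1)%:C * cexp ((8 * pi)^-1%:C * z ^+ 2).
have eg : entire g.
  apply: entireZ; apply: (entire_comp_sqr (f := fun z => cexp ((8 * pi)^-1%:C * z))).
  by eexists; exact: entire_cexp.
have [b bD] : entire (fun z => f z + g z) by apply: entireD => //; eexists; exact: ef.
have D0 (x : R) : f x%:C + g x%:C = 0.
  have gx : g x%:C = (- (expR (x ^+ 2 / (8 * pi)) / Num.sqrt 2))%:C.
    rewrite /g expr2 mulrA -rmorphM phir -rmorphM /=; congr (_%:C).
    have -> : (8 * pi)^-1 * x * x = x ^+ 2 / (8 * pi) by rewrite expr2 [RHS]mulrC mulrA.
    by rewrite mulNr mulrC.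
  have [_ h] := gsn_exp x.
  have Rf : complex.Re (f x%:C) = expR (x ^+ 2 / (8 * pi)) / Num.sqrt 2.
    rewrite -h -[f _]mul1r -fE; congr ing; apply/funext => t.
    by rewrite /phi mul1r phir.
  have If : complex.Im (f x%:C) = 0.
    have -> : complex.Im (f x%:C) = complex.Re (- 'i%C * f x%:C).
      by case: (f x%:C) => u v /=; ring.
    rewrite -fE (_ : (fun t => _) = (fun=> 0)); last first.
      by apply/funext => t; rewrite /phi phir /=; ring.
    by rewrite /ing /Rintegral integral0.
  by rewrite gx; apply: eq_ReIm; rewrite ?ReD ?ImD ?Rf ?If /= ?subrr ?addr0.
have := ent_real_zero bD D0 s => /eqP; rewrite addr_eq0 => /eqP fs.
rewrite fE fs /g; move: (cexp _) ((Num.sqrt 2)^-1 : R) => w q.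
by case: w => u v; case: (c) => x y /=; ring.
Qed.

End GaussianTransform.

(** * Inner products of time-frequency shifts *)

Section Gram.
Variable R : realType.
Implicit Types (p q : seq (R[i] * R[i])) (z w c : R[i]).

Definition ev p (t : R) : R[i] := \sum_(x <- p) x.1 * tf_shift x.2 (@gauss R) t.

(** The shifts at [z] and [w] have inner product [2^(-1/2) * al z * conj (al w) * exp (pi z conj
    w)]: this factor relates the shift at [z] to the Fock kernel at [z], as the Bargmann transform
    does. *)
Definition al z : R[i] := cexp ((pi / 2)%:C * z ^+ 2) * (expR (- (pi * complex.Re z ^+ 2)))%:C.

Definition toK p : seq (R[i] * R[i]) := [seq (x.1 * al x.2, x.2) | x <- p].

Lemma al_neq0 z : al z != 0.
Proof.
by rewrite mulf_neq0 ?cexp_neq0// -normc_eq0 normc_real normr_eq0 gt_eqF ?expR_gt0.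
Qed.

Lemma tf_shift_mul c z w t : complex.Re (c * tf_shift z (@gauss R) t * (tf_shift w (@gauss R) t)^*) =
  phi (c * (expR (- (pi * complex.Re z ^+ 2)))%:C * (expR (- (pi * complex.Re w ^+ 2)))%:C)
    ((2 * pi)%:C * (z + w^*)) t * gsn t.
Proof.
rewrite /phi /tf_shift /gauss.
set E1 := (expR _)%:C; set E2 := (expR (- (pi * (t - _) ^+ 2)))%:C.
set A := (expR (- (pi * complex.Re z ^+ 2)))%:C; set B := (expR _)%:C.
have -> : complex.Re (c * A * B * cexp ((2 * pi)%:C * (z + w^*) * t%:C)) * gsn t =
   complex.Re (c * A * B * cexp ((2 * pi)%:C * (z + w^*) * t%:C) * (gsn t)%:C).
  by rewrite [RHS]ReM /= mulr0 subr0.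
congr complex.Re.
have -> : (2 * pi)%:C * (z + w^*) * t%:C = (2 * pi * (complex.Re z + complex.Re w) * t) +i*
    (2 * pi * complex.Im z * t + - (2 * pi * complex.Im w * t)).
  by apply: eq_ReIm; case: (z) (w) => x y [x' y'] /=; ring.
rewrite /cexp [complex.Re _]/= [complex.Im _]/= expiD.
have cj (b : R) : (expi b)^*%R = expi (- b).
  by apply: eq_ReIm; rewrite /expi /= ?cosN ?sinN.
have rj (b : R) : (b%:C)^*%R = b%:C :> R[i] by apply: eq_ReIm => /=; rewrite ?oppr0.
have key : E1 * E2 = A * B * (expR (2 * pi * (complex.Re z + complex.Re w) * t))%:C * (gsn t)%:C.
  rewrite -!rmorphM -!expRD; congr (expR _)%:C; ring.
have cm (a b : R[i]) : (a * b)^*%R = a^*%R * b^*%R by rewrite rmorphM.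
rewrite cm cj rj.
transitivity (c * (expi (2 * pi * complex.Im z * t) * expi (- (2 * pi * complex.Im w * t))) * (E1 * E2)).
  by ring.
by rewrite key; ring.
Qed.

Lemma ev_sqr p t : normc (ev p t) ^+ 2 = \sum_(x <- p) \sum_(y <- p)
  complex.Re (x.1 * y.1^* * tf_shift x.2 (@gauss R) t * (tf_shift y.2 (@gauss R) t)^*).
Proof.
transitivity (complex.Re (ev p t * (ev p t)^*)); first by rewrite mulc_conj.
rewrite {1}/ev mulr_suml Re_sum; apply: eq_bigr => x _.
rewrite /ev rmorph_sum mulr_sumr Re_sum; apply: eq_bigr => y _.
by congr complex.Re; rewrite rmorphM /=; ring.
Qed.

Lemma ev_norm p : itg (fun t => normc (ev p t) ^+ 2) /\
  ing (fun t => normc (ev p t) ^+ 2) = qf (toK p) / Num.sqrt 2.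
Proof.
pose s (x y : R[i] * R[i]) : R[i] := (2 * pi)%:C * (x.2 + y.2^*).
pose k (x y : R[i] * R[i]) : R[i] := x.1 * y.1^* * (expR (- (pi * complex.Re x.2 ^+ 2)))%:C *
   (expR (- (pi * complex.Re y.2 ^+ 2)))%:C.
have -> : (fun t => normc (ev p t) ^+ 2) = (fun t => \sum_(x <- p) \sum_(y <- p)
    phi (k x y) (s x y) t * gsn t).
  apply/funext => t; rewrite ev_sqr; apply: eq_bigr => x _; apply: eq_bigr => y _.
  exact: tf_shift_mul.
have h1 x := itg_ing_sum p (fun y => itg_phi (k x y) (s x y)).
have [h2 h3] := itg_ing_sum p (fun x => (h1 x).1); split=> //.
rewrite h3 /qf /kf big_map Re_sum mulr_suml; apply: eq_bigr => x _.
rewrite (h1 x).2 big_map Re_sum mulr_suml; apply: eq_bigr => y _ /=.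
rewrite gauss_transform; congr (complex.Re _ / _); rewrite /k /s /al.
have cj v : (cexp v)^*%R = cexp (v^*) by rewrite cexp_conj.
have rj (b : R) : (b%:C)^*%R = b%:C :> R[i] by apply: eq_ReIm => /=; rewrite ?oppr0.
have p0 : 0 < pi :> R by exact: pi_gt0.
have -> : (8 * pi)^-1%:C * ((2 * pi)%:C * (x.2 + y.2^*)) ^+ 2 =
   (pi / 2)%:C * x.2 ^+ 2 + (pi / 2)%:C * (y.2^*) ^+ 2 + pi%:C * x.2 * y.2^* :> R[i].
  rewrite exprMn mulrA -rmorphXn -rmorphM.
  have -> : (8 * pi)^-1 * (2 * pi) ^+ 2 = pi / 2 :> R.
    by move: (pi : R) p0 => a a0; field; rewrite gt_eqF.
  have -> : pi%:C = (pi / 2)%:C + (pi / 2)%:C :> R[i].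
    by rewrite -rmorphD; congr (_%:C); field.
  by ring.
rewrite !cexpD.
have cm (a v b : R[i]) : (a * (v * b))^*%R = a^*%R * (v^*%R * b^*%R) by rewrite !rmorphM.
rewrite cm cj rj.
have -> : ((pi / 2)%:C * y.2 ^+ 2)^* = (pi / 2)%:C * y.2^* ^+ 2.
  by case: (y.2) => a b; rewrite !expr2; apply: eq_ReIm => /=; ring.
by ring.
Qed.

Lemma L2normE (h : R -> R[i]) : itg (fun t => normc (h t) ^+ 2) ->
  L2norm h = (Num.sqrt (ing (fun t => normc (h t) ^+ 2)))%:E.
Proof.
move=> ih; rewrite /L2norm unlock /Lnorm.
have -> : (\int[@lebesgue_measure R]_x `|(EFin \o (fun t => normc (h t))) x| `^ 2 =
   \int[@lebesgue_measure R]_x (normc (h x) ^+ 2)%:E)%E.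
  apply: eq_integral => x _ /=.
  by rewrite ger0_norm ?normc_ge0// powR_mulrn ?normc_ge0.
rewrite -[X in (X `^ _)%E]fineK; last exact: integrable_fin_num.
rewrite -[fine _]/(ing _) poweR_EFin powR12_sqrt//.
by apply: Rintegral_ge0 => t _; exact: sqr_ge0.
Qed.

End Gram.

(** * Functions approximable by time-frequency shifts, and multipliers *)

Section Density.
Variable R : realType.
Local Notation mu := (@lebesgue_measure R).
Implicit Types (h k : R -> R[i]) (m : R -> R) (p q : seq (R[i] * R[i])) (c z : R[i]).

Definition n2 h (t : R) : R := normc (h t) ^+ 2.

Lemma n2_ge0 h t : 0 <= n2 h t. Proof. exact: sqr_ge0. Qed.

Lemma measurable_n2 h : measurable_cfun h -> measurable_fun [set: R] (n2 h).
Proof.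
move=> [h1 h2]; have -> : n2 h = fun t => complex.Re (h t) ^+ 2 + complex.Im (h t) ^+ 2.
  by apply/funext => t; exact: sqr_normcE.
by apply: measurable_funD; exact: measurable_funX.
Qed.

Lemma mcD h k : measurable_cfun h -> measurable_cfun k -> measurable_cfun (fun t => h t + k t).
Proof.
move=> [h1 h2] [k1 k2]; split.
  by under eq_fun do rewrite ReD; exact: measurable_funD.
by under eq_fun do rewrite ImD; exact: measurable_funD.
Qed.

Lemma mcM h k : measurable_cfun h -> measurable_cfun k -> measurable_cfun (fun t => h t * k t).
Proof.
move=> [h1 h2] [k1 k2]; split.
  by under eq_fun do rewrite ReM; apply: measurable_funB; exact: measurable_funM.
by under eq_fun do rewrite ImM; apply: measurable_funD; exact: measurable_funM.
Qed.

Lemma mc_cst c : measurable_cfun (fun _ : R => c).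
Proof. by split; exact: measurable_cst. Qed.

Lemma mc_real m : measurable_fun [set: R] m -> measurable_cfun (fun t => (m t)%:C).
Proof. by move=> h; split => //=; exact: measurable_cst. Qed.

Lemma mcB h k : measurable_cfun h -> measurable_cfun k -> measurable_cfun (fun t => h t - k t).
Proof.
move=> hh hk; have := mcD hh (mcM (mc_cst (-1)) hk).
by congr measurable_cfun; apply/funext => t; rewrite mulN1r.
Qed.

Lemma mc_ev p : measurable_cfun (ev p).
Proof.
elim: p => [|x p IHp].
  by have := mc_cst 0; congr measurable_cfun; apply/funext => t; rewrite /ev big_nil.
have [hx _] := tf_shift_gauss_L2 x.2.
have := mcD (mcM (mc_cst x.1) hx) IHp; congr measurable_cfun; apply/funext => t.
by rewrite /ev big_cons.
Qed.

Lemma n2D_le h k t : n2 (fun t => h t + k t) t <= 2 * n2 h t + 2 * n2 k t.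
Proof.
rewrite /n2; apply: (@le_trans _ _ ((normc (h t) + normc (k t)) ^+ 2)).
  by rewrite lerXn2r ?nnegrE ?addr_ge0 ?normc_ge0// normcD.
have := sqr_ge0 (normc (h t) - normc (k t)); rewrite sqrrB sqrrD; lra.
Qed.

Lemma ing_ge0 (f : R -> R) : (forall t, 0 <= f t) -> 0 <= ing f.
Proof. by move=> f0; apply: Rintegral_ge0 => t _. Qed.

Lemma itg_n2D h k : measurable_cfun h -> measurable_cfun k -> itg (n2 h) -> itg (n2 k) ->
  itg (n2 (fun t => h t + k t)) /\
  ing (n2 (fun t => h t + k t)) <= 2 * ing (n2 h) + 2 * ing (n2 k).
Proof.
move=> mh mk ih ik; have i2 := itgD (itgZ 2 ih) (itgZ 2 ik).
have mhk := measurable_n2 (mcD mh mk).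
have b t : `|n2 (fun t => h t + k t) t| <= 2 * n2 h t + 2 * n2 k t.
  by rewrite ger0_norm ?n2_ge0// n2D_le.
split; first exact: itg_le i2.
apply: (le_trans (ler_norm _)); apply: (le_trans (ing_le mhk b i2)).
by rewrite (ingD (itgZ 2 ih) (itgZ 2 ik)) !ingZ.
Qed.

Lemma itg_n2M h k (B : R) : measurable_cfun h -> measurable_cfun k -> itg (n2 k) ->
  (forall t, normc (h t) <= B) -> itg (n2 (fun t => h t * k t)) /\
  ing (n2 (fun t => h t * k t)) <= B ^+ 2 * ing (n2 k).
Proof.
move=> mh mk ik hB; have i2 := itgZ (B ^+ 2) ik.
have b t : `|n2 (fun t => h t * k t) t| <= B ^+ 2 * n2 k t.
  rewrite ger0_norm ?n2_ge0// /n2 normcM exprMn ler_wpM2r ?sqr_ge0//.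
  by rewrite lerXn2r ?nnegrE ?normc_ge0// (le_trans (normc_ge0 _) (hB t)).
have mm := measurable_n2 (mcM mh mk).
split; first exact: itg_le i2.
by apply: (le_trans (ler_norm _)); apply: (le_trans (ing_le mm b i2)); rewrite ingZ.
Qed.

(** [eps] bounds the squared distance, so a triangle inequality costs a factor 2 and tolerances are
    divided by 4. *)
Definition close h k (eps : R) := itg (n2 (fun t => h t - k t)) /\
  ing (n2 (fun t => h t - k t)) < eps.

Definition app h := measurable_cfun h /\ forall eps : R, 0 < eps -> exists p, close h (ev p) eps.

Lemma app_lim h : measurable_cfun h ->
  (forall eps : R, 0 < eps -> exists2 k, app k & close h k eps) -> app h.
Proof.
move=> mh H; split=> // eps e0; have e4 : 0 < eps / 4 by rewrite divr_gt0.
have [k [mk kp] [i1 l1]] := H _ e4; have [p [i2 l2]] := kp _ e4; exists p.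
have [i3 l3] := itg_n2D (mcB mh mk) (mcB mk (mc_ev p)) i1 i2.
have E : (fun t => h t - k t + (k t - ev p t)) = (fun t => h t - ev p t).
  by apply/funext => t; rewrite addrA subrK.
by rewrite E in i3 l3; split=> //; lra.
Qed.

Lemma close_refl h (eps : R) : 0 < eps -> close h h eps.
Proof.
move=> e0; rewrite /close; have -> : n2 (fun t => h t - h t) = (fun=> 0).
  by apply/funext => t; rewrite /n2 subrr normc0 expr0n.
by rewrite /ing /Rintegral integral0; split=> //; exact: integrable0.
Qed.

Lemma app_ev p : app (ev p).
Proof. by split=> [|eps e0]; [exact: mc_ev|exists p; exact: close_refl]. Qed.

Lemma ev_cat p q t : ev (p ++ q) t = ev p t + ev q t.
Proof. by rewrite /ev big_cat. Qed.

Lemma ev_scal c p t : ev (scal c p) t = c * ev p t.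
Proof. by rewrite /ev big_map mulr_sumr; apply: eq_bigr => x _; rewrite mulrA. Qed.

Lemma appD h k : app h -> app k -> app (fun t => h t + k t).
Proof.
move=> [mh hp] [mk kq]; split=> [|eps e0]; first exact: mcD.
have e4 : 0 < eps / 4 by rewrite divr_gt0.
have [p [i1 l1]] := hp _ e4; have [q [i2 l2]] := kq _ e4; exists (p ++ q).
have [i3 l3] := itg_n2D (mcB mh (mc_ev p)) (mcB mk (mc_ev q)) i1 i2.
have E : (fun t => h t - ev p t + (k t - ev q t)) = (fun t => h t + k t - ev (p ++ q) t).
  by apply/funext => t; rewrite ev_cat; ring.
by rewrite E in i3 l3; split=> //; lra.
Qed.

(** Multiplication by a bounded function is continuous, so it suffices to test it on the
    combinations [ev p]; this justifies the form of [mult]. *)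
Lemma appM (g : R -> R[i]) h (B : R) : measurable_cfun g -> (forall t, normc (g t) <= B) ->
  (forall p, app (fun t => g t * ev p t)) -> app h -> app (fun t => g t * h t).
Proof.
move=> mg gB gp [mh hp]; apply: app_lim; first exact: mcM.
move=> eps e0; have B0 : 0 < B ^+ 2 + 1 by rewrite ltr_wpDl ?sqr_ge0.
have [p [i1 l1]] := hp (eps / (B ^+ 2 + 1)) ltac:(by rewrite divr_gt0).
exists (fun t => g t * ev p t) => //.
have [i2 l2] := itg_n2M mg (mcB mh (mc_ev p)) i1 gB.
have E : (fun t => g t * (h t - ev p t)) = (fun t => g t * h t - g t * ev p t).
  by apply/funext => t; rewrite mulrBr.
rewrite E in i2 l2; split=> //; apply: (le_lt_trans l2).
apply: (@le_lt_trans _ _ ((B ^+ 2 + 1) * ing (n2 (fun t => h t - ev p t)))).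
  by rewrite ler_wpM2r ?lerDl ?ing_ge0// => t; exact: n2_ge0.
by rewrite mulrC -ltr_pdivlMr.
Qed.

Lemma appZ c h : app h -> app (fun t => c * h t).
Proof.
apply: (@appM (fun=> c) h (normc c)); first exact: mc_cst.
  by [].
move=> p; have := app_ev (scal c p); congr app; apply/funext => t; exact: ev_scal.
Qed.

Lemma ing_cvg0 (g_ : nat -> R -> R) (G : R -> R) (eps : R) :
  (forall n, measurable_fun [set: R] (g_ n)) ->
  (forall n t, `|g_ n t| <= G t) -> itg G -> (forall t, (fun n => g_ n t) @ \oo --> (0 : R)) ->
  0 < eps -> exists n, `|ing (g_ n)| < eps.
Proof.
move=> mg gG iG g0 e0.
have [||||_ _ h] := @dominated_convergence _ _ _ mu [set: R] measurableT
  (fun n t => (g_ n t)%:E) (fun=> 0%E) (EFin \o G) _ _ _ iG.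
- by move=> n; apply/measurable_EFinP; exact: mg.
- exact: measurable_cst.
- by apply: aeW => t _; apply: cvg_EFin; [exact: nearW|exact: g0].
- by apply: aeW => t n _ /=; rewrite lee_fin.
move: h; rewrite integral0 => /fine_cvgP [_ /cvgrPdist_lt /(_ _ e0) [N _ NP]].
exists N; have := NP N (leqnn N).
by rewrite /= sub0r normrN.
Qed.

Definition mult m := [/\ measurable_fun [set: R] m, exists B, forall t, `|m t| <= B &
  forall p, app (fun t => (m t)%:C * ev p t)].

Lemma multM m m' : mult m -> mult m' -> mult (fun t => m t * m' t).
Proof.
move=> [mm [B mB] mp] [mm' [B' mB'] mp']; split; first exact: measurable_funM.
  by exists (B * B') => t; rewrite normrM; apply: ler_pM.
move=> p; have E : (fun t => (m t)%:C * ((m' t)%:C * ev p t)) = (fun t => (m t * m' t)%:C * ev p t).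
  by apply/funext => t; rewrite mulrA -rmorphM.
rewrite -E; apply: appM (mc_real mm) _ mp (mp' p) => t.
by rewrite normc_real; exact: mB.
Qed.

Lemma multD m m' : mult m -> mult m' -> mult (fun t => m t + m' t).
Proof.
move=> [mm [B mB] mp] [mm' [B' mB'] mp']; split; first exact: measurable_funD.
  by exists (B + B') => t; apply: le_trans (ler_normD _ _) _; exact: lerD.
move=> p; have := appD (mp p) (mp' p); congr app; apply/funext => t.
by rewrite rmorphD mulrDl.
Qed.

Lemma mult_cst a : mult (fun=> a).
Proof.
split; [exact: measurable_cst|by exists `|a| |] => p.
have := app_ev (scal a%:C p); congr app; apply/funext => t; exact: ev_scal.
Qed.

Lemma multZ a m : mult m -> mult (fun t => a * m t).
Proof. exact: multM (mult_cst a). Qed.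

(** Dominated convergence, with the majorant [4 B^2 |ev p|^2] of the squared error. *)
Lemma mult_lim (m_ : nat -> R -> R) m (B : R) : (forall n, mult (m_ n)) ->
  (forall n t, `|m_ n t| <= B) -> (forall t, (fun n => m_ n t) @ \oo --> m t) -> mult m.
Proof.
move=> mP mB mc; have mm : measurable_fun [set: R] m.
  apply: (@measurable_fun_cvg _ _ _ _ m_) => [n|t _]; first by case: (mP n).
  exact: mc.
have mb t : `|m t| <= B.
  have : (fun n => `|m_ n t|) @ \oo --> `|m t| by apply: cvg_norm; exact: mc.
  move/cvg_lim => <-//; apply: limr_le; last exact: nearW.
  by apply/cvg_ex; exists `|m t|; apply: cvg_norm; exact: mc.
split=> //; first by exists B.
move=> p; apply: app_lim; first exact: mcM (mc_real mm) (mc_ev p).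
move=> eps e0.
have [ip _] := ev_norm p.
pose k n t := (m_ n t)%:C * ev p t.
have mk n : measurable_cfun (k n) by case: (mP n) => h _ _; exact: mcM (mc_real h) (mc_ev p).
have mh := mcM (mc_real mm) (mc_ev p).
pose G t := 4 * B ^+ 2 * normc (ev p t) ^+ 2.
have gG n t : `|n2 (fun t => (m t)%:C * ev p t - k n t) t| <= G t.
  rewrite ger0_norm ?n2_ge0// /n2 /k -mulrBl -rmorphB normcM exprMn normc_real /G.
  rewrite ler_wpM2r ?sqr_ge0//.
  have -> : 4 * B ^+ 2 = (B + B) ^+ 2 by ring.
  have h : `|m t - m_ n t| <= B + B by apply: (le_trans (ler_normB _ _)); exact: lerD.
  by rewrite lerXn2r ?nnegrE// (le_trans (normr_ge0 _) h).
have [|n nP] := @ing_cvg0 (fun n => n2 (fun t => (m t)%:C * ev p t - k n t)) G eps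
  (fun n => measurable_n2 (mcB mh (mk n))) gG (itgZ _ ip) _ e0.
  move=> t; have -> : (fun n => n2 (fun t => (m t)%:C * ev p t - k n t) t) =
      (fun n => (m t - m_ n t) * (m t - m_ n t) * normc (ev p t) ^+ 2).
    apply/funext => n; rewrite /n2 /k -mulrBl -rmorphB normcM exprMn normc_real.
    by rewrite real_normK ?num_real// expr2.
  have c1 : (fun n => m t - m_ n t) @ \oo --> (0 : R).
    by rewrite -(subrr (m t)); apply: cvgB; [exact: cvg_cst|exact: mc].
  rewrite [X in _ --> X](_ : _ = 0 * 0 * normc (ev p t) ^+ 2); last by rewrite !mul0r.
  by apply: cvgM; [exact: (cvgM c1 c1)|exact: cvg_cst].
exists (k n); first by case: (mP n) => _ _; exact.
split; last exact: le_lt_trans (ler_norm _) nP.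
by apply: itg_le (itgZ _ ip); [exact: measurable_n2 (mcB mh (mk n))|exact: gG].
Qed.

End Density.

(** * From sines to all bounded measurable multipliers *)

Section Multipliers.
Variable R : realType.
Implicit Types (h : R -> R[i]) (m : R -> R) (p q : seq (R[i] * R[i])) (c z : R[i]).

Definition modulate (b : R) p : seq (R[i] * R[i]) := [seq (x.1, x.2 + 0 +i* b) | x <- p].

Lemma ev_modulate b p t : ev (modulate b p) t = expi (2 * pi * b * t) * ev p t.
Proof.
rewrite /ev big_map mulr_sumr; apply: eq_bigr => x _ /=.
rewrite /tf_shift ImD ReD /= addr0 mulrDr mulrDl expiD; ring.
Qed.

Lemma mult_sin a b : mult (fun t : R => sin (2 * pi * b * (t - a))).
Proof.
split.
- apply: measurableT_comp.
    by apply: continuous_measurable_fun => ?; exact: continuous_sin.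
  by apply: measurable_funM => //; exact: measurable_funB.
- by exists 1 => t; rewrite ler_norml sin_geN1 sin_le1.
move=> p; pose kap : R[i] := 0 -i* (1 / 2).
have := app_ev (scal (kap * expi (- (2 * pi * b * a))) (modulate b p) ++
   scal (- kap * expi (2 * pi * b * a)) (modulate (- b) p)).
congr app; apply/funext => t; rewrite ev_cat !ev_scal !ev_modulate.
set A := 2 * pi * b * a; have -> : 2 * pi * b * (t - a) = 2 * pi * b * t + - A by rewrite /A; ring.
have -> : 2 * pi * - b * t = - (2 * pi * b * t) by ring.
move: (2 * pi * b * t) A (ev p t) => T A e.
have -> : (sin (T + - A))%:C = kap * expi (- A) * expi T - kap * expi A * expi (- T) :> R[i].
  rewrite /expi /kap sinD !cosN !sinN; apply: eq_ReIm => /=; by field.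
by ring.
Qed.

(** For [0 < y <= w <= 1] the iteration increases, and [1 - f w] is [1 - w] times
    [(1 - w) (2 + w) / 2], which is at most [1 - y / 2]: the convergence to 1 is geometric. The rest
    is oddness. *)
Lemma sgn_iter_cvg (x : R) : `|x| <= 1 ->
  (fun n => iter n (fun y : R => (3 * y - y ^+ 3) / 2) x) @ \oo --> Num.sg x.
Proof.
set f := fun y : R => (3 * y - y ^+ 3) / 2.
have pos y : 0 < y <= 1 -> (fun n => iter n f y) @ \oo --> (1 : R).
  move=> /andP[y0 y1].
  have H n : y <= iter n f y <= 1 /\ 1 - iter n f y <= (1 - y / 2) ^+ n.
    elim: n => [|n [/andP[h1 h2] h3]]; first by rewrite /= lexx y1 expr0; split=> //; lra.
    rewrite iterS; move: (iter n f y) h1 h2 h3 => w h1 h2 h3.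
    have e1 : f w - w = w * (1 - w) * (1 + w) / 2 by rewrite /f; field.
    have e2 : 1 - f w = (1 - w) * ((1 - w) * (2 + w) / 2) by rewrite /f; field.
    have w0 : 0 <= w * (1 - w) * (1 + w) by rewrite !mulr_ge0//; lra.
    have w1 : 0 <= (1 - w) * (2 + w) by rewrite mulr_ge0//; lra.
    have w2 : 0 <= (1 - w) * ((1 - w) * (2 + w) / 2) by rewrite mulr_ge0//; lra.
    split; first by apply/andP; split; lra.
    rewrite e2 exprSr; apply: ler_pM => //; try lra.
    have := mulr_ge0 (ltW y0) (ltW y0); have : 0 <= w * w by rewrite mulr_ge0//; lra.
    lra.
  apply/cvgrPdist_le => e e0.
  have c0 : (fun n => (1 - y / 2) ^+ n) @ \oo --> (0 : R).
    by apply: cvg_expr; rewrite ger0_norm; lra.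
  have := c0; move/cvgrPdist_le => /(_ _ e0); apply: filterS => n.
  have [/andP[_ h2] h3] := H n.
  rewrite sub0r normrN ger0_norm; last by apply: exprn_ge0; lra.
  by rewrite ger0_norm ?subr_ge0//; exact: le_trans.
move=> x1; have [x0|x0|->] := ltrgtP x 0.
- have fN n : iter n f x = - iter n f (- x).
    elim: n => [|n IHn]; first by rewrite /= opprK.
    by rewrite !iterS IHn /f; field.
  rewrite ltr0_sg//; under eq_fun do rewrite fN; apply: cvgN; apply: pos.
  by move: x1; rewrite ltr0_norm// => x1; apply/andP; split; lra.
- by rewrite gtr0_sg//; apply: pos; rewrite x0 (le_trans (ler_norm x)).
- have f0 n : iter n f 0 = 0 by elim: n => // n IHn; rewrite iterS IHn /f expr0n mulr0 subr0 mul0r.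
  by rewrite sgr0; under eq_fun do rewrite f0; exact: cvg_cst.
Qed.

Lemma mult_sg m : mult m -> (forall t, `|m t| <= 1) -> mult (fun t => Num.sg (m t)).
Proof.
move=> mm m1; set f := fun y : R => (3 * y - y ^+ 3) / 2.
apply: (@mult_lim _ (fun n t => iter n f (m t)) _ 1) => [n|n t|t].
- elim: n => [//|n IHn].
  have := multD (multZ (3 / 2) IHn) (multZ (- (1 / 2)) (multM IHn (multM IHn IHn))).
  by congr mult; apply/funext => t; rewrite iterS /f; field.
- elim: n => [|n IHn]; first exact: m1.
  rewrite iterS; move: (iter n f (m t)) IHn => w; rewrite !ler_norml => /andP[w1 w2].
  have : 0 <= (1 - w) * ((1 - w) * (2 + w)) by rewrite !mulr_ge0//; lra.
  have : 0 <= (1 + w) * ((1 + w) * (2 - w)) by rewrite !mulr_ge0//; lra.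
  have -> : (1 + w) * ((1 + w) * (2 - w)) = 2 + 2 * f w by rewrite /f; field.
  have -> : (1 - w) * ((1 - w) * (2 + w)) = 2 - 2 * f w by rewrite /f; field.
  by move=> *; apply/andP; split; lra.
- exact: sgn_iter_cvg.
Qed.

(** The sine of period [n + 1] centred at [a] has the sign of [t - a] as soon as
    [2 |t - a| < n + 1]. *)
Lemma mult_sg_sub (a : R) : mult (fun t => Num.sg (t - a)).
Proof.
apply: (@mult_lim _ (fun n t => Num.sg (sin (2 * pi * (n.+1%:R^-1) * (t - a)))) _ 1).
- move=> n; apply: mult_sg; first exact: mult_sin.
  by move=> t; rewrite ler_norml sin_geN1 sin_le1.
- by move=> n t; rewrite normr_sg; case: (_ == _).
move=> t; have p0 : 0 < pi :> R by exact: pi_gt0.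
have pos (y : R) : 0 < y -> \forall n \near \oo, 0 < sin (2 * pi * (n.+1%:R^-1) * y).
  move=> y0; exists (Num.bound (2 * y)) => // n /= nN.
  have h : 2 * y < n.+1%:R.
    apply: (@lt_le_trans _ _ (Num.bound (2 * y))%:R); first by apply: archi_boundP; rewrite mulr_ge0// ltW.
    by rewrite ler_nat; exact: leqW.
  have -> : 2 * pi * n.+1%:R^-1 * y = pi * (2 * y / n.+1%:R) by ring.
  apply: sin_gt0_pi; apply/andP; split; first by rewrite mulr_gt0// divr_gt0// mulr_gt0.
  by rewrite gtr_pMr// ltr_pdivrMr// mul1r.
have [t0|t0|->] := ltrgtP t a.
- have y0 : 0 < a - t by rewrite subr_gt0.
  apply: cvg_near_cst; have := pos _ y0; apply: filterS => n h.
  rewrite -(opprB a t) mulrN sinN !sgrN; congr (- _).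
  by rewrite !gtr0_sg.
- have y0 : 0 < t - a by rewrite subr_gt0.
  by apply: cvg_near_cst; have := pos _ y0; apply: filterS => n h; rewrite !gtr0_sg.
- by under eq_fun do rewrite subrr mulr0 sin0; rewrite subrr; exact: cvg_cst.
Qed.

Lemma indicE' (A : set R) t : \1_A t = (if t \in A then 1 else 0) :> R.
Proof. by rewrite indicE; case: (t \in A). Qed.

(** The sets whose indicator is a multiplier form a sigma-algebra, which contains the open
    half-lines. *)
Lemma mult_indic (A : set R) : measurable A -> mult (\1_A : R -> R).
Proof.
have -> : measurable A = (@RGenOInfty.G R).-sigma.-measurable A.
  rewrite -RGenOInfty.measurableE; exact: erefl.
apply: (@smallest_sub _ _ _ [set A : set R | mult (\1_A : R -> R)]).
  split.
  - by have := mult_cst (0 : R); congr mult; apply/funext => t; rewrite indic0.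
  - move=> B mB; have := multD (mult_cst 1) (multZ (-1) mB).
    congr mult; apply/funext => t; rewrite !indicE' setTD in_setC.
    by case: (t \in B) => /=; ring.
  (* The indicator of the union is the limit of one minus the products of the complementary
     indicators, which is stationary at each point. *)
  - move=> B mB; pose U n t : R := \prod_(i < n) (1 + -1 * \1_(B i) t).
    have mU n : mult (U n).
      elim: n => [|n IHn].
        by have := mult_cst (1 : R); congr mult; apply/funext => t; rewrite /U big_ord0.
      have := multM IHn (multD (mult_cst 1) (multZ (-1) (mB n))).
      by congr mult; apply/funext => t; rewrite /U big_ord_recr.
    have U01 n t : 0 <= U n t <= 1.
      apply/andP; split; [apply: prodr_ge0 => i _|apply: prodr_ile1 => i _];
        by rewrite indicE'; case: ifP => _; lra.
    apply: (@mult_lim _ (fun n t => 1 + -1 * U n t) _ 1).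
    + by move=> n; apply: multD (mult_cst 1) (multZ (-1) (mU n)).
    + by move=> n t; have /andP[? ?] := U01 n t; rewrite ler_norml; apply/andP; split; lra.
    move=> t; apply: cvg_near_cst; rewrite indicE'; case: ifPn => [|tn].
      rewrite inE => -[k _ kt]; exists k.+1 => // n /= kn.
      rewrite /U (bigD1 (Ordinal kn))//= indicE' mem_set//; ring.
    exists 0%N => // n _; rewrite /U big1 => [|i _]; first by ring.
    rewrite indicE' ifN; first by ring.
    by apply: contra tn; rewrite !inE => ti; exists i.
move=> B [x ->] /=.
have mx := mult_sg_sub x.
(* [(sg^2 + sg) / 2] is 1 on the positive numbers and 0 elsewhere. *)
have := multZ (1 / 2) (multD (multM mx mx) mx).
congr mult; apply/funext => t; rewrite indicE'.
have [tx|tx|->] := ltrgtP x t.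
- by rewrite gtr0_sg ?subr_gt0// mem_set/= ?in_itv/= ?tx//; field.
- rewrite ltr0_sg ?subr_lt0// memNset/=; first by field.
  by rewrite in_itv/= ltNge ltW.
- rewrite subrr sgr0 memNset/=; first by ring.
  by rewrite in_itv/= ltxx.
Qed.

Lemma mult_sum (f : nat -> R -> R) n : (forall i, mult (f i)) ->
  mult (fun t => \sum_(i < n) f i t).
Proof.
move=> mf; elim: n => [|n IHn].
  by have := mult_cst (0 : R); congr mult; apply/funext => t; rewrite big_ord0.
by have := multD IHn (mf n); congr mult; apply/funext => t; rewrite big_ord_recr.
Qed.

Lemma count_le (x : R) N : 0 <= x <= N%:R ->
  x - 1 <= \sum_(k < N) (if k.+1%:R <= x then 1 else 0) <= x.
Proof.
elim: N x => [|N IHN] x /andP[x0 xN].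
  by rewrite big_ord0; apply/andP; split; lra.
rewrite big_ord_recr /=; have [h|h] := leP N.+1%:R x.
  have -> : x = N.+1%:R by apply/eqP; rewrite eq_le xN.
  rewrite (eq_bigr (fun=> 1)); last by move=> k _; rewrite ler_nat ltnS ltnW.
  rewrite sumr_const card_ord -(natr1 N); apply/andP; split; lra.
rewrite addr0; have [h2|h2] := leP x N%:R; first by apply: IHN; rewrite x0.
rewrite (eq_bigr (fun=> 1)); last first.
  move=> k _; rewrite ifT//; apply: le_trans (ltW h2); rewrite ler_nat; exact: ltn_ord.
rewrite sumr_const card_ord; move: h; rewrite -(natr1 N) => h; apply/andP; split; lra.
Qed.

(** Staircase approximation: the sum of the indicators counts the positive integers up to
    [(N + 1) * m t], and this count is within 1 of that number. *)
Lemma mult_unit m : measurable_fun [set: R] m -> (forall t, 0 <= m t <= 1) -> mult m.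
Proof.
move=> mm m01.
pose A (N k : nat) : set R := [set t | k.+1%:R <= N.+1%:R * m t].
have mA (N k : nat) : measurable (A N k).
  rewrite -[X in measurable X]setTI.
  have mN : measurable_fun [set: R] (fun t => N.+1%:R * m t) by exact: measurable_funM.
  have := mN measurableT `[k.+1%:R, +oo[%classic (measurable_itv _).
  by congr measurable; apply/seteqP; split => t /=; rewrite in_itv/= andbT.
pose F (N : nat) (t : R) : R := N.+1%:R^-1 * \sum_(k < N.+1) \1_(A N k) t.
have FE (N : nat) (t : R) : `|F N t - m t| <= N.+1%:R^-1.
  have N0 : 0 < N.+1%:R :> R by [].
  have /andP[m0 m1] := m01 t.
  have := @count_le (N.+1%:R * m t) N.+1; rewrite mulr_ge0// ler_piMr// => /(_ isT).
  have -> : \sum_(k < N.+1) (if k.+1%:R <= N.+1%:R * m t then 1 else 0) =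
      \sum_(k < N.+1) \1_(A N k) t :> R.
    by apply: eq_bigr => k _; rewrite indicE' /A; congr (if _ then _ else _); rewrite mem_setE.
  rewrite /F; move: (\sum_(k < N.+1) \1_(A N k) t) => S /andP[S1 S2].
  have -> : N.+1%:R^-1 * S - m t = (S - N.+1%:R * m t) / N.+1%:R by field; rewrite gt_eqF.
  rewrite normrM [`|_^-1|]gtr0_norm ?invr_gt0// ler_piMl ?invr_ge0//.
  by rewrite ler_norml; apply/andP; split; lra.
apply: (@mult_lim _ F _ 2).
- by move=> N; exact: multZ (mult_sum N.+1 (fun k => mult_indic (mA N k))).
- move=> N t; have := FE N t; have /andP[m0 m1] := m01 t.
  have : N.+1%:R^-1 <= 1 :> R by rewrite invf_le1// ler1n.
  move: (F N t) (N.+1%:R^-1) => y w w1; rewrite !ler_norml => /andP[? ?].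
  by apply/andP; split; lra.
move=> t; apply/cvgrPdist_le => e e0.
exists (Num.bound e^-1) => // N /= NB; rewrite distrC; apply: (le_trans (FE N t)).
rewrite invf_ple ?posrE//; apply: (@le_trans _ _ (Num.bound e^-1)%:R).
  by apply: ltW; apply: archi_boundP; rewrite invr_ge0 ltW.
by rewrite ler_nat; exact: leqW.
Qed.

Lemma mult_bounded m (B : R) : measurable_fun [set: R] m -> (forall t, `|m t| <= B) -> mult m.
Proof.
move=> mm mB; pose C := `|B| + 1; have C0 : 0 < C by rewrite ltr_wpDl.
have h : mult (fun t => (m t / C + 1) / 2).
  apply: mult_unit.
    by apply: measurable_funM => //; apply: measurable_funD => //; exact: measurable_funM.
  move=> t; have : `|m t / C| <= 1.
    rewrite normrM normfV (gtr0_norm C0) ler_pdivrMr// mul1r; apply: (le_trans (mB t)).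
    by rewrite /C; have := ler_norm B; lra.
  by rewrite ler_norml => /andP[? ?]; apply/andP; split; lra.
have := multD (multZ (2 * C) h) (mult_cst (- C)); congr mult; apply/funext => t.
by field; rewrite gt_eqF.
Qed.

(** [u] is [v] times the Gaussian, which is itself a time-frequency shift. Truncating [v] gives a
    bounded multiplier, and the squared errors are dominated by [u ^+ 2]. *)
Lemma app_real (u : R -> R) : measurable_fun [set: R] u -> itg (fun t => u t ^+ 2) ->
  app (fun t => (u t)%:C).
Proof.
move=> mu iu; apply: app_lim; first exact: mc_real.
move=> eps e0.
pose v t : R := u t * expR (pi * t ^+ 2).
have mv : measurable_fun [set: R] v.
  apply: measurable_funM => //; apply: measurableT_comp => //.
  by apply: measurable_funM => //; exact: measurable_funX.
pose F (n : nat) (t : R) : R := Num.max (- n%:R) (Num.min n%:R (v t)).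
have mF n : measurable_fun [set: R] (F n).
  by apply: measurable_maxr => //; exact: measurable_minr.
have Fb n t : `|F n t| <= n%:R.
  have n0 : 0 <= n%:R :> R by [].
  by rewrite ler_norml /F le_max lexx/= ge_max ge_min lexx/= andbT; lra.
pose k (n : nat) (t : R) : R[i] := (F n t)%:C * ev [:: (1, 0)] t.
have evE t : ev [:: (1, 0 : R[i])] t = (expR (- (pi * t ^+ 2)))%:C.
  by rewrite /ev big_seq1 mul1r /tf_shift /= mulr0 mul0r subr0 /expi cos0 sin0 mul1r.
have uE t : u t = v t * expR (- (pi * t ^+ 2)).
  by rewrite /v -mulrA -expRD subrr expR0 mulr1.
have kE n t : n2 (fun t => (u t)%:C - k n t) t = (v t - F n t) ^+ 2 * expR (- (pi * t ^+ 2)) ^+ 2.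
  rewrite /n2 /k evE {1}uE -rmorphM -rmorphB -mulrBl normc_real normrM exprMn.
  by rewrite !real_normK ?num_real.
have mk n : measurable_cfun (k n) by exact: mcM (mc_real (mF n)) (mc_ev _).
have vF n t : (v t - F n t) ^+ 2 <= v t ^+ 2.
  have n0 : 0 <= n%:R :> R by [].
  rewrite /F; have [h1|h1] := leP (v t) n%:R.
    have [h2|h2] := leP (v t) (- n%:R); last by rewrite subrr expr0n sqr_ge0.
    by rewrite !expr2; nra.
  by rewrite max_r; [rewrite !expr2; nra|lra].
have gG n t : `|n2 (fun t => (u t)%:C - k n t) t| <= u t ^+ 2.
  rewrite ger0_norm ?n2_ge0// kE uE exprMn ler_wpM2r ?sqr_ge0//; exact: vF.
have mn n := measurable_n2 (mcB (mc_real mu) (mk n)).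
have [|n nP] := @ing_cvg0 _ (fun n => n2 (fun t => (u t)%:C - k n t)) _ eps mn gG iu _ e0.
  move=> t; apply: cvg_near_cst; exists (Num.bound `|v t|) => // n /= nb.
  have h : `|v t| < n%:R.
    apply: (@lt_le_trans _ _ (Num.bound `|v t|)%:R); first by apply: archi_boundP.
    by rewrite ler_nat.
  move: h; rewrite ltr_norml => /andP[h1 h2].
  by rewrite kE /F (min_r (ltW h2)) (max_r (ltW h1)) subrr expr0n mul0r.
exists (k n); first by have [_ _ h] := mult_bounded (mF n) (Fb n); exact: h.
by split; [exact: itg_le (mn n) (gG n) iu|exact: le_lt_trans (ler_norm _) nP].
Qed.

Lemma L2_itg h : L2 h -> itg (n2 h).
Proof.
move=> [mh hoo]; have mn := measurable_n2 mh.
apply/integrableP; split; first exact/measurable_EFinP.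
move: hoo; rewrite /L2norm unlock /Lnorm.
have -> : (\int[@lebesgue_measure R]_x `|(EFin \o (fun t => normc (h t))) x| `^ 2 =
   \int[@lebesgue_measure R]_x `|(EFin \o n2 h) x|)%E.
  apply: eq_integral => x _ /=.
  by rewrite !ger0_norm ?n2_ge0 ?normc_ge0// powR_mulrn ?normc_ge0.
apply: contraTT; rewrite -leNgt leye_eq => /eqP ->.
by rewrite poweRyr ?ltxx// invr_eq0 pnatr_eq0.
Qed.

Theorem L2_app h : L2 h -> app h.
Proof.
move=> L; have ih := L2_itg L; case: L => -[m1 m2] _.
have i1 : itg (fun t => complex.Re (h t) ^+ 2).
  apply: itg_le ih; first exact: measurable_funX.
  by move=> t; rewrite ger0_norm ?sqr_ge0// /n2 sqr_normcE lerDl sqr_ge0.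
have i2 : itg (fun t => complex.Im (h t) ^+ 2).
  apply: itg_le ih; first exact: measurable_funX.
  by move=> t; rewrite ger0_norm ?sqr_ge0// /n2 sqr_normcE lerDr sqr_ge0.
have := appD (app_real m1 i1) (appZ 'i%C (app_real m2 i2)).
congr app; apply/funext => t; case: (h t) => a b.
by apply: eq_ReIm => /=; ring.
Qed.

End Multipliers.

(** * Pairing of a Fock function with a combination of kernels *)

Section Pairing.
Variable R : realType.
Implicit Types (p q : seq (R[i] * R[i])) (F : R[i] -> R[i]).

(** The pairing is the sum of the [a k * bsum q k], and the weights [k! / pi^k] and [pi^k / k!] of
    the two norms are inverse to each other. The free parameter [th] lets AM-GM replace
    Cauchy-Schwarz. *)
Lemma dual_pairing (a : nat -> R[i]) F (S th : R) q : ent a F -> 0 < th ->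
  (forall K, \sum_(0 <= j < K) normc (a j) ^+ 2 * (j`!%:R / pi ^+ j) <= S) ->
  normc (\sum_(x <- q) x.1 * F x.2) <= (th * S + qf q / th) / 2.
Proof.
move=> aF th0 aS.
have pp k : 0 < pi ^+ k :> R by rewrite exprn_gt0// pi_gt0.
have pf k : 0 < k`!%:R :> R by rewrite ltr0n fact_gt0.
have [K KP] := choice (fun z => let: ex_intro2 K _ KP := ent_lim z aF in
  ex_intro (fun K => forall n, normc (F z - psum a n z) <= K / 2 ^+ n) K KP).
apply: (@le_geo _ _ _ (\sum_(x <- q) normc x.1 * K x.2)) => n.
have E : \sum_(x <- q) x.1 * psum a n x.2 = \sum_(k < n) a k * bsum q k.
  under eq_bigr do rewrite mulr_sumr.
  rewrite exchange_big; apply: eq_bigr => k _ /=; rewrite mulr_sumr.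
  by apply: eq_bigr => x _; ring.
have -> : \sum_(x <- q) x.1 * F x.2 = \sum_(k < n) a k * bsum q k +
    \sum_(x <- q) x.1 * (F x.2 - psum a n x.2).
  by rewrite -E -big_split /=; apply: eq_bigr => x _; ring.
apply: (le_trans (normcD _ _)); apply: lerD; last first.
  apply: (le_trans (normc_sum _ _ _)); rewrite mulr_suml; apply: ler_sum => x _.
  by rewrite normcM -mulrA ler_wpM2l ?normc_ge0.
apply: (le_trans (normc_sum _ _ _)).
have hS := aS n; have hq := bessel_kf q n.
apply: (@le_trans _ _ ((th * \sum_(0 <= j < n) normc (a j) ^+ 2 * (j`!%:R / pi ^+ j) +
   (\sum_(k < n) pi ^+ k / k`!%:R * normc (bsum q k) ^+ 2) / th) / 2)); last first.
  by rewrite ler_pM2r//; apply: lerD; [rewrite ler_pM2l|rewrite ler_pM2r// invr_gt0].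
rewrite big_mkord mulr_sumr mulr_suml -big_split /= mulr_suml; apply: ler_sum => k _.
(* AM-GM with weight [th k! / pi^k] *)
rewrite normcM; move: (normc (a k)) (normc (bsum q k)) => x y.
have w0 := mulr_gt0 th0 (divr_gt0 (pf k) (pp k)).
set w := th * (k`!%:R / pi ^+ k) in w0 *.
have -> : th * (x ^+ 2 * (k`!%:R / pi ^+ k)) + pi ^+ k / k`!%:R * y ^+ 2 / th = w * x ^+ 2 + y ^+ 2 / w.
  by rewrite /w; field; rewrite !gt_eqF.
have := mulr_ge0 (ltW w0) (sqr_ge0 (x - y / w)).
have -> : w * (x - y / w) ^+ 2 = w * x ^+ 2 + y ^+ 2 / w - 2 * (x * y) by field; rewrite gt_eqF.
lra.
Qed.

End Pairing.

(** * Completeness and minimality of the Gabor system *)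

Section SpanOfZeros.
Variables (R : realType) (lam : nat -> R[i]) (d : R).
Hypothesis d0 : 0 <= d.
Hypothesis d1 : d < 1 / 2.
Hypothesis near : forall n : nat, (1 <= n)%N ->
  normc ((sqrt2n R n)%:C - lam n) <= d / sqrt2n R n.
Hypothesis lam_inj : forall m n : nat, (1 <= m)%N -> (1 <= n)%N ->
  lam m = lam n -> m = n.
Implicit Types (p q : seq (R[i] * R[i])).

Lemma qf_scal (c : R[i]) p : qf (scal c p) = normc c ^+ 2 * qf p.
Proof.
rewrite {1}/qf kf_scall kf_scalr mulrA mulc_conj kf_qf -rmorphM.
by [].
Qed.

Lemma span_zeros1 (c z0 : R[i]) (eps : R) : 0 < eps ->
  exists2 q, in_zeros lam q & close (ev [:: (c, z0)]) (ev q) eps.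
Proof.
move=> e0; pose C := normc (c * al z0) ^+ 2 + 1.
have C0 : 0 < C by rewrite ltr_wpDl ?sqr_ge0.
have [q qz qe] := kernel_complete d0 d1 near lam_inj z0 (divr_gt0 e0 C0).
(* [kernel_complete] makes the kernel at [z0] plus a combination small, whence the sign; the factors
   [al] convert kernels into shifts. *)
pose r := [seq (- (c * al z0 * y.1 / al y.2), y.2) | y <- q].
exists r; first by move=> x /mapP[y yq ->] /=; exact: qz.
pose s := (c, z0) :: [seq (c * al z0 * y.1 / al y.2, y.2) | y <- q].
have E : n2 (fun t => ev [:: (c, z0)] t - ev r t) = (fun t => normc (ev s t) ^+ 2).
  apply/funext => t; congr (normc _ ^+ 2); rewrite /ev big_seq1 [RHS]big_cons /r !big_map.
  congr (_ + _); rewrite -sumrN; apply: eq_bigr => y _ /=; ring.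
rewrite /close E; have [i1 ->] := ev_norm s; split=> //.
have -> : toK s = scal (c * al z0) ((1, z0) :: q).
  rewrite /toK /scal /= mulr1; congr (_ :: _); rewrite -map_comp; apply: eq_map => y /=.
  by rewrite divfK ?al_neq0.
rewrite qf_scal ltr_pdivrMr ?sqrtr_gt0//.
have s1 : 1 <= Num.sqrt 2 :> R.
  by rewrite -(@ler_pXn2r _ 2) ?nnegrE ?sqrtr_ge0// sqr_sqrtr// expr1n; lra.
apply: (@lt_le_trans _ _ eps); last by rewrite ler_peMr// ltW.
apply: (@le_lt_trans _ _ (C * qf ((1, z0) :: q))).
  by rewrite ler_wpM2r ?qf_ge0// lerDl.
by rewrite mulrC -ltr_pdivlMr.
Qed.

Lemma span_zeros p (eps : R) : 0 < eps ->
  exists2 q, in_zeros lam q & close (ev p) (ev q) eps.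
Proof.
elim: p eps => [|[c z] p IHp] eps e0.
  by exists [::] => //; exact: close_refl.
have e4 : 0 < eps / 4 by rewrite divr_gt0.
have [q1 z1 [i1 l1]] := span_zeros1 c z e4; have [q2 z2 [i2 l2]] := IHp _ e4.
exists (q1 ++ q2); first by move=> x; rewrite mem_cat => /orP[/z1|/z2].
have [i3 l3] := itg_n2D (mcB (mc_ev _) (mc_ev q1)) (mcB (mc_ev p) (mc_ev q2)) i1 i2.
have E : (fun t => ev [:: (c, z)] t - ev q1 t + (ev p t - ev q2 t)) =
    (fun t => ev ((c, z) :: p) t - ev (q1 ++ q2) t).
  by apply/funext => t; rewrite -(cat1s (c, z) p) !ev_cat; ring.
by rewrite E in i3 l3; split=> //; lra.
Qed.

Lemma zeros_Lambda N l : l \in zeros lam N -> Lambda lam l.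
Proof.
have pos n : n \in iota 1 N -> (1 <= n)%N by rewrite mem_iota => /andP[].
rewrite /zeros !mem_cat !inE => /orP[/orP[/eqP ->|/eqP ->]|]; [by right; left|by right; right|].
by case/or4P => /mapP[n /pos n1 ->]; left; exists n => //;
  [apply: Or41|apply: Or42|apply: Or43|apply: Or44].
Qed.

Lemma Lambda_zeros l : Lambda lam l -> exists N, l \in zeros lam N.
Proof.
move=> [[n n1 h]|[->|->]]; last 2 first.
- by exists 0%N; rewrite inE eqxx.
- by exists 0%N; rewrite !inE eqxx orbT.
exists n; have nI : n \in iota 1 n by rewrite mem_iota n1 add1n ltnS leqnn.
rewrite /zeros !mem_cat; case: h => ->.
- by rewrite (map_f lam nI) !orbT.
- by rewrite (map_f (fun n => - (sqrt2n R n)%:C) nI) !orbT.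
- by rewrite (map_f (fun n => 0 +i* sqrt2n R n) nI) !orbT.
- by rewrite (map_f (fun n => 0 -i* sqrt2n R n) nI) !orbT.
Qed.

Lemma gabor_complete : complete_in_L2 (gabor_system (Lambda lam)).
Proof.
move=> f Lf; split=> // eps e0.
have e4 : 0 < eps ^+ 2 / 4 by rewrite divr_gt0// exprn_gt0.
have [mf /(_ _ e4) [p [i1 l1]]] := L2_app Lf.
have [q qz [i2 l2]] := span_zeros p e4.
have [i3 l3] := itg_n2D (mcB mf (mc_ev p)) (mcB (mc_ev p) (mc_ev q)) i1 i2.
have E : (fun t => f t - ev p t + (ev p t - ev q t)) = (f \- ev q)%R.
  by apply/funext => t; rewrite addrA subrK.
rewrite E in i3 l3; exists (ev q).
  exists (size q), (fun i => (tnth (in_tuple q) i).1),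
    (fun i => tf_shift (tnth (in_tuple q) i).2 (@gauss R)); split.
    move=> i; exists (tnth (in_tuple q) i).2 => //.
    by have [N lN] := qz _ (mem_tnth i (in_tuple q)); exact: zeros_Lambda lN.
  by apply/funext => t; rewrite /ev big_tnth.
have eE : eps = Num.sqrt (eps ^+ 2) by rewrite sqrtr_sqr gtr0_norm.
rewrite (L2normE i3) lte_fin eE ltr_sqrt ?exprn_gt0//.
apply: (le_lt_trans l3); lra.
Qed.

(** The points of the approximating combination, hence [N], are known only after [eps] is fixed: the
    constants of [dual_bound] must not depend on [N]. The pairing with [F] annihilates every term
    except the one at [l]. *)
Lemma gabor_minimal : minimal_in_L2 (gabor_system (Lambda lam)).
Proof.
move=> _ [l lL <-] [_ cl].
have [N0 lN0] := Lambda_zeros lL.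
have [S [c [N1 [c0 dual]]]] := dual_bound d0 d1 near lam_inj lN0.
pose A := normc (al l) * c; have A0 : 0 < A by rewrite mulr_gt0// normc_gt0 al_neq0.
(* With this [th] and the [eps] below, [th * S <= A] and [qf (toK p) / th < A], so that
   [dual_pairing] puts [|al l * F l|] strictly below [A], although it is at least [A]. *)
pose th := A / (`|S| + 1); have S1 : 0 < `|S| + 1 by rewrite ltr_wpDl.
have th0 : 0 < th by rewrite divr_gt0.
have s0 : 0 < Num.sqrt 2 :> R by rewrite sqrtr_gt0.
pose eps := Num.sqrt (th * A / Num.sqrt 2).
have tA : 0 < th * A / Num.sqrt 2 by rewrite divr_gt0// mulr_gt0.
have [h [n [a [s [sS hE]]]] hl] := cl eps ltac:(by rewrite sqrtr_gt0).
have zx i : exists z, [/\ Lambda lam z, z != l & s i = tf_shift z (@gauss R)].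
  have [[z zL zE] sl] := sS i; exists z; split=> //.
  by apply: contra_not_neq sl => zl; rewrite -zE zl.
have [z zP] := choice zx.
have Nx i : exists N, z i \in zeros lam N by apply: Lambda_zeros; have [] := zP i.
have [M MP] := choice Nx.
pose N := maxn N1 (\max_(i < n) M i).
have [b [F [bF F0 cF bS]]] := dual N (leq_maxl _ _).
pose p := (1, l) :: [seq (- a i, z i) | i <- index_enum 'I_n].
have E : (tf_shift l (@gauss R) \- h)%R = ev p.
  apply/funext => t; rewrite /ev big_cons big_map mul1r hE /=; congr (_ + _).
  rewrite -sumrN; apply: eq_bigr => i _; have [_ _ ->] := zP i.
  by rewrite mulNr.
have [ip qp] := ev_norm p.
have qS : qf (toK p) < th * A.
  move: hl; rewrite E (L2normE ip) lte_fin qp ltr_sqrt//.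
  by rewrite ltr_pM2r// invr_gt0.
have := dual_pairing (toK p) bF th0 bS.
have -> : \sum_(x <- toK p) x.1 * F x.2 = al l * F l.
  rewrite /toK big_map big_cons big_map big1 => [|i _] /=; first by rewrite mul1r addr0.
  have [_ zl _] := zP i; rewrite F0 ?mulr0//.
  apply: (mem_zeros_mono d0 d1 _ (MP i)); apply: leq_trans (leq_maxr _ _).
  exact: (@leq_bigmax _ M i).
rewrite normcM; apply/negP; rewrite -ltNge.
have h1 : A <= normc (al l) * normc (F l) by rewrite ler_wpM2l ?normc_ge0.
have h2 : th * S <= A.
  rewrite /th mulrAC ler_pdivrMr// ler_wpM2l ?(ltW A0)//.
  by have := ler_norm S; lra.
have h3 : qf (toK p) / th < A by rewrite ltr_pdivrMr// mulrC.
lra.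
Qed.

End SpanOfZeros.

Theorem theorem1p7 (R : realType) (lam : nat -> R[i]) (delta : R)
  (lam_inj : forall m n : nat, (1 <= m)%N -> (1 <= n)%N ->
     lam m = lam n -> m = n)
  (delta_lt : delta < 1 / 2)
  (lam_near : forall n : nat, (1 <= n)%N ->
     `|(sqrt2n R n)%:C - lam n| <= (delta / sqrt2n R n)%:C) :
  complete_in_L2 (gabor_system (Lambda lam)) /\
  minimal_in_L2 (gabor_system (Lambda lam)).
Proof.
have near n : (1 <= n)%N -> normc ((sqrt2n R n)%:C - lam n) <= delta / sqrt2n R n.
  by move=> n1; rewrite -lecR; exact: lam_near.
(* The hypothesis at [n = 1] already forces [delta] to be nonnegative. *)
have delta_ge0 : 0 <= delta.
  have u1 : 0 < sqrt2n R 1 by rewrite sqrtr_gt0 mulr_gt0.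
  rewrite -(pmulr_lge0 _ (_ : 0 < (sqrt2n R 1)^-1)) ?invr_gt0//.
  exact: le_trans (normc_ge0 _) (near 1%N isT).
split; first exact: (gabor_complete delta_ge0 delta_lt near lam_inj).
exact: (gabor_minimal delta_ge0 delta_lt near lam_inj).
Qed.
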